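(* Let $\overline\Omega=\bigcup_{j=1}^J\overline\Omega_j$ with $\Omega_1,\dots,\Omega_J$ pairwise disjoint Lipschitz subdomains of $\Omega$ (not necessarily aligned with the mesh). Let $\frac1d\le\alpha\le1$ and $\frac{2\alpha}{2+\alpha}\le\beta\le\alpha$. Suppose that the meshes $\mathcal{T}_h$ are face weakly acute, that $$\Big(\sum_{\omega_i\subset\Omega_j}\int_{\omega_i}|A(x)-\bar A(x_i)|^d\,dx\Big)^{1/d}\le C(A)\,h^\beta\qquad\text{for all }1\le j\le J$$ (the sum being over the interior nodes $x_i$ whose star $\omega_i$ is contained in $\Omega_j$), and that there exists a solution $u\in W^2_\infty(\Omega)$ of $A(x):D^2u(x)=f(x)$ in $\Omega$, $u=0$ on $\partial\Omega$, with $u\in C^{2,\alpha}(\overline\Omega_j)$ for all $1\le j\le J$. If the two scales $h$ and $\epsilon$ satisfy $\epsilon=C_3\big(h^2|\ln h|\big)^{d/(1+2d)}$ with $C_3>0$ arbitrary, then the finite element solution $u_h^\epsilon$ satisfies $$\|u-u_h^\epsilon\|_{L^\infty(\Omega)}\le C\big(h^2|\ln h|\big)^{\frac1{1+2d}},$$ where $C$ is independent of $h$ and depends on $\sigma,\Omega,d,\lambda$ (through the constant of the discrete Alexandroff-Bakelman-Pucci estimate), on $|u|_{W^2_\infty(\Omega)}$, on $|u|_{C^{2,\alpha}(\overline\Omega_j)}$ for $1\le j\le J$, and on $C(A)$.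
   Context: Domain and data: $d\ge2$; $\Omega\subset\mathbb{R}^d$ is a bounded domain with (at least) $C^{1,1}$ boundary; $A:\Omega\to\mathbb{R}^{d\times d}$ is measurable with symmetric values and $\lambda I\le A(x)\le\Lambda I$ for a.e. $x$, $0<\lambda\le\Lambda$; $f\in L^d(\Omega)$. $Q:=(\Lambda-\lambda/2)^{1/2}$. $|u|_{C^{2,\alpha}}$ is the $\alpha$-Hölder seminorm of $D^2u$ and $|u|_{W^2_\infty(\Omega)}$ the $L^\infty$ norm of $D^2u$. Kernel: $\varphi\ge0$ is a fixed smooth radially symmetric function on $\mathbb{R}^d$ with compact support in the unit ball and $\int_{\mathbb{R}^d}|y|^2\varphi(y)\,dy=d$. Meshes: $\{\mathcal{T}_h\}$ is a family of conforming, quasi-uniform (meshsize $h$), uniformly shape regular (constant $\sigma$, bounding the ratio of element diameter to inscribed ball diameter) partitions into simplices of polytopes $\Omega_h$ whose boundary nodes lie on $\partial\Omega$. Simplifying convention of the paper: the discrepancy between $\Omega_h$ and $\Omega$ is ignored, i.e. $\Omega_h=\Omega$ is assumed; under it the Galerkin projection $u_G\in\mathbb{V}_h^0$, defined by $\int_\Omega\nabla u_G\cdot\nabla v_h=\int_\Omega\nabla u\cdot\nabla v_h$ for all $v_h\in\mathbb{V}_h^0$, is known to satisfy $\|u-u_G\|_{L^\infty(\Omega)}\le Ch^2|\ln h|\,|u|_{W^2_\infty(\Omega)}$. $\mathcal{N}_h$: interior nodes; $\mathbb{V}_h$: continuous functions affine on each $K\in\mathcal{T}_h$; $\mathbb{V}_h^0$: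 those vanishing on $\partial\Omega$; $\phi_i$: hat function of node $x_i$; $\omega_i=\operatorname{supp}\phi_i$. The regime is $h\to0$: $h$ (hence $\epsilon$) is sufficiently small. The data $\Lambda$, $\varphi$, $C_3$, the subdomains $\Omega_j$ and the quasi-uniformity constant are fixed. Face weak acuteness: for every interior face $F$ of $\mathcal{T}_h$, with $\omega_F$ the union of the two elements containing $F$, $\int_{\omega_F}\nabla\phi_i\cdot\nabla\phi_j\le0$ for all nodes $x_i\ne x_j$ (boundary nodes included). Second differences: for $x$ with $\operatorname{dist}(x,\partial\Omega)>Q\epsilon$ put $\theta(x)=1$; for $x\in\Omega$ with $\operatorname{dist}(x,\partial\Omega)\le Q\epsilon$ let $\theta(x)\in(0,1]$ be the largest number such that $x\pm\theta y\in\Omega$ for all $y\in B_{Q\epsilon}(0)$. Set $\delta v(x,y):=\theta^{-2}[v(x+\theta y)+v(x-\theta y)-2v(x)]$, $\theta=\theta(x)$. Discrete problem: $\bar A(x_i)=|\omega_i|^{-1}\int_{\omega_i}A$ is the mean of $A$ over the star; $M(x_i)=(\bar A(x_i)-\frac\lambda2I)^{1/2}$; $I_\epsilon v(x_i)=\int_{\mathbb{R}^d}\frac{\delta v(x_i,y)}{\epsilon^{d+2}\det M(x_i)}\varphi\big(\frac{M(x_i)^{-1}y}{\epsilon}\big)dy$; $\Delta_hv_h(x_i)=-(\int_\Omega\phi_i)^{-1}\int_\Omega\nabla v_h\cdot\nabla\phi_i$; $L_h^\epsilon v_h(x_i)=\frac\lambda2\Delta_hv_h(x_i)+I_\epsilon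 v_h(x_i)$. The finite element solution $u_h^\epsilon\in\mathbb{V}_h^0$ satisfies $L_h^\epsilon u_h^\epsilon(x_i)=f_i:=\int_\Omega f\phi_i/\int_\Omega\phi_i$ for all $x_i\in\mathcal{N}_h$. The discrete Alexandroff-Bakelman-Pucci estimate referred to: if $v_h\in\mathbb{V}_h$, $v_h\ge0$ on $\partial\Omega$ and $L_h^\epsilon v_h(x_i)\le g_i$ for all $x_i\in\mathcal{N}_h$, then $\sup_\Omega v_h^-\le C(\sigma,d,\lambda,\Omega)\big(\sum_{x_i\in\mathcal{N}_h}|g_i^+|^d|\omega_i|\big)^{1/d}$.
   Formalization: The assumptions that Ω is C^{1,1} and that Ω equals the polytope Ω_h contradict each other; here Ω is the meshed polytope, C^{1,1} is dropped, and the L^∞ Galerkin estimate and the discrete Alexandroff-Bakelman-Pucci estimate are hypotheses whose constants C may depend on. *)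

(* Defs.v *)
From HB Require Import structures.
From mathcomp Require Import all_boot all_order all_algebra.
From mathcomp Require Import all_classical all_reals all_analysis.

Set Implicit Arguments.
Unset Strict Implicit.
Unset Printing Implicit Defensive.

Import Order.TTheory GRing.Theory Num.Theory.
Import numFieldNormedType.Exports.

Local Open Scope classical_set_scope.
Local Open Scope ring_scope.

Definition rV_display : measure_display -> measure_display.
Proof. exact. Qed.

Section measurable_rV.
Context {R : realType} (n : nat).

Let coors : 'I_n -> 'rV[R]_n -> R := fun i v => v 0 i.

Let rV_set0 : g_sigma_preimage coors set0.
Proof. exact: sigma_algebra0. Qed.

Let rV_setC A : g_sigma_preimage coors A -> g_sigma_preimage coors (~` A).
Proof. exact: sigma_algebraC. Qed.

Let rV_bigcup (F : (set 'rV[R]_n)^nat) :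
  (forall i, g_sigma_preimage coors (F i)) ->
  g_sigma_preimage coors (\bigcup_i (F i)).
Proof. exact: sigma_algebra_bigcup. Qed.

HB.instance Definition _ := @isMeasurable.Build
  (rV_display default_measure_display)
  'rV[R]_n (g_sigma_preimage coors) rV_set0 rV_setC rV_bigcup.

End measurable_rV.

Section lebesgue_rV.
Context {R : realType}.

Lemma measurable_coord n (i : 'I_n) :
  measurable_fun [set: 'rV[R]_n] (fun v => v 0 i).
Proof.
move=> _ Y mY; rewrite setTI; apply: sub_sigma_algebra => /=.
rewrite -bigcup_seq/=; exists i => /=; first by rewrite mem_index_enum.
by exists Y => //; rewrite setTI.
Qed.

Lemma measurable_fun_rV d (T : measurableType d) n (f : T -> 'rV[R]_n) :
  (forall i, measurable_fun [set: T] (fun x => f x 0 i)) ->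
  measurable_fun [set: T] f.
Proof.
move=> mf; have pre_sub : g_sigma_preimage (fun (i : 'I_n) x => f x 0 i)
    `<=` measurable.
  apply: smallest_sub; first exact: sigma_algebra_measurable.
  case: n f mf => [|n] f mf; first by rewrite big_ord0.
  rewrite -bigcup_mkord_ord; apply: bigcup_sub => i _ A [B mB <-].
  exact: mf.
move=> _ A mA; apply: pre_sub.
rewrite (g_sigma_preimage_comp (fun (i : 'I_n) (v : 'rV[R]_n) => v 0 i) f).
by exists A.
Qed.

Definition rV_cons n (x : R * 'rV[R]_n) : 'rV[R]_n.+1 :=
  row_mx (x.1)%:M x.2.

Definition rV_uncons n (v : 'rV[R]_n.+1) : R * 'rV[R]_n :=
  (v 0 0, \row_i v 0 (lift ord0 i)).

Lemma rV_cons0 n (x : R * 'rV[R]_n) : rV_cons x 0 ord0 = x.1.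
Proof.
rewrite /rV_cons mxE; case: splitP => [j _|k] //.
by rewrite ord1 mxE eqxx mulr1n.
Qed.

Lemma rV_consS n (x : R * 'rV[R]_n) i : rV_cons x 0 (lift ord0 i) = x.2 0 i.
Proof.
rewrite /rV_cons mxE; case: splitP => [j|k /=]; first by rewrite ord1.
by rewrite /bump leq0n => -[/val_inj ->].
Qed.

Lemma rV_unconsK n : cancel (@rV_uncons n) (@rV_cons n).
Proof.
move=> v; apply/rowP => i; case: (unliftP ord0 i) => [j ->|->].
  by rewrite rV_consS mxE.
by rewrite rV_cons0.
Qed.

Lemma rV_consK n : cancel (@rV_cons n) (@rV_uncons n).
Proof.
case=> t v; rewrite /rV_uncons rV_cons0; congr pair.
by apply/rowP => i; rewrite mxE rV_consS.
Qed.

Lemma measurable_rV_cons n :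
  measurable_fun [set: measurableTypeR R * 'rV[R]_n] (@rV_cons n).
Proof.
apply: measurable_fun_rV => i; case: (unliftP ord0 i) => [j ->|->].
  apply: (eq_measurable_fun (fun x : measurableTypeR R * 'rV[R]_n => x.2 0 j)).
    by move=> x _; rewrite rV_consS.
  exact: (measurableT_comp (measurable_coord j)).
apply: (eq_measurable_fun (fun x : measurableTypeR R * 'rV[R]_n => x.1)).
  by move=> x _; rewrite rV_cons0.
exact: measurable_fst.
Qed.

Lemma measurable_rV_uncons n :
  @measurable_fun _ _ 'rV[R]_n.+1 (measurableTypeR R * 'rV[R]_n)%type setT
    (@rV_uncons n).
Proof.
apply: measurable_fun_pair; first exact: measurable_coord.
apply: measurable_fun_rV => i.
apply: (eq_measurable_fun (fun v : 'rV[R]_n.+1 => v 0 (lift ord0 i))).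
  by move=> v _; rewrite mxE.
exact: measurable_coord.
Qed.

Section step.
Variables (n : nat) (mu : {sigma_finite_measure set 'rV[R]_n -> \bar R}).

Definition lebesgue_cons : set 'rV[R]_n.+1 -> \bar R :=
  pushforward (@lebesgue_measure R \x mu)%E (@rV_cons n).

Let lebesgue_cons0 : lebesgue_cons set0 = 0%E.
Proof. by rewrite /lebesgue_cons /pushforward preimage_set0 measure0. Qed.

Let lebesgue_cons_ge0 A : (0 <= lebesgue_cons A)%E.
Proof. exact: (measure_ge0 (@lebesgue_measure R \x mu)%E). Qed.

Let lebesgue_cons_sigma_additive : semi_sigma_additive lebesgue_cons.
Proof.
move=> F mF tF mUF; rewrite /lebesgue_cons /pushforward preimage_bigcup.
apply: measure_semi_sigma_additive.
- by move=> k; rewrite -[X in measurable X]setTI; exact: measurable_rV_cons.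
- apply/trivIsetP => /= i j _ _ ij; rewrite -preimage_setI.
  by move/trivIsetP : tF => /(_ _ _ _ _ ij) ->//; rewrite preimage_set0.
- rewrite -preimage_bigcup -[X in measurable X]setTI.
  exact: measurable_rV_cons.
Qed.

HB.instance Definition _ := isMeasure.Build _ _ _ lebesgue_cons
  lebesgue_cons0 lebesgue_cons_ge0 lebesgue_cons_sigma_additive.

Let lebesgue_cons_sigma_finite : sigma_finite setT lebesgue_cons.
Proof.
have /sigma_finiteP[F [TF ndF Foo]] := sigma_finiteT (@lebesgue_measure R).
have /sigma_finiteP[G [TG ndG Goo]] := sigma_finiteT mu.
exists (fun k => @rV_uncons n @^-1` (F k `*` G k)).
  apply/esym; rewrite -subTset => v _.
  have : setT (rV_uncons v).1 by [].
  have : setT (rV_uncons v).2 by [].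
  rewrite TF TG => -[k _ Gk] [j _ Fj]; exists (maxn j k) => //; split.
  - by move: Fj; exact/subsetPset/ndF/leq_maxl.
  - by move: Gk; exact/subsetPset/ndG/leq_maxr.
move=> k; have [mF ?] := Foo k; have [mG ?] := Goo k; split.
  rewrite -[X in measurable X]setTI.
  by apply: measurable_rV_uncons => //; exact: measurableX.
rewrite /lebesgue_cons /pushforward -comp_preimage.
rewrite (_ : _ \o _ = id) ?preimage_id; last first.
  by apply/funext => x /=; rewrite rV_consK.
by rewrite product_measure1E// lte_mul_pinfty// ge0_fin_numE.
Qed.

HB.instance Definition _ := Measure_isSigmaFinite.Build _ _ _ lebesgue_cons
  lebesgue_cons_sigma_finite.
End step.

Fixpoint lebesgue_rV n : {sigma_finite_measure set 'rV[R]_n -> \bar R} :=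
  match n with
  | 0 => \d_(0 : 'rV[R]_0)
  | m.+1 => lebesgue_cons (lebesgue_rV m)
  end.

End lebesgue_rV.

Section euclidean.
Context {R : realType} {d : nat}.
Implicit Types (x y : 'rV[R]_d) (A B : 'M[R]_d) (U : set 'rV[R]_d).

Definition dot x y : R := (x *m y^T) 0 0.

(* The library norm on matrices is the sup norm; this is the Euclidean norm of
   a vector and the Frobenius norm of a matrix. *)
Definition enorm m n (M : 'M[R]_(m, n)) : R :=
  Num.sqrt (\sum_i \sum_j M i j ^+ 2).

Definition eball x (r : R) : set 'rV[R]_d := [set y | enorm (y - x) < r].

Definition boundary U : set 'rV[R]_d := closure U `\` interior U.

Definition dist_to x U : R := inf [set enorm (x - y) | y in U].

Definition mx_le A B : Prop :=
  forall x, dot (x *m A) x <= dot (x *m B) x.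

Definition sqrtmx A : 'M[R]_d :=
  xget 0 [set M | [/\ M^T = M, mx_le 0 M & M *m M = A]].

Definition partial (i : 'I_d) (v : 'rV[R]_d -> R) : 'rV[R]_d -> R :=
  fun x => 'D_(delta_mx 0 i) v x.

Definition grad (v : 'rV[R]_d -> R) x : 'rV[R]_d := \row_i partial i v x.

End euclidean.

Section domains.
Context {R : realType} {d : nat}.
Implicit Types U : set 'rV[R]_d.

Definition is_domain U : Prop := [/\ open U, connected U & U !=set0].

(* Near each boundary point, in coordinates rotated so that the unit vector n
   is vertical, U is the set lying above a Lipschitz graph. Only the values of
   g on the hyperplane orthogonal to n matter. *)
Definition lipschitz_boundary U : Prop :=
  forall z, boundary U z ->
  exists (r L : R) (n : 'rV[R]_d) (g : 'rV[R]_d -> R),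
  [/\ 0 < r, enorm n = 1,
      forall x y, `|g x - g y| <= L * enorm (x - y) &
      forall x, eball z r x -> (U x <-> g (x - dot x n *: n) < dot x n)].

Definition lipschitz_domain U : Prop :=
  [/\ is_domain U, bounded_set U & lipschitz_boundary U].

End domains.

Section function_spaces.
Context {R : realType} {d : nat}.
Implicit Types (U : set 'rV[R]_d) (v w : 'rV[R]_d -> R).

Local Notation leb := (lebesgue_rV (R := R) d).

(* Measurability with respect to the Lebesgue sigma-algebra, i.e. the
   completion of the Borel one. *)
Definition lebesgue_measurable_fun U v : Prop :=
  exists2 w, measurable_fun U w & {ae leb, forall x, U x -> v x = w x}.

Definition Lp_norm (p : \bar R) U v : \bar R := Lnorm leb p (EFin \o (v \_ U)).

Definition Lp (p : \bar R) U v : Prop :=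
  lebesgue_measurable_fun U v /\ (Lp_norm p U v < +oo)%E.

Definition smooth v : Prop :=
  forall (s : seq 'I_d) i x,
    derivable (foldr partial v s) x (delta_mx 0 i) /\
    {for x, continuous (foldr partial v s)}.

Definition test_function U v : Prop :=
  [/\ smooth v, compact (closure [set x | v x != 0]) &
      closure [set x | v x != 0] `<=` U].

Definition weak_partial U (i : 'I_d) v w : Prop :=
  forall psi, test_function U psi ->
    \int[leb]_(x in U) (v x * partial i psi x) =
    - \int[leb]_(x in U) (w x * psi x).

(* v belongs to W^2_oo(U), with weak gradient Dv and weak Hessian D2v. *)
Definition W2oo U v (Dv : 'rV[R]_d -> 'rV[R]_d) (D2v : 'rV[R]_d -> 'M[R]_d) :=
  [/\ Lp +oo U v,
      forall i, Lp +oo U (fun x => Dv x 0 i),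
      forall i j, Lp +oo U (fun x => D2v x i j),
      forall i, weak_partial U i v (fun x => Dv x 0 i) &
      forall i j, weak_partial U j (fun x => Dv x 0 i) (fun x => D2v x i j)].

(* W^2_oo functions are represented by continuous functions on the closure. *)
Definition zero_on_boundary U v : Prop :=
  {within closure U, continuous v} /\ (forall x, boundary U x -> v x = 0).

Definition continuous_upto_boundary U v : Prop :=
  exists2 w, {within closure U, continuous w} & {in U, v =1 w}.

Definition hess v x : 'M[R]_d := \matrix_(i, j) partial j (partial i v) x.

(* v belongs to C^{2,alpha} of the closure of U, the alpha-Hölder seminorm of
   its Hessian being at most K. *)
Definition C2alpha (alpha : R) U v (K : R) : Prop :=
  [/\ continuous_upto_boundary U v,
      forall i, {in U, forall x, derivable v x (delta_mx 0 i)} /\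
        continuous_upto_boundary U (partial i v),
      forall i j, {in U, forall x, derivable (partial i v) x (delta_mx 0 j)} /\
        continuous_upto_boundary U (partial j (partial i v)) &
      {in U &, forall x y,
        enorm (hess v x - hess v y) <= K * enorm (x - y) `^ alpha}].

End function_spaces.

Section meshes.
Context {R : realType} {d : nat}.

(* The elements of a mesh are the convex hulls of the listed sets of nodes. *)
Record mesh := Mesh {
  nb_nodes : nat;
  node : 'I_nb_nodes -> 'rV[R]_d;
  elements : {set {set 'I_nb_nodes}} }.

Implicit Types (T : mesh) (Omega : set 'rV[R]_d) (v w : 'rV[R]_d -> R).

Local Notation leb := (lebesgue_rV (R := R) d).

Definition hull T (K : {set 'I_(nb_nodes T)}) : set 'rV[R]_d :=
  [set x | exists c : 'I_(nb_nodes T) -> R,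
     [/\ forall i, i \in K -> 0 <= c i, \sum_(i in K) c i = 1 &
         x = \sum_(i in K) c i *: node i]].

Definition affinely_independent T (K : {set 'I_(nb_nodes T)}) : Prop :=
  forall c : 'I_(nb_nodes T) -> R,
    \sum_(i in K) c i = 0 -> \sum_(i in K) c i *: node i = 0 ->
    forall i, i \in K -> c i = 0.

(* T is a conforming partition of Omega into d-simplices, so Omega is itself the
   polytope. No C^{1,1} domain is of this kind: imposing both would make every
   statement about meshes vacuous. What boundary regularity is used for enters
   through galerkin_Loo_estimate and discrete_ABP_estimate below. *)
Definition mesh_of Omega T : Prop :=
  [/\ injective (@node T),
      forall i, exists2 K, K \in elements T & i \in K,
      forall K, K \in elements T -> #|K| = d.+1 /\ affinely_independent K,
      forall K K', K \in elements T -> K' \in elements T ->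
        hull K `&` hull K' = hull (K :&: K') &
      Omega = interior (\bigcup_(K in [set` elements T]) hull K)].

Definition diam T (K : {set 'I_(nb_nodes T)}) : R :=
  sup [set r | exists x y, [/\ hull K x, hull K y & r = enorm (x - y)]].

Definition inscribed_diam T (K : {set 'I_(nb_nodes T)}) : R :=
  sup [set r | 0 <= r /\ exists x, eball x (r / 2) `<=` hull K].

Definition mesh_size T : R := \big[Num.max/0]_(K in elements T) diam K.

Definition shape_regular (sigma : R) T : Prop :=
  forall K, K \in elements T -> diam K <= sigma * inscribed_diam K.

Definition quasi_uniform (q : R) T : Prop :=
  forall K, K \in elements T -> mesh_size T <= q * diam K.

Definition interior_node Omega T (i : 'I_(nb_nodes T)) : bool :=
  `[< Omega (node i) >].

Definition Vh Omega T v : Prop :=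
  {within closure Omega, continuous v} /\
  forall K, K \in elements T ->
    exists (a : 'rV[R]_d) (b : R), forall x, hull K x -> v x = dot a x + b.

Definition Vh0 Omega T v : Prop :=
  Vh Omega T v /\ forall x, boundary Omega x -> v x = 0.

(* Extended by zero outside the closed domain, the hat function is unique. *)
Definition hat Omega T (i : 'I_(nb_nodes T)) : 'rV[R]_d -> R :=
  xget (fun=> 0) [set v | [/\ Vh Omega T v,
                              forall j, v (node j) = (i == j)%:R &
                              forall x, ~ closure Omega x -> v x = 0]].

Definition star Omega T (i : 'I_(nb_nodes T)) : set 'rV[R]_d :=
  closure [set x | hat Omega i x != 0].

(* Integral of G1 . G2 over the union of the elements in S. The union of their
   interiors is used: gradients of piecewise affine functions do not exist on
   the inter-element faces, which form a null set. *)
Definition dirichlet T (S : {set {set 'I_(nb_nodes T)}})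
    (G1 G2 : 'rV[R]_d -> 'rV[R]_d) : R :=
  \int[leb]_(x in \bigcup_(K in [set` S]) interior (hull K)) dot (G1 x) (G2 x).

Definition face_weakly_acute Omega T : Prop :=
  forall K K', K \in elements T -> K' \in elements T -> K != K' ->
    #|K :&: K'| = d ->
  forall i j : 'I_(nb_nodes T), i != j ->
    dirichlet [set K; K'] (grad (hat Omega i)) (grad (hat Omega j)) <= 0.

(* v is the Galerkin projection of a function with weak gradient Du. *)
Definition galerkin_projection Omega T (Du : 'rV[R]_d -> 'rV[R]_d) v : Prop :=
  Vh0 Omega T v /\
  forall w, Vh0 Omega T w ->
    dirichlet (elements T) (grad v) (grad w) =
    dirichlet (elements T) Du (grad w).

Definition galerkin_Loo_estimate Omega T (C : R) : Prop :=
  forall w Dw D2w wG,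
    W2oo Omega w Dw D2w -> zero_on_boundary Omega w ->
    galerkin_projection Omega T Dw wG ->
    (Lp_norm +oo Omega (w \- wG)%R <=
     (C * (mesh_size T ^+ 2 * `|ln (mesh_size T)|))%:E *
     Lp_norm +oo Omega (fun x => enorm (D2w x))%R)%E.

End meshes.
Arguments mesh : clear implicits.

Section two_scale_method.
Context {R : realType} {d : nat}.
Variables (Omega : set 'rV[R]_d) (lambda Lambda : R) (phi : 'rV[R]_d -> R).
Implicit Types (T : mesh R d) (A : 'rV[R]_d -> 'M[R]_d) (v : 'rV[R]_d -> R).

Local Notation leb := (lebesgue_rV (R := R) d).

Definition coefficient_matrix A : Prop :=
  [/\ forall i j, lebesgue_measurable_fun Omega (fun x => A x i j),
      forall x, Omega x -> (A x)^T = A x &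
      {ae leb, forall x, Omega x ->
         mx_le lambda%:M (A x) /\ mx_le (A x) Lambda%:M}].

Definition kernel_function : Prop :=
  [/\ smooth phi,
      forall x, 0 <= phi x,
      forall x y, enorm x = enorm y -> phi x = phi y,
      forall x, 1 < enorm x -> phi x = 0 &
      \int[leb]_y (enorm y ^+ 2 * phi y) = d%:R].

Definition Qradius : R := Num.sqrt (Lambda - lambda / 2).

Definition theta (eps : R) (x : 'rV[R]_d) : R :=
  if Qradius * eps < dist_to x (boundary Omega) then 1
  else sup [set t : R | 0 < t <= 1 /\
              forall y, eball 0 (Qradius * eps) y ->
                Omega (x + t *: y) /\ Omega (x - t *: y)].

Definition second_difference (eps : R) v (x y : 'rV[R]_d) : R :=
  let t := theta eps x in
  (t ^+ 2)^-1 * (v (x + t *: y) + v (x - t *: y) - 2 * v x).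

Definition star_measure T (i : 'I_(nb_nodes T)) : R :=
  fine (leb (star Omega i)).

Definition Abar A T (i : 'I_(nb_nodes T)) : 'M[R]_d :=
  \matrix_(k, l) ((star_measure i)^-1 * \int[leb]_(x in star Omega i) A x k l).

Definition Mnode A T (i : 'I_(nb_nodes T)) : 'M[R]_d :=
  sqrtmx (Abar A i - (lambda / 2)%:M).

(* Vectors are rows: M^-1 y is written y *m invmx M, M being symmetric. *)
Definition Ieps (eps : R) A T v (i : 'I_(nb_nodes T)) : R :=
  \int[leb]_y (second_difference eps v (node i) y /
                 (eps ^+ (d + 2) * \det (Mnode A i)) *
               phi (eps^-1 *: (y *m invmx (Mnode A i)))).

Definition discrete_laplacian T v (i : 'I_(nb_nodes T)) : R :=
  - (\int[leb]_(x in Omega) hat Omega i x)^-1 *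
  dirichlet (elements T) (grad v) (grad (hat Omega i)).

Definition Leps (eps : R) A T v (i : 'I_(nb_nodes T)) : R :=
  lambda / 2 * discrete_laplacian v i + Ieps eps A v i.

Definition load (f : 'rV[R]_d -> R) T (i : 'I_(nb_nodes T)) : R :=
  (\int[leb]_(x in Omega) (f x * hat Omega i x)) /
  (\int[leb]_(x in Omega) hat Omega i x).

Definition fem_solution (eps : R) A (f : 'rV[R]_d -> R) T v : Prop :=
  Vh0 Omega T v /\
  forall i : 'I_(nb_nodes T), interior_node Omega i ->
    Leps eps A v i = load f i.

(* The discrete Alexandroff-Bakelman-Pucci estimate, with a constant C that
   depends neither on the mesh, nor on eps, nor on A beyond its bounds. *)
Definition discrete_ABP_estimate (sigma q C : R) : Prop :=
  forall T A (eps : R), 0 < eps ->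
    mesh_of Omega T -> shape_regular sigma T -> quasi_uniform q T ->
    face_weakly_acute Omega T -> coefficient_matrix A ->
  forall v (g : 'I_(nb_nodes T) -> R),
    Vh Omega T v -> (forall x, boundary Omega x -> 0 <= v x) ->
    (forall i, interior_node Omega i -> Leps eps A v i <= g i) ->
  forall x, Omega x ->
    Num.max (- v x) 0 <=
    C * (\sum_(i | interior_node Omega i)
           Num.max (g i) 0 ^+ d * star_measure i) `^ d%:R^-1.

(* L^d distance, over the stars contained in U, between A and its averages. *)
Definition coefficient_oscillation A T (U : set 'rV[R]_d) : R :=
  (\sum_(i < nb_nodes T | interior_node Omega i && `[< star Omega i `<=` U >])
     \int[leb]_(x in star Omega i) (enorm (A x - Abar A i) ^+ d)) `^ d%:R^-1.

(* A : D2u = f a.e. in Omega *)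
Definition solves A (f : 'rV[R]_d -> R) (D2u : 'rV[R]_d -> 'M[R]_d) : Prop :=
  {ae leb, forall x, Omega x -> \sum_i \sum_j A x i j * D2u x i j = f x}.

End two_scale_method.

(* Main.v *)
(* Put tau = (h^2 |ln h|)^(1/(1+2d)), so that eps = C3 tau^d, and compare u_h with
   the Galerkin projection u_G, which is within C h^2 |ln h| <= C tau of u. The
   Alexandroff-Bakelman-Pucci estimate applied to u_G - u_h and u_h - u_G reduces
   everything to sum_i |r_i|^d |omega_i| <= C tau^d, where r_i = L u_G (x_i) - f_i.
   Testing against a hat turns the discrete Laplacian of u_G into the hat average of
   the Laplacian of u, and mollification gives |u(x+y) + u(x-y) - 2 u(x) - y.Hy| <=
   2 k |y|^2 whenever |D2u - H| <= k near x. Taking H = D2u(x_i) at the nodes whose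
   eps-neighbourhood lies in one subdomain gives |r_i| <= C (tau + mean |A - Abar|),
   and Jensen's inequality brings in the oscillation of A. The other nodes lie in a
   strip of width C eps around the Lipschitz interfaces, hence of measure C tau^d;
   there r_i is bounded, except in the layer of width h |ln h| along the boundary
   of the domain, where theta is small and r_i = O(|ln h|). *)

(* The choice of eps balances two errors. The projection error s = h^2 |ln h| = tau^(1+2d) costs s /
   eps^2, of order tau, in the integral operator, while the strips have measure of order eps, whose
   d-th root is again tau. The lower bound on alpha makes eps^alpha = O(tau) and, through 2 alpha /
   (2 + alpha) >= 2 / (1 + 2d), makes h^beta <= tau. Three obstacles shape the rest. The
   coefficients and D2u are Lebesgue measurable with bounds almost everywhere, so estimates are made
   on bounded Borel versions with bounded support, and integrals of the original data are only
   rewritten almost everywhere. A hat function is not smooth, so it enters weak derivatives through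
   truncation and mollification. Hat functions are selected by [xget] and supply no nodal basis, so
   meshes are handled through barycentric coordinates and the Galerkin projection comes from an
   abstract subspace of nodal vectors. *)
Require Import Defs.
From HB Require Import structures.
From mathcomp Require Import all_boot all_order all_algebra fingroup perm.
From mathcomp Require Import all_classical all_reals all_analysis.
From mathcomp Require Import measurable_realfun ess_sup_inf ring lra.

Set Implicit Arguments.
Unset Strict Implicit.
Unset Printing Implicit Defensive.

Import Order.TTheory GRing.Theory Num.Theory.
Import numFieldNormedType.Exports.

Local Open Scope classical_set_scope.
Local Open Scope ring_scope.

(** * Affine changes of variables *)

Section lebesgue_affine.
Context {R : realType}.
Local Notation mR := (measurableTypeR R).
Local Notation leb n := (lebesgue_rV (R := R) n).

Lemma measurable_affine1 (a b : R) :
  measurable_fun [set: mR] (fun t : mR => t * a + b : mR).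
Proof. by apply: measurable_funD => //; apply: measurable_funM. Qed.

(** The pushforward scaled by [|a|] gives half-open intervals their length, which characterises
    Lebesgue measure. For negative [a] the preimage of an interval is closed at the other end. *)
Lemma lebesgue_affine1 (a b : R) (A : set mR) : a != 0 -> measurable A ->
  (@lebesgue_measure R A =
   `|a|%:E * @lebesgue_measure R ((fun t => t * a + b)%R @^-1` A))%E.
Proof.
move=> a0 mA; have mf := measurable_affine1 a b.
pose mu : {measure set mR -> \bar R} :=
  mscale (NngNum (normr_ge0 a))
    (pushforward (@lebesgue_measure R) (fun t : mR => t * a + b : mR)).
rewrite (lebesgue_measure_unique (mu := mu mf)) //.
move=> X [[x y] _ <-] /=.
rewrite /mu /mscale /= /pushforward.
case: (ltgtP a 0) a0 => // a0 _.
- have -> : (fun t => t * a + b) @^-1` `]x, y]%classic =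
    `[(y - b) / a, (x - b) / a[%classic :> set R.
    apply/seteqP; split=> t /=;
      rewrite !in_itv /= ler_ndivrMr // ltr_ndivlMr //;
      by move=> /andP[h1 h2]; apply/andP; split; lra.
  rewrite !lebesgue_measure_itv /= !lte_fin ltr_nM2r ?invr_lt0 // ltrD2r.
  case: ifP => _; last by rewrite mule0.
  rewrite ltr0_norm// -!EFinB -EFinM; congr EFin; field; exact: ltr0_neq0.
- have -> : (fun t => t * a + b) @^-1` `]x, y]%classic =
    `](x - b) / a, (y - b) / a]%classic :> set R.
    apply/seteqP; split=> t /=;
      rewrite !in_itv /= ltr_pdivrMr // ler_pdivlMr //;
      by move=> /andP[h1 h2]; apply/andP; split; lra.
  rewrite !lebesgue_measure_itv /= !lte_fin ltr_pM2r ?invr_gt0 // ltrD2r.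
  case: ifP => _; last by rewrite mule0.
  rewrite gtr0_norm// -!EFinB -EFinM; congr EFin; field; exact: lt0r_neq0.
Qed.

Lemma ge0_integral_affine1 (f : mR -> \bar R) (a b : R) : a != 0 ->
  measurable_fun setT f -> (forall x, 0 <= f x)%E ->
  (\int[@lebesgue_measure R]_t f (t * a + b)%R =
   `|a|^-1%:E * \int[@lebesgue_measure R]_t f t)%E.
Proof.
move=> a0 mf f0; have ma := measurable_affine1 a b.
pose pf : {measure set mR -> \bar R} :=
    (pushforward (@lebesgue_measure R) (fun t : mR => t * a + b : mR)).
have -> : (\int[@lebesgue_measure R]_t f t =
    \int[mscale (NngNum (normr_ge0 a)) (pf ma)]_t f t)%E.
  by apply: eq_measure_integral => A mA _; exact: lebesgue_affine1.
rewrite ge0_integral_mscale// muleA -EFinM mulVf ?normr_eq0// mul1e.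
by rewrite ge0_integral_pushforward.
Qed.

Lemma ge0_integral_rVS n (f : 'rV[R]_n.+1 -> \bar R) :
  measurable_fun setT f -> (forall x, 0 <= f x)%E ->
  (\int[leb n.+1]_x f x =
   \int[@lebesgue_measure R]_t \int[leb n]_v f (rV_cons (t, v)))%E.
Proof.
move=> mf f0; rewrite [LHS]ge0_integral_pushforward//; last first.
  exact: measurable_rV_cons.
have mfc : measurable_fun setT (f \o @rV_cons R n).
  by apply: measurableT_comp => //; exact: measurable_rV_cons.
exact: (fubini_tonelli1 (m1 := @lebesgue_measure R) (m2 := leb n) _ mfc (fun x => f0 _)).
Qed.

Lemma ge0_integral_rVSC n (f : 'rV[R]_n.+1 -> \bar R) :
  measurable_fun setT f -> (forall x, 0 <= f x)%E ->
  (\int[leb n.+1]_x f x =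
   \int[leb n]_v \int[@lebesgue_measure R]_t f (rV_cons (t, v)))%E.
Proof.
move=> mf f0; rewrite [LHS]ge0_integral_pushforward//; last first.
  exact: measurable_rV_cons.
have mfc : measurable_fun setT (f \o @rV_cons R n).
  by apply: measurableT_comp => //; exact: measurable_rV_cons.
exact: (fubini_tonelli2 (m1 := @lebesgue_measure R) (m2 := leb n) _ mfc (fun x => f0 _)).
Qed.

Lemma measurable_rV_affine n m (A : 'M[R]_(n, m)) (b : 'rV[R]_m) :
  measurable_fun setT (fun x : 'rV[R]_n => x *m A + b).
Proof.
apply: measurable_fun_rV => i.
apply: (eq_measurable_fun (fun x : 'rV[R]_n => \sum_j x 0 j * A j i + b 0 i)).
  by move=> x _; rewrite !mxE.
apply: measurable_funD => //.
apply: measurable_sum => j; apply: measurable_funM => //.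
exact: measurable_coord.
Qed.

(** Quantifying over every translation [b] makes the property stable under products, so that it can
    be proved factor by factor. *)
Definition affine_change n (A : 'M[R]_n) := forall (f : 'rV[R]_n -> \bar R) b,
  measurable_fun setT f -> (forall x, 0 <= f x)%E ->
  (\int[leb n]_x f (x *m A + b)%R = `|\det A|^-1%:E * \int[leb n]_x f x)%E.

Lemma affine_change_mul n (A B : 'M[R]_n) :
  affine_change A -> affine_change B -> affine_change (A *m B).
Proof.
move=> hA hB f b mf f0.
pose g (y : 'rV[R]_n) := f (y *m B + b).
have mg : measurable_fun setT g.
  by apply: measurableT_comp => //; exact: measurable_rV_affine.
transitivity (\int[leb n]_x g (x *m A + 0)%R)%E.
  by apply: eq_integral => x _; rewrite /g addr0 mulmxA.
rewrite (hA g 0 mg (fun x => f0 _)) /g hB// muleA det_mulmx normrM invfM -EFinM.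
by [].
Qed.

Lemma rV_cons_block n (x : R * 'rV[R]_n) (a : R) (b : 'rV[R]_n) (c : 'cV[R]_n)
    (S : 'M[R]_n) (e : R * 'rV[R]_n) :
  rV_cons x *m (block_mx a%:M b c S : 'M[R]_n.+1) + rV_cons e =
  rV_cons (x.1 * a + (x.2 *m c) 0 0 + e.1, x.1 *: b + x.2 *m S + e.2).
Proof.
rewrite /rV_cons.
etransitivity; first exact: (f_equal (fun z => z + row_mx e.1%:M e.2)
  (mul_row_block x.1%:M x.2 a%:M b c S)).
apply: (etrans (@add_row_mx _ 1 1 n _ _ _ _)).
congr row_mx => /=.
  apply/matrixP => i j; rewrite !ord1 !mxE !big_ord1 !mxE eqxx !mulr1n.
  by [].
by rewrite mul_scalar_mx.
Qed.

(** For a fixed first coordinate [t], the row [b] only translates the remaining ones by [t *: b],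
    which [affine_change] absorbs; a one-dimensional change in [t] follows. *)
Lemma affine_change_upper n (a : R) (b : 'rV[R]_n) (S : 'M[R]_n) :
  a != 0 -> affine_change S ->
  @affine_change n.+1 (block_mx a%:M b 0 S).
Proof.
move=> a0 hS f e mf f0.
have mg : measurable_fun setT (fun x : 'rV[R]_n.+1 =>
    f (x *m (block_mx a%:M b 0 S : 'M[R]_n.+1) + e)).
  by apply: measurableT_comp => //; exact: measurable_rV_affine.
rewrite ge0_integral_rVS// [in RHS]ge0_integral_rVS//.
rewrite -(rV_unconsK e).
have mft t : measurable_fun setT (fun v : 'rV[R]_n => f (rV_cons (t, v))).
  apply: measurableT_comp => //.
  by apply: (measurableT_comp (@measurable_rV_cons R n)); exact: measurable_pair1.
transitivity (\int[@lebesgue_measure R]_t (`|\det S|^-1%:E *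
    \int[leb n]_v f (rV_cons (t * a + (rV_uncons e).1, v)%R)))%E.
  apply: eq_integral => t _; rewrite -(hS _ (t *: b + (rV_uncons e).2))//.
  apply: eq_integral => v _; rewrite rV_cons_block /= mulmx0 mxE addr0.
  by rewrite addrAC addrA addrAC [v *m S + _]addrC.
have mF : measurable_fun [set: mR] (fun t => \int[leb n]_v f (rV_cons (t, v)))%E.
  apply: (measurable_fun_fubini_tonelli_F (m2 := leb n) (f \o @rV_cons R n)).
    by apply: measurableT_comp => //; exact: measurable_rV_cons.
  by move=> x; exact: f0.
rewrite (ge0_integral_affine1 (f := fun t => (`|\det S|^-1%:E *
    \int[leb n]_v f (rV_cons (t, v)))%E))//.
- rewrite ge0_integralZl//; last by move=> t _; exact: integral_ge0.
  rewrite muleA -EFinM -invfM -normrM.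
  by rewrite (det_ublock a%:M b S) det_scalar1.
- exact: measurable_funeM.
- move=> t; apply: mule_ge0; first by rewrite lee_fin invr_ge0.
  exact: integral_ge0.
Qed.

(** Integrating in the first coordinate first, the shear is a translation by [v *m c]. *)
Lemma affine_change_shear n (c : 'cV[R]_n) : affine_change (1%:M : 'M[R]_n) ->
  @affine_change n.+1 (block_mx (1%:M : 'M[R]_1) 0 c 1%:M).
Proof.
move=> h1 f e mf f0.
have mg : measurable_fun setT (fun x : 'rV[R]_n.+1 =>
    f (x *m (block_mx (1%:M : 'M[R]_1) 0 c 1%:M : 'M[R]_n.+1) + e)).
  by apply: measurableT_comp => //; exact: measurable_rV_affine.
have -> : \det (block_mx (1%:M : 'M[R]_1) 0 c 1%:M : 'M[R]_n.+1) = 1.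
  by rewrite (det_lblock (1%:M : 'M[R]_1) c 1%:M) !det1 mulr1.
rewrite normr1 invr1 mul1e ge0_integral_rVSC//.
rewrite -(rV_unconsK e).
have mft v : measurable_fun [set: mR] (fun t => f (rV_cons (t, v))).
  apply: measurableT_comp => //.
  by apply: (measurableT_comp (@measurable_rV_cons R n)); exact: measurable_pair2.
transitivity (\int[leb n]_v \int[@lebesgue_measure R]_t
    f (rV_cons (t, v *m 1%:M + (rV_uncons e).2)%R))%E.
  apply: eq_integral => v _.
  have H := ge0_integral_affine1 ((v *m c) 0 0 + (rV_uncons e).1)
    (oner_neq0 R) (mft (v *m 1%:M + (rV_uncons e).2)) (fun x => f0 _).
  rewrite normr1 invr1 mul1e in H; rewrite -H.
  by apply: eq_integral => t _; rewrite rV_cons_block /= scaler0 add0r addrA.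
rewrite (ge0_integral_rVSC mf f0).
have mF : measurable_fun setT
    (fun v => \int[@lebesgue_measure R]_t f (rV_cons (t, v)))%E.
  apply: (measurable_fun_fubini_tonelli_G (m1 := @lebesgue_measure R)
    (f \o @rV_cons R n)).
    by apply: measurableT_comp => //; exact: measurable_rV_cons.
  by move=> x; exact: f0.
rewrite (h1 _ (rV_uncons e).2 mF); last by move=> v; exact: integral_ge0.
by rewrite det1 normr1 invr1 mul1e.
Qed.

(** Gaussian elimination, by induction on the dimension. *)
Lemma affine_change_unit n (A : 'M[R]_n) : A \in unitmx -> affine_change A.
Proof.
elim: n A => [|n IH] A Au.
  move=> f b mf f0; rewrite det_mx00 normr1 invr1 mul1e.
  by apply: eq_integral => x _; rewrite !thinmx0.
(* With a nonzero pivot: a shear times an upper block matrix whose lower right block is the Schur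
   complement. *)
have ind (B : 'M[R]_n.+1) : B \in unitmx -> B 0 0 != 0 -> affine_change B.
  move=> Bu a0; set a := B 0 0 in a0.
  pose b : 'rV[R]_n := ursubmx (B : 'M[R]_(1 + n)).
  pose c : 'cV[R]_n := dlsubmx (B : 'M[R]_(1 + n)).
  pose D : 'M[R]_n := drsubmx (B : 'M[R]_(1 + n)).
  have EB : B = block_mx (1%:M : 'M[R]_1) 0 (a^-1 *: c) 1%:M *m
      (block_mx a%:M b 0 (D - a^-1 *: (c *m b)) : 'M[R]_n.+1).
    rewrite [RHS](mulmx_block (1%:M : 'M[R]_1) 0 (a^-1 *: c) 1%:M a%:M b 0 _).
    rewrite -[LHS](submxK (B : 'M[R]_(1 + n))).
    rewrite !mul1mx !mul0mx !addr0 mul_mx_scalar scalerA mulfV//.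
    rewrite scale1r -scalemxAl addrC subrK.
    have -> // : ulsubmx (B : 'M[R]_(1 + n)) = a%:M.
    apply/matrixP => i j; rewrite !ord1 !mxE eqxx mulr1n /a.
    by congr (B _ _); apply/val_inj.
  have Eu : (block_mx a%:M b 0 (D - a^-1 *: (c *m b)) : 'M[R]_n.+1) \in unitmx.
    by move: Bu; rewrite EB unitmx_mul => /andP[].
  rewrite EB; apply: affine_change_mul; first by apply: affine_change_shear; exact: IH (unitmx1 _ _).
  apply: affine_change_upper => //; apply: IH.
  move: Eu; rewrite !unitmxE (det_ublock a%:M b) unitrM => /andP[_].
  by [].
have [a0|a0] := eqVneq (A 0 0) 0; last exact: ind.
have /existsP[k ak] : [exists k, A k 0 != 0].
  apply: contraT => /existsPn h; move: Au; rewrite unitmxE unitfE.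
  rewrite (expand_det_col _ 0) big1 ?eqxx// => i _.
  by have := h i; rewrite negbK => /eqP ->; rewrite mul0r.
case: (unliftP 0 k) ak => [k' ->|->]; last by rewrite a0 eqxx.
move=> ak.
(* [P 1] adds to the first row a row whose first entry is nonzero; [P (-1)] undoes it. *)
pose w : 'rV[R]_n := delta_mx 0 k'.
pose P (s : R) : 'M[R]_n.+1 := block_mx (1%:M : 'M[R]_1) (s *: w) 0 1%:M.
have PP : P (-1) *m P 1 = 1%:M.
  rewrite [LHS](mulmx_block (1%:M : 'M[R]_1) _ _ 1%:M 1%:M _ _ 1%:M).
  rewrite !mul1mx !mulmx1 !mulmx0 !mul0mx !addr0 add0r scaleN1r scale1r subrr.
  by rewrite -scalar_mx_block.
have -> : A = P (-1) *m (P 1 *m A) by rewrite mulmxA PP mul1mx.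
apply: affine_change_mul.
  apply: affine_change_upper; first exact: oner_neq0.
  by apply: IH; exact: unitmx1.
apply: ind.
  rewrite unitmx_mul Au andbT unitmxE (det_ublock (1%:M : 'M[R]_1)) !det1 mulr1.
  exact: unitr1.
suff -> : (P 1 *m A) 0 0 = A 0 0 + A (lift 0 k') 0 by rewrite a0 add0r.
rewrite mxE big_ord_recl; congr (_ + _).
  rewrite (_ : P 1 0 0 = 1) ?mul1r//.
  rewrite /P (_ : (0 : 'I_n.+1) = lshift n (0 : 'I_1)); last exact/val_inj.
  apply: (etrans (@block_mxEul R 1 n 1 n 1%:M (1 *: w) 0 1%:M 0 0)).
  by rewrite mxE eqxx.
rewrite (bigD1 k') //= big1 ?addr0; last first.
  move=> j jk; rewrite (_ : P 1 0 _ = 0) ?mul0r//.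
  rewrite /P (_ : (0 : 'I_n.+1) = lshift n (0 : 'I_1)); last exact/val_inj.
  rewrite (_ : @lift n.+1 ord0 j = rshift 1 j); last exact/val_inj.
  apply: (etrans (@block_mxEur R 1 n 1 n 1%:M (1 *: w) 0 1%:M 0 j)).
  by rewrite !mxE eqxx (negbTE jk) mulr0.
rewrite (_ : P 1 0 _ = 1) ?mul1r//.
rewrite /P (_ : (0 : 'I_n.+1) = lshift n (0 : 'I_1)); last exact/val_inj.
rewrite (_ : @lift n.+1 ord0 k' = rshift 1 k'); last exact/val_inj.
apply: (etrans (@block_mxEur R 1 n 1 n 1%:M (1 *: w) 0 1%:M 0 k')).
by rewrite !mxE !eqxx mulr1.
Qed.

End lebesgue_affine.

(** * Euclidean and Frobenius norms *)

Section frobenius.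
Context {R : realType}.

Definition mdot m n (A B : 'M[R]_(m, n)) : R := \sum_i \sum_j A i j * B i j.

Section mdot_theory.
Variables m n : nat.
Implicit Types (A B C : 'M[R]_(m, n)) (a : R).

Lemma mdotC A B : mdot A B = mdot B A.
Proof. by apply: eq_bigr => i _; apply: eq_bigr => j _; rewrite mulrC. Qed.

Lemma mdotDl A B C : mdot (A + B) C = mdot A C + mdot B C.
Proof.
rewrite -big_split; apply: eq_bigr => i _ /=; rewrite -big_split /=.
by apply: eq_bigr => j _; rewrite mxE mulrDl.
Qed.

Lemma mdotZl a A B : mdot (a *: A) B = a * mdot A B.
Proof.
rewrite mulr_sumr; apply: eq_bigr => i _ /=; rewrite mulr_sumr.
by apply: eq_bigr => j _; rewrite mxE mulrA.
Qed.

Lemma mdotDr A B C : mdot A (B + C) = mdot A B + mdot A C.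
Proof. by rewrite mdotC mdotDl !(mdotC A). Qed.

Lemma mdotZr a A B : mdot A (a *: B) = a * mdot A B.
Proof. by rewrite mdotC mdotZl mdotC. Qed.

Lemma mdotNl A B : mdot (- A) B = - mdot A B.
Proof. by rewrite -scaleN1r mdotZl mulN1r. Qed.

Lemma mdotNr A B : mdot A (- B) = - mdot A B.
Proof. by rewrite mdotC mdotNl mdotC. Qed.

Lemma mdotBl A B C : mdot (A - B) C = mdot A C - mdot B C.
Proof. by rewrite mdotDl mdotNl. Qed.

Lemma mdotBr A B C : mdot A (B - C) = mdot A B - mdot A C.
Proof. by rewrite mdotDr mdotNr. Qed.

Lemma mdot0l A : mdot 0 A = 0.
Proof. by rewrite -(scale0r A) mdotZl mul0r. Qed.

Lemma mdot_ge0 A : 0 <= mdot A A.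
Proof. by apply: sumr_ge0 => i _; apply: sumr_ge0 => j _; rewrite -expr2 sqr_ge0. Qed.

Lemma enorm_sqr A : enorm A ^+ 2 = mdot A A.
Proof.
rewrite /enorm sqr_sqrtr; last by apply: sumr_ge0 => i _; apply: sumr_ge0 => j _; exact: sqr_ge0.
by apply: eq_bigr => i _; apply: eq_bigr => j _; rewrite expr2.
Qed.

Lemma enorm_ge0 A : 0 <= enorm A.
Proof. exact: sqrtr_ge0. Qed.
Hint Resolve enorm_ge0 : core.

Lemma coord_le_enorm A i j : `|A i j| <= enorm A.
Proof.
rewrite -ler_sqr ?nnegrE// enorm_sqr real_normK ?num_real// /mdot.
rewrite (bigD1 i)//= (bigD1 j)//= -expr2 -addrA lerDl.
apply: addr_ge0; first by apply: sumr_ge0 => k _; rewrite -expr2 sqr_ge0.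
by apply: sumr_ge0 => k _; apply: sumr_ge0 => l _; rewrite -expr2 sqr_ge0.
Qed.

Lemma enorm0_eq0 A : enorm A = 0 -> A = 0.
Proof.
move=> A0; apply/matrixP => i j; rewrite mxE; apply/eqP.
by rewrite -normr_le0 -A0 coord_le_enorm.
Qed.

Lemma enorm0 : enorm (0 : 'M[R]_(m, n)) = 0.
Proof. by apply/eqP; rewrite -sqrf_eq0 enorm_sqr mdot0l. Qed.

Lemma enormZ a A : enorm (a *: A) = `|a| * enorm A.
Proof.
apply/eqP; rewrite -(@eqrXn2 _ 2) ?mulr_ge0//; apply/eqP.
by rewrite exprMn !enorm_sqr mdotZl mdotZr real_normK ?num_real// mulrA.
Qed.

Lemma enormN A : enorm (- A) = enorm A.
Proof. by rewrite -scaleN1r enormZ normrN1 mul1r. Qed.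

Lemma enormBC A B : enorm (A - B) = enorm (B - A).
Proof. by rewrite -enormN opprB. Qed.

Lemma mdot_le A B : mdot A B <= enorm A * enorm B.
Proof.
have [B0|B0] := eqVneq (enorm B) 0.
  by rewrite (enorm0_eq0 B0) mdotC mdot0l enorm0 mulr0.
have Bp : 0 < enorm B by rewrite lt_neqAle eq_sym B0 /=.
have [A0|A0] := eqVneq (enorm A) 0.
  by rewrite (enorm0_eq0 A0) mdot0l enorm0 mul0r.
have Ap : 0 < enorm A by rewrite lt_neqAle eq_sym A0 /=.
(* Expanded, this reads 2 |A| |B| (|A| |B| - A:B) >= 0. *)
have := mdot_ge0 (enorm B *: A - enorm A *: B).
rewrite mdotBl !mdotBr !mdotZl !mdotZr -!enorm_sqr (mdotC B A) => h.
have AB : 0 < enorm A * enorm B by exact: mulr_gt0.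
rewrite -(ler_pM2l AB); nra.
Qed.

Lemma normr_mdot_le A B : `|mdot A B| <= enorm A * enorm B.
Proof. by rewrite ler_norml mdot_le andbT lerNl -mdotNl -(enormN A) mdot_le. Qed.

Lemma enormD A B : enorm (A + B) <= enorm A + enorm B.
Proof.
rewrite -ler_sqr ?nnegrE ?addr_ge0// enorm_sqr mdotDl !mdotDr -!enorm_sqr.
by rewrite (mdotC B); have := mdot_le A B; nra.
Qed.

Lemma enormB A B : enorm (A - B) <= enorm A + enorm B.
Proof. by rewrite -(enormN B) enormD. Qed.

Lemma enorm_dist A B : `|enorm A - enorm B| <= enorm (A - B).
Proof.
have h1 := enormD (A - B) B; have h2 := enormD (B - A) A.
rewrite subrK in h1; rewrite subrK enormBC in h2.
by rewrite ler_norml; apply/andP; split; lra.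
Qed.

Lemma enorm_le_sum A : enorm A <= \sum_i \sum_j `|A i j|.
Proof.
have s0 : 0 <= \sum_i \sum_j `|A i j| by apply: sumr_ge0 => i _; apply: sumr_ge0.
rewrite -ler_sqr ?nnegrE// enorm_sqr expr2 {1}/mdot mulr_suml.
apply: ler_sum => i _; rewrite mulr_suml; apply: ler_sum => j _.
rewrite -expr2 -real_normK ?num_real// expr2; apply: ler_wpM2l => //.
by rewrite (bigD1 i)//= (bigD1 j)//= -addrA lerDl addr_ge0// ?sumr_ge0// => k _; rewrite sumr_ge0.
Qed.

Lemma enorm_delta i j : enorm (delta_mx i j : 'M[R]_(m, n)) = 1.
Proof.
apply/eqP; rewrite -(@eqrXn2 _ 2)// expr1n enorm_sqr /mdot; apply/eqP.
rewrite (bigD1 i)//= (bigD1 j)//= !mxE !eqxx mulr1 !big1 ?addr0// => k.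
  by move=> /negbTE ki; rewrite big1// => l _; rewrite mxE ki mul0r.
by move=> /negbTE kj; rewrite mxE kj andbF mul0r.
Qed.

Lemma normr_le_enorm A : `|A| <= enorm A.
Proof.
rewrite [`|A|]mx_normrE; apply/bigmax_leP; split; first exact: enorm_ge0.
by move=> ij _; exact: coord_le_enorm.
Qed.

Lemma enorm_le_normr A : enorm A <= (m * n)%:R * `|A|.
Proof.
apply: (le_trans (enorm_le_sum A)).
apply: (@le_trans _ _ (\sum_(i < m) \sum_(j < n) `|A|)).
  apply: ler_sum => i _; apply: ler_sum => j _; rewrite [leRHS]mx_normrE.
  exact: (le_trans _ (le_bigmax _ _ (i, j))).
by rewrite !sumr_const !card_ord -mulrnA mulr_natl mulnC.
Qed.

End mdot_theory.

Lemma mulmx_enorm m n p (A : 'M[R]_(m, n)) (B : 'M[R]_(n, p)) :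
  enorm (A *m B) <= enorm A * enorm B.
Proof.
rewrite -ler_sqr ?nnegrE ?mulr_ge0 ?enorm_ge0// exprMn !enorm_sqr.
rewrite /mdot [X in X * _](_ : _ = \sum_i \sum_k A i k ^+ 2); last first.
  by apply: eq_bigr => i _; apply: eq_bigr => j _; rewrite expr2.
rewrite [X in _ * X](_ : _ = \sum_j \sum_k B k j ^+ 2); last first.
  rewrite exchange_big; apply: eq_bigr => i _; apply: eq_bigr => j _ /=.
  by rewrite expr2.
rewrite mulr_suml; apply: ler_sum => i _; rewrite mulr_sumr; apply: ler_sum => j _.
have := mdot_le (row i A) (col j B)^T.
have := mdot_le (- row i A) (col j B)^T.
rewrite mdotNl enormN !mxE.
have -> : mdot (row i A) (col j B)^T = \sum_k A i k * B k j.
  by rewrite /mdot big_ord1; apply: eq_bigr => k _; rewrite !mxE.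
have -> : \sum_k A i k ^+ 2 = enorm (row i A) ^+ 2.
  by rewrite enorm_sqr /mdot big_ord1; apply: eq_bigr => k _; rewrite !mxE expr2.
have -> : \sum_k B k j ^+ 2 = enorm (col j B)^T ^+ 2.
  by rewrite enorm_sqr /mdot big_ord1; apply: eq_bigr => k _; rewrite !mxE expr2.
set S := \sum_k _ => h1 h2; have h : `|S| <= enorm (row i A) * enorm (col j B)^T.
  by rewrite ler_norml; apply/andP; split; lra.
by rewrite -exprMn -expr2 -(real_normK (num_real S)) ler_sqr ?nnegrE// mulr_ge0 ?enorm_ge0.
Qed.

End frobenius.
#[export] Hint Extern 0 (is_true (0 <= enorm _)) => exact: enorm_ge0 : core.

(** * Euclidean balls, topology and Borel sets of row vectors *)

Section euclidean_theory.
Context {R : realType} {d : nat}.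
Implicit Types (x y z : 'rV[R]_d).

Lemma dotE x y : dot x y = mdot x y.
Proof.
by rewrite /dot /mdot big_ord1 mxE; apply: eq_bigr => i _; rewrite mxE.
Qed.

Lemma dot_sum x y : dot x y = \sum_i x 0 i * y 0 i.
Proof. by rewrite dotE /mdot big_ord1. Qed.

Lemma dotC x y : dot x y = dot y x. Proof. by rewrite !dotE mdotC. Qed.
Lemma dotDl x y z : dot (x + y) z = dot x z + dot y z.
Proof. by rewrite !dotE mdotDl. Qed.
Lemma dotZl a x y : dot (a *: x) y = a * dot x y.
Proof. by rewrite !dotE mdotZl. Qed.
Lemma dotNl x y : dot (- x) y = - dot x y.
Proof. by rewrite !dotE mdotNl. Qed.
Lemma dotBl x y z : dot (x - y) z = dot x z - dot y z.
Proof. by rewrite !dotE mdotBl. Qed.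
Lemma dotDr x y z : dot x (y + z) = dot x y + dot x z.
Proof. by rewrite !dotE mdotDr. Qed.
Lemma dotZr a x y : dot x (a *: y) = a * dot x y.
Proof. by rewrite !dotE mdotZr. Qed.
Lemma dotNr x y : dot x (- y) = - dot x y.
Proof. by rewrite !dotE mdotNr. Qed.
Lemma dotBr x y z : dot x (y - z) = dot x y - dot x z.
Proof. by rewrite !dotE mdotBr. Qed.
Lemma dot0l x : dot 0 x = 0. Proof. by rewrite dotE mdot0l. Qed.
Lemma dot0r x : dot x 0 = 0. Proof. by rewrite dotC dot0l. Qed.
Lemma dotxx x : dot x x = enorm x ^+ 2. Proof. by rewrite dotE enorm_sqr. Qed.
Lemma normr_dot_le x y : `|dot x y| <= enorm x * enorm y.
Proof. by rewrite dotE normr_mdot_le. Qed.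

Lemma eball_norm x r : 0 < r -> eball x r `<=` ball x r.
Proof.
move=> r0 y; rewrite /eball /= => h; rewrite mx_norm_ball /ball_ /=.
by rewrite distrC (le_lt_trans (normr_le_enorm _)).
Qed.

Lemma norm_eball x r : 0 < r -> exists2 s, 0 < s & ball x s `<=` eball x r.
Proof.
move=> r0; have p0 : 0 < (1 * d)%:R + 1 :> R by rewrite ltr_wpDl.
exists (r / ((1 * d)%:R + 1)); first by rewrite divr_gt0.
move=> y; rewrite mx_norm_ball /ball_ /= distrC ltr_pdivlMr// => h.
rewrite /eball /=; apply: le_lt_trans h.
apply: (le_trans (enorm_le_normr _)); rewrite mulrC; apply: ler_wpM2l => //.
by rewrite lerDl.
Qed.

(** The topology of row vectors is that of the sup norm while the geometry here is Euclidean;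
    equivalence of the norms bridges the two. *)
Lemma nbhs_eballP x (A : set 'rV[R]_d) :
  nbhs x A <-> exists2 r, 0 < r & eball x r `<=` A.
Proof.
split.
  move=> /nbhs_ballP [r /= r0 h]; exists r => // y hy; apply: h.
  exact: eball_norm hy.
move=> [r r0 h]; have [s s0 hs] := norm_eball x r0.
by apply/nbhs_ballP; exists s => //= y hy; apply: h; apply: hs.
Qed.

Lemma open_eballP (A : set 'rV[R]_d) :
  open A <-> forall x, A x -> exists2 r, 0 < r & eball x r `<=` A.
Proof.
rewrite openE; split=> h x Ax; first exact/nbhs_eballP/h.
by apply/nbhs_eballP/h.
Qed.

Lemma eball_center x r : 0 < r -> eball x r x.
Proof. by move=> r0; rewrite /eball /= subrr enorm0. Qed.

Lemma open_eball x r : open (eball x r).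
Proof.
apply/open_eballP => y; rewrite /eball /= => h.
exists (r - enorm (y - x)); first by rewrite subr_gt0.
move=> z /=; rewrite ltrBrDr; apply: le_lt_trans.
by rewrite -[z - x](subrKA y) enormD.
Qed.

Lemma continuous_eballP (f : 'rV[R]_d -> R) x :
  {for x, continuous f} <-> forall e : R, 0 < e ->
  exists2 r : R, 0 < r & forall y, eball x r y -> `|f x - f y| < e.
Proof.
split => [h e e0|h].
  have /nbhs_eballP[r r0 hr] : \forall y \near x, `|f x - f y| < e.
    exact: (iffLR (@cvgrPdist_lt _ _ _ (nbhs x) (nbhs_filter x) f (f x)) h e e0).
  by exists r.
apply: (iffRL (@cvgrPdist_lt _ _ _ (nbhs x) (nbhs_filter x) f (f x))) => e e0.
by have [r r0 hr] := h _ e0; apply/nbhs_eballP; exists r.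
Qed.

Lemma enorm_continuous : continuous (fun x : 'rV[R]_d => enorm x).
Proof.
move=> x; apply/continuous_eballP => e e0; exists e => // y hy.
apply: le_lt_trans hy; rewrite distrC; exact: enorm_dist.
Qed.

Lemma mulmx_enorm_l x (A : 'M[R]_d) : enorm (x *m A) <= enorm x * enorm A.
Proof. exact: mulmx_enorm. Qed.

(** Measurable sets are generated by the coordinates, so [U] is exhausted by the countably many
    cubes inside it with rational centres and half-widths 1 / (k + 1). *)
Lemma open_rV_measurable (U : set 'rV[R]_d) : open U -> measurable U.
Proof.
move=> oU.
pose B (c : 'rV[rat]_d * nat) : set 'rV[R]_d :=
  \bigcap_(i in [set: 'I_d]) [set x | `|x 0 i - ratr (c.1 0 i)| < c.2.+1%:R^-1].
have mB c : measurable (B c).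
  rewrite /B; apply: fin_bigcap_measurable => //.
  move=> i _; rewrite -[X in measurable X]setTI.
  have mf : measurable_fun setT (fun x : 'rV[R]_d => `|x 0 i - ratr (c.1 0 i)|).
    apply: measurableT_comp => //; apply: measurable_funB => //.
    exact: measurable_coord.
  have := mf measurableT _ (measurable_itv `]-oo, c.2.+1%:R^-1[).
  by congr measurable; apply/seteqP; split => x /=; rewrite in_itv.
have -> : U = \bigcup_(c in [set c | B c `<=` U]) B c.
  apply/seteqP; split => [x Ux|x [c /= h]]; last exact: h.
  have /nbhs_ballP[e /= e0 he] : nbhs x U by move: oU; rewrite openE; exact.
  have e2 : 0 < e / 2 by rewrite divr_gt0.
  have [k _ /(_ k (leqnn k)) /= hk] := near_infty_natSinv_lt (PosNum e2).
  have ex i : exists q : rat, `|x 0 i - ratr q| < k.+1%:R^-1.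
    set a : R := k.+1%:R^-1.
    have kp : 0 < a by rewrite invr_gt0.
    have [|q] := @rat_in_itvoo R (x 0 i - a) (x 0 i + a).
      by rewrite ltrBlDr -addrA ltrDl addr_gt0.
    by rewrite in_itv /= => /andP[h1 h2]; exists q; rewrite ltr_norml; apply/andP; split; lra.
  pose c : 'rV[rat]_d := \row_i sval (cid (ex i)).
  exists (c, k).
    move=> y /= By; apply: he; rewrite mx_norm_ball /ball_ /=.
    rewrite [`|_|]mx_normrE; apply/bigmax_ltP; split => // -[i j] _ /=.
    rewrite !ord1 !mxE; have := By j I; have := svalP (cid (ex j)); rewrite /= mxE.
    pose a : R := k.+1%:R^-1; have ha : a < e / 2 := hk.
    rewrite -/a !ltr_norml => /andP[? ?] /andP[? ?]; apply/andP; split; lra.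
  by move=> i _ /=; rewrite mxE; exact: svalP (cid (ex i)).
rewrite bigcup_mkcond; apply: countable_bigcupT_measurable => // c.
by case: ifP => _ //; exact: mB.
Qed.

End euclidean_theory.

(** * Integration of bounded Borel functions *)

Section ae_integral.
Local Open Scope ereal_scope.
Context d (T : measurableType d) (R : realType) (mu : {measure set T -> \bar R}).
Import HBNNSimple.

(** Measurability is not assumed: the integral is a supremum over simple functions below [f], and
    such a function falls below [g] once set to 0 on the null set. This is what allows Lebesgue
    measurable data to be replaced by Borel versions under an integral. *)
Lemma ge0_ae_le_integral_gen (f g : T -> \bar R) :
  (forall x, 0 <= f x) -> (forall x, 0 <= g x) ->
  {ae mu, forall x, f x <= g x} -> \int[mu]_x f x <= \int[mu]_x g x.
Proof.
move=> f0 g0 [N [mN N0 subN]]; rewrite !ge0_integralTE//.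
apply: ge_ereal_sup => _ [h /= hf <-].
pose h' := proj_nnsfun h (measurableC mN).
have -> : sintegral mu h = sintegral mu h'.
  have E (k : {nnsfun T >-> R}) : sintegral mu k = \int[mu]_x (k x)%:E.
    by move=> *; rewrite (integral_nnsfun _ measurableT) patch_setT.
  rewrite !E; apply: ge0_ae_eq_integral => //.
  - exact/measurable_EFinP.
  - exact/measurable_EFinP.
  - by move=> x _; rewrite lee_fin.
  - by move=> x _; rewrite lee_fin.
  exists N; split => // x /=; apply: contra_notP => Nx _.
  by rewrite /h' /= mindicE mem_set// mulr1.
apply: ereal_sup_ubound; exists h' => //= x.
rewrite /h' /= mindicE; have [xN|xN] := boolP (x \in ~` N); last by rewrite mulr0.
rewrite mulr1; apply: (le_trans (hf x)).
by move: xN; rewrite inE /=; apply: contra_notP => h1; apply: subN.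
Qed.

Lemma ae_eq_integral_gen (f g : T -> \bar R) :
  {ae mu, forall x, f x = g x} -> \int[mu]_x f x = \int[mu]_x g x.
Proof.
move=> fg; rewrite integralE [RHS]integralE; congr (_ - _); apply/le_anti.
  by apply/andP; split; apply: ge0_ae_le_integral_gen => //;
    apply: filterS fg => x fgx; rewrite !funeposE fgx.
by apply/andP; split; apply: ge0_ae_le_integral_gen => //;
  apply: filterS fg => x fgx; rewrite !funenegE fgx.
Qed.

End ae_integral.

Section bounded_integrals.
Context {R : realType}.
Local Notation leb n := (lebesgue_rV (R := R) n).

Definition box n (r : R) : set 'rV[R]_n := [set x | forall i, `|x 0 i| < r].

Lemma box_measurable n r : measurable (@box n r).
Proof.
have -> : @box n r = \bigcap_(i in [set: 'I_n]) [set x | `|x 0 i| < r].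
  by apply/seteqP; split => x h i //=; exact: h.
apply: fin_bigcap_measurable => // i _.
have mf : measurable_fun setT (fun x : 'rV[R]_n => `|x 0 i|).
  by apply: measurableT_comp => //; exact: measurable_coord.
have := mf measurableT _ (measurable_itv `]-oo, r[).
by rewrite setTI; congr measurable; apply/seteqP; split => x /=; rewrite in_itv.
Qed.

Lemma box_lty n r : (leb n (@box n r) < +oo)%E.
Proof.
elim: n => [|n IH].
  by rewrite /= diracE; case: (_ \in _); rewrite ltry.
rewrite /= /lebesgue_cons /pushforward.
have -> : @rV_cons R n @^-1` (@box n.+1 r) = `]-r, r[%classic `*` @box n r.
  apply/seteqP; split => [[t v] h|[t v] [/= h1 h2] i].
    split; first by have := h ord0; rewrite rV_cons0 /= in_itv /= ltr_norml.
    by move=> i; have := h (lift ord0 i); rewrite rV_consS.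
  case: (unliftP ord0 i) => [j ->|->]; first by rewrite rV_consS; exact: h2.
  by rewrite rV_cons0 /= ltr_norml; move: h1; rewrite in_itv.
rewrite product_measure1E//; last exact: box_measurable.
rewrite lte_mul_pinfty ?measure_ge0//.
by have := lebesgue_measure_itv `]-r, r[ => /= ->; case: ifP.
Qed.

Section fixed_dim.
Variable n : nat.
Local Notation rV := 'rV[R]_n.
Implicit Types (f g : rV -> R).

Definition supported f := exists r : R, forall x, r <= enorm x -> f x = 0.
Definition bounded_fun f := exists M : R, forall x, `|f x| <= M.
(* Borel, bounded, and zero off some ball. *)
Definition bms f := [/\ measurable_fun setT f, bounded_fun f & supported f].

Lemma bms_measurable f : bms f -> measurable_fun setT f. Proof. by case. Qed.
Hint Resolve bms_measurable : core.

Lemma bmsM f g : bms f -> measurable_fun setT g -> bounded_fun g ->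
  bms (fun x => f x * g x).
Proof.
move=> [mf [M hM] [r hr]] mg [N hN]; split; first exact: measurable_funM.
  exists (M * N) => x; rewrite normrM; apply: ler_pM => //.
by exists r => x /hr ->; rewrite mul0r.
Qed.

Lemma bmsMr f g : bms f -> measurable_fun setT g -> bounded_fun g ->
  bms (fun x => g x * f x).
Proof.
move=> hf mg bg; have := bmsM hf mg bg; congr bms.
by apply/funext => x; rewrite mulrC.
Qed.

Lemma bmsMM f g : bms f -> bms g -> bms (fun x => f x * g x).
Proof. by move=> hf [mg bg _]; exact: bmsM. Qed.

Lemma bmsD f g : bms f -> bms g -> bms (fun x => f x + g x).
Proof.
move=> [mf [M hM] [r hr]] [mg [N hN] [s hs]]; split; first exact: measurable_funD.
  by exists (M + N) => x; apply: (le_trans (ler_normD _ _)); exact: lerD.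
exists (Num.max r s) => x; rewrite ge_max => /andP[h1 h2].
by rewrite hr// hs// addr0.
Qed.

Lemma bmsZ (a : R) f : bms f -> bms (fun x => a * f x).
Proof. by move=> hf; apply: bmsMr => //; exists `|a|. Qed.

Lemma bmsN f : bms f -> bms (fun x => - f x).
Proof. by move=> /(bmsZ (-1)); congr bms; apply/funext => x; rewrite mulN1r. Qed.

Lemma bmsB f g : bms f -> bms g -> bms (fun x => f x - g x).
Proof. by move=> hf /bmsN; exact: bmsD. Qed.

Lemma bms0 : bms (fun=> 0).
Proof. by split => //; [exists 0 => x; rewrite normr0|exists 0]. Qed.

Lemma bms_sum I (s : seq I) (P : pred I) (F : I -> rV -> R) :
  (forall i, P i -> bms (F i)) -> bms (fun x => \sum_(i <- s | P i) F i x).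
Proof.
move=> h; elim: s => [|i s IH].
  by rewrite (_ : (fun x => _) = fun=> 0); [exact: bms0|apply/funext => x; rewrite big_nil].
case Pi: (P i).
  rewrite (_ : (fun x => _) = fun x => F i x + \sum_(j <- s | P j) F j x).
    by apply: bmsD => //; exact: h.
  by apply/funext => x; rewrite big_cons Pi.
rewrite (_ : (fun x => _) = fun x => \sum_(j <- s | P j) F j x)//.
by apply/funext => x; rewrite big_cons Pi.
Qed.

Lemma bms_norm f : bms f -> bms (fun x => `|f x|).
Proof.
move=> [mf [M hM] [r hr]]; split; first exact: measurableT_comp.
  by exists M => x; rewrite normr_id.
by exists r => x /hr ->; rewrite normr0.
Qed.

Lemma bms_le f g : measurable_fun setT f -> bms g -> (forall x, `|f x| <= `|g x|) ->
  bms f.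
Proof.
move=> mf [mg [M hM] [r hr]] h; split => //.
  by exists M => x; exact: le_trans (h x) (hM x).
by exists r => x /hr gx; apply/eqP; rewrite -normr_le0 (le_trans (h x))// gx normr0.
Qed.

Lemma bms_indic (A : set rV) : measurable A -> (exists r : R, A `<=` eball 0 r) ->
  bms (\1_A : rV -> R).
Proof.
move=> mA [r hr]; split; first exact: measurable_indic.
  by exists 1 => x; rewrite indicE; case: (_ \in _); rewrite ?normr1// normr0.
exists r => x h; rewrite indicE memNset// => /hr.
by rewrite /eball /= subr0 ltNge h.
Qed.

Lemma bounded_lty (A : set rV) : (exists r : R, A `<=` eball 0 r) ->
  measurable A -> (leb n A < +oo)%E.
Proof.
move=> [r hr] mA; apply: le_lt_trans (box_lty n r).
apply: le_measure; rewrite ?inE//; first exact: box_measurable.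
move=> x /hr; rewrite /eball /= subr0 => h i.
exact: le_lt_trans (coord_le_enorm _ _ _) h.
Qed.

Lemma bms_integrable f : bms f -> (leb n).-integrable setT (EFin \o f).
Proof.
move=> [mf [M hM] [r hr]].
have mB : measurable (eball (0 : rV) r) by apply: open_rV_measurable; exact: open_eball.
have -> : EFin \o f = (EFin \o f) \_ (eball 0 r).
  apply/funext => x; rewrite /patch; case: ifPn => // h /=.
  rewrite hr//; move: h; rewrite notin_setE /eball /= subr0 => /negP.
  by rewrite -leNgt.
apply: (iffLR (integrable_mkcond _ mB)); apply: measurable_bounded_integrable => //.
- by apply: bounded_lty => //; exists r.
- exact: measurable_funTS.
exists M; split; first exact: num_real.
by move=> N hN x _; exact: le_trans (hM x) (ltW hN).
Qed.
Hint Resolve bms_integrable : core.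

Definition bint f : R := \int[leb n]_x f x.

Lemma bintE f : bms f -> (\int[leb n]_x (f x)%:E)%E = (bint f)%:E.
Proof.
move=> hf; rewrite /bint /Rintegral fineK//.
exact: integrable_fin_num (bms_integrable hf).
Qed.

Lemma eq_bint f g : f =1 g -> bint f = bint g.
Proof. by move=> fg; congr bint; apply/funext. Qed.

Lemma bintD f g : bms f -> bms g -> bint (fun x => f x + g x) = bint f + bint g.
Proof. by move=> hf hg; exact: RintegralD measurableT (bms_integrable hf) (bms_integrable hg). Qed.

Lemma bintZ a f : bms f -> bint (fun x => a * f x) = a * bint f.
Proof. by move=> hf; exact: RintegralZl measurableT (bms_integrable hf). Qed.

Lemma bintN f : bms f -> bint (fun x => - f x) = - bint f.
Proof.
move=> hf; rewrite -mulN1r -bintZ//.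
by apply: eq_bint => x; rewrite mulN1r.
Qed.

Lemma bintB f g : bms f -> bms g -> bint (fun x => f x - g x) = bint f - bint g.
Proof. by move=> hf hg; rewrite bintD ?bintN//; exact: bmsN. Qed.

Lemma bint0 : bint (fun=> 0) = 0.
Proof. by rewrite -[RHS](mul0r (bint (fun=> 0))) -bintZ ?mul0r//; exact: bms0. Qed.

Lemma bint_sum I (s : seq I) (P : pred I) (F : I -> rV -> R) :
  (forall i, P i -> bms (F i)) ->
  bint (fun x => \sum_(i <- s | P i) F i x) = \sum_(i <- s | P i) bint (F i).
Proof.
move=> h; elim: s => [|i s IH].
  by rewrite big_nil -[RHS]bint0; apply: eq_bint => x; rewrite big_nil.
rewrite big_cons; case Pi: (P i).
  rewrite -IH -bintD//; [|exact: h|exact: bms_sum].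
  by apply: eq_bint => x; rewrite big_cons Pi.
by rewrite -IH; apply: eq_bint => x; rewrite big_cons Pi.
Qed.

Lemma bint_ae_eq f g : {ae leb n, forall x, f x = g x} -> bint f = bint g.
Proof.
move=> fg; congr fine; apply: ae_eq_integral_gen.
by apply: filterS fg => x ->.
Qed.

Lemma bint_ge0 f : (forall x, 0 <= f x) -> 0 <= bint f.
Proof. by move=> f0; exact: Rintegral_ge0. Qed.

Lemma le_bint f g : bms f -> bms g -> (forall x, f x <= g x) -> bint f <= bint g.
Proof.
move=> hf hg fg; rewrite -subr_ge0 -bintB//.
by apply: bint_ge0 => x; rewrite subr_ge0.
Qed.

Lemma le_bint_ae f g : bms f -> bms g -> {ae leb n, forall x, f x <= g x} ->
  bint f <= bint g.
Proof.
move=> hf hg fg; have h : bms (fun x => g x - f x) by exact: bmsB.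
rewrite -subr_ge0 -bintB//.
rewrite (@bint_ae_eq _ (fun x => Num.max (g x - f x) 0)).
  by apply: bint_ge0 => x; rewrite le_max lexx orbT.
by apply: filterS fg => x fg; rewrite max_l// subr_ge0.
Qed.

Lemma le_normr_bint f : bms f -> `|bint f| <= bint (fun x => `|f x|).
Proof. by move=> hf; exact: le_normr_Rintegral measurableT (bms_integrable hf). Qed.

Lemma bint_indic (A : set rV) : measurable A -> bint (\1_A) = fine (leb n A).
Proof. by move=> mA; rewrite /bint /Rintegral integral_indic// setIT. Qed.

Lemma bint_set f (A : set rV) :
  \int[leb n]_(x in A) f x = bint (fun x => \1_A x * f x).
Proof.
rewrite Rintegral_mkcond; apply: eq_bint => x; rewrite /patch indicE.
by case: (_ \in _); rewrite ?mul1r ?mul0r.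
Qed.

Lemma bms_affine f (A : 'M[R]_n) (b : rV) : A \in unitmx -> bms f ->
  bms (fun x => f (x *m A + b)).
Proof.
move=> Au [mf [M hM] [r hr]]; split.
- by apply: measurableT_comp => //; exact: measurable_rV_affine.
- by exists M => x.
exists ((`|r| + enorm b) * enorm (invmx A) + 1) => x hx; apply: hr.
rewrite leNgt; apply/negP => h.
have h1 : enorm x <= enorm (x *m A) * enorm (invmx A).
  by rewrite -{1}[x](mulmxK Au) mulmx_enorm_l.
have h2 : enorm (x *m A) <= `|r| + enorm b.
  rewrite -{1}[x *m A](addrK b); apply: (le_trans (enormB _ _)); rewrite lerD2r.
  by apply: (le_trans (ltW h)); exact: ler_norm.
have := le_trans h1 (ler_wpM2r (enorm_ge0 _) h2).
by move: hx; lra.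
Qed.

Lemma bint_affine f (A : 'M[R]_n) (b : rV) : A \in unitmx -> bms f ->
  bint (fun x => f (x *m A + b)) = `|\det A|^-1 * bint f.
Proof.
move=> Au hf.
have pos g : bms g -> (forall x, 0 <= g x) ->
    bint (fun x => g (x *m A + b)) = `|\det A|^-1 * bint g.
  move=> hg g0; apply: EFin_inj; rewrite EFinM -!bintE//; last exact: bms_affine.
  rewrite -(@affine_change_unit _ _ _ Au (EFin \o g) b)//.
  by apply/measurable_EFinP; case: hg.
pose p x : R := Num.max (f x) 0; pose m x : R := Num.max (- f x) 0.
have E x : f x = p x - m x by rewrite /p /m /Num.max; do 2 case: ltP => ?; lra.
have bm g : bms g -> bms (fun x => Num.max (g x) 0).
  move=> hg; apply: (bms_le _ hg) => [|x].
    by apply: measurable_maxr => //; case: hg.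
  rewrite ger0_norm ?le_max ?lexx ?orbT// ge_max normr_ge0 andbT; exact: ler_norm.
have bp : bms p by exact: bm.
have bmm : bms m by apply: bm; exact: bmsN.
rewrite (eq_bint (g := fun x => p (x *m A + b) - m (x *m A + b))); last by move=> x; exact: E.
rewrite bintB; try exact: bms_affine.
rewrite !pos//; [|by move=> x; rewrite le_max lexx orbT..].
by rewrite -mulrBr -bintB//; congr (_ * _); apply: eq_bint => x; rewrite -E.
Qed.

Lemma bint_translate f (b : rV) : bms f -> bint (fun x => f (x + b)) = bint f.
Proof.
move=> hf; have := bint_affine b (unitmx1 _ _) hf.
rewrite det1 normr1 invr1 mul1r => <-; apply: eq_bint => x; by rewrite mulmx1.
Qed.

Lemma bms_translate f (b : rV) : bms f -> bms (fun x => f (x + b)).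
Proof.
move=> hf; have := bms_affine b (unitmx1 _ _) hf; congr bms.
by apply/funext => x; rewrite mulmx1.
Qed.

Lemma bint_dct (F : nat -> rV -> R) f (M r : R) :
  (forall k, measurable_fun setT (F k)) -> measurable_fun setT f ->
  (forall k x, `|F k x| <= M) -> (forall k x, r <= enorm x -> F k x = 0) ->
  {ae leb n, forall x, F ^~ x @ \oo --> f x} ->
  (fun k => bint (F k)) @ \oo --> bint f.
Proof.
move=> mF mf hM hr hf.
have bF k : bms (F k) by split => //; [exists M | exists r => x /hr].
pose g (x : rV) : R := `|M| * \1_(eball 0 r) x.
have bg : bms g.
  apply: bmsZ; apply: bms_indic; last by exists r.
  by apply: open_rV_measurable; exact: open_eball.
have Fg k x : `|F k x| <= g x.
  rewrite /g indicE; case: (boolP (x \in _)) => [_|].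
    by rewrite mulr1 (le_trans (hM k x))// ler_norm.
  by rewrite notin_setE /eball /= subr0 => /negP; rewrite -leNgt mulr0 => /hr ->; rewrite normr0.
have [i1 _ i2] : [/\ (leb n).-integrable setT (EFin \o f),
  [sequence (\int[leb n]_x (`|(F k x)%:E - (f x)%:E|))%E]_k @ \oo --> 0%E &
  [sequence (\int[leb n]_x (F k x)%:E)%E]_k @ \oo --> (\int[leb n]_x (f x)%:E)%E].
  apply: (@dominated_convergence _ _ _ (leb n) setT measurableT
    (fun k => EFin \o F k) (EFin \o f) (EFin \o g)).
  - by move=> k; apply/measurable_EFinP.
  - exact/measurable_EFinP.
  - by apply: filterS hf => x h _; apply: cvg_EFin => //; exact: nearW.
  - exact: bms_integrable.
  - by apply: aeW => x k _; rewrite lee_fin.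
apply/fine_cvg.
have fi : (\int[leb n]_x (f x)%:E)%E \is a fin_num by exact: integrable_fin_num i1.
rewrite /bint /Rintegral fineK//.
Qed.

Lemma bint_bound f (M r : R) : bms f -> (forall x, `|f x| <= M) ->
  (forall x, r <= enorm x -> f x = 0) ->
  `|bint f| <= M * bint (\1_(eball (0 : rV) r)).
Proof.
move=> hf hM hr; have mB : measurable (eball (0 : rV) r).
  by apply: open_rV_measurable; exact: open_eball.
have bB : bms (\1_(eball (0 : rV) r)) by apply: bms_indic => //; exists r.
apply: (le_trans (le_normr_bint hf)); rewrite -bintZ//.
apply: le_bint; [exact: bms_norm|exact: bmsZ|move=> x].
rewrite indicE; case: (boolP (x \in _)) => [_|]; first by rewrite mulr1.
by rewrite notin_setE /eball /= subr0 => /negP; rewrite -leNgt mulr0 => /hr ->; rewrite normr0.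
Qed.

End fixed_dim.

Lemma bint_fubini n m (F : 'rV[R]_n -> 'rV[R]_m -> R) (M r : R) :
  measurable_fun setT (fun z : 'rV[R]_n * 'rV[R]_m => F z.1 z.2) ->
  (forall x y, `|F x y| <= M) ->
  (forall x y, r <= enorm x \/ r <= enorm y -> F x y = 0) ->
  [/\ bms (fun x => bint (F x)), bms (fun y => bint (F ^~ y)) &
      bint (fun x => bint (F x)) = bint (fun y => bint (F ^~ y))].
Proof.
move=> mF hM hr.
have b1 x : bms (F x).
  split; [|by exists M|by exists r => y hy; apply: hr; right].
  exact: (measurableT_comp mF (measurable_pair1 x)).
have b2 y : bms (F ^~ y).
  split; [|by exists M|by exists r => x hx; apply: hr; left].
  exact: (measurableT_comp mF (measurable_pair2 y)).
have mB k : measurable (eball (0 : 'rV[R]_k) r).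
  by apply: open_rV_measurable; exact: open_eball.
have bB k : bms (\1_(eball (0 : 'rV[R]_k) r)) by apply: bms_indic => //; exists r.
have imf : ((leb n \x leb m)%E).-integrable setT (fun z : 'rV[R]_n * 'rV[R]_m => (F z.1 z.2)%:E).
  apply/integrable12ltyP; first exact/measurable_EFinP.
  pose c := `|M| * bint (\1_(eball (0 : 'rV[R]_m) r)).
  pose g (x : 'rV[R]_n) := c * \1_(eball (0 : 'rV[R]_n) r) x.
  have bg : bms g by exact: bmsZ.
  apply: (@le_lt_trans _ _ (\int[leb n]_x (g x)%:E)%E); last by rewrite bintE ?ltry.
  apply: ge0_ae_le_integral_gen.
  - by move=> x; exact: integral_ge0.
  - move=> x; rewrite lee_fin; apply: mulr_ge0; last by rewrite indicE.
    by apply: mulr_ge0 => //; apply: bint_ge0 => y; rewrite indicE.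
  apply: aeW => x /=; rewrite (bintE (bms_norm (b1 x))) lee_fin /g indicE.
  case: (boolP (x \in _)) => [_|].
    rewrite mulr1; apply: (le_trans (ler_norm _)); apply: bint_bound.
    - exact: bms_norm.
    - by move=> y; rewrite normr_id (le_trans (hM _ _))// ler_norm.
    - by move=> y hy; rewrite hr ?normr0//; right.
  rewrite notin_setE /eball /= subr0 => /negP; rewrite -leNgt mulr0 => hx.
  rewrite (eq_bint (g := fun=> 0)) ?bint0// => y.
  by rewrite hr ?normr0//; left.
have E1 : fubini_F (leb m) (fun z : 'rV[R]_n * 'rV[R]_m => (F z.1 z.2)%:E) =
    EFin \o (fun x => bint (F x)).
  by apply/funext => x; rewrite /fubini_F /= bintE.
have E2 : fubini_G (leb n) (fun z : 'rV[R]_n * 'rV[R]_m => (F z.1 z.2)%:E) =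
    EFin \o (fun y => bint (F ^~ y)).
  by apply/funext => y; rewrite /fubini_G /= bintE.
have c1 : bms (fun x => bint (F x)).
  split.
  - by apply/measurable_EFinP; rewrite -E1; exact: measurable_fubini_F imf.
  - exists (M * bint (\1_(eball (0 : 'rV[R]_m) r))) => x; apply: bint_bound => // y hy.
    by apply: hr; right.
  - exists r => x hx; rewrite (eq_bint (g := fun=> 0)) ?bint0// => y.
    by rewrite hr//; left.
have c2 : bms (fun y => bint (F ^~ y)).
  split.
  - by apply/measurable_EFinP; rewrite -E2; exact: measurable_fubini_G imf.
  - exists (M * bint (\1_(eball (0 : 'rV[R]_n) r))) => y; apply: bint_bound => // x hx.
    by apply: hr; left.
  - exists r => y hy; rewrite (eq_bint (g := fun=> 0)) ?bint0// => x.
    by rewrite hr//; right.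
split=> //; apply: EFin_inj; rewrite -!bintE//.
have := Fubini imf; rewrite -/(fubini_F _ _) -/(fubini_G _ _).
have -> : (\int[leb n]_x (bint (F x))%:E = \int[leb n]_x \int[leb m]_y (F x y)%:E)%E.
  by apply: eq_integral => x _; rewrite bintE.
move=> ->.
by apply/esym; apply: eq_integral => y _; rewrite -(bintE (b2 y)).
Qed.

End bounded_integrals.

(** * Volumes of strips around Lipschitz boundaries *)

Section volumes.
Context {R : realType} {d : nat}.
Local Notation rV := 'rV[R]_d.
Local Notation leb := (lebesgue_rV (R := R) d).

Lemma lebesgue_rV_translate (A : set rV) (b : rV) : measurable A ->
  leb [set x | A (x + b)] = leb A.
Proof.
move=> mA; have h := @affine_change_unit R d 1%:M (unitmx1 _ _)
  (EFin \o \1_A) b.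
have -> : leb A = (\int[leb]_x (\1_A x)%:E)%E by rewrite integral_indic// setIT.
have mB : measurable [set x | A (x + b)].
  have := measurable_rV_affine 1%:M b measurableT mA.
  by rewrite setTI; congr measurable; apply/seteqP; split => x /=; rewrite mulmx1.
have -> : leb [set x | A (x + b)] = (\int[leb]_x (\1_[set x | A (x + b)] x)%:E)%E.
  by rewrite integral_indic// setIT.
move: h; rewrite det1 normr1 invr1 mul1e => <-.
- by apply: eq_integral => x _; rewrite /= mulmx1.
- exact/measurable_EFinP.
- by move=> x; rewrite lee_fin.
Qed.

Lemma eball_measurable (x : rV) r : measurable (eball x r).
Proof. by apply: open_rV_measurable; exact: open_eball. Qed.

Lemma box_gt0 n (r : R) : 0 < r -> (0 < lebesgue_rV n (@box R n r))%E.
Proof.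
move=> r0; elim: n => [|n IH].
  by rewrite /= diracE mem_set// => -[].
rewrite /= /lebesgue_cons /pushforward.
have -> : @rV_cons R n @^-1` (@box R n.+1 r) = `]-r, r[%classic `*` @box R n r.
  apply/seteqP; split => [[t v] h|[t v] [/= h1 h2] i].
    split; first by have := h ord0; rewrite rV_cons0 /= in_itv /= ltr_norml.
    by move=> i; have := h (lift ord0 i); rewrite rV_consS.
  case: (unliftP ord0 i) => [j ->|->]; first by rewrite rV_consS; exact: h2.
  by rewrite rV_cons0 /= ltr_norml; move: h1; rewrite in_itv.
rewrite product_measure1E//; last exact: box_measurable.
apply: mule_gt0 => //.
have := lebesgue_measure_itv `]-r, r[ => /= ->.
rewrite lte_fin gtrN// -EFinB lte_fin; lra.
Qed.

Lemma eball_gt0 (x : rV) r : 0 < r -> (0 < leb (eball x r))%E.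
Proof.
move=> r0; have [s s0 hs] := norm_eball (0 : rV) r0.
rewrite -(lebesgue_rV_translate x (eball_measurable _ _)).
apply: (lt_le_trans (box_gt0 d s0)); apply: le_measure.
- by rewrite inE; exact: box_measurable.
- rewrite inE; have := measurable_rV_affine 1%:M x measurableT (eball_measurable x r).
  by rewrite setTI; congr measurable; apply/seteqP; split => y /=; rewrite mulmx1.
move=> y hy; have : ball (0 : rV) s y.
  rewrite mx_norm_ball /ball_ /= sub0r normrN [`|_|]mx_normrE.
  by apply/bigmax_ltP; split => // -[i j] _ /=; rewrite ord1; exact: hy.
by move=> /hs; rewrite /eball /= subr0 addrK.
Qed.

Lemma indic_ge0 (A : set rV) x : 0 <= \1_A x :> R.
Proof. by rewrite indicE. Qed.

Lemma le_indic (A B : set rV) x : A `<=` B -> \1_A x <= \1_B x :> R.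
Proof.
move=> AB; rewrite !indicE; case: (boolP (x \in A)) => [|_]; last by case: (_ \in _).
by rewrite inE => /AB Bx; rewrite mem_set.
Qed.

Lemma bms_indic_eball r : bms (\1_(eball (0 : rV) r)).
Proof. by apply: bms_indic; [exact: eball_measurable|exists r]. Qed.

(** Packing: translates of the slab by multiples of 3 delta along [n] are disjoint, and about 1 / (3
    delta) of them stay in one fixed ball. *)
Lemma vol_slab (F : rV -> R) (n : rV) (rho : R) :
  measurable_fun setT F -> (forall x t, F (x + t *: n) = F x + t) ->
  exists2 C, 0 <= C & forall delta : R, 0 < delta ->
    bint (\1_([set x | `|F x| <= delta] `&` eball 0 rho)) <= C * delta.
Proof.
move=> mF hF; pose V := bint (\1_(eball (0 : rV) (rho + enorm n))).
have V0 : 0 <= V by apply: bint_ge0 => x; exact: indic_ge0.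
exists (6 * V); first by rewrite mulr_ge0.
move=> e e0; set T := _ `&` _.
have mT : measurable T.
  apply: measurableI; last exact: eball_measurable.
  have mf : measurable_fun setT (fun x : rV => `|F x|) by exact: measurableT_comp.
  have := mf measurableT _ (measurable_itv `]-oo, e]).
  by rewrite setTI; congr measurable; apply/seteqP; split => x /=; rewrite in_itv.
have bT : bms (\1_T) by apply: bms_indic => //; exists rho => x [].
(* A wide slab is bounded by the whole ball. For [e <= 1 / 6] the step [s = 3 e] satisfies
   [s^-1 >= 2], so there are at least [s^-1 / 2] translates. *)
have [e6|e6] := ltP (6^-1) e.
  apply: (@le_trans _ _ V).
    apply: le_bint => //; first exact: bms_indic_eball.
    move=> x; apply: le_indic => y [_]; rewrite /eball /= => h.
    by rewrite (lt_le_trans h)// lerDl.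
  by move: e6; rewrite -(ltr_pM2l (x := 6))// mulfV// => e6; nra.
pose s := 3 * e; have s0 : 0 < s by rewrite mulr_gt0.
pose N := Num.truncn s^-1.
have N1 : s^-1 / 2 <= N%:R.
  have := truncn_itv (ltW (_ : 0 < s^-1)); rewrite invr_gt0 => /(_ s0).
  rewrite -/N -natr1 => /andP[_ h].
  have : 2 <= s^-1 by rewrite -[2]invrK lef_pV2 ?posrE// /s; lra.
  by lra.
have N2 : N%:R * s <= 1.
  have := truncn_itv (ltW (_ : 0 < s^-1)); rewrite invr_gt0 => /(_ s0) /andP[h _].
  by rewrite -ler_pdivlMr// mul1r.
pose G (x : rV) : R := \sum_(j < N) \1_T (x + (j%:R * s) *: n).
have bG : bms G by apply: bms_sum => j _; exact: bms_translate.
have IG : bint G = N%:R * bint (\1_T).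
  rewrite /G bint_sum; last by move=> j _; exact: bms_translate.
  rewrite (eq_bigr (fun=> bint (\1_T))); last by move=> j _; rewrite bint_translate.
  by rewrite sumr_const card_ord mulr_natl.
have GV : bint G <= V.
  apply: le_bint => //; first exact: bms_indic_eball.
  move=> x; rewrite /G.
  have [[j Tj]|no] := pselect (exists j : 'I_N, T (x + (j%:R * s) *: n)); last first.
    rewrite big1 ?indic_ge0// => j _; rewrite indicE memNset// => Tj; apply: no.
    by exists j.
  rewrite (bigD1 j)//= big1 ?addr0; last first.
    move=> k kj; rewrite indicE memNset// => -[/= + _].
    case: Tj => /= + _; rewrite !hF => h1 h2.
    have : `|(k%:R - j%:R) * s| <= 2 * e.
      have -> : (k%:R - j%:R) * s = (F x + k%:R * s) - (F x + j%:R * s) by ring.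
      by apply: (le_trans (ler_normB _ _)); lra.
    rewrite normrM (gtr0_norm s0).
    have : 1 <= `|k%:R - j%:R : R|.
      case: (ltngtP k j) (kj) => [kj' _|kj' _|/val_inj ->]; last by rewrite eqxx.
        rewrite distrC ger0_norm ?subr_ge0 ?ler_nat 1?ltnW//.
        by rewrite lerBrDr nat1r ler_nat.
      rewrite ger0_norm ?subr_ge0 ?ler_nat 1?ltnW//.
      by rewrite lerBrDr nat1r ler_nat.
    by move: s0; rewrite /s; nra.
  rewrite !indicE mem_set//; case: Tj => /= _; rewrite /eball /= subr0 => h.
  rewrite mem_set// /eball /= subr0.
  have -> : x = (x + (j%:R * s) *: n) - (j%:R * s) *: n by rewrite addrK.
  apply: (le_lt_trans (enormB _ _)); rewrite enormZ.
  apply: ltr_leD => //; rewrite ger0_norm; last by apply: mulr_ge0 => //; exact: ltW.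
  rewrite -[leRHS]mul1r; apply: ler_wpM2r => //; apply: le_trans N2.
  by rewrite ler_wpM2r ?(ltW s0)// ler_nat ltnW.
have T0 : 0 <= bint (\1_T) by apply: bint_ge0 => x; exact: indic_ge0.
rewrite IG in GV.
have h1 : s^-1 / 2 * bint (\1_T) <= V by apply: le_trans GV; exact: ler_wpM2r.
have -> : 6 * V * e = (2 * s) * V by rewrite /s; ring.
apply: le_trans (ler_wpM2l _ h1); last by lra.
by rewrite mulrA (_ : 2 * s * (s^-1 / 2) = 1) ?mul1r//; field; exact: lt0r_neq0.
Qed.

(** A hyperplane lies in slabs of every positive width, so its trace on each ball has measure 0. *)
Lemma hyperplane_negligible (a : rV) (b : R) : a != 0 ->
  leb.-negligible [set x | dot a x + b = 0].
Proof.
move=> a0.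
have aa : 0 < dot a a.
  rewrite dotxx exprn_gt0// lt_neqAle eq_sym enorm_ge0 andbT.
  by apply: contra a0 => /eqP /enorm0_eq0 ->.
pose F x := dot a x + b.
have mF : measurable_fun setT F.
  apply: measurable_funD => //.
  rewrite (_ : dot a = fun x => \sum_i a 0 i * x 0 i); last by apply/funext => x; rewrite dot_sum.
  apply: measurable_sum => i; apply: measurable_funM => //; exact: measurable_coord.
have hF x t : F (x + t *: ((dot a a)^-1 *: a)) = F x + t.
  rewrite /F dotDr !dotZr mulVf ?gt_eqF// mulr1; ring.
have mH k : measurable ([set x | F x = 0] `&` eball 0 k%:R).
  apply: measurableI; last exact: eball_measurable.
  have := mF measurableT _ (measurable_set1 0).
  by rewrite setTI.
have sub : [set x | dot a x + b = 0] `<=` \bigcup_k ([set x | F x = 0] `&` eball 0 k%:R).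
  move=> x /= hx; exists (Num.truncn (enorm x)).+1 => //; split => //.
  rewrite /eball /= subr0.
  by have := truncn_itv (enorm_ge0 x) => /andP[].
apply: negligibleS sub _; apply: negligible_bigcup => k; apply/negligibleP => //.
have [C C0 hC] := @vol_slab F _ k%:R mF hF.
set H := _ `&` _.
have HB : H `<=` eball 0 k%:R by move=> x [].
have Hf : (leb H < +oo)%E by apply: (bounded_lty _ (mH k)); exists k%:R.
have E : leb H = (bint (\1_H))%:E.
  by rewrite (bint_indic (mH k)) fineK// ge0_fin_numE.
apply: (etrans E); congr EFin; apply/eqP; rewrite eq_le; apply/andP; split; last first.
  by apply: bint_ge0 => x; exact: indic_ge0.
apply/ler_addgt0Pl => e e0; rewrite addr0.
have e1 : 0 < e / (C + 1) by rewrite divr_gt0// ltr_wpDl.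
apply: (@le_trans _ _ (C * (e / (C + 1)))); last first.
  rewrite mulrCA -[leRHS]mulr1 ler_wpM2l ?(ltW e0)// ler_pdivrMr ?ltr_wpDl//.
  by rewrite mul1r lerDl.
apply: le_trans (hC _ e1); apply: le_bint.
- by apply: (bms_indic (mH k)); exists k%:R.
- apply: bms_indic; last by exists k%:R => x; case.
  apply: measurableI; last exact: eball_measurable.
  have mf : measurable_fun setT (fun x : rV => `|F x|) by exact: measurableT_comp.
  have := mf measurableT _ (measurable_itv `]-oo, (e / (C + 1))]).
  by rewrite setTI; congr measurable; apply/seteqP; split => x /=; rewrite in_itv.
move=> x; apply: le_indic => y [/= h1 h2]; split => //=.
by rewrite h1 normr0 ltW.
Qed.

Definition nbd (A : set rV) (delta : R) : set rV :=
  [set x | exists2 z, A z & enorm (x - z) < delta].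

Lemma nbd_measurable A delta : measurable (nbd A delta).
Proof.
apply: open_rV_measurable.
have -> : nbd A delta = \bigcup_(z in A) eball z delta.
  by apply/seteqP; split => x [z Az h]; exists z.
by apply: bigcup_open => z _; exact: open_eball.
Qed.

Lemma graph_height_lipschitz (L : R) (n : rV) (g : rV -> R) (x y : rV) :
  (forall x y, `|g x - g y| <= L * enorm (x - y)) -> enorm n = 1 ->
  `|(dot x n - g (x - dot x n *: n)) - (dot y n - g (y - dot y n *: n))| <=
    (1 + 2 * `|L|) * enorm (x - y).
Proof.
move=> hg n1.
have e1 : `|dot x n - dot y n| <= enorm (x - y).
  by rewrite -dotBl (le_trans (normr_dot_le _ _))// n1 mulr1.
have e2 : enorm ((x - dot x n *: n) - (y - dot y n *: n)) <= 2 * enorm (x - y).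
  have -> : (x - dot x n *: n) - (y - dot y n *: n) = (x - y) - (dot x n - dot y n) *: n.
    by apply/rowP => i; rewrite !mxE; ring.
  by apply: (le_trans (enormB _ _)); rewrite enormZ n1 mulr1; lra.
have e3 := hg (x - dot x n *: n) (y - dot y n *: n).
have e4 : L * enorm ((x - dot x n *: n) - (y - dot y n *: n)) <= `|L| * (2 * enorm (x - y)).
  by apply: (le_trans (ler_wpM2r (enorm_ge0 _) (ler_norm L))); exact: ler_wpM2l.
set a := dot x n; set b := dot y n; set c := g _; set e := g _.
have -> : (a - c) - (b - e) = (a - b) - (c - e) by ring.
by apply: (le_trans (ler_normB _ _)); move: e1 e3; rewrite -/a -/b -/c -/e; lra.
Qed.

(** The height above the graph is continuous and its sign decides membership in [U] near [z]; around
    a point of nonzero height a whole ball is on one side. *)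
Lemma lipschitz_graph_boundary (U : set rV) (z : rV) (r L : R) (n : rV) (g : rV -> R) :
  (forall x y, `|g x - g y| <= L * enorm (x - y)) ->
  enorm n = 1 ->
  (forall x, eball z r x -> (U x <-> g (x - dot x n *: n) < dot x n)) ->
  forall w, eball z r w -> boundary U w -> dot w n = g (w - dot w n *: n).
Proof.
move=> hg n1 hU w zw [clw nint].
pose F x := dot x n - g (x - dot x n *: n).
have FL x y : `|F x - F y| <= (1 + 2 * `|L|) * enorm (x - y).
  exact: graph_height_lipschitz.
have L0 : 0 <= `|L| by [].
have c0 : 0 < 1 + 2 * `|L| by lra.
have [r2 r20 hr2] : exists2 s : R, 0 < s & eball w s `<=` eball z r.
  exact: (open_eballP _).1 (@open_eball _ _ z r) w zw.
apply: contrapT => Fw.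
have F0 : 0 < `|F w| by rewrite normr_gt0 subr_eq0; apply/eqP.
pose s := Num.min r2 (`|F w| / (1 + 2 * `|L|)).
have s0 : 0 < s by rewrite lt_min r20 divr_gt0.
have hs y : eball w s y -> eball z r y /\ `|F y - F w| < `|F w|.
  rewrite /eball /= lt_min => /andP[h1 h2]; split; first exact: hr2.
  apply: (le_lt_trans (FL _ _)); by rewrite mulrC -ltr_pdivlMr.
have [Fp|Fn] := ltP 0 (F w).
  apply: nint; apply/nbhs_eballP; exists s => // y /hs[zy].
  rewrite (gtr0_norm Fp) ltr_norml => /andP[h _].
  by apply/(hU y zy); rewrite -subr_gt0 -/(F y); lra.
have h : nbhs w (eball w s) by apply/nbhs_eballP; exists s.
have [y [Uy /hs[zy]]] := clw _ h.
rewrite (ler0_norm Fn) ltr_norml => /andP[_ h3].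
by move/(hU y zy): Uy; rewrite -subr_gt0 -/(F y); lra.
Qed.

Lemma boundary_closed (U : set rV) : closed (boundary U).
Proof.
rewrite /boundary setDE; apply: closedI; first exact: closed_closure.
apply: open_closedC; exact: open_interior.
Qed.

Lemma bounded_setP (U : set rV) : bounded_set U -> exists2 r : R, 0 < r & U `<=` eball 0 r.
Proof.
move=> [M [_ hM]]; exists ((1 * d)%:R * (`|M| + 1) + 1).
  by rewrite ltr_wpDl// mulr_ge0// addr_ge0.
move=> x Ux; rewrite /eball /= subr0; apply: (le_lt_trans (enorm_le_normr _)).
apply: (@le_lt_trans _ _ ((1 * d)%:R * (`|M| + 1))); last by rewrite ltrDl.
apply: ler_wpM2l => //; apply: (hM (`|M| + 1)) => //.
by rewrite (le_lt_trans (ler_norm _))// ltrDl.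
Qed.

Lemma bounded_eball (U : set rV) (r : R) : U `<=` eball 0 r -> bounded_set U.
Proof.
move=> h; exists r; split; first exact: num_real.
move=> N rN x /h; rewrite /eball /= subr0 => xr.
by apply: (le_trans (normr_le_enorm _)); apply: ltW; exact: lt_trans rN.
Qed.

Lemma closure_eball (U : set rV) (r : R) : U `<=` eball 0 r -> closure U `<=` eball 0 (r + 1).
Proof.
move=> h x /(_ (eball x 1))[]; first by apply/nbhs_eballP; exists 1.
move=> y [/h]; rewrite /eball /= !subr0 => h1 h2.
have -> : x = y - (y - x) by rewrite opprB addrC subrK.
by apply: (le_lt_trans (enormB _ _)); rewrite ltrD.
Qed.

(** By compactness finitely many graph charts cover the boundary. In each chart the height is
    Lipschitz and vanishes on the boundary, so the strip lies in a slab of comparable width. *)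
Lemma vol_strip (U : set rV) (rho : R) : bounded_set U -> lipschitz_boundary U ->
  exists2 C, 0 <= C & forall delta : R, 0 < delta ->
    bint (\1_(nbd (boundary U) delta `&` eball 0 rho)) <= C * delta.
Proof.
move=> /bounded_setP[rU rU0 hrU] lipU.
have cU : compact (boundary U).
  apply: bounded_closed_compact; last exact: boundary_closed.
  apply: (@bounded_eball _ (rU + 1)) => x [clx _]; exact: closure_eball hrU x clx.
pose P (z : rV) (rC : R * R) := [/\ 0 < rC.1, 0 <= rC.2 & forall delta, 0 < delta -> delta <= rC.1 ->
   bint (\1_(nbd (boundary U `&` eball z rC.1) delta `&` eball 0 rho)) <= rC.2 * delta].
have ex z : exists rC, boundary U z -> P z rC.
  have [bz|nbz] := pselect (boundary U z); last by exists (0, 0).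
  have [r [L [n [g [r0 n1 hg hU]]]]] := lipU z bz.
  have hb := lipschitz_graph_boundary hg n1 hU.
  pose F x := dot x n - g (x - dot x n *: n).
  have FL x y : `|F x - F y| <= (1 + 2 * `|L|) * enorm (x - y).
    exact: graph_height_lipschitz.
  have L0 : 0 <= `|L| by [].
  have c0 : 0 < 1 + 2 * `|L| by lra.
  have mF : measurable_fun setT F.
    have cF : continuous F.
      move=> x; apply/continuous_eballP => e e0; exists (e / (1 + 2 * `|L|)).
        by rewrite divr_gt0.
      move=> y; rewrite /eball /= ltr_pdivlMr// mulrC => h; apply: le_lt_trans h.
      by rewrite distrC; exact: FL.
    apply: (measurability _ (RGenOpens.measurableE R)) => //.
    move=> _ [_ [a [b ->] <-]]; rewrite setTI; apply: open_rV_measurable.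
    by apply: open_comp => //; exact: interval_open.
  have hF x t : F (x + t *: n) = F x + t.
    rewrite /F dotDl dotZl dotxx n1 expr1n mulr1.
    have -> : x + t *: n - (dot x n + t) *: n = x - dot x n *: n.
      by apply/rowP => i; rewrite !mxE; ring.
    ring.
  have [C C0 hC] := vol_slab rho mF hF.
  exists (r / 2, C * (1 + 2 * `|L|)) => _; split => /=.
  - by rewrite divr_gt0.
  - by rewrite mulr_ge0// ltW.
  move=> e e0 er; rewrite -mulrA; apply: le_trans (hC _ (mulr_gt0 c0 e0)).
  have mS : measurable ([set x | `|F x| <= (1 + 2 * `|L|) * e] `&` eball 0 rho).
    apply: measurableI; last exact: eball_measurable.
    have mf : measurable_fun setT (fun x : rV => `|F x|) by exact: measurableT_comp.
    have := mf measurableT _ (measurable_itv `]-oo, ((1 + 2 * `|L|) * e)]).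
    by rewrite setTI; congr measurable; apply/seteqP; split => x /=; rewrite in_itv.
  apply: le_bint.
  - apply: bms_indic; last by exists rho => x [].
    by apply: measurableI; [exact: nbd_measurable|exact: eball_measurable].
  - by apply: bms_indic => //; exists rho => x [].
  move=> x; apply: le_indic => y [[w [bw zw] yw] By]; split => //=.
  have Fw : F w = 0.
    apply/eqP; rewrite subr_eq0; apply/eqP; apply: hb => //; move: zw; rewrite /eball /= => h.
    by apply: (lt_trans h); rewrite ltr_pdivrMr// mulr2n mulrDr mulr1 ltrDl.
  have := FL y w; rewrite Fw subr0 => h; apply: (le_trans h).
  by apply: ler_wpM2l; exact: ltW.
pose rC z := sval (cid (ex z)).
have hrC z : boundary U z -> P z (rC z) by exact: svalP (cid (ex z)).
move: (cU); rewrite compact_cover => /(_ rV (boundary U) (fun z => eball z ((rC z).1 / 2))).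
case.
- by move=> z _; exact: open_eball.
- move=> z bz; exists z => //; apply: eball_center; rewrite divr_gt0//.
  by case: (hrC z bz).
move=> D hD cov.
have hD' z (zD : z \in finmap.enum_fset D) : boundary U z := set_mem (hD z zD).
pose r0 : R := \big[Num.min/1]_(z <- finmap.enum_fset D) ((rC z).1 / 2).
have r00 : 0 < r0.
  rewrite /r0 big_seq; elim/big_ind : _ => //.
    by move=> x y x0 y0; rewrite lt_min x0.
  by move=> z /hD' bz; rewrite divr_gt0//; case: (hrC z bz).
pose B := bint (\1_(eball (0 : rV) rho)).
have B0 : 0 <= B by apply: bint_ge0 => x; exact: indic_ge0.
(* The summand [B / r0] serves widths [e] above [r0], where the whole ball has volume at most
   [B / r0 * e]. *)
pose C := \sum_(z <- finmap.enum_fset D) `|(rC z).2| + B / r0.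
have C0 : 0 <= C.
  by rewrite /C addr_ge0// ?divr_ge0// ?(ltW r00)//; apply: sumr_ge0.
exists C => // e e0.
have mS A : measurable (nbd A e `&` eball 0 rho).
  by apply: measurableI; [exact: nbd_measurable|exact: eball_measurable].
have bS A : bms (\1_(nbd A e `&` eball 0 rho)).
  by apply: bms_indic => //; exists rho => x [].
have S0 : 0 <= \sum_(z <- finmap.enum_fset D) `|(rC z).2| by apply: sumr_ge0.
have [er|er] := ltP r0 e.
  apply: (@le_trans _ _ B).
    apply: le_bint => //; first exact: bms_indic_eball.
    by move=> x; apply: le_indic => y [].
  apply: (@le_trans _ _ (B / r0 * e)).
    by rewrite mulrAC ler_pdivlMr// ler_wpM2l// ltW.
  by rewrite ler_wpM2r ?(ltW e0)// /C lerDr.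
apply: (@le_trans _ _ (\sum_(z <- finmap.enum_fset D) `|(rC z).2| * e)); last first.
  rewrite -mulr_suml ler_wpM2r ?(ltW e0)// /C lerDl divr_ge0//; exact: ltW.
apply: (@le_trans _ _ (\sum_(z <- finmap.enum_fset D)
    bint (\1_(nbd (boundary U `&` eball z (rC z).1) e `&` eball 0 rho)))).
  rewrite -bint_sum; last by move=> z _; exact: bS.
  apply: le_bint => //; first by apply: bms_sum => z _; exact: bS.
  move=> x; rewrite indicE; case: (boolP (x \in _)) => [|_]; last first.
    by apply: sumr_ge0 => z _; exact: indic_ge0.
  rewrite inE => -[[w bw xw] Bx].
  have [z /= zD wz] := cov _ bw.
  rewrite (big_rem z)//= indicE mem_set.
    by rewrite lerDl; apply: sumr_ge0 => y _; exact: indic_ge0.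
  split => //; exists w => //; split => //; move: wz; rewrite /eball /= => h.
  have [h1 _ _] := hrC z (hD' z zD).
  by apply: (lt_trans h); rewrite ltr_pdivrMr// mulr2n mulrDr mulr1 ltrDl.
rewrite big_seq [leRHS]big_seq; apply: ler_sum => z zD.
have [h1 h2 h3] := hrC z (hD' z zD).
rewrite (ger0_norm h2); apply: h3 => //; apply: (le_trans er).
apply: (@le_trans _ _ ((rC z).1 / 2)); last by rewrite ler_pdivrMr// mulr2n mulrDr mulr1 lerDl ltW.
rewrite /r0; elim: (finmap.enum_fset D) zD => // y t IH.
by rewrite inE big_cons ge_min => /orP[/eqP ->|/IH ->]; rewrite ?lexx ?orbT.
Qed.

End volumes.

(** * Directional derivatives *)

Section difference_quotients.
Context {R : realType}.

Lemma is_deriveP (V : normedModType R) (f : V -> R) (x v : V) (l : R) :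
  is_derive x v f l <-> forall e : R, 0 < e -> exists2 r : R, 0 < r &
    forall h : R, h != 0 -> `|h| < r -> `|h^-1 * (f (x + h *: v) - f x) - l| < e.
Proof.
have E : (fun h => h^-1 *: ((f \o shift x) (h *: v) - f x)) =
    (fun h : R => h^-1 * (f (x + h *: v) - f x)).
  by apply/funext => h /=; rewrite /shift /= [h *: v + x]addrC.
split=> [[/= df dl] e e0|H].
  have cv : (fun h : R => h^-1 * (f (x + h *: v) - f x)) @ 0^' --> l.
    by rewrite -dl /derive E; move: df; rewrite /derivable E => /cvg_toP; exact.
  move/cvgrPdist_lt: cv => /(_ e e0) /nbhs_ballP[r /= r0 hr]; exists r => // h h0 hh; rewrite distrC.
  by apply: hr => //; rewrite /ball /= sub0r normrN.
have cv : (fun h : R => h^-1 * (f (x + h *: v) - f x)) @ 0^' --> l.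
  apply/cvgrPdist_lt => e e0.
  have [r r0 hr] := H e e0; apply/nbhs_ballP; exists r => //= h.
  by rewrite /ball /= sub0r normrN distrC => hh h0; exact: hr.
split; first by rewrite /derivable E; apply/cvg_ex; exists l.
by rewrite /derive E; exact: cvg_lim cv.
Qed.

(** The sequential form is the one to which dominated convergence applies. *)
Lemma is_derive_seqP (V : normedModType R) (f : V -> R) (x v : V) (l : R) :
  is_derive x v f l <-> forall h : nat -> R, (forall k, h k != 0) ->
    h @ \oo --> 0 -> (fun k => (h k)^-1 * (f (x + h k *: v) - f x)) @ \oo --> l.
Proof.
split=> [/is_deriveP H h h0 hc|H].
  apply/cvgrPdist_lt => e e0; have [r r0 hr] := H e e0.
  move/cvgrPdist_lt: hc => /(_ r r0).
  by apply: filterS => k; rewrite sub0r normrN distrC; exact: hr.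
apply/is_deriveP => e e0; apply: contrapT => no.
have ex k : exists h : R, [/\ h != 0, `|h| < k.+1%:R^-1 &
    e <= `|h^-1 * (f (x + h *: v) - f x) - l|].
  apply: contrapT => no'; apply: no; exists k.+1%:R^-1; first by rewrite invr_gt0.
  by move=> h h0 hk; rewrite ltNge; apply/negP => he; apply: no'; exists h.
pose h k := sval (cid (ex k)).
have hP k := svalP (cid (ex k)).
have h0 k : h k != 0 by case: (hP k).
have hc : h @ \oo --> 0.
  apply/cvgrPdist_lt => a a0; have := near_infty_natSinv_lt (PosNum a0).
  apply: filterS => k /= ka; rewrite sub0r normrN; apply: lt_trans ka.
  by case: (hP k).
move/cvgrPdist_lt: (H h h0 hc) => /(_ e e0).
case=> N _ /(_ N (leqnn N)) /=; rewrite distrC.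
by case: (hP N) => _ _; rewrite -/(h N) leNgt => /negP.
Qed.

Lemma is_derive_lineP (V : normedModType R) (f : V -> R) (x v : V) (t l : R) :
  is_derive (x + t *: v) v f l <->
  is_derive t (1 : R) (fun s : R => f (x + s *: v)) l.
Proof.
have E (h : R) : x + t *: v + h *: v = x + (t + h *: (1 : R)) *: v.
  by rewrite scalerDl addrA [h *: 1]mulr1.
by split=> /is_deriveP H; apply/is_deriveP => e /H[r r0 hr]; exists r => // h h0 hh;
  have := hr h h0 hh; rewrite E.
Qed.

Lemma mvt_line (V : normedModType R) (f : V -> R) (x v : V) (D : R -> R) (a b : R) :
  a <= b ->
  (forall t, a <= t <= b -> is_derive (x + t *: v) v f (D t)) ->
  exists2 c, a <= c <= b & f (x + b *: v) - f (x + a *: v) = D c * (b - a).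
Proof.
move=> ab H; have [| |c] := @MVT_segment R (fun s => f (x + s *: v)) D a b ab.
- move=> t; rewrite in_itv /= => /andP[h1 h2]; have ht : a <= t <= b by rewrite !ltW.
  exact: (iffLR (is_derive_lineP f x v t (D t)) (H t ht)).
- apply: derivable_within_continuous => t; rewrite in_itv /= => ht.
  by have [] := iffLR (is_derive_lineP f x v t (D t)) (H t ht).
by rewrite in_itv /= => hc ->; exists c.
Qed.

Lemma lipschitz_line (V : normedModType R) (f : V -> R) (x v : V) (L h : R) (D : V -> R) :
  (forall y, is_derive y v f (D y)) -> (forall y, `|D y| <= L) ->
  `|f (x + h *: v) - f x| <= L * `|h|.
Proof.
move=> df dL; have [h0|h0] := leP 0 h.
  have [c _] := @mvt_line V f x v (fun t => D (x + t *: v)) 0 h h0.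
  rewrite scale0r addr0 subr0 => ->; rewrite normrM; exact: ler_wpM2r.
have [c _] := @mvt_line V f x v (fun t => D (x + t *: v)) h 0 (ltW h0).
rewrite scale0r addr0 sub0r distrC => ->; rewrite normrM normrN; exact: ler_wpM2r.
Qed.

Lemma is_derive_affine (V : normedModType R) (f : V -> R) (x v c : V) (a b l : R) :
  is_derive (b *: x + c) v f l -> is_derive x v (fun y => a * f (b *: y + c)) (a * b * l).
Proof.
move=> H; have [->|b0] := eqVneq b 0.
  rewrite mulr0 mul0r; apply/is_deriveP => e e0; exists 1 => // h h0 _.
  by rewrite !scale0r subrr mulr0 subrr normr0.
have [->|a0] := eqVneq a 0.
  rewrite !mul0r; apply/is_deriveP => e e0; exists 1 => // h h0 _.
  by rewrite !mul0r subrr mulr0 subrr normr0.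
move/is_deriveP: H => H; apply/is_deriveP => e e0.
have ab0 : 0 < `|a * b| by rewrite normr_gt0 mulf_neq0.
have [r r0 hr] := H (e / `|a * b|) (divr_gt0 e0 ab0).
exists (r / `|b|); first by rewrite divr_gt0// normr_gt0.
move=> h h0; rewrite ltr_pdivlMr ?normr_gt0// -normrM => hh.
have := hr (h * b) (mulf_neq0 h0 b0) hh; rewrite ltr_pdivlMr// -normrM.
congr (`|_| < _); have -> : b *: x + c + (h * b) *: v = b *: (x + h *: v) + c.
  by rewrite scalerDr scalerA (mulrC h) addrAC.
field; by rewrite h0 b0.
Qed.

End difference_quotients.

Section c1_functions.
Context {R : realType} {d : nat}.
Local Notation rV := 'rV[R]_d.
Local Notation e_ i := (delta_mx 0 i : rV).

Definition C1 (f : rV -> R) :=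
  forall i, (forall x, derivable f x (e_ i)) /\ continuous (partial i f).

Lemma is_derive_partial (f : rV -> R) i x : derivable f x (e_ i) ->
  is_derive x (e_ i) f (partial i f x).
Proof. by move=> h; split. Qed.

Lemma is_derive_partialE (f : rV -> R) i x l : is_derive x (e_ i) f l -> partial i f x = l.
Proof. by case. Qed.

(** The increment is telescoped one coordinate at a time, with the mean value theorem for each
    coordinate. *)
Lemma C1_is_derive (f : rV -> R) (x v : rV) : C1 f ->
  is_derive x v f (\sum_i v 0 i * partial i f x).
Proof.
move=> c1; apply/is_deriveP => e e0.
pose S := \sum_i `|v 0 i| + 1; have S0 : 0 < S.
  by rewrite ltr_wpDl//; apply: sumr_ge0.
have eS : 0 < e / S by rewrite divr_gt0.
have ex i : exists r : R, 0 < r /\ forall y, eball x r y -> `|partial i f x - partial i f y| < e / S.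
  by have [r r0 hr] := (continuous_eballP _ _).1 ((c1 i).2 x) _ eS; exists r.
pose r i := sval (cid (ex i)).
have rP i := svalP (cid (ex i)).
pose r0 : R := \big[Num.min/1]_i r i.
have r00 : 0 < r0.
  rewrite /r0; elim/big_ind : _ => //; last by move=> i _; case: (rP i).
  by move=> a b a0 b0; rewrite lt_min a0.
have r0i i : r0 <= r i by rewrite /r0; exact: bigmin_le.
have V0 : 0 < enorm v + 1 by rewrite ltr_wpDl.
exists (r0 / (enorm v + 1)); first by rewrite divr_gt0.
move=> h h0; rewrite ltr_pdivlMr// => hh.
(* [P k] keeps the first [k] coordinates of [v]. Every point of the broken path is within [|h| |v|]
   of [x], hence in the balls where the partial derivatives vary by less than [e / S]. *)
pose P (k : nat) : rV := \row_i (if (i < k)%N then v 0 i else 0).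
have Pd : P d = v by apply/rowP => i; rewrite mxE ltn_ord.
have P0 : P 0%N = 0 by apply/rowP => i; rewrite !mxE.
have PS (k : 'I_d) : P k.+1 = P k + v 0 k *: e_ k.
  apply/rowP => i; rewrite !mxE eqxx /= ltnS leq_eqVlt.
  have [->|ik] := eqVneq i k; first by rewrite eqxx ltnn add0r mulr1.
  by rewrite (_ : (i == k :> nat) = false) ?mulr0 ?addr0//; apply/negbTE.
have hP k t : 0 <= t <= 1 -> forall i : 'I_d, k = i ->
    enorm (P k + (t * v 0 i) *: e_ i) <= enorm v.
  move=> /andP[t0 t1] i ki.
  rewrite -ler_sqr ?nnegrE// !enorm_sqr /mdot !big_ord1; apply: ler_sum => j _.
  rewrite !mxE eqxx /= -!expr2; have [->|ji] := eqVneq j i.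
    rewrite ki ltnn add0r mulr1 exprMn -[leRHS]mul1r ler_wpM2r ?sqr_ge0//.
    by rewrite expr_le1.
  rewrite mulr0 addr0; case: ifP => // _.
  by rewrite expr0n /= sqr_ge0.
have step (k : 'I_d) : `|h^-1 * (f (x + h *: P k.+1) - f (x + h *: P k)) -
    v 0 k * partial k f x| <= `|v 0 k| * (e / S).
  pose y := x + h *: P k.
  have [||c /andP[c0 c1']] := @mvt_line R rV f y (e_ k) (fun t => partial k f (y + t *: e_ k))
      (Num.min 0 (h * v 0 k)) (Num.max 0 (h * v 0 k)).
  - by rewrite ge_min le_max lexx.
  - by move=> t _; apply: is_derive_partial; exact: (c1 k).1.
  move=> E.
  have E2 : f (x + h *: P k.+1) - f (x + h *: P k) = partial k f (y + c *: e_ k) * (h * v 0 k).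
    have -> : x + h *: P k.+1 = y + (h * v 0 k) *: e_ k.
      by rewrite PS scalerDr addrA scalerA.
    move: E; rewrite /Num.min /Num.max; case: ltP => _; rewrite ?scale0r ?addr0 ?subr0// => E.
    by rewrite -opprB E; ring.
  have ck : exists2 t, 0 <= t <= 1 & c = h * (t * v 0 k).
    have [hv0|hv0] := eqVneq (h * v 0 k) 0.
      exists 0; first by rewrite lexx ler01.
      move: c0 c1'; rewrite hv0 /Num.min /Num.max ltxx => a1 a2.
      by apply/eqP; rewrite mul0r mulr0 eq_le a1 a2.
    exists (c / (h * v 0 k)); last first.
      by rewrite mulrCA divfK.
    move: c0 c1'; rewrite /Num.min /Num.max; case: (ltP 0 (h * v 0 k)) => hp a1 a2.
      by rewrite divr_ge0 ?(ltW hp)//= ler_pdivrMr// mul1r.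
    have hn : h * v 0 k < 0 by rewrite lt_neqAle hv0.
    by rewrite mulr_le0// ?invr_le0//= ler_ndivrMr// mul1r.
  have [t t01 ct] := ck.
  have yb : eball x (r k) (y + c *: e_ k).
    rewrite /eball /=.
    have -> : y + c *: e_ k - x = h *: (P k + (t * v 0 k) *: e_ k).
      by rewrite /y ct; apply/rowP => i; rewrite !mxE; ring.
    rewrite enormZ.
    apply: (@lt_le_trans _ _ r0) => //; apply: le_lt_trans hh.
    apply: ler_wpM2l => //; apply: (le_trans (hP k t t01 k erefl)).
    by rewrite lerDl.
  have := (rP k).2 _ yb => hb.
  rewrite E2 (_ : h^-1 * _ - _ = - (v 0 k * (partial k f x - partial k f (y + c *: e_ k)))); last by field.
  rewrite normrN normrM; apply: ler_wpM2l => //; exact: ltW.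
have -> : h^-1 * (f (x + h *: v) - f x) - \sum_i v 0 i * partial i f x =
   \sum_(k < d) (h^-1 * (f (x + h *: P k.+1) - f (x + h *: P k)) - v 0 k * partial k f x).
  rewrite big_split /= -sumrN; congr (_ + _).
  rewrite -mulr_sumr; congr (_ * _).
  rewrite -(big_mkord xpredT (fun k => f (x + h *: P k.+1) - f (x + h *: P k))).
  by rewrite telescope_sumr// Pd P0 scaler0 addr0.
apply: (le_lt_trans (ler_norm_sum _ _ _)).
apply: (@le_lt_trans _ _ (\sum_k `|v 0 k| * (e / S))); first by apply: ler_sum => k _; exact: step.
rewrite -mulr_suml mulrA ltr_pdivrMr// mulrC ltr_pM2l// /S ltrDl.
exact: ltr01.
Qed.

Lemma partial_lipschitz (f : rV -> R) (L : R) : C1 f ->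
  (forall i x, `|partial i f x| <= L) ->
  forall x y, `|f x - f y| <= d%:R * L * enorm (x - y).
Proof.
move=> c1 hL x y.
have [|c _] := @mvt_line R rV f y (x - y) (fun t => \sum_i (x - y) 0 i * partial i f (y + t *: (x - y))) 0 1 ler01.
  by move=> t _; exact: C1_is_derive.
have -> : y + 1 *: (x - y) = x by rewrite scale1r addrC subrK.
rewrite scale0r addr0 subr0 mulr1 => ->.
apply: (le_trans (ler_norm_sum _ _ _)).
apply: (@le_trans _ _ (\sum_(i < d) L * enorm (x - y))).
  apply: ler_sum => i _; rewrite normrM mulrC; apply: ler_pM => //; exact: coord_le_enorm.
by rewrite sumr_const card_ord -mulrA mulr_natl.
Qed.

Lemma continuous_measurable_rV (f : rV -> R) : continuous f -> measurable_fun setT f.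
Proof.
move=> cf; apply: (measurability _ (RGenOpens.measurableE R)) => //.
move=> _ [_ [a [b ->] <-]]; rewrite setTI; apply: open_rV_measurable.
by apply: open_comp => //; exact: interval_open.
Qed.

Lemma bms_continuous (f : rV -> R) : continuous f -> supported f -> bms f.
Proof.
move=> cf [r hr]; split; [exact: continuous_measurable_rV| |by exists r].
pose B : set rV := closure (eball 0 (`|r| + 1)).
have r1 : 0 < `|r| + 1 by rewrite ltr_wpDl.
have cB : compact B.
  apply: bounded_closed_compact; last exact: closed_closure.
  by apply: (@bounded_eball _ _ _ (`|r| + 1 + 1)); apply: closure_eball.
have cnf : {within B, continuous (fun x => `|f x|)}.
  by apply: continuous_subspaceT => x; exact: (cvg_norm (cf x)).
have [c _ hc] := @EVT_max_rV R d _ B (ex_intro _ 0 (subset_closure (eball_center _ r1))) cB cnf.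
exists `|f c| => x; have [xr|xr] := ltP (enorm x) (`|r| + 1).
  by apply: hc; rewrite inE; apply: subset_closure; rewrite /eball /= subr0.
rewrite hr ?normr0//; apply: le_trans xr.
by rewrite (le_trans (ler_norm _))// lerDl.
Qed.

End c1_functions.

(** * Convolution *)

Section convolution.
Context {R : realType} {d : nat}.
Local Notation rV := 'rV[R]_d.
Local Notation leb := (lebesgue_rV (R := R) d).
Local Notation e_ i := (delta_mx 0 i : rV).

Definition conv (u rho : rV -> R) (x : rV) : R := bint (fun z => u z * rho (x - z)).

Lemma measurable_reflect (rho : rV -> R) (x : rV) : measurable_fun setT rho ->
  measurable_fun setT (fun z : rV => rho (x - z)).
Proof.
move=> mr; have := measurableT_comp mr (measurable_rV_affine (- 1%:M) x).
by congr measurable_fun; apply/funext => z /=; rewrite mulmxN mulmx1 addrC.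
Qed.

Lemma unitmxN1 : (- 1%:M : 'M[R]_d) \in unitmx.
Proof. by rewrite -scaleN1r scalemx1 unitmxE det_scalar unitrX// unitrN1. Qed.

Lemma bms_reflect (rho : rV -> R) x : bms rho -> bms (fun z => rho (x - z)).
Proof.
move=> mr; have := bms_affine x unitmxN1 mr.
by congr bms; apply/funext => z /=; rewrite mulmxN mulmx1 addrC.
Qed.

Lemma bint_reflect (rho : rV -> R) x : bms rho ->
  bint (fun z => rho (x - z)) = bint rho.
Proof.
move=> mr; have := bint_affine x unitmxN1 mr.
have -> : `|\det (- 1%:M : 'M[R]_d)| = 1.
  by rewrite -scaleN1r scalemx1 det_scalar normrX normrN1 expr1n.
rewrite invr1 mul1r => <-.
by apply: eq_bint => z /=; rewrite mulmxN mulmx1 addrC.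
Qed.

Lemma bms_conv_arg (u rho : rV -> R) x : bms u -> measurable_fun setT rho ->
  bounded_fun rho -> bms (fun z => u z * rho (x - z)).
Proof.
move=> bu mr [M hM]; apply: bmsM => //; first exact: measurable_reflect.
by exists M.
Qed.

(** The bound [L] dominates the difference quotients of [rho], so the derivative passes under the
    integral. *)
Lemma conv_derive (u rho rho' : rV -> R) (v x : rV) (L : R) : bms u ->
  measurable_fun setT rho -> bounded_fun rho -> measurable_fun setT rho' ->
  (forall y, is_derive y v rho (rho' y)) -> (forall y, `|rho' y| <= L) ->
  is_derive x v (conv u rho) (conv u rho' x).
Proof.
move=> bu mr br mr' dr hL; apply/is_derive_seqP => h h0 hc.
have [mu [M hM] [r hr]] := bu.
have br' : bounded_fun rho' by exists L.
have b k : bms (fun z => u z * rho (x + h k *: v - z)) by exact: bms_conv_arg.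
have b0 : bms (fun z => u z * rho (x - z)) by exact: bms_conv_arg.
pose F k z := u z * ((h k)^-1 * (rho (x - z + h k *: v) - rho (x - z))).
have -> : (fun k => (h k)^-1 * (conv u rho (x + h k *: v) - conv u rho x)) =
    (fun k => bint (F k)).
  apply/funext => k; rewrite /conv -bintB// -bintZ; last exact: bmsB.
  by apply: eq_bint => z; rewrite /F addrAC; ring.
have L0 : 0 <= L by apply: le_trans (hL 0).
apply: (@bint_dct _ _ _ _ (M * L) r).
- move=> k; apply: measurable_funM => //; apply: measurable_funM => //.
  apply: measurable_funB; last exact: measurable_reflect.
  have := measurable_reflect (x + h k *: v) mr.
  by congr measurable_fun; apply/funext => z; rewrite addrAC.
- by apply: measurable_funM => //; exact: measurable_reflect.
- move=> k z; rewrite normrM; apply: ler_pM => //.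
  rewrite normrM normfV mulrC ler_pdivrMr ?normr_gt0//.
  exact: lipschitz_line dr hL.
- by move=> k z /hr uz; rewrite /F uz mul0r.
- apply: aeW => z; apply: cvgM; first exact: cvg_cst.
  by have /is_derive_seqP := dr (x - z); exact.
Qed.

Lemma conv_lipschitz (u rho : rV -> R) (L : R) x y : bms u ->
  measurable_fun setT rho -> bounded_fun rho ->
  (forall x y, `|rho x - rho y| <= L * enorm (x - y)) ->
  `|conv u rho x - conv u rho y| <= bint (fun z => `|u z|) * L * enorm (x - y).
Proof.
move=> bu mr br hL; rewrite /conv -bintB; try exact: bms_conv_arg.
have b : bms (fun z => u z * rho (x - z) - u z * rho (y - z)).
  by apply: bmsB; exact: bms_conv_arg.
apply: (le_trans (le_normr_bint b)); rewrite -mulrA mulrC -bintZ; last exact: bms_norm.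
apply: le_bint; [exact: bms_norm|by apply: bmsZ; exact: bms_norm|move=> z].
rewrite -mulrBr normrM mulrC ler_wpM2r//.
apply: (le_trans (hL _ _)).
by rewrite (_ : x - z - (y - z) = x - y)// opprB addrA subrK.
Qed.

Lemma lipschitz_continuous (f : rV -> R) (L : R) :
  (forall x y, `|f x - f y| <= L * enorm (x - y)) -> continuous f.
Proof.
move=> hL x; apply/continuous_eballP => e e0.
have c0 : 0 < `|L| + 1 by rewrite ltr_wpDl.
exists (e / (`|L| + 1)); first by rewrite divr_gt0.
move=> y; rewrite /eball /= ltr_pdivlMr// mulrC enormBC; apply: le_lt_trans.
apply: (le_trans (hL _ _)); apply: ler_wpM2r => //.
by rewrite (le_trans (ler_norm _))// lerDl.
Qed.

(** Convolution with a probability density is an average over a closed ball of radius [r]; the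
    strictly larger [r'] is there because [rho] may be nonzero on the sphere itself. *)
Lemma conv_close (g rho : rV -> R) (p : rV) (r r' c e : R) : bms g -> bms rho ->
  (forall x, 0 <= rho x) -> bint rho = 1 -> (forall x, r < enorm x -> rho x = 0) -> r < r' ->
  {ae leb, forall z, eball p r' z -> `|g z - c| <= e} -> `|conv g rho p - c| <= e.
Proof.
move=> bg br r0 r1 hr rr' h.
have b1 : bms (fun z => rho (p - z)) by exact: bms_reflect.
have b2 : bms (fun z => g z * rho (p - z)) by exact: bmsMM.
have I1 : bint (fun z => rho (p - z)) = 1 by rewrite bint_reflect.
have -> : conv g rho p - c = bint (fun z => (g z - c) * rho (p - z)).
  rewrite (eq_bint (g := fun z => g z * rho (p - z) - c * rho (p - z))); last first.
    by move=> z; rewrite mulrBl.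
  by rewrite bintB// ?bintZ// ?I1 ?mulr1//; exact: bmsZ.
have b3 : bms (fun z => (g z - c) * rho (p - z)).
  rewrite (_ : (fun z => _) = fun z => g z * rho (p - z) - c * rho (p - z)).
    by apply: bmsB => //; exact: bmsZ.
  by apply/funext => z; rewrite mulrBl.
apply: (le_trans (le_normr_bint b3)).
rewrite -[leRHS]mulr1 -I1 -bintZ//; apply: le_bint_ae; [exact: bms_norm|exact: bmsZ|].
apply: filterS h => z hz; rewrite normrM (ger0_norm (r0 _)).
have [zr|zr] := ltP r (enorm (p - z)); first by rewrite hr// !mulr0.
apply: ler_wpM2r => //; apply: hz; rewrite /eball /= enormBC.
exact: le_lt_trans rr'.
Qed.

(** Fubini, evenness exchanging the two variables of the kernel. It moves a mollifier from one
    factor of a product to the other. *)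
Lemma conv_swap (f g rho : rV -> R) : bms f -> bms g -> bms rho ->
  (forall x, rho (- x) = rho x) ->
  [/\ bms (fun x => f x * conv g rho x), bms (fun z => g z * conv f rho z) &
  bint (fun x => f x * conv g rho x) = bint (fun z => g z * conv f rho z)].
Proof.
move=> [mf [Mf hf] [rf sf]] [mg [Mg hg] [rg sg]] [mr [Mr hr] sr] ev.
have bg : bms g by split; [|exists Mg|exists rg].
have bf : bms f by split; [|exists Mf|exists rf].
have br : bms rho by split => //; exists Mr.
pose F (x z : rV) := f x * (g z * rho (x - z)).
have mF : measurable_fun setT (fun p : rV * rV => F p.1 p.2).
  apply: measurable_funM; first exact: (measurableT_comp mf).
  apply: measurable_funM; first exact: (measurableT_comp mg).
  apply: (measurableT_comp mr); apply: measurable_fun_rV => i.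
  rewrite (_ : (fun x => _) = fun p : rV * rV => p.1 0 i - p.2 0 i); last first.
    by apply/funext => p; rewrite !mxE.
  apply: measurable_funB.
    exact: (measurableT_comp (measurable_coord i) measurable_fst).
  exact: (measurableT_comp (measurable_coord i) measurable_snd).
have [|x z|b1 b2 E] := @bint_fubini R d d F (Mf * (Mg * Mr)) (Num.max rf rg) mF.
- by move=> x z; rewrite /F !normrM; do 2 (apply: ler_pM => //; rewrite ?mulr_ge0//).
- by rewrite /F !ge_max => -[/andP[/sf -> _]|/andP[_ /sg ->]]; rewrite ?mul0r ?mulr0.
have E1 : (fun x => bint (F x)) = (fun x => f x * conv g rho x).
  apply/funext => x.
  exact: (bintZ (f x) (bms_conv_arg x bg mr (ex_intro _ Mr hr))).
have E2 : (fun z => bint (F ^~ z)) = (fun z => g z * conv f rho z).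
  apply/funext => z.
  rewrite /conv -(bintZ (g z) (bms_conv_arg z bf mr (ex_intro _ Mr hr))).
  by apply: eq_bint => x; rewrite /F -(ev (x - z)) opprB; ring.
by move: b1 b2 E; rewrite E1 E2.
Qed.

End convolution.

(** * Smooth functions, reflected mollifiers as test functions, weak derivatives *)

Section smooth_functions.
Context {R : realType} {d : nat}.
Local Notation rV := 'rV[R]_d.
Local Notation e_ i := (delta_mx 0 i : rV).

Definition vanish_off (r : R) (f : rV -> R) := forall x, r < enorm x -> f x = 0.

Lemma near_eq_is_derive (f g : rV -> R) (x v : rV) (r l : R) : 0 < r ->
  (forall y, eball x r y -> f y = g y) -> is_derive x v f l -> is_derive x v g l.
Proof.
move=> r0 fg /is_deriveP H; apply/is_deriveP => e e0.
have [s s0 hs] := H e e0; have V0 : 0 < enorm v + 1 by rewrite ltr_wpDl.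
exists (Num.min s (r / (enorm v + 1))); first by rewrite lt_min s0 divr_gt0.
move=> h h0; rewrite lt_min => /andP[h1 h2].
have fgh : f (x + h *: v) = g (x + h *: v).
  apply: fg; rewrite /eball /= [x + _]addrC addrK enormZ.
  apply: (@le_lt_trans _ _ (`|h| * (enorm v + 1))).
    by apply: ler_wpM2l => //; rewrite lerDl.
  by rewrite -ltr_pdivlMr.
by rewrite -fgh -(fg x (eball_center x r0)); exact: hs.
Qed.

Lemma is_derive_cst0 (x v : rV) : is_derive x v (fun=> 0 : R) 0.
Proof.
by apply/is_deriveP => e e0; exists 1 => // h h0 _; rewrite !subrr mulr0 subrr normr0.
Qed.

Lemma partial_near0 (f : rV -> R) i (x : rV) (r : R) : 0 < r ->
  (forall y, eball x r y -> f y = 0) -> partial i f x = 0.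
Proof.
move=> r0 hf; apply: is_derive_partialE; apply: near_eq_is_derive r0 _ (is_derive_cst0 _ _).
by move=> y /hf.
Qed.

Lemma partial_vanish (f : rV -> R) i r : vanish_off r f -> vanish_off r (partial i f).
Proof.
move=> hf x hx; apply: (@partial_near0 _ _ _ (enorm x - r)); first by rewrite subr_gt0.
move=> y; rewrite /eball /= => h; apply: hf.
have := enormB y (y - x); rewrite opprB addrC subrK => h2.
by lra.
Qed.

Lemma smooth_partial (f : rV -> R) i : smooth f -> smooth (partial i f).
Proof. by move=> sf s j x; have := sf (rcons s i) j x; rewrite foldr_rcons. Qed.

Lemma smooth_derivable (f : rV -> R) i x : smooth f -> is_derive x (e_ i) f (partial i f x).
Proof. by move=> sf; apply: is_derive_partial; exact: (sf [::] i x).1. Qed.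

Lemma smooth_continuous (f : rV -> R) : (0 < d)%N -> smooth f -> continuous f.
Proof. by move=> d0 sf x; exact: (sf [::] (Ordinal d0) x).2. Qed.

Lemma smooth_C1 (f : rV -> R) : (0 < d)%N -> smooth f -> C1 f.
Proof.
move=> d0 sf i; split; first by move=> x; exact: (sf [::] i x).1.
exact/smooth_continuous/smooth_partial.
Qed.

Lemma vanish_supported r (f : rV -> R) : vanish_off r f -> supported f.
Proof. by move=> hf; exists (r + 1) => x hx; apply: hf; lra. Qed.

Lemma smooth_bms (f : rV -> R) r : (0 < d)%N -> smooth f -> vanish_off r f -> bms f.
Proof.
move=> d0 sf vf; apply: bms_continuous; first exact: smooth_continuous.
exact: vanish_supported vf.
Qed.

Lemma smooth_affine (f : rV -> R) (a b : R) (c : rV) : smooth f ->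
  smooth (fun x => a * f (b *: x + c)).
Proof.
move=> sf.
have E s : foldr partial (fun x => a * f (b *: x + c)) s =
    fun x => (a * b ^+ size s) * foldr partial f s (b *: x + c).
  elim: s => [|i s IH] /=; first by apply/funext => x; rewrite expr0 mulr1.
  apply/funext => x; apply: is_derive_partialE; rewrite IH exprSr mulrA.
  by apply: is_derive_affine; apply: is_derive_partial; exact: (sf s i _).1.
move=> s i x; rewrite E; split.
  have /is_derive_affine h : is_derive (b *: x + c) (e_ i) (foldr partial f s) (partial i (foldr partial f s) (b *: x + c)).
    by apply: is_derive_partial; exact: (sf s i _).1.
  by have [] := h (a * b ^+ size s).
apply/continuous_eballP => e e0.
have [a0|a0] := eqVneq (a * b ^+ size s) 0.
  by exists 1 => // y _; rewrite a0 !mul0r subrr normr0.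
have A0 : 0 < `|a * b ^+ size s| by rewrite normr_gt0.
have [r r0 hr] := (continuous_eballP _ _).1 (sf s i (b *: x + c)).2 _ (divr_gt0 e0 A0).
have B0 : 0 < `|b| + 1 by rewrite ltr_wpDl.
exists (r / (`|b| + 1)); first by rewrite divr_gt0.
move=> y; rewrite /eball /= ltr_pdivlMr// => hy.
rewrite -mulrBr normrM mulrC -ltr_pdivlMr//; apply: hr.
rewrite /eball /= (_ : b *: y + c - (b *: x + c) = b *: (y - x)); last first.
  by apply/rowP => k; rewrite !mxE; ring.
rewrite enormZ mulrC; apply: le_lt_trans hy; apply: ler_wpM2l => //.
by rewrite lerDl.
Qed.

Lemma partial_reflect (rho : rV -> R) (x z : rV) i : smooth rho ->
  partial i (fun z => rho (x - z)) z = - partial i rho (x - z).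
Proof.
move=> sr; apply: is_derive_partialE.
have h : is_derive ((-1) *: z + x) (e_ i) rho (partial i rho ((-1) *: z + x)) by exact: smooth_derivable.
have := is_derive_affine 1 h; rewrite mul1r scaleN1r addrC mulN1r.
by congr is_derive; apply/funext => y; rewrite mul1r scaleN1r addrC.
Qed.

Lemma test_reflect (rho : rV -> R) (U : set rV) (x : rV) (r r' : R) : smooth rho ->
  vanish_off r rho -> r < r' -> eball x r' `<=` U -> test_function U (fun z => rho (x - z)).
Proof.
move=> sr vr rr' hU.
have sub : closure [set z | rho (x - z) != 0] `<=` [set z | enorm (z - x) <= r].
  move=> z cz /=; rewrite leNgt; apply/negP => h.
  have nz : nbhs z (eball z (enorm (z - x) - r)).
    by apply/nbhs_eballP; exists (enorm (z - x) - r) => //; rewrite subr_gt0.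
  have [y [/= /eqP ry]] := cz _ nz; rewrite /eball /= => yz; apply: ry; apply: vr.
  have := enormB (y - x) (y - z); rewrite (_ : y - x - (y - z) = z - x); last first.
    by apply/rowP => k; rewrite !mxE; ring.
  by rewrite (enormBC x y); lra.
split.
- have := smooth_affine 1 (-1) x sr; congr smooth; apply/funext => z.
  by rewrite mul1r scaleN1r addrC.
- apply: bounded_closed_compact; last exact: closed_closure.
  apply: (@bounded_eball _ _ _ (enorm x + r')) => z /sub /= h.
  rewrite /eball /= subr0 -{1}(subrK x z); apply: (le_lt_trans (enormD _ _)).
  by lra.
by move=> z /sub /= h; apply: hU; rewrite /eball /=; exact: le_lt_trans rr'.
Qed.

(** [weak_partial] with integrals over the whole space: test functions and their derivatives vanish
    off [U], so the values of [u] and [w] there do not matter. *)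
Definition weakp (U : set rV) (i : 'I_d) (u w : rV -> R) :=
  forall psi, test_function U psi ->
    bint (fun x => u x * partial i psi x) = - bint (fun x => w x * psi x).

(** The reflected mollifier centred at [x] is an admissible test function; the sign from the
    reflection cancels the one from the weak derivative. *)
Lemma conv_weak (U : set rV) i (u w rho : rV -> R) (x : rV) (r r' : R) : (0 < d)%N ->
  bms u -> bms w -> weakp U i u w -> smooth rho -> vanish_off r rho -> r < r' ->
  eball x r' `<=` U -> conv u (partial i rho) x = conv w rho x.
Proof.
move=> d0 bu bw H sr vr rr' hU; have := H _ (test_reflect sr vr rr' hU).
rewrite (eq_bint (g := fun z => - (u z * partial i rho (x - z)))); last first.
  by move=> z; rewrite partial_reflect// mulrN.
rewrite bintN; first by move=> /oppr_inj.
have [m b _] := smooth_bms d0 (smooth_partial i sr) (partial_vanish i vr).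
exact: bms_conv_arg.
Qed.

End smooth_functions.

(** * Mollified second differences *)

Section mollifiers.
Context {R : realType} {d : nat}.
Local Notation rV := 'rV[R]_d.
Local Notation leb := (lebesgue_rV (R := R) d).
Local Notation e_ i := (delta_mx 0 i : rV).

Definition mollifier (r : R) (rho : rV -> R) :=
  [/\ smooth rho, forall x, 0 <= rho x, vanish_off r rho, bint rho = 1 &
      forall x, rho (- x) = rho x].

Lemma enorm_measurable : measurable_fun setT (fun x : rV => enorm x).
Proof. exact: continuous_measurable_rV enorm_continuous. Qed.

(** Since [phi] lives in the unit ball, its mass is at least its second moment [d]. *)
Lemma kernel_bint_gt0 (phi : rV -> R) : (0 < d)%N -> kernel_function phi -> 0 < bint phi.
Proof.
move=> d0 [sp p0 _ vp I]; have bp : bms phi by exact: smooth_bms sp vp.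
have I' : bint (fun y => enorm y ^+ 2 * phi y) = d%:R by exact: I.
have d0' : 0 < d%:R :> R by rewrite ltr0n.
have h x : enorm x ^+ 2 * phi x <= phi x.
  have [x1|x1] := ltP 1 (enorm x); first by rewrite vp// mulr0.
  by rewrite ler_piMl// exprn_ile1.
apply: (lt_le_trans d0'); rewrite -I'; apply: le_bint => //.
apply: (bms_le _ bp) => [|x].
  apply: measurable_funM; last by case: bp.
  apply: measurable_funX; exact: enorm_measurable.
by rewrite !ger0_norm// mulr_ge0// exprn_ge0.
Qed.

(** The kernel of the scheme itself, rescaled to radius [r] and mass 1, serves as mollifier; radial
    symmetry makes it even. *)
Lemma mollifier_exists (phi : rV -> R) (r : R) : (0 < d)%N -> kernel_function phi ->
  0 < r -> exists rho, mollifier r rho.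
Proof.
move=> d0 kp r0; have m0 := kernel_bint_gt0 d0 kp; case: kp => sp p0 rp vp _.
have bp : bms phi by exact: smooth_bms sp vp.
pose a := (bint phi * r ^+ d)^-1.
have rd : 0 < r ^+ d by exact: exprn_gt0.
have a0 : 0 < a by rewrite invr_gt0 mulr_gt0.
exists (fun x => a * phi (r^-1 *: x + 0)); split.
- exact: smooth_affine.
- by move=> x; rewrite mulr_ge0// ltW.
- move=> x hx; rewrite vp ?mulr0// addr0 enormZ ger0_norm ?invr_ge0 ?(ltW r0)//.
  by rewrite ltr_pdivlMl// mulr1.
- have u : (r^-1)%:M \in @unitmx R d by rewrite unitmxE det_scalar unitrX// unitrV unitfE gt_eqF.
  have E x : phi (r^-1 *: x + 0) = phi (x *m (r^-1)%:M + 0) by rewrite mul_mx_scalar.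
  rewrite (eq_bint (g := fun x => a * phi (x *m (r^-1)%:M + 0))); last by move=> x; rewrite E.
  rewrite bintZ; last exact: bms_affine.
  rewrite bint_affine// det_scalar exprVn normfV (gtr0_norm rd) invrK /a.
  field; by rewrite !gt_eqF.
- by move=> x; rewrite scalerN !addr0; congr (_ * _); apply: rp; rewrite enormN.
Qed.

Lemma is_derive_congr (V : normedModType R) (f : V -> R) (x v : V) (a b : R) :
  is_derive x v f a -> a = b -> is_derive x v f b.
Proof. by move=> h <-. Qed.

(** Mean value theorem twice: for [h t + h (- t) - t ^+ 2 * c] on [0, 1], giving a point [xi], then
    for [h1] on [- xi, xi]. The outcome is [(h2 z - c) * (2 * xi)] with [xi <= 1], whence the factor
    2. *)
Lemma second_difference_bound (h h1 h2 : R -> R) (c k : R) : 0 <= k ->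
  (forall t : R, -1 <= t <= 1 -> is_derive t (1 : R) h (h1 t)) ->
  (forall t : R, -1 <= t <= 1 -> is_derive t (1 : R) h1 (h2 t)) ->
  (forall t, -1 <= t <= 1 -> `|h2 t - c| <= k) ->
  `|h 1 + h (-1) - 2 * h 0 - c| <= 2 * k.
Proof.
move=> k0 d1 d2 b2.
pose g t := h t + h (- t) - t ^+ 2 * c.
pose g1 t := h1 t - h1 (- t) - (2 * t) * c.
have dg (t : R) : 0 <= t <= 1 -> is_derive t (1 : R) g (g1 t).
  move=> /andP[t0 t1].
  have i1 : is_derive t (1 : R) h (h1 t) by apply: d1; apply/andP; split; lra.
  have i2 : is_derive (- t) (1 : R) h (h1 (- t)) by apply: d1; apply/andP; split; lra.
  have i3 : is_derive t (1 : R) (h \o -%R) (h1 (- t) * -1).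
    by apply: is_derive1_comp.
  have i5 : is_derive t (1 : R) (fun t : R => t ^+ 2 * c) (2 * t * c).
    apply/is_deriveP => e e0; have c0 : 0 < `|c| + 1 by rewrite ltr_wpDl.
    exists (e / (`|c| + 1)); first by rewrite divr_gt0.
    move=> a a0; rewrite ltr_pdivlMr// => ha.
    rewrite [a *: 1]mulr1 (_ : a^-1 * _ - _ = a * c); last by field.
    by rewrite normrM (le_lt_trans _ ha)// ler_wpM2l// lerDl.
  have := is_deriveB (is_deriveD i1 i3) i5.
  by move=> /is_derive_congr; apply; rewrite mulrN1.
have [c0| |xi] := @MVT_segment R g g1 0 1 ler01.
- by rewrite in_itv /= => /andP[? ?]; apply: dg; rewrite !ltW.
- apply: derivable_within_continuous => t; rewrite in_itv /= => ht.
  by have [] := dg t ht.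
rewrite in_itv /= => /andP[xi0 xi1] E.
have [xz|xin0] := eqVneq xi 0.
  have -> : h 1 + h (-1) - 2 * h 0 - c = g 1 - g 0.
    by rewrite /g oppr0; ring.
  rewrite E /g1 xz oppr0 (_ : _ * _ = 0); last by ring.
  by rewrite normr0 mulr_ge0.
have xip : 0 < xi by rewrite lt_neqAle eq_sym xin0.
have [t| |z] := @MVT_segment R h1 h2 (- xi) xi (ge0_cp xi0).2.
- by rewrite in_itv /= => /andP[? ?]; apply: d2; apply/andP; split; lra.
- apply: derivable_within_continuous => s; rewrite in_itv /= => /andP[? ?].
  by have [] : is_derive s 1 h1 (h2 s) by apply: d2; apply/andP; split; lra.
rewrite in_itv /= => /andP[z0 z1] E2.
have -> : h 1 + h (-1) - 2 * h 0 - c = (h2 z - c) * (2 * xi).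
  have -> : h 1 + h (-1) - 2 * h 0 - c = g 1 - g 0 by rewrite /g oppr0; ring.
  by rewrite E /g1 E2; ring.
rewrite normrM (ger0_norm (_ : 0 <= 2 * xi)); last by rewrite mulr_ge0.
have hz : `|h2 z - c| <= k by apply: b2; apply/andP; split; lra.
have := normr_ge0 (h2 z - c); nra.
Qed.

Definition quad (H : 'M[R]_d) (y : rV) : R := \sum_i \sum_j y 0 i * y 0 j * H i j.

Lemma quad_le (H : 'M[R]_d) (y : rV) : `|quad H y| <= enorm H * enorm y ^+ 2.
Proof.
have -> : quad H y = dot (y *m H) y.
  rewrite dot_sum /quad exchange_big; apply: eq_bigr => j _; rewrite mxE mulr_suml.
  by apply: eq_bigr => i _; ring.
apply: (le_trans (normr_dot_le _ _)); rewrite expr2 mulrA; apply: ler_wpM2r => //.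
by rewrite mulrC; exact: mulmx_enorm_l.
Qed.

Lemma quadB (H K : 'M[R]_d) y : quad (H - K) y = quad H y - quad K y.
Proof.
rewrite /quad -sumrB; apply: eq_bigr => i _; rewrite -sumrB; apply: eq_bigr => j _.
by rewrite !mxE; ring.
Qed.

(** Along the segment the second derivative of the mollified function is the mollified quadratic
    form of the weak Hessian, an average of values within [k |y|^2] of [quad H y]. The margin
    [2 * s] keeps the averaging inside the ball. *)
Lemma second_difference_molli (U : set rV) (u : rV -> R) (Du : 'I_d -> rV -> R)
    (D2u : 'I_d -> 'I_d -> rV -> R) (H : 'M[R]_d) (x y : rV) (k r s : R) rho :
  (0 < d)%N -> 0 <= k ->
  bms u -> (forall i, bms (Du i)) -> (forall i j, bms (D2u i j)) ->
  (forall i, weakp U i u (Du i)) -> (forall i j, weakp U j (Du i) (D2u i j)) ->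
  eball x r `<=` U ->
  {ae leb, forall z, eball x r z -> enorm (\matrix_(i, j) D2u i j z - H) <= k} ->
  mollifier s rho -> enorm y + 2 * s < r -> 0 < s ->
  `|conv u rho (x + y) + conv u rho (x - y) - 2 * conv u rho x - quad H y| <=
    2 * (k * enorm y ^+ 2).
Proof.
move=> d0 k0 bu bDu bD2 w1 w2 hU hH [sr r0 vr r1 er] hys s0.
have br : bms rho by exact: smooth_bms sr vr.
have sp i : smooth (partial i rho) by exact: smooth_partial.
have spp i j : smooth (partial j (partial i rho)) by exact: smooth_partial.
have vp i : vanish_off s (partial i rho) by exact: partial_vanish.
have vpp i j : vanish_off s (partial j (partial i rho)) by exact: partial_vanish.
have bp i : bms (partial i rho) by exact: smooth_bms (sp i) (vp i).
have bpp i j : bms (partial j (partial i rho)) by exact: smooth_bms (spp i j) (vpp i j).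
have cd (v rr : rV -> R) : bms v -> smooth rr -> vanish_off s rr -> forall i p,
    is_derive p (e_ i) (conv v rr) (conv v (partial i rr) p).
  move=> bv srr vrr i p; have [m1 b1 _] := smooth_bms d0 srr vrr.
  have [m2 [L hL] _] := smooth_bms d0 (smooth_partial i srr) (partial_vanish i vrr).
  by apply: conv_derive hL => // q; exact: smooth_derivable.
have cc (v rr : rV -> R) : bms v -> smooth rr -> vanish_off s rr -> continuous (conv v rr).
  move=> bv srr vrr; have [m1 b1 _] := smooth_bms d0 srr vrr.
  have hb i : exists L : R, forall q, `|partial i rr q| <= L.
    by have [_ ] := smooth_bms d0 (smooth_partial i srr) (partial_vanish i vrr).
  pose L i := sval (cid (hb i)); have hL i q : `|partial i rr q| <= L i := svalP (cid (hb i)) q.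
  have L0 i : 0 <= L i by apply: le_trans (hL i 0).
  have hL' i q : `|partial i rr q| <= \sum_j L j.
    apply: (le_trans (hL i q)); rewrite (bigD1 i)//= lerDl; exact: sumr_ge0.
  apply: (@lipschitz_continuous _ _ _ (bint (fun z => `|v z|) * (d%:R * \sum_j L j))) => p q.
  apply: conv_lipschitz => // a b; apply: partial_lipschitz => //.
  exact: smooth_C1.
have pE (v rr : rV -> R) i : bms v -> smooth rr -> vanish_off s rr -> partial i (conv v rr) = conv v (partial i rr).
  by move=> bv srr vrr; apply/funext => p; apply: is_derive_partialE; exact: cd.
have c1 (v rr : rV -> R) : bms v -> smooth rr -> vanish_off s rr -> C1 (conv v rr).
  move=> bv srr vrr i; split; first by move=> p; have [] := cd v rr bv srr vrr i p.
  by rewrite pE//; apply: cc => //; [exact: smooth_partial|exact: partial_vanish].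
pose h t := conv u rho (x + t *: y).
pose h1 t := \sum_i y 0 i * conv u (partial i rho) (x + t *: y).
pose h2 t := \sum_i y 0 i * \sum_j y 0 j * conv u (partial j (partial i rho)) (x + t *: y).
have dh t : is_derive t (1 : R) h (h1 t).
  apply: (iffLR (is_derive_lineP (conv u rho) x y t _)).
  have := @C1_is_derive R d (conv u rho) (x + t *: y) y (c1 u rho bu sr vr).
  by move=> /is_derive_congr; apply; apply: eq_bigr => i _; rewrite pE.
have dh1 t : is_derive t (1 : R) h1 (h2 t).
  have -> : h1 = \sum_(i < d) (fun t => y 0 i * conv u (partial i rho) (x + t *: y)).
    by apply/funext => q; rewrite fct_sumE.
  apply: is_derive_sum => i.
  have : is_derive t (1 : R) (fun t => conv u (partial i rho) (x + t *: y))
      (\sum_j y 0 j * conv u (partial j (partial i rho)) (x + t *: y)).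
    apply: (iffLR (is_derive_lineP (conv u (partial i rho)) x y t _)).
    have := @C1_is_derive R d _ (x + t *: y) y (c1 u _ bu (sp i) (vp i)).
    by move=> /is_derive_congr; apply; apply: eq_bigr => j _; rewrite pE.
  by move=> H'; have := is_deriveZ (y 0 i) H'.
have y0 := enorm_ge0 y.
have inb t : -1 <= t <= 1 -> forall z, eball (x + t *: y) (2 * s) z -> eball x r z.
  move=> t1 z; rewrite /eball /= => hz.
  have -> : z - x = (z - (x + t *: y)) + t *: y.
    by apply/rowP => i; rewrite !mxE; ring.
  apply: (le_lt_trans (enormD _ _)); rewrite enormZ.
  have : `|t| <= 1 by rewrite ler_norml.
  by move=> t2; nra.
have s2 : s < 2 * s by lra.
have h2E t : -1 <= t <= 1 -> h2 t = conv (fun z => quad (\matrix_(i, j) D2u i j z) y) rho (x + t *: y).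
  move=> t1; rewrite /h2 [RHS]/conv.
  have bq i j : bms (fun z => D2u i j z * rho (x + t *: y - z)).
    by apply: bms_conv_arg => //; case: br.
  rewrite (eq_bint (g := fun z => \sum_i \sum_j (y 0 i * y 0 j) * (D2u i j z * rho (x + t *: y - z)))); last first.
    move=> z; rewrite /quad mulr_suml; apply: eq_bigr => i _; rewrite mulr_suml.
    by apply: eq_bigr => j _; rewrite mxE mulrA.
  rewrite bint_sum; last by move=> i _; apply: bms_sum => j _; exact: bmsZ.
  transitivity (\sum_i \sum_j (y 0 i * y 0 j) * conv (D2u i j) rho (x + t *: y)); last first.
    apply: eq_bigr => i _; rewrite bint_sum; last by move=> j _; exact: bmsZ.
    by apply: eq_bigr => j _; rewrite bintZ.
  rewrite exchange_big /=; apply: eq_bigr => i _; rewrite mulr_sumr; apply: eq_bigr => j _.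
  rewrite mulrA (mulrC (y 0 i)); congr (_ * _).
  rewrite (@conv_weak _ _ U j u (Du j) (partial i rho) _ s (2 * s))//; last first.
    by move=> z hz; apply: hU; exact: inb hz.
  rewrite (@conv_weak _ _ U i (Du j) (D2u j i) rho _ s (2 * s))//.
  by move=> z hz; apply: hU; exact: inb hz.
have bQ : bms (fun z => quad (\matrix_(i, j) D2u i j z) y).
  rewrite /quad; apply: bms_sum => i _; apply: bms_sum => j _.
  rewrite (_ : (fun x => _) = fun z => (y 0 i * y 0 j) * D2u i j z); first exact: bmsZ.
  by apply/funext => z; rewrite mxE.
have h2b t : -1 <= t <= 1 -> `|h2 t - quad H y| <= k * enorm y ^+ 2.
  move=> t1; rewrite h2E//; apply: (@conv_close _ _ _ _ _ s (2 * s)) => //.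
  apply: filterS hH => z hz hb; rewrite -quadB; apply: (le_trans (quad_le _ _)).
  by apply: ler_wpM2r; [exact: exprn_ge0|apply: hz; exact: inb hb].
have := @second_difference_bound h h1 h2 (quad H y) (k * enorm y ^+ 2) _
  (fun t _ => dh t) (fun t _ => dh1 t) h2b.
rewrite /h scale1r scaleN1r scale0r addr0; apply.
by rewrite mulr_ge0// exprn_ge0.
Qed.

(** The mollified bound is uniform in the radius, and [u] is continuous at the three points
    involved, so the radius can shrink to 0. *)
Lemma second_difference_le (phi : rV -> R) (U : set rV) (u : rV -> R) (Du : 'I_d -> rV -> R)
    (D2u : 'I_d -> 'I_d -> rV -> R) (H : 'M[R]_d) (x y : rV) (k r : R) :
  (0 < d)%N -> kernel_function phi -> 0 <= k ->
  bms u -> (forall i, bms (Du i)) -> (forall i j, bms (D2u i j)) ->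
  (forall i, weakp U i u (Du i)) -> (forall i j, weakp U j (Du i) (D2u i j)) ->
  eball x r `<=` U -> (forall z, U z -> {for z, continuous u}) ->
  {ae leb, forall z, eball x r z -> enorm (\matrix_(i, j) D2u i j z - H) <= k} ->
  enorm y < r ->
  `|u (x + y) + u (x - y) - 2 * u x - quad H y| <= 2 * (k * enorm y ^+ 2).
Proof.
move=> d0 kp k0 bu bDu bD2 w1 w2 hU cu hH yr.
apply/ler_addgt0Pl => e e0.
have e4 : 0 < e / 4 by rewrite divr_gt0.
have near p : eball x r p -> exists2 s : R, 0 < s & forall q, eball p s q -> `|u p - u q| < e / 4.
  by move=> hp; exact: (continuous_eballP _ _).1 (cu p (hU p hp)) _ e4.
have y0 := enorm_ge0 y.
have [s1 s10 hs1] : exists2 s : R, 0 < s & forall q, eball (x + y) s q -> `|u (x + y) - u q| < e / 4.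
  by apply: near; rewrite /eball /= addrC addKr.
have [s2 s20 hs2] : exists2 s : R, 0 < s & forall q, eball (x - y) s q -> `|u (x - y) - u q| < e / 4.
  by apply: near; rewrite /eball /= addrC addKr enormN.
have [s3 s30 hs3] : exists2 s : R, 0 < s & forall q, eball x s q -> `|u x - u q| < e / 4.
  by apply: near; apply: eball_center; exact: le_lt_trans yr.
pose s := Num.min (Num.min s1 s2) (Num.min s3 ((r - enorm y) / 2)) / 2.
have s0 : 0 < s by rewrite divr_gt0// !lt_min s10 s20 s30 divr_gt0// subr_gt0.
have [sl1 sl2 sl3 sl4] : [/\ s < s1, s < s2, s < s3 & enorm y + 2 * s < r].
  have : s * 2 <= s1 /\ s * 2 <= s2 /\ s * 2 <= s3 /\ s * 2 <= (r - enorm y) / 2.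
    rewrite /s divfK// !ge_min !lexx ?orbT/=.
    by do !split => //; rewrite ?lexx ?orbT.
  by move=> [? [? [? ?]]]; split; lra.
have [rho mo] := mollifier_exists d0 kp s0.
have main := second_difference_molli d0 k0 bu bDu bD2 w1 w2 hU hH mo sl4 s0.
case: mo => sr r0 vr r1 _; have br : bms rho by exact: smooth_bms sr vr.
have close p t : s < t -> (forall q, eball p t q -> `|u p - u q| < e / 4) ->
    `|conv u rho p - u p| <= e / 4.
  move=> st hq; apply: (@conv_close _ _ _ _ _ s t) => //.
  by apply: aeW => z hz; rewrite distrC ltW// hq.
have c1 := close _ _ sl1 hs1; have c2 := close _ _ sl2 hs2; have c3 := close _ _ sl3 hs3.
set a := conv u rho (x + y) in main c1; set b := conv u rho (x - y) in main c2.
set c := conv u rho x in main c3.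
have -> : u (x + y) + u (x - y) - 2 * u x - quad H y =
  (a + b - 2 * c - quad H y) - ((a - u (x + y)) + (b - u (x - y)) - 2 * (c - u x)) by ring.
apply: (le_trans (ler_normB _ _)); rewrite addrC; apply: lerD => //.
apply: (le_trans (ler_normB _ _)); rewrite normrM (ger0_norm (_ : 0 <= 2))//.
have := ler_normD (a - u (x + y)) (b - u (x - y)); lra.
Qed.

End mollifiers.

(** * Integration by parts and du Bois-Reymond *)

Section integration_by_parts.
Context {R : realType} {d : nat}.
Local Notation rV := 'rV[R]_d.
Local Notation leb := (lebesgue_rV (R := R) d).
Local Notation e_ i := (delta_mx 0 i : rV).

Lemma cvg_cst_eq (a l : R) : (fun _ : nat => a) @ \oo --> l -> l = a.
Proof.
move=> H; apply: (@cvg_unique R^o (@norm_hausdorff R R^o) _ _ _ _ H); exact: cvg_cst.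
Qed.

(** Translation invariance gives each difference quotient integral 0, and the Lipschitz bound along
    [v] dominates the quotients. *)
Lemma bint_derivative0 (p p' : rV -> R) (v : rV) (L : R) : bms p -> bms p' ->
  (forall x h, `|p (x + h *: v) - p x| <= L * `|h|) ->
  {ae leb, forall x, is_derive x v p (p' x)} -> bint p' = 0.
Proof.
move=> bp bp' hL hd; have [mp [M hM] [r hr]] := bp.
pose h (k : nat) : R := k.+1%:R^-1.
have h0 k : h k != 0 by rewrite invr_eq0.
have hc : h @ \oo --> 0.
  apply/cvgrPdist_lt => a a0; have := near_infty_natSinv_lt (PosNum a0).
  by apply: filterS => k /= ka; rewrite sub0r normrN ger0_norm ?invr_ge0.
have h1 k : `|h k| <= 1.
  by rewrite ger0_norm ?invr_ge0// invf_le1 ?ltr0n// ler1n.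
pose F k x := (h k)^-1 * (p (x + h k *: v) - p x).
have bF k : bms (fun x => p (x + h k *: v)) by exact: bms_translate.
have F0 k : bint (F k) = 0.
  by rewrite /F bintZ ?bintB ?bint_translate ?subrr ?mulr0//; exact: bmsB.
have : (fun k => bint (F k)) @ \oo --> bint p'.
  apply: (@bint_dct _ _ _ _ L (`|r| + enorm v + 1)).
  - by move=> k; case: (bmsZ (h k)^-1 (bmsB (bF k) bp)).
  - by case: bp'.
  - move=> k x; rewrite normrM normfV mulrC ler_pdivrMr ?normr_gt0//.
  - move=> k x hx; have hr' : r <= `|r| by exact: ler_norm.
    have v0 := enorm_ge0 v.
    rewrite /F !hr ?subrr ?mulr0//; first by lra.
    have := enormB (x + h k *: v) (h k *: v); rewrite addrK enormZ => e1.
    have e2 : `|h k| * enorm v <= enorm v by rewrite ler_piMl.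
    by lra.
  apply: filterS hd => x /is_derive_seqP; exact.
rewrite (_ : (fun k => bint (F k)) = fun=> 0); last exact/funext.
exact: cvg_cst_eq.
Qed.

Lemma is_derive_mul (f g : rV -> R) (x v : rV) (a b : R) :
  is_derive x v f a -> is_derive x v g b ->
  is_derive x v (fun y => f y * g y) (a * g x + f x * b).
Proof.
move=> hf hg; have := is_deriveM hf hg => /is_derive_congr; apply.
by rewrite addrC [g x *: a]mulrC.
Qed.

Lemma test_bms (U : set rV) (psi : rV -> R) : (0 < d)%N -> test_function U psi -> bms psi.
Proof.
move=> d0 [sp cp _]; apply: bms_continuous; first exact: smooth_continuous.
have [r r0 hr] := bounded_setP (compact_bounded cp).
exists r => x hx; apply/eqP/negPn/negP => /= h.
have : eball 0 r x by apply: hr; exact: subset_closure.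
by rewrite /eball /= subr0 ltNge hx.
Qed.

Lemma test_off (U : set rV) (psi : rV -> R) (x : rV) : test_function U psi -> ~ U x ->
  exists2 r : R, 0 < r & forall y, eball x r y -> psi y = 0.
Proof.
move=> [_ _ sub] nU.
have : (~` closure [set x | psi x != 0]) x by move=> /sub.
move=> /((open_eballP _).1 (closed_openC (@closed_closure _ _))) [r r0 hr].
exists r => // y /hr ny; apply/eqP/negPn/negP => h; apply: ny.
exact: subset_closure.
Qed.

Lemma test_partial (U : set rV) (psi : rV -> R) i : test_function U psi ->
  test_function U (partial i psi).
Proof.
move=> [sp cp sub].
have S : closure [set x | partial i psi x != 0] `<=` closure [set x | psi x != 0].
  rewrite [X in _ `<=` X](iffLR (closure_id _) (@closed_closure _ _)); apply: closure_subset.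
  move=> x /= /eqP px; apply: contrapT => nx; apply: px.
  have := (open_eballP _).1 (closed_openC (@closed_closure _ [set x | psi x != 0])) x nx.
  move=> [r r0 hr]; apply: (@partial_near0 _ _ _ _ _ r) => // y /hr ny.
  by apply/eqP/negPn/negP => h; apply: ny; exact: subset_closure.
split; first exact: smooth_partial.
  exact: (subclosed_compact (@closed_closure _ _) cp S).
exact: subset_trans sub.
Qed.

(** The product of [v] with a test function is differentiable on the whole space, being 0 near every
    point outside [U], so its derivative integrates to 0. *)
Lemma classical_weakp (U : set rV) i (v w : rV -> R) : (0 < d)%N -> bms v -> bms w ->
  (forall x, U x -> is_derive x (e_ i) v (w x)) -> weakp U i v w.
Proof.
move=> d0 bv bw dv psi tp.
have bp := test_bms d0 tp; have bpp := test_bms d0 (test_partial i tp).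
have sp : smooth psi by case: tp.
have dp x : is_derive x (e_ i) (fun y => v y * psi y) (w x * psi x + v x * partial i psi x).
  have [Ux|nUx] := pselect (U x).
    by apply: is_derive_mul; [exact: dv|exact: smooth_derivable].
  have [r r0 hr] := test_off tp nUx.
  rewrite (hr x (eball_center x r0)) mulr0 add0r (partial_near0 i r0 hr) mulr0.
  apply: near_eq_is_derive r0 _ (is_derive_cst0 _ _).
  by move=> y /hr ->; rewrite mulr0.
have b1 : bms (fun x => w x * psi x) by exact: bmsMM.
have b2 : bms (fun x => v x * partial i psi x) by exact: bmsMM.
have b3 : bms (fun x => w x * psi x + v x * partial i psi x) by exact: bmsD.
have [_ [L hL] _] := b3.
have := @bint_derivative0 _ _ (e_ i) L (bmsMM bv bp) b3 _ (aeW _ dp).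
rewrite bintD// => h; apply/eqP; rewrite -addr_eq0 addrC h// => x t.
exact: lipschitz_line dp hL.
Qed.

End integration_by_parts.

Section du_bois_reymond.
Context {R : realType} {d : nat}.
Local Notation rV := 'rV[R]_d.
Local Notation leb := (lebesgue_rV (R := R) d).

Definition obox (a b : rV) : set rV := [set x | forall i, a 0 i < x 0 i < b 0 i].
Definition orthant (b : rV) : set rV := [set x | forall i, x 0 i < b 0 i].

Lemma obox_nbhs (a b x : rV) : obox a b x -> exists2 r : R, 0 < r & eball x r `<=` obox a b.
Proof.
move=> hx.
have ex i : exists r : R, 0 < r /\ (a 0 i + r <= x 0 i <= b 0 i - r).
  have /andP[h1 h2] := hx i.
  exists (Num.min (x 0 i - a 0 i) (b 0 i - x 0 i)); split; first by rewrite lt_min !subr_gt0 h1.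
  have : Num.min (x 0 i - a 0 i) (b 0 i - x 0 i) <= x 0 i - a 0 i by rewrite ge_min lexx.
  have : Num.min (x 0 i - a 0 i) (b 0 i - x 0 i) <= b 0 i - x 0 i by rewrite ge_min lexx orbT.
  by move=> *; apply/andP; split; lra.
pose r i := sval (cid (ex i)); have rP i := svalP (cid (ex i)).
exists (\big[Num.min/1]_i r i).
  elim/big_ind : _ => //; last by move=> i _; case: (rP i).
  by move=> u v u0 v0; rewrite lt_min u0.
move=> y hy i; have [_ /andP[h1 h2]] := rP i; rewrite -/(r i) in h1 h2.
have := coord_le_enorm (y - x) 0 i; rewrite !mxE => h3.
have h4 : \big[Num.min/1]_i r i <= r i by exact: bigmin_le.
have := lt_le_trans (le_lt_trans h3 hy) h4; rewrite ltr_norml => /andP[? ?].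
by apply/andP; split; lra.
Qed.

Lemma obox_open (a b : rV) : open (obox a b).
Proof. by apply/open_eballP => x; exact: obox_nbhs. Qed.

Lemma obox_off (a b x : rV) : ~ obox a b x -> (forall i, x 0 i != a 0 i) ->
  (forall i, x 0 i != b 0 i) -> exists2 r : R, 0 < r & forall y, eball x r y -> ~ obox a b y.
Proof.
move=> nx na nb.
have /existsNP[i /negP] : ~ forall i, a 0 i < x 0 i < b 0 i by [].
rewrite negb_and -!leNgt => /orP[h|h].
  exists (a 0 i - x 0 i); first by rewrite subr_gt0 lt_neqAle na.
  move=> y hy /(_ i) /andP[h1 _].
  have := coord_le_enorm (y - x) 0 i; rewrite !mxE => h3.
  have := le_lt_trans h3 hy; rewrite ltr_norml => /andP[? ?]; lra.
exists (x 0 i - b 0 i); first by rewrite subr_gt0 lt_neqAle eq_sym nb.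
move=> y hy /(_ i) /andP[_ h1].
have := coord_le_enorm (y - x) 0 i; rewrite !mxE => h3.
have := le_lt_trans h3 hy; rewrite ltr_norml => /andP[? ?]; lra.
Qed.

Lemma coord_hyperplane_negligible (i : 'I_d) (c : R) : leb.-negligible [set x | x 0 i = c].
Proof.
have a0 : (delta_mx 0 i : rV) != 0.
  by apply/eqP => /rowP /(_ i); rewrite !mxE !eqxx /= => /eqP; rewrite oner_eq0.
have := hyperplane_negligible (- c) a0; apply: negligibleS => x /= <-.
rewrite dot_sum (bigD1 i)//= mxE !eqxx mul1r big1 ?addr0 ?subrr// => j ji.
by rewrite mxE (negbTE ji) andbF mul0r.
Qed.

Lemma obox_bounded (a b : rV) : exists r : R, obox a b `<=` eball 0 r.
Proof.
exists (\sum_i \sum_j (`|a i j| + `|b i j|) + 1) => x hx.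
rewrite /eball /= subr0; apply: (@le_lt_trans _ _ (\sum_i \sum_j (`|a i j| + `|b i j|))); last first.
  by rewrite ltrDl.
apply: (le_trans (enorm_le_sum x)); apply: ler_sum => i _; apply: ler_sum => j _.
have /andP[h1 h2] := hx j; rewrite ord1 ler_norml.
have := ler_norm (b 0 j); have := ler_norm (- a 0 j); rewrite normrN => *.
have := normr_ge0 (b 0 j); have := normr_ge0 (a 0 j) => *.
by apply/andP; split; lra.
Qed.

Lemma bms_obox (a b : rV) : bms (\1_(obox a b)).
Proof.
by apply: bms_indic; [apply: open_rV_measurable; exact: obox_open|exact: obox_bounded].
Qed.

(** Mollifiers centred in the box are test functions in [U], so the mollified [g] vanishes on the
    box. [conv_swap] rewrites this with mollified indicators, which converge off the hyperplanes
    carrying the faces. *)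
Lemma bint_obox0 (phi g : rV -> R) (U : set rV) (a b : rV) (s : R) : (0 < d)%N ->
  kernel_function phi -> bms g ->
  (forall psi, test_function U psi -> bint (fun x => g x * psi x) = 0) -> 0 < s ->
  (forall x, obox a b x -> eball x s `<=` U) ->
  bint (fun x => \1_(obox a b) x * g x) = 0.
Proof.
move=> d0 kp bg hg s0 hs.
have hk (k : nat) : 0 < Num.min k.+1%:R^-1 (s / 2) by rewrite lt_min invr_gt0 ltr0n divr_gt0.
pose rho k := sval (cid (mollifier_exists d0 kp (hk k))).
have rP k : mollifier (Num.min k.+1%:R^-1 (s / 2)) (rho k) := svalP (cid (mollifier_exists d0 kp (hk k))).
have br k : bms (rho k) by case: (rP k) => sr _ vr _ _; exact: smooth_bms sr vr.
have bf := bms_obox a b.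
pose f := \1_(obox a b) : rV -> R.
have E k : bint (fun z => g z * conv f (rho k) z) = 0.
  case: (rP k) => sr r0 vr r1 er.
  have [_ _ <-] := conv_swap bf bg (br k) er.
  rewrite -[RHS](@bint0 R d); apply: eq_bint => x; rewrite indicE.
  case: (boolP (x \in _)) => [|_]; last by rewrite mul0r.
  rewrite inE => /hs xU; rewrite mul1r /conv; apply: hg.
  apply: test_reflect sr vr _ xU; apply: (@le_lt_trans _ _ (s / 2)); first by rewrite ge_min lexx orbT.
  by rewrite ltr_pdivrMr// ltr_pMr// ltr1n.
have C : (fun k => bint (fun z => g z * conv f (rho k) z)) @ \oo --> bint (fun x => g x * f x).
  have [mg [M hM] [r hr]] := bg.
  have cb k z : `|conv f (rho k) z| <= 1.
    case: (rP k) => sr r0 vr r1 er.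
    rewrite -[conv _ _ _]subr0; apply: (@conv_close _ _ _ _ _ _ (Num.min k.+1%:R^-1 (s / 2) + 1) 0 1 bf (br k) r0 r1 vr).
      by rewrite ltrDl.
    by apply: aeW => x _; rewrite subr0 indicE; case: (_ \in _); rewrite ?normr1// normr0.
  have mc k : bms (fun z => g z * conv f (rho k) z).
    by case: (rP k) => sr r0 vr r1 er; have [] := conv_swap bf bg (br k) er.
  apply: (@bint_dct _ _ _ _ M r).
  - by move=> k; case: (mc k).
  - by case: (bmsMM bg bf).
  - move=> k x; rewrite normrM -[leRHS]mulr1; exact: ler_pM.
  - by move=> k x /hr ->; rewrite mul0r.
  have hp (i : 'I_d) (c : R) : {ae leb, forall x : rV, x 0 i != c}.
    have := coord_hyperplane_negligible i c; apply: negligibleS => x /=.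
    by move=> /negP; rewrite negbK => /eqP.
  have N : {ae leb, forall x : rV, forall i, x 0 i != a 0 i /\ x 0 i != b 0 i}.
    by apply: filter_forall => i; apply: filterS2 (hp i (a 0 i)) (hp i (b 0 i)).
  apply: filterS N => x /= hx.
  have na i : x 0 i != a 0 i by case: (hx i).
  have nb i : x 0 i != b 0 i by case: (hx i).
  have [t t0 ht] : exists2 t : R, 0 < t & forall y, eball x t y -> f y = f x.
    have [xab|xab] := pselect (obox a b x).
      have [t t0 ht] := obox_nbhs xab; exists t => // y /ht hy.
      by rewrite /f !indicE !mem_set.
    have [t t0 ht] := obox_off xab na nb; exists t => // y /ht hy.
    by rewrite /f !indicE !memNset.
  apply: cvgM; first exact: cvg_cst.
  have := near_infty_natSinv_lt (PosNum t0) => hN.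
  apply: (@cvg_trans _ ((fun=> f x) @ \oo)); last exact: cvg_cst.
  apply: near_eq_cvg; apply: filterS hN => k /= kt.
  case: (rP k) => sr r0 vr r1 er; apply/eqP; rewrite eq_sym -subr_eq0 -normr_le0; apply/eqP.
  apply/eqP; apply: (@conv_close _ _ _ _ _ (Num.min k.+1%:R^-1 (s / 2)) t (f x) 0 bf (br k) r0 r1 vr).
    by rewrite gt_min kt.
  by apply: aeW => y /ht fy; rewrite -/f fy subrr normr0.
rewrite (eq_bint (g := fun x => g x * f x)); last by move=> x; rewrite mulrC.
have {}E : (fun k => bint (fun z => g z * conv f (rho k) z)) = fun=> 0 by exact/funext.
rewrite E in C.
exact: cvg_cst_eq C.
Qed.

Lemma orthant_setI : setI_closed (range orthant).
Proof.
move=> _ _ [b _ <-] [c _ <-]; exists (\row_i Num.min (b 0 i) (c 0 i)) => //.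
apply/seteqP; split => x hx.
  by split => i; have := hx i; rewrite mxE lt_min => /andP[].
by move=> i; rewrite mxE lt_min; case: hx => /(_ i) -> /(_ i) ->.
Qed.

(** An open half-space bounding one coordinate is the countable union of orthants whose other bounds
    tend to infinity. *)
Lemma measurable_orthants (A : set rV) : measurable A -> <<s range orthant >> A.
Proof.
move: A; apply: smallest_sub; first exact: smallest_sigma_algebra.
have ray (i : 'I_d) (c : R) : <<s range orthant >> [set x : rV | x 0 i < c].
  have -> : [set x : rV | x 0 i < c] =
      \bigcup_k orthant (\row_j (if j == i then c else k%:R)).
    apply/seteqP; split => [x /= xc|x [k _ /(_ i)]]; last by rewrite mxE eqxx.
    exists (Num.truncn (enorm x)).+1 => //= j; rewrite mxE; case: eqP => [->//|_].
    have := coord_le_enorm x 0 j; have := truncn_itv (enorm_ge0 x) => /andP[_ h1] h2.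
    exact: le_lt_trans (le_trans (ler_norm _) h2) h1.
  apply: (@sigma_algebra_bigcup _ setT (range orthant)) => k.
  by apply: sub_sigma_algebra; exists (\row_j (if j == i then c else k%:R)).
have sub (i : 'I_d) : preimage_set_system setT (fun x : rV => x 0 i) (@measurable _ (measurableTypeR R))
    `<=` <<s range orthant >>.
  move=> _ [B mB <-]; rewrite setTI.
  have : @RGenInftyO.G R `<=` [set B | <<s range orthant >> ((fun x : rV => x 0 i) @^-1` B)].
    by move=> _ [c ->] /=; rewrite (_ : _ @^-1` _ = [set x : rV | x 0 i < c]).
  move=> hG; suff : <<s @RGenInftyO.G R >> `<=` [set B | <<s range orthant >> ((fun x : rV => x 0 i) @^-1` B)].
    by move=> /(_ B); apply; move: mB; rewrite RGenInftyO.measurableE.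
  apply: smallest_sub => //.
  split.
  - by rewrite /= preimage_set0; exact: sigma_algebra0.
  - by move=> C /= hC; exact: (sigma_algebraCD hC).
  - by move=> F hF /=; rewrite preimage_bigcup; exact: sigma_algebra_bigcup.
elim/big_ind : _ => //; first by move=> X Y hX hY x [/hX|/hY].
Qed.

(** The sets where [h] is positive and negative give the integral of |h|. *)
Lemma bint_sets_eq0 (h : rV -> R) : bms h ->
  (forall A, measurable A -> bint (fun x => \1_A x * h x) = 0) ->
  {ae leb, forall x, h x = 0}.
Proof.
move=> bh H.
have mp : measurable [set x | 0 < h x].
  have := bms_measurable bh measurableT (measurable_itv `]0, +oo[).
  by rewrite setTI; congr measurable; apply/seteqP; split => x /=; rewrite in_itv /= andbT.
have mn : measurable [set x | h x < 0].
  have := bms_measurable bh measurableT (measurable_itv `]-oo, 0[).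
  by rewrite setTI; congr measurable; apply/seteqP; split => x /=; rewrite in_itv.
have b1 A : measurable A -> bms (fun x => \1_A x * h x).
  move=> mA; apply: bmsMr => //; exists 1 => x.
  by rewrite indicE; case: (_ \in _); rewrite ?normr1 ?normr0.
have I0 : bint (fun x => `|h x|) = 0.
  rewrite (eq_bint (g := fun x => \1_[set x | 0 < h x] x * h x - \1_[set x | h x < 0] x * h x)).
    by rewrite bintB ?H ?subrr//; exact: b1.
  move=> x; rewrite !indicE; case: (ltgtP (h x) 0) => hx.
  - rewrite memNset /=; last by rewrite ltNge (ltW hx).
    by rewrite mem_set//= ltr0_norm// mul0r mul1r sub0r.
  - rewrite mem_set//= memNset /=; last by rewrite ltNge (ltW hx).
    by rewrite gtr0_norm// mul0r mul1r subr0.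
  - by rewrite hx normr0 !mulr0 subrr.
have mh : measurable_fun setT (EFin \o h) by apply/measurable_EFinP; exact: bms_measurable.
have := (ae_eq_integral_abs (lebesgue_rV d) measurableT mh).1.
have -> : (\int[leb]_x `|(EFin \o h) x| = 0)%E.
  by rewrite -[RHS]/((0 : R)%:E) -I0 -bintE//; exact: bms_norm.
by move=> /(_ erefl); apply: filterS => x /(_ I) [].
Qed.

(** Monotone classes: the sets over which [h] integrates to 0 form a lambda-system, which contains
    the intersection-stable family of orthants because an orthant cuts the box in a smaller box. *)
Lemma du_bois_reymond_box (phi g : rV -> R) (U : set rV) (a b : rV) (s : R) : (0 < d)%N ->
  kernel_function phi -> bms g ->
  (forall psi, test_function U psi -> bint (fun x => g x * psi x) = 0) -> 0 < s ->
  (forall x, obox a b x -> eball x s `<=` U) ->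
  {ae leb, forall x, obox a b x -> g x = 0}.
Proof.
move=> d0 kp bg hg s0 hs.
pose h x := \1_(obox a b) x * g x.
have bh : bms h by apply: bmsMM => //; exact: bms_obox.
suff : {ae leb, forall x, h x = 0}.
  apply: filterS => x; rewrite /h indicE => hx ab; move: hx.
  by rewrite mem_set// mul1r.
apply: bint_sets_eq0 => // A mA.
have b1 B : measurable B -> bms (fun x => \1_B x * h x).
  move=> mB; apply: bmsMr => //; exists 1 => x.
  by rewrite indicE; case: (_ \in _); rewrite ?normr1 ?normr0.
pose H := [set A | measurable A /\ bint (fun x => \1_A x * h x) = 0].
suff : <<s range orthant >> `<=` H by move=> /(_ A (measurable_orthants mA)) [].
have bint_box (c : rV) : bint (fun x => \1_(orthant c) x * h x) = 0.
  have E : obox a (\row_i Num.min (b 0 i) (c 0 i)) = orthant c `&` obox a b.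
    apply/seteqP; split => x hx.
      split => i; have := hx i; rewrite mxE lt_min => /andP[h1 /andP[h2 h3]] //.
      by rewrite h1.
    by case: hx => h1 h2 i; rewrite mxE lt_min h1 andbT; exact: h2.
  have := @bint_obox0 phi g U a (\row_i Num.min (b 0 i) (c 0 i)) s d0 kp bg hg s0.
  rewrite E => <-; last by move=> x [_]; exact: hs.
  by apply: eq_bint => x; rewrite /h mulrA indicI.
have mO c : measurable (orthant c).
  have -> : orthant c = \bigcap_(i in [set: 'I_d]) [set x | x 0 i < c 0 i].
    by apply/seteqP; split => x hx i //=; exact: hx.
  apply: fin_bigcap_measurable => // i _.
  have := measurable_coord i measurableT (measurable_itv `]-oo, c 0 i[).
  by rewrite setTI; congr measurable; apply/seteqP; split => x /=; rewrite in_itv.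
apply: lambda_system_subset => //; [exact: orthant_setI| |].
- split.
  + by [].
  + split => //; have := @bint_obox0 phi g U a b s d0 kp bg hg s0 hs => <-.
    by apply: eq_bint => x; rewrite indicE mem_set// mul1r.
  + move=> A1 B1 BA [mA1 A0] [mB1 B0]; split; first exact: measurableD.
    rewrite (eq_bint (g := fun x => \1_A1 x * h x - \1_B1 x * h x)); last first.
      move=> x; rewrite -mulrBl; congr (_ * _); rewrite !indicE in_setD.
      case: (boolP (x \in B1)) => [|_]; last by rewrite andbT subr0.
      by rewrite inE => /BA Ax; rewrite andbF mem_set// subrr.
    by rewrite bintB ?A0 ?B0 ?subrr//; exact: b1.
  + move=> F ndF HF; have mF : measurable (\bigcup_i F i).
      by apply: bigcup_measurable => i _; case: (HF i).
    split => //.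
    have C : (fun k => bint (fun x => \1_(F k) x * h x)) @ \oo --> bint (fun x => \1_(\bigcup_i F i) x * h x).
      have [mh [M hM] [r hr]] := bh.
      apply: (@bint_dct _ _ _ _ M r).
      * by move=> k; have [mFk _] := HF k; case: (b1 _ mFk).
      * by case: (b1 _ mF).
      * move=> k x; rewrite normrM -[leRHS]mul1r; apply: ler_pM => //.
        by rewrite indicE; case: (_ \in _); rewrite ?normr1 ?normr0.
      * by move=> k x /hr ->; rewrite mulr0.
      apply: aeW => x; apply: cvgM; last exact: cvg_cst.
      apply: (@cvg_trans _ ((fun=> \1_(\bigcup_i F i) x : R) @ \oo)); last exact: cvg_cst.
      apply: near_eq_cvg.
      have [[k _ Fkx]|no] := pselect ((\bigcup_i F i) x).
        exists k => // j /= kj.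
        have Fj : F j x by move: Fkx; apply: (subsetPset _ _ (ndF _ _ kj)).
        by rewrite !indicE !mem_set//; exists k.
      exists 0%N => // j _ /=; rewrite !indicE !memNset// => Fj; apply: no.
      by exists j.
    move: C; rewrite (_ : (fun k => _) = fun=> 0); first exact: cvg_cst_eq.
    by apply/funext => k; case: (HF k).
- by move=> _ [c _ <-]; split; [exact: mO|exact: bint_box].
Qed.

(** [U] is covered by countably many rational boxes, each at positive distance from the complement
    of [U]. *)
Lemma du_bois_reymond (phi g : rV -> R) (U : set rV) : (0 < d)%N ->
  kernel_function phi -> bms g -> open U ->
  (forall psi, test_function U psi -> bint (fun x => g x * psi x) = 0) ->
  {ae leb, forall x, U x -> g x = 0}.
Proof.
move=> d0 kp bg oU hg.
pose Q (c : 'rV[rat]_d * nat) : set rV :=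
  obox (\row_i (ratr (c.1 0 i) - c.2.+1%:R^-1)) (\row_i (ratr (c.1 0 i) + c.2.+1%:R^-1)).
pose ok c := exists2 s : R, 0 < s & forall x, Q c x -> eball x s `<=` U.
pose N (k : nat) : set rV := if unpickle k is Some c then
  (if `[< ok c >] then Q c `&` [set x | g x != 0] else set0) else set0.
have nN k : leb.-negligible (N k).
  rewrite /N; case: (unpickle k) => [c|]; last exact: negligible_set0.
  case: asboolP => [okc|_]; last exact: negligible_set0.
  have [s s0 hs] := okc.
  have := @du_bois_reymond_box phi g U _ _ s d0 kp bg hg s0 hs.
  apply: negligibleS => x [Qx /= gx] /= h.
  by move: gx; rewrite h// eqxx.
have := negligible_bigcup nN; apply: negligibleS => x /= /not_implyP[Ux /eqP gx].
have [e e0 he] := (open_eballP _).1 oU x Ux.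
(* A box of half-width [t] has Euclidean diameter at most [2 * d * t]; this choice leaves a margin
   [e / 2] inside the ball of radius [e]. *)
have e4 : 0 < e / (4 * (1 * d)%:R + 2) by rewrite divr_gt0// ltr_wpDl// mulr_ge0.
have [k _ /(_ k (leqnn k)) /= hk] := near_infty_natSinv_lt (PosNum e4).
pose t : R := k.+1%:R^-1; have t0 : 0 < t by rewrite invr_gt0.
have ex i : exists q : rat, ratr q \in `](x 0 i - t), (x 0 i + t)[.
  by apply: rat_in_itvoo; rewrite ltrBlDr -addrA ltrDl addr_gt0.
pose q : 'rV[rat]_d := \row_i sval (cid (ex i)).
have Qx : Q (q, k) x.
  move=> i; rewrite !mxE; have := svalP (cid (ex i)); rewrite in_itv /= -/t => /andP[? ?].
  by apply/andP; split; lra.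
exists (pickle (q, k)) => //; rewrite /N pickleK.
case: asboolP => [_|no]; first by split.
exfalso; apply: no; exists (e / 2); first by rewrite divr_gt0.
move=> y Qy z hz; apply: he.
have hyx : enorm (y - x) <= (1 * d)%:R * (2 * t).
  apply: (le_trans (enorm_le_normr _)); apply: ler_wpM2l => //.
  rewrite [`|_|]mx_normrE; apply/bigmax_leP; split; first by rewrite mulr_ge0// ltW.
  move=> -[i j] _ /=; rewrite ord1 !mxE.
  have := Qx j; have := Qy j; rewrite !mxE /= -/t => /andP[? ?] /andP[? ?].
  by rewrite ler_norml; apply/andP; split; lra.
have hk' : t < e / (4 * (1 * d)%:R + 2) := hk.
move: hk'; rewrite ltr_pdivlMr ?ltr_wpDl// ?mulr_ge0// => hk'.
rewrite /eball /= -[z - x](subrKA y); apply: (le_lt_trans (enormD _ _)).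
by move: hz hyx; rewrite /eball /=; set n := (1 * d)%:R in hk' *; lra.
Qed.

End du_bois_reymond.

(** * Barycentric coordinates *)

Section barycentric.
Context {R : realType} {d : nat} (T : mesh R d).
Local Notation rV := 'rV[R]_d.
Local Notation N := (nb_nodes T).
Implicit Types (K : {set 'I_N}) (i j k : 'I_N) (x y z : rV).

(** Solving for a row of weights against the rows (1, node) expresses at once that the weights sum
    to 1 and that they reproduce the point. Zero rows for the other nodes let all simplices share
    one index type. *)
Definition nodemx K : 'M[R]_(N, d.+1) :=
  \matrix_(i, j) (if i \in K then rV_cons (1, node i) 0 j else 0).

(* Barycentric coordinates; they vanish when [i] is not a vertex of [K]. *)
Definition lam K i x : R :=
  if i \in K then (rV_cons (1, x) *m pinvmx (nodemx K)) 0 i else 0.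

Definition bgrad K i : rV :=
  if i \in K then \row_j (pinvmx (nodemx K)) (lift ord0 j) i else 0.

Definition bconst K i : R := if i \in K then (pinvmx (nodemx K)) ord0 i else 0.

Lemma lamE K i x : lam K i x = dot (bgrad K i) x + bconst K i.
Proof.
rewrite /lam /bgrad /bconst; case: ifP => _; last by rewrite dot0l addr0.
rewrite mxE big_ord_recl rV_cons0 mul1r addrC dot_sum; congr (_ + _).
by apply: eq_bigr => j _; rewrite rV_consS /= mxE mulrC.
Qed.

Lemma lam_off K i x : i \notin K -> lam K i x = 0.
Proof. by rewrite /lam => /negbTE ->. Qed.

Lemma lam_comb K i x y (t : R) :
  lam K i ((1 - t) *: x + t *: y) = (1 - t) * lam K i x + t * lam K i y.
Proof. by rewrite !lamE dotDr !dotZr; ring. Qed.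

Lemma lamB K i x y : lam K i x - lam K i y = dot (bgrad K i) (x - y).
Proof. by rewrite !lamE dotBr; ring. Qed.

Lemma lam_lipschitz K i x y : `|lam K i x - lam K i y| <= enorm (bgrad K i) * enorm (x - y).
Proof. by rewrite lamB; exact: normr_dot_le. Qed.

Lemma lam_continuous K i : continuous (lam K i).
Proof. exact: lipschitz_continuous (lam_lipschitz K i). Qed.

Section simplex.
Variable K : {set 'I_N}.
Hypotheses (cK : #|K| = d.+1) (aK : affinely_independent K).

Lemma affine_unique (c c' : 'I_N -> R) :
  (forall i, i \notin K -> c i = 0) -> (forall i, i \notin K -> c' i = 0) ->
  \sum_i c i = \sum_i c' i -> \sum_i c i *: node i = \sum_i c' i *: node i -> c =1 c'.
Proof.
move=> c0 c0' s1 s2 i; have [iK|iK] := boolP (i \in K); last by rewrite c0// c0'.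
apply/eqP; rewrite -subr_eq0; apply/eqP.
have E (f : 'I_N -> R) : (forall i, i \notin K -> f i = 0) ->
    \sum_i f i = \sum_(i in K) f i /\ \sum_i f i *: node i = \sum_(i in K) f i *: node i.
  move=> f0; split; rewrite [LHS](bigID (mem K)) /= [X in _ + X]big1 ?addr0// => j jK.
  by rewrite f0// scale0r.
pose e j := c j - c' j.
have e0 j : j \notin K -> e j = 0 by move=> jK; rewrite /e c0// c0'// subrr.
have [E1 E2] := E e e0.
apply: (aK (c := e)) => //.
  by rewrite -E1 /e sumrB s1 subrr.
rewrite -E2 /e (eq_bigr (fun j => c j *: node j - c' j *: node j)); last first.
  by move=> j _; rewrite scalerBl.
by rewrite sumrB s2 subrr.
Qed.

(** Affine independence of the [d + 1] vertices is linear independence of their rows (1, node), as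
    many as there are columns. *)
Lemma nodemx_full : row_full (nodemx K).
Proof.
rewrite /row_full eqn_leq rank_leq_col /=.
pose f (a : 'I_#|K|) : 'I_N := enum_val a.
have fr : row_free (rowsub f (nodemx K)).
  apply: inj_row_free => v hv.
  pose c i : R := \sum_(a | f a == i) v 0 a.
  have fK a : f a \in K by exact: enum_valP.
  have fi : injective f by exact: enum_val_inj.
  have ca a : c (f a) = v 0 a.
    rewrite /c (bigD1 a)//= big1 ?addr0// => b /andP[/eqP /fi -> ]; by rewrite eqxx.
  have col (j : 'I_d.+1) : \sum_(i in K) c i * rV_cons (1, node i) 0 j = 0.
    have := congr1 (fun M : 'rV_d.+1 => M 0 j) hv; rewrite !mxE => E0; rewrite -[RHS]E0.
    rewrite (reindex_onto f (fun i => enum_rank_in (fK (cast_ord (esym cK) ord0)) i)) /=; last first.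
      by move=> i iK; rewrite /f enum_rankK_in.
    apply: eq_big => [a|a _]; last by rewrite ca !mxE fK.
    by rewrite fK /= /f enum_valK_in eqxx.
  apply/rowP => a; rewrite mxE -ca; apply: (aK (c := c)) => //.
    by rewrite -[RHS](col ord0); apply: eq_bigr => i _; rewrite rV_cons0 mulr1.
  apply/rowP => j; rewrite summxE mxE -[RHS](col (lift ord0 j)).
  by apply: eq_bigr => i _; rewrite rV_consS mxE.
move: fr; rewrite /row_free => /eqP h.
by rewrite -[X in (X <= _)%N]cK -h; apply: mxrankS; exact: rowsub_sub.
Qed.

Lemma lam_spec x : \sum_i lam K i x = 1 /\ \sum_i lam K i x *: node i = x.
Proof.
have h : rV_cons (1, x) *m pinvmx (nodemx K) *m nodemx K = rV_cons (1, x).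
  by rewrite mulmxKpV// submx_full// nodemx_full.
have col (j : 'I_d.+1) : \sum_i lam K i x * rV_cons (1, node i) 0 j = rV_cons (1, x) 0 j.
  rewrite -[in RHS]h mxE; apply: eq_bigr => i _; rewrite [nodemx K i j]mxE /lam.
  by case: ifP => _ //; rewrite mul0r mulr0.
split.
  have := col ord0; rewrite rV_cons0 /= => <-.
  by apply: eq_bigr => i _; rewrite rV_cons0 mulr1.
apply/rowP => j; rewrite summxE; have := col (lift ord0 j); rewrite rV_consS => <-.
by apply: eq_bigr => i _; rewrite rV_consS mxE.
Qed.

Lemma lam_sum x : \sum_i lam K i x = 1. Proof. by case: (lam_spec x). Qed.
Lemma lam_comb_node x : \sum_i lam K i x *: node i = x. Proof. by case: (lam_spec x). Qed.

Lemma lam_unique (c : 'I_N -> R) x : (forall i, i \notin K -> c i = 0) ->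
  \sum_i c i = 1 -> \sum_i c i *: node i = x -> forall i, c i = lam K i x.
Proof.
move=> c0 c1 cx; apply: affine_unique => //; first by move=> i; exact: lam_off.
  by rewrite lam_sum.
by rewrite lam_comb_node.
Qed.

Lemma lam_node i j : j \in K -> lam K i (node j) = (i == j)%:R.
Proof.
move=> jK; symmetry; apply: (lam_unique (c := fun i => (i == j)%:R)).
- by move=> k kK; case: eqP => // kj; move: kK; rewrite kj jK.
- by rewrite (bigD1 j)//= eqxx big1 ?addr0// => k /negbTE ->.
- rewrite (bigD1 j)//= eqxx scale1r big1 ?addr0// => k /negbTE ->.
  by rewrite scale0r.
Qed.

Lemma hullP x : hull K x <-> forall i, 0 <= lam K i x.
Proof.
split=> [[c [c0 c1 cx]] i|h].
  have [iK|iK] := boolP (i \in K); last by rewrite lam_off.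
  rewrite -(lam_unique (c := fun i => if i \in K then c i else 0)) ?iK ?c0//.
  - by move=> j /negbTE ->.
  - by rewrite -big_mkcond.
  - rewrite cx [RHS]big_mkcond; apply: eq_bigr => j _.
    by case: ifP => //; rewrite scale0r.
exists (fun i => lam K i x); split => //.
  rewrite -(lam_sum x) [LHS]big_mkcond; apply: eq_bigr => j _.
  by case: ifP => // /negbT /lam_off ->.
rewrite -{1}(lam_comb_node x) [RHS]big_mkcond; apply: eq_bigr => j _.
by case: ifP => // /negbT /lam_off ->; rewrite scale0r.
Qed.

Lemma lam_le1 i x : hull K x -> lam K i x <= 1.
Proof.
move=> /hullP h; rewrite -(lam_sum x) (bigD1 i)//= lerDl; exact: sumr_ge0.
Qed.

Lemma hull_closed : closed (hull K).
Proof.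
have -> : hull K = \bigcap_(i in [set: 'I_N]) [set x | 0 <= lam K i x].
  by apply/seteqP; split => x; [move=> /hullP h i _ /=; exact: h|move=> h; apply/hullP => i; exact: h].
apply: closed_bigI => i _.
have -> : [set x | 0 <= lam K i x] = lam K i @^-1` [set t | 0 <= t] by [].
apply: closed_comp; last exact: closed_ge.
by move=> x _; exact: lam_continuous.
Qed.

Definition ihull : set rV := [set x | forall i, i \in K -> 0 < lam K i x].

Lemma ihull_open : open ihull.
Proof.
have -> : ihull = \bigcap_(i in [set` K]) [set x | 0 < lam K i x].
  by apply/seteqP; split => x h i /=; exact: h.
rewrite bigcap_fset_set; last exact: finite_finset.
elim/big_ind : _; [exact: openT|exact: openI|move=> i _].
have -> : [set x | 0 < lam K i x] = lam K i @^-1` [set t | 0 < t] by [].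
apply: open_comp; last exact: open_gt.
by move=> x _; exact: lam_continuous.
Qed.

Lemma ihull_hull : ihull `<=` hull K.
Proof.
move=> x h; apply/hullP => i; have [iK|iK] := boolP (i \in K); last by rewrite lam_off.
exact: ltW (h i iK).
Qed.

(** If a coordinate vanished at an interior point, moving slightly away from the corresponding
    vertex would make it negative. *)
Lemma interior_hull : interior (hull K) = ihull.
Proof.
apply/seteqP; split => x; last first.
  by move=> h; apply: (interiorS ihull_hull); move: ihull_open; rewrite openE; exact.
move=> /nbhs_eballP[r r0 hr] i iK.
have hx : forall k, 0 <= lam K k x by apply/hullP; apply: hr; exact: eball_center.
rewrite lt_neqAle hx andbT eq_sym; apply/eqP => l0.
pose t : R := r / (2 * (enorm (x - node i) + 1)).
have e0 : 0 < enorm (x - node i) + 1 by rewrite ltr_wpDl.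
have t0 : 0 < t by rewrite divr_gt0// mulr_gt0.
have : eball x r ((1 - (1 + t)) *: node i + (1 + t) *: x).
  rewrite /eball /= (_ : _ - x = t *: (x - node i)); last first.
    by apply/rowP => j; rewrite !mxE; ring.
  rewrite enormZ gtr0_norm// /t mulrAC ltr_pdivrMr ?mulr_gt0//.
  rewrite ltr_pM2l//; have := enorm_ge0 (x - node i); lra.
move=> /hr /hullP /(_ i); rewrite lam_comb l0 lam_node// eqxx mulr0 addr0 mulr1; lra.
Qed.

Lemma bgrad_neq0 i : (0 < d)%N -> i \in K -> bgrad K i != 0.
Proof.
move=> d0 iK.
have [j jK ji] : exists2 j, j \in K & j != i.
  have : (0 < #|K :\ i|)%N by have := cardsD1 i K; rewrite iK cK add1n => /succn_inj <-.
  by move=> /card_gt0P[j]; rewrite !inE => /andP[? ?]; exists j.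
apply/eqP => g0; have := lamB K i (node i) (node j).
by rewrite g0 dot0l !lam_node// eqxx eq_sym (negbTE ji) subr0 => /eqP; rewrite oner_eq0.
Qed.

Lemma hull_minus_negligible : (0 < d)%N ->
  (lebesgue_rV (R := R) d).-negligible (hull K `\` ihull).
Proof.
move=> d0.
have sub : hull K `\` ihull `<=` \big[setU/set0]_(i in K) [set x | lam K i x = 0].
  move=> x [/hullP hx nx]; apply: contrapT => no; apply: nx => i iK.
  rewrite lt_neqAle hx andbT eq_sym; apply/eqP => l0; apply: no.
  by rewrite (bigD1 i)//=; left.
apply: negligibleS sub _; elim/big_ind : _ => [|A B|i iK]; [exact: negligible_set0|exact: negligibleU|].
have := hyperplane_negligible (bconst K i) (bgrad_neq0 d0 iK).
by apply: negligibleS => x /=; rewrite lamE.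
Qed.

Lemma hull_eball x : hull K x -> enorm x <= \sum_i enorm (@node _ _ T i).
Proof.
move=> hx; rewrite -{1}(lam_comb_node x).
have /hullP h0 := hx.
elim/big_ind2 : _ => [|a b a' b' h1 h2|i _].
- by rewrite enorm0.
- by apply: (le_trans (enormD _ _)); exact: lerD.
by rewrite enormZ ger0_norm// ler_piMl// lam_le1.
Qed.

Lemma hull_diam x y : hull K x -> hull K y -> enorm (x - y) <= diam K.
Proof.
move=> hx hy; apply: ub_le_sup; last by exists x, y.
exists (\sum_i enorm (@node _ _ T i) + \sum_i enorm (@node _ _ T i)) => _ [a [b [ha hb ->]]].
by apply: (le_trans (enormB _ _)); apply: lerD; exact: hull_eball.
Qed.

(** Across an inscribed ball, along its gradient, the coordinate varies by |gradient| times the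
    diameter, yet it stays in [0, 1]. *)
Lemma bgrad_inscribed i : enorm (bgrad K i) * inscribed_diam K <= 1.
Proof.
have [->|g0] := eqVneq (enorm (bgrad K i)) 0; first by rewrite mul0r.
have gp : 0 < enorm (bgrad K i) by rewrite lt_neqAle eq_sym g0 /=.
rewrite mulrC -ler_pdivlMr// mul1r /inscribed_diam.
apply: ge_sup; first by exists 0; split => //; exists 0 => y; rewrite /eball /= mul0r ltNge enorm_ge0.
move=> r [r0 [x hx]]; rewrite -div1r ler_pdivlMr//.
apply/ler_addgt0Pl => e e0.
have [rs|rs] := leP r (e / enorm (bgrad K i)).
  by apply: (@le_trans _ _ e); [rewrite -ler_pdivlMr|rewrite lerDl].
(* The inscribed ball is open, so a slightly smaller radius is used; the variation lost is exactly
   [e]. *)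
pose s := (r - e / enorm (bgrad K i)) / 2.
have s0 : 0 < s by rewrite divr_gt0// subr_gt0.
have eg : 0 < e / enorm (bgrad K i) by rewrite divr_gt0.
have sr : s < r / 2 by rewrite /s; lra.
pose w := (s / enorm (bgrad K i)) *: bgrad K i.
have ew : enorm w = s.
  by rewrite enormZ ger0_norm; [rewrite divfK|rewrite divr_ge0// ltW].
have h1 : hull K (x + w) by apply: hx; rewrite /eball /= addrC addKr ew.
have h2 : hull K (x - w) by apply: hx; rewrite /eball /= addrC addKr enormN ew.
have := lamB K i (x + w) (x - w); rewrite (_ : x + w - (x - w) = 2 *: w); last first.
  by apply/rowP => j; rewrite !mxE; ring.
have /hullP/(_ i) := h2; have := lam_le1 i h1.
rewrite dotZr /w dotZr dotxx.
rewrite (_ : 2 * (s / enorm (bgrad K i) * enorm (bgrad K i) ^+ 2) = r * enorm (bgrad K i) - e); last first.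
  by rewrite /s; field.
lra.
Qed.

End simplex.

End barycentric.

(** * Geometry of conforming meshes *)

Section mesh_geometry.
Context {R : realType} {d : nat} (Omega : set 'rV[R]_d) (T : mesh R d).
Local Notation rV := 'rV[R]_d.
Local Notation N := (nb_nodes T).
Local Notation leb := (lebesgue_rV (R := R) d).
Implicit Types (K : {set 'I_N}) (i j k : 'I_N) (x y z : rV).
Hypotheses (hT : mesh_of Omega T) (d0 : (0 < d)%N).

Definition hulls : set rV := \bigcup_(K in [set` elements T]) hull K.

Lemma element_card K : K \in elements T -> #|K| = d.+1.
Proof. by case: hT => _ _ h _ _ /h[]. Qed.

Lemma element_affine K : K \in elements T -> affinely_independent K.
Proof. by case: hT => _ _ h _ _ /h[]. Qed.

Lemma hullsE : Omega = interior hulls. Proof. by case: hT. Qed.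

Lemma Omega_open : open Omega. Proof. by rewrite hullsE; exact: open_interior. Qed.

Lemma hulls_closed : closed hulls.
Proof.
apply: closed_bigcup; first exact: finite_finset.
by move=> K /= hK; apply: hull_closed (element_card hK) (element_affine hK).
Qed.

Lemma closure_hulls : closure Omega `<=` hulls.
Proof.
rewrite [X in _ `<=` X]((closure_id _).1 hulls_closed).
by apply: closure_subset; rewrite hullsE; exact: interior_subset.
Qed.

Lemma Omega_hulls : Omega `<=` hulls.
Proof. by rewrite {1}hullsE; exact: interior_subset. Qed.

Lemma ihull_Omega K : K \in elements T -> ihull K `<=` Omega.
Proof.
move=> hK; rewrite hullsE -((interior_id _).1 (@ihull_open _ _ T K)); apply: interiorS.
move=> x /(ihull_hull (element_card hK) (element_affine hK)) hx; by exists K.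
Qed.

Lemma hulls_bounded : hulls `<=` eball 0 (\sum_i enorm (@node _ _ T i) + 1).
Proof.
move=> x [K /= hK hx]; rewrite /eball /= subr0.
by have := hull_eball (element_card hK) (element_affine hK) hx; lra.
Qed.

(** By conformity a common point is a convex combination of common vertices, and barycentric
    coordinates are unique in each element. *)
Lemma lam_conform K K' x k : K \in elements T -> K' \in elements T ->
  hull K x -> hull K' x -> lam K k x = lam K' k x.
Proof.
move=> hK hK' hx hx'.
have : (hull K `&` hull K') x by [].
have -> : hull K `&` hull K' = hull (K :&: K') by case: hT => _ _ _ h _; exact: h.
move=> [c [c0 c1 cx]]; pose e k := if k \in K :&: K' then c k else 0.
have e1 : \sum_k e k = 1 by rewrite -big_mkcond.
have ex : \sum_k e k *: node k = x.
  rewrite cx [RHS]big_mkcond; apply: eq_bigr => j _; rewrite /e.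
  by case: ifP => //; rewrite scale0r.
rewrite -(lam_unique (element_card hK) (element_affine hK) (c := e) _ e1 ex); last first.
  by move=> j jK; rewrite /e inE (negbTE jK).
rewrite -(lam_unique (element_card hK') (element_affine hK') (c := e) _ e1 ex) //.
by move=> j jK; rewrite /e inE (negbTE jK) andbF.
Qed.

Lemma ihull_disjoint K K' x : K \in elements T -> K' \in elements T ->
  ihull K x -> hull K' x -> K = K'.
Proof.
move=> hK hK' ix hx'.
have hx := ihull_hull (element_card hK) (element_affine hK) ix.
apply/eqP; rewrite eqEcard (element_card hK) (element_card hK') leqnn andbT.
apply/fintype.subsetP => k kK; apply: contraTT (ix k kK) => kK'.
by rewrite (lam_conform k hK hK' hx hx') lam_off// ltxx.
Qed.

Lemma ae_ihull : {ae leb, forall x, (exists2 K, K \in elements T & ihull K x) \/ ~ hulls x}.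
Proof.
have sub : ~` [set x | (exists2 K, K \in elements T & ihull K x) \/ ~ hulls x] `<=`
    \big[setU/set0]_(K in elements T) (hull K `\` ihull K).
  move=> x /= /not_orP[n1 /contrapT[K /= hK hx]].
  rewrite (bigD1 K)//=; left; split=> // ix; by apply: n1; exists K.
apply: negligibleS sub _; elim/big_ind : _ => [|A B|K hK]; [exact: negligible_set0|exact: negligibleU|].
exact: hull_minus_negligible (element_card hK) (element_affine hK) d0.
Qed.

(* An element containing a point near the vertex on the segment to [x] shares
   with [K] the face carrying that point, so it contains a neighbourhood of
   [x] in the cone with that apex: the cone over the star fills up. *)
Lemma lam_gt0_interior K i x : K \in elements T -> Omega (node i) -> hull K x ->
  0 < lam K i x -> Omega x.
Proof.
move=> hK Oi hx lx.
have iK : i \in K by apply: contraTT lx => /lam_off ->; rewrite ltxx.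
have /open_eballP/(_ _ Oi)[r0 r00 hr0] := Omega_open.
pose a := enorm (x - node i) + 1.
have a0 : 0 < a by rewrite /a ltr_wpDl// enorm_ge0.
pose t := Num.min 1 (r0 / a).
have t0 : 0 < t by rewrite /t lt_min ltr01 divr_gt0.
have t1 : t <= 1 by rewrite /t ge_min lexx.
have ta : t * a <= r0 by rewrite -ler_pdivlMr// /t ge_min lexx orbT.
pose g z : rV := (1 - t) *: node i + t *: z.
have gp K' k z : i \in K' -> K' \in elements T ->
    lam K' k (g z) = (1 - t) * (k == i)%:R + t * lam K' k z.
  by move=> iK' hK'; rewrite lam_comb lam_node//; [exact: element_card|exact: element_affine].
have P K' : \forall z \near x, K' \in elements T -> hull K' (g z) -> hull K' z.
  have [hK'|nK'] := boolP (K' \in elements T); last first.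
    by apply/nbhs_eballP; exists 1.
  have [hp|hp] := pselect (hull K' (g x)); last first.
    have /closed_openC/open_eballP/(_ _ hp)[r r_0 hr] :=
      hull_closed (element_card hK') (element_affine hK').
    apply/nbhs_eballP; exists r => // z; rewrite /eball /= => zr _ hg.
    suff /hr : eball (g x) r (g z) by [].
    rewrite /eball /= (_ : g z - g x = t *: (z - x)); last first.
      by apply/rowP => j; rewrite !mxE; ring.
    by rewrite enormZ gtr0_norm//; apply: le_lt_trans zr; rewrite ler_piMl// enorm_ge0.
  have hpK : hull K (g x).
    apply/(hullP (element_card hK) (element_affine hK)) => k; rewrite gp//.
    have /(hullP (element_card hK) (element_affine hK))/(_ k) lk := hx.
    by rewrite addr_ge0// mulr_ge0// ?subr_ge0// ltW.
  have lp : 0 < lam K' i (g x).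
    rewrite -(lam_conform i hK hK' hpK hp) gp// eqxx mulr1.
    by rewrite ltr_wpDl ?subr_ge0// mulr_gt0.
  have iK' : i \in K' by apply: contraTT lp => /lam_off ->; rewrite ltxx.
  have lx' : 0 < lam K' i x.
    have := lam_conform i hK hK' hpK hp; rewrite !gp// eqxx mulr1 => /addrI.
    by move=> /(mulfI (lt0r_neq0 t0)) <-.
  have /continuous_eballP/(_ _ lx')[r r_0 hr] := @lam_continuous _ _ T K' i x.
  apply/nbhs_eballP; exists r => // z zr _ hg.
  have h1 := (hullP (element_card hK') (element_affine hK') _).1 hg.
  apply/(hullP (element_card hK') (element_affine hK')) => k.
  have [->|ki] := eqVneq k i.
    by have := hr z zr; rewrite ltr_norml => /andP[]; lra.
  have := h1 k; rewrite gp// (negbTE ki) mulr0 add0r.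
  by rewrite pmulr_rge0.
have /nbhs_eballP[r r_0 hr] := @filter_forall _ _ _ _ (nbhs_filter x) P.
rewrite hullsE; apply/nbhs_eballP; exists (Num.min r 1); first by rewrite lt_min r_0 ltr01.
move=> z; rewrite /eball /= lt_min => /andP[zr z1].
have [K' /= hK' hz] : hulls (g z).
  apply: Omega_hulls; apply: hr0; rewrite /eball /=.
  rewrite (_ : g z - node i = t *: (z - node i)); last first.
    by apply/rowP => j; rewrite !mxE; ring.
  rewrite enormZ gtr0_norm//; apply: lt_le_trans ta; rewrite ltr_pM2l// /a.
  apply: (@le_lt_trans _ _ (enorm (z - x) + enorm (x - node i))); last by lra.
  by have := enormD (z - x) (x - node i); rewrite addrA subrK.
by exists K' => //=; exact: (hr z zr K' hK' hz).
Qed.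

(** The piecewise constant gradient of the hat function of node [k], written without that function:
    it makes sense for every node, is Borel, and is 0 on the faces. *)
Definition pg k x : rV := \sum_(K in elements T) \1_(ihull K) x *: bgrad K k.

Lemma pgE k K x : K \in elements T -> ihull K x -> pg k x = bgrad K k.
Proof.
move=> hK ix; rewrite /pg (bigD1 K)//= big1 ?addr0.
  by rewrite indicE mem_set// scale1r.
move=> K' /andP[hK' nK]; rewrite indicE memNset ?scale0r// => ix'.
have := ihull_disjoint hK hK' ix (ihull_hull (element_card hK') (element_affine hK') ix').
by move=> E; rewrite E eqxx in nK.
Qed.

Lemma pg_off k x : ~ (exists2 K, K \in elements T & ihull K x) -> pg k x = 0.
Proof.
move=> no; rewrite /pg big1// => K hK; rewrite indicE memNset ?scale0r// => ix.
by apply: no; exists K.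
Qed.

Lemma bms_ihull K : K \in elements T -> bms (\1_(ihull K) : rV -> R).
Proof.
move=> hK; apply: bms_indic; first by apply: open_rV_measurable; exact: ihull_open.
exists (\sum_i enorm (@node _ _ T i) + 1) => x ix; apply: hulls_bounded.
by exists K => //; apply: ihull_hull ix; [exact: element_card|exact: element_affine].
Qed.

Lemma bms_pg k (m : 'I_d) : bms (fun x => pg k x 0 m).
Proof.
rewrite (_ : (fun x => _) = (fun x => \sum_(K in elements T) bgrad K k 0 m * \1_(ihull K) x)).
  by apply: bms_sum => K hK; apply: bmsZ; exact: bms_ihull.
by apply/funext => x; rewrite /pg summxE; apply: eq_bigr => K _; rewrite mxE mulrC.
Qed.

Section Vh_functions.
Variable v : rV -> R.
Hypothesis hv : Vh Omega T v.

Definition pgrad x : rV := \sum_k v (node k) *: pg k x.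

Lemma Vh_hull K x : K \in elements T -> hull K x -> v x = \sum_k v (node k) * lam K k x.
Proof.
move=> hK hx; have [_ /(_ K hK)[a [b hab]]] := hv.
have cK := element_card hK; have aK := element_affine hK.
have nK k : k \in K -> v (node k) = dot a (node k) + b.
  move=> kK; apply: hab; apply/(hullP cK aK) => j; rewrite lam_node//; exact: ler0n.
rewrite hab// -{1}(lam_comb_node cK aK x) dotC.
rewrite (_ : \sum_k _ = \sum_k lam K k x * (dot a (node k) + b)); last first.
  apply: eq_bigr => k _; have [kK|kK] := boolP (k \in K); first by rewrite nK// mulrC.
  by rewrite lam_off// mulr0 mul0r.
under [in RHS]eq_bigr do rewrite mulrDr.
rewrite big_split/= -mulr_suml lam_sum// mul1r; congr (_ + _).
elim/big_ind2 : _ => [|y r y' r' <- <-|k _]; [exact: dot0l|exact: dotDl|].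
by rewrite dotZl dotC.
Qed.

Lemma Vh_grad K x : K \in elements T -> ihull K x -> grad v x = pgrad x.
Proof.
move=> hK ix; have cK := element_card hK; have aK := element_affine hK.
apply/rowP => m; rewrite mxE; apply: is_derive_partialE.
have /open_eballP/(_ _ ix)[r r0 hr] := @ihull_open _ _ T K.
apply: (near_eq_is_derive (f := fun y => \sum_k v (node k) * lam K k y) r0).
  by move=> y /hr iy; rewrite -Vh_hull//; exact: ihull_hull.
apply/is_deriveP => e e0; exists 1 => // h h0 _.
suff -> : \sum_k v (node k) * lam K k (x + h *: delta_mx 0 m) -
    \sum_k v (node k) * lam K k x = h * pgrad x 0 m.
  by rewrite mulrA mulVf// mul1r subrr normr0.
rewrite -sumrB /pgrad summxE mulr_sumr; apply: eq_bigr => k _.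
rewrite -mulrBr lamB (addrC x) addrK dotZr mxE (pgE k hK ix) mulrCA; congr (_ * (_ * _)).
rewrite dot_sum (bigD1 m)//= big1 ?addr0 ?mxE ?eqxx ?mulr1// => l lm.
by rewrite mxE (negbTE lm) mulr0.
Qed.

Lemma bms_pgrad (m : 'I_d) : bms (fun x => pgrad x 0 m).
Proof.
rewrite (_ : (fun x => _) = (fun x => \sum_k v (node k) * pg k x 0 m)).
  by apply: bms_sum => k _; apply: bmsZ; exact: bms_pg.
by apply/funext => x; rewrite /pgrad summxE; apply: eq_bigr => k _; rewrite mxE.
Qed.

Lemma dirichlet_Vh (G : rV -> rV) :
  dirichlet (elements T) G (grad v) = bint (fun x => dot (G x) (pgrad x)).
Proof.
rewrite /dirichlet bint_set; apply: eq_bint => x; rewrite indicE.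
have [[K /= hK]|no] := pselect ((\bigcup_(K in [set` elements T]) interior (hull K)) x).
  rewrite (interior_hull (element_card hK) (element_affine hK)) => ix.
  rewrite mem_set; last by exists K => //; rewrite (interior_hull (element_card hK) (element_affine hK)).
  by rewrite mul1r (Vh_grad hK ix).
rewrite memNset// mul0r /pgrad big1 ?dot0r// => k _; rewrite pg_off ?scaler0//.
move=> [K hK ix]; apply: no; exists K => //.
by rewrite (interior_hull (element_card hK) (element_affine hK)).
Qed.

End Vh_functions.

Lemma dirichlet_Vh2 v w : Vh Omega T v -> Vh Omega T w ->
  dirichlet (elements T) (grad v) (grad w) = bint (fun x => dot (pgrad v x) (pgrad w x)).
Proof.
move=> hv hw; rewrite dirichlet_Vh//; apply: eq_bint => x.
have [[K hK ix]|no] := pselect (exists2 K, K \in elements T & ihull K x).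
  by rewrite (Vh_grad hv hK ix).
by rewrite [pgrad w x]big1 ?dot0r// => k _; rewrite pg_off ?scaler0.
Qed.

End mesh_geometry.

(** * Hat functions *)

Section local_lipschitz.
Context {R : realType}.

(** Continuous induction: the supremum of the parameters where the estimate from 0 holds is one of
    them, and could be increased if it were below 1. *)
Lemma local_lipschitz01 (f : R -> R) (L : R) : 0 <= L ->
  (forall t : R, exists2 r : R, 0 < r & forall s, `|s - t| < r -> `|f s - f t| <= L * `|s - t|) ->
  `|f 1 - f 0| <= L.
Proof.
move=> L0 loc; pose S : set R := [set t | 0 <= t <= 1 /\ `|f t - f 0| <= L * t].
have S0 : S 0 by rewrite /S /= lexx ler01 subrr normr0 mulr0.
have hS : has_sup S.
  by split; [exists 0|exists 1 => t [/andP[]]].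
pose c := sup S.
have c0 : 0 <= c by apply: ub_le_sup => //; case: hS.
have c1 : c <= 1 by apply: ge_sup; [exists 0|move=> t [/andP[]]].
have [r r0 hr] := loc c.
have [s [/andP[s0 s1] Ss] sc] := sup_adherent r0 hS.
have sc' : s <= c by apply: ub_le_sup; [case: hS|split => //; apply/andP].
have fc : `|f c - f 0| <= L * c.
  have := hr s; rewrite ler0_norm ?subr_le0// => /(_ _)h.
  have {}h : `|f s - f c| <= L * - (s - c) by apply: h; rewrite /c; lra.
  apply: (le_trans (ler_distD (f s) _ _)); rewrite distrC; lra.
have [c1'|c1'] := eqVneq c 1; first by move: fc; rewrite c1' mulr1.
exfalso; have clt : c < 1 by rewrite lt_neqAle c1' c1.
pose t := Num.min 1 (c + r / 2).
have tc : c < t by rewrite /t lt_min clt /= ltrDl divr_gt0.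
have tr : t - c < r.
  have : t <= c + r / 2 by rewrite /t ge_min lexx orbT.
  by move=> ?; lra.
have : S t.
  split; first by rewrite (le_trans c0 (ltW tc)) /= /t ge_min lexx.
  have := hr t; rewrite gtr0_norm ?subr_gt0// => /(_ tr) h.
  apply: (le_trans (ler_distD (f c) _ _)); lra.
by move=> /(ub_le_sup hS.2); rewrite leNgt tc.
Qed.

Lemma local_lipschitz d (v : 'rV[R]_d -> R) (L : R) : 0 <= L ->
  (forall x, exists2 r : R, 0 < r & forall y, eball x r y -> `|v y - v x| <= L * enorm (y - x)) ->
  forall x y, `|v x - v y| <= L * enorm (x - y).
Proof.
move=> L0 loc x y; pose g (t : R) := y + t *: (x - y).
have -> : v x - v y = v (g 1) - v (g 0).
  by rewrite /g scale1r scale0r addr0 addrCA subrr addr0.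
apply: (local_lipschitz01 (f := fun t => v (g t))); first by rewrite mulr_ge0// enorm_ge0.
move=> t; have [r r0 hr] := loc (g t).
pose n : R := enorm (x - y); have n0 : 0 <= n by exact: enorm_ge0.
exists (r / (n + 1)); first by rewrite divr_gt0// ltr_wpDl.
move=> s; rewrite ltr_pdivlMr ?ltr_wpDl// => hs.
have E : enorm (g s - g t) = `|s - t| * n.
  rewrite -enormZ; congr enorm; apply/rowP => i; rewrite !mxE; ring.
have := hr (g s); rewrite E mulrAC -mulrA; apply.
rewrite /eball /= E; apply: le_lt_trans hs.
by rewrite ler_wpM2l// lerDl.
Qed.

End local_lipschitz.

Section ball_volumes.
Context {R : realType} {d : nat}.
Local Notation rV := 'rV[R]_d.

Definition unit_ball_volume : R := bint (\1_(eball (0 : rV) 1)).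

Lemma bms_indic_ball (x : rV) r : bms (\1_(eball x r)).
Proof.
apply: bms_indic; first exact: eball_measurable.
exists (enorm x + r) => y; rewrite /eball /= subr0 => h.
by have := enormD (y - x) x; rewrite subrK => ?; lra.
Qed.

Lemma ball_volume (x : rV) r : 0 < r -> bint (\1_(eball x r)) = r ^+ d * unit_ball_volume.
Proof.
move=> r0; have r_n0 : r != 0 by rewrite gt_eqF.
have uA : (r^-1%:M : 'M[R]_d) \in unitmx.
  by rewrite unitmxE det_scalar unitfE expf_neq0// invr_neq0.
have := bint_affine (- (r^-1 *: x)) uA (bms_indic_eball 1).
rewrite det_scalar normrX ger0_norm ?invr_ge0 ?ltW// -exprVn invrK => <-.
apply: eq_bint => y; rewrite !indicE; congr ((_ : bool)%:R).
apply/idP/idP => /set_mem h; apply/mem_set; move: h; rewrite /eball /= subr0 mul_mx_scalar -scalerBr.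
  by rewrite enormZ ger0_norm ?invr_ge0 ?(ltW r0)// mulrC ltr_pdivrMr// mul1r.
by rewrite enormZ ger0_norm ?invr_ge0 ?(ltW r0)// mulrC ltr_pdivrMr// mul1r.
Qed.

Lemma unit_ball_volume_gt0 : 0 < unit_ball_volume.
Proof.
rewrite /unit_ball_volume bint_indic; last exact: eball_measurable.
rewrite fine_gt0// eball_gt0//=; apply: bounded_lty; last exact: eball_measurable.
by exists 1.
Qed.

End ball_volumes.

(** * Mesh regularity and the size of barycentric gradients *)

Section mesh_scale.
Context {R : realType} {d : nat} (Omega : set 'rV[R]_d) (T : mesh R d).
Local Notation N := (nb_nodes T).
Implicit Types (K : {set 'I_N}) (i j k : 'I_N) (x y z : 'rV[R]_d).
Hypotheses (hT : mesh_of Omega T) (d0 : (0 < d)%N).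

Lemma le_mesh_size K : K \in elements T -> diam K <= mesh_size T.
Proof. by move=> hK; exact: le_bigmax_cond. Qed.

Lemma diam_ge0 K : K \in elements T -> 0 <= diam K.
Proof.
move=> hK; have cK := element_card hT hK; have aK := element_affine hT hK.
have /card_gt0P[i iK] : (0 < #|K|)%N by rewrite cK.
have hi : hull K (node i) by apply/(hullP cK aK) => k; rewrite lam_node// ler0n.
by have := hull_diam cK aK hi hi; rewrite subrr enorm0.
Qed.

Lemma mesh_size_gt0 : Omega !=set0 -> 0 < mesh_size T.
Proof.
move=> [x /(Omega_hulls hT)[K /= hK _]].
have cK := element_card hT hK; have aK := element_affine hT hK.
have /card_gt0P[i iK] : (0 < #|K|)%N by rewrite cK.
have /card_gt0P[j] : (0 < #|K :\ i|)%N.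
  by have := cardsD1 i K; rewrite iK cK add1n => /succn_inj <-.
rewrite !inE => /andP[ji jK].
have hi k : k \in K -> hull K (node k).
  by move=> kK; apply/(hullP cK aK) => l; rewrite lam_node// ler0n.
apply: lt_le_trans (le_mesh_size hK); apply: lt_le_trans (hull_diam cK aK (hi i iK) (hi j jK)).
rewrite lt_neqAle enorm_ge0 andbT eq_sym; apply: contraNneq ji => /enorm0_eq0 /eqP.
rewrite subr_eq0 => /eqP E; apply/eqP; symmetry.
by case: hT => inj _ _ _ _; exact: inj.
Qed.

(** The set contains 0, so the point is to bound it above, without which [sup] is a default value: a
    ball of diameter [r] contains a segment of length [r - 1], at most the diameter of the
    element. *)
Lemma inscribed_diam_ge0 K : K \in elements T -> 0 <= inscribed_diam K.
Proof.
move=> hK; have cK := element_card hT hK; have aK := element_affine hT hK.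
have /card_gt0P[i iK] : (0 < #|K|)%N by rewrite cK.
have gp : 0 < enorm (bgrad K i).
  rewrite lt_neqAle enorm_ge0 andbT eq_sym; apply: contraNneq (bgrad_neq0 cK aK d0 iK).
  by move=> /enorm0_eq0 ->.
apply: ub_le_sup; last first.
  by split => //; exists 0 => y; rewrite /eball /= mul0r ltNge enorm_ge0.
exists (diam K + 1) => r [r0 [x hx]].
have [r0'|r0'] := leP r 1; first by have := diam_ge0 hK; lra.
(* Any unit vector would do; a normalised barycentric gradient is at hand. *)
pose e : 'rV[R]_d := (enorm (bgrad K i))^-1 *: bgrad K i.
have e1 : enorm e = 1 by rewrite enormZ ger0_norm ?invr_ge0 ?(ltW gp)// mulVf// gt_eqF.
pose a := (r - 1) / 2.
have a0 : 0 < a by rewrite /a; lra.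
have ha s : `|s| <= a -> hull K (x + s *: e).
  move=> hs; apply: hx; rewrite /eball /= addrC addKr enormZ e1 mulr1.
  apply: le_lt_trans hs _; rewrite /a; lra.
have := hull_diam cK aK (ha a _) (ha (- a) _); rewrite normrN ger0_norm ?(ltW a0)//.
rewrite (_ : _ - _ = (r - 1) *: e).
  by rewrite enormZ e1 mulr1 ger0_norm; [move=> /(_ (lexx _) (lexx _)); lra|lra].
rewrite opprD addrACA subrr add0r -scaleNr opprK -scalerDl; congr (_ *: _).
by rewrite /a; field.
Qed.

(** Outside the discrete maximum principle, shape regularity and quasi-uniformity act only through
    this bound. *)
Lemma bgrad_mesh_size sigma q K i : shape_regular sigma T -> quasi_uniform q T ->
  K \in elements T -> mesh_size T * enorm (bgrad K i) <= `|q| * `|sigma|.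
Proof.
move=> hs hq hK; have cK := element_card hT hK; have aK := element_affine hT hK.
have g0 := enorm_ge0 (bgrad K i).
apply: (@le_trans _ _ (`|q| * diam K * enorm (bgrad K i))).
  rewrite ler_wpM2r//; apply: (le_trans (hq K hK)).
  by rewrite ler_wpM2r ?ler_norm// diam_ge0.
rewrite -mulrA ler_wpM2l//.
apply: (@le_trans _ _ (`|sigma| * inscribed_diam K * enorm (bgrad K i))).
  rewrite ler_wpM2r//; apply: (le_trans (hs K hK)).
  by rewrite ler_wpM2r ?ler_norm// inscribed_diam_ge0.
by rewrite -mulrA mulrC -[leRHS]mul1r ler_wpM2r// mulrC bgrad_inscribed.
Qed.

End mesh_scale.

Section hat_functions.
Context {R : realType} {d : nat} (Omega : set 'rV[R]_d) (T : mesh R d).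
Local Notation rV := 'rV[R]_d.
Local Notation N := (nb_nodes T).
Implicit Types (K : {set 'I_N}) (i j k : 'I_N) (x y z : rV).
Hypotheses (hT : mesh_of Omega T) (d0 : (0 < d)%N).

Definition is_hat i (v : rV -> R) :=
  [/\ Vh Omega T v, forall j, v (node j) = (i == j)%:R & forall x, ~ closure Omega x -> v x = 0].

(* Hat functions need not be constructed: where none exists, [hat] is the junk
   value 0, its star is empty, and the node gets weight 0 in the discrete
   Alexandroff-Bakelman-Pucci estimate. *)
Lemma hat_cases i : is_hat i (hat Omega i) \/ hat Omega i = fun=> 0.
Proof. by rewrite /hat; case: xgetP => [v -> hv|_]; [left|right]. Qed.

Variables (i : 'I_N) (v : rV -> R).
Hypotheses (hv : is_hat i v) (Oi : Omega (node i)).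

Lemma hat_lam K x : K \in elements T -> hull K x -> v x = lam K i x.
Proof.
move=> hK hx; have [h1 h2 _] := hv; rewrite (Vh_hull hT h1 hK hx).
rewrite (bigD1 i)//= h2 eqxx mul1r big1 ?addr0// => k /negbTE ki.
by rewrite h2 eq_sym ki mul0r.
Qed.

Lemma hat_pgrad x : pgrad T v x = pg i x.
Proof.
have [h1 h2 _] := hv; rewrite /pgrad (bigD1 i)//= h2 eqxx scale1r big1 ?addr0// => k /negbTE ki.
by rewrite h2 eq_sym ki scale0r.
Qed.

(** Off the closure this is the normalisation in [hat]; in the closure, a positive value would put
    the point inside the domain by [lam_gt0_interior]. *)
Lemma hat_out x : ~ Omega x -> v x = 0.
Proof.
move=> nx; have [/(closure_hulls hT)[K /= hK hx]|] := pselect (closure Omega x); last first.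
  by case: hv => _ _; apply.
have cK := element_card hT hK; have aK := element_affine hT hK.
rewrite (hat_lam hK hx); apply/eqP; rewrite eq_le ((hullP cK aK x).1 hx i) andbT leNgt.
by apply/negP => l0; apply: nx; exact: (lam_gt0_interior hT hK Oi hx l0).
Qed.

Lemma hat_ge0 x : 0 <= v x.
Proof.
have [/(Omega_hulls hT)[K /= hK hx]|/hat_out ->//] := pselect (Omega x).
rewrite (hat_lam hK hx).
exact: (hullP (element_card hT hK) (element_affine hT hK) x).1 hx i.
Qed.

Lemma hat_le1 x : v x <= 1.
Proof.
have [/(Omega_hulls hT)[K /= hK hx]|/hat_out ->//] := pselect (Omega x).
rewrite (hat_lam hK hx).
by apply: lam_le1 hx; [exact: (element_card hT)|exact: (element_affine hT)].
Qed.

Lemma hat_near x : v x != 0 -> enorm (x - node i) <= mesh_size T.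
Proof.
move=> vx; have [/(Omega_hulls hT)[K /= hK hx]|/hat_out vx0] := pselect (Omega x); last first.
  by rewrite vx0 eqxx in vx.
have cK := element_card hT hK; have aK := element_affine hT hK.
have iK : i \in K by apply: contraNT vx => iK; rewrite (hat_lam hK hx) lam_off.
apply: le_trans (le_mesh_size hK); apply: hull_diam => //.
by apply/(hullP cK aK) => k; rewrite lam_node// ler0n.
Qed.

(** Near [x] only elements containing [x] are met, so a small increment from [x] takes place inside
    one element or is 0. *)
Lemma hat_lipschitz (L : R) : 0 <= L -> (forall K, K \in elements T -> enorm (bgrad K i) <= L) ->
  forall x y, `|v x - v y| <= L * enorm (x - y).
Proof.
move=> L0 hL; apply: local_lipschitz => // x.
have P K' : \forall z \near x, K' \in elements T -> hull K' z -> hull K' x.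
  have [hK'|nK'] := boolP (K' \in elements T); last by apply/nbhs_eballP; exists 1.
  have [hp|hp] := pselect (hull K' x); first by apply/nbhs_eballP; exists 1.
  have /closed_openC/open_eballP/(_ _ hp)[r r_0 hr] :=
    hull_closed (element_card hT hK') (element_affine hT hK').
  by apply/nbhs_eballP; exists r => // z zr _ hz; case: (hr z zr hz).
have /nbhs_eballP[r r_0 hr] := @filter_forall _ _ _ _ (nbhs_filter x) P.
have [s s0 hs] : exists2 s : R, 0 < s & Omega x -> eball x s `<=` Omega.
  have [Ox|Ox] := pselect (Omega x); last by exists 1.
  by have [s s0 hs] := (open_eballP _).1 (Omega_open hT) x Ox; exists s.
exists (Num.min r s); first by rewrite lt_min r_0.
move=> y; rewrite /eball /= lt_min => /andP[yr ys].
have [Oy|nOy] := pselect (Omega y); last first.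
  have nOx : ~ Omega x by move=> Ox; apply: nOy; exact: hs.
  by rewrite !hat_out// subrr normr0 mulr_ge0// enorm_ge0.
have [K /= hK hy] := Omega_hulls hT Oy.
have hx := hr y yr K hK hy.
rewrite (hat_lam hK hy) (hat_lam hK hx); apply: (le_trans (lam_lipschitz _ _ _ _)).
by rewrite ler_wpM2r ?enorm_ge0// hL.
Qed.

End hat_functions.

(** * Hat functions as test functions *)

Section lipschitz_test_functions.
Context {R : realType} {d : nat}.
Local Notation rV := 'rV[R]_d.
Local Notation leb := (lebesgue_rV (R := R) d).
Local Notation e_ i := (delta_mx 0 i : rV).

Lemma bms_bound (f : rV -> R) : bms f -> exists2 M : R, 0 <= M & forall x, `|f x| <= M.
Proof.
by move=> [_ [M hM] _]; exists M => //; exact: le_trans (normr_ge0 _) (hM 0).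
Qed.

Lemma conv_bounded (f rho : rV -> R) : bms f -> bms rho ->
  exists2 M : R, 0 <= M & forall x, `|conv f rho x| <= M.
Proof.
move=> hf hr; have [M M0 hM] := bms_bound hr.
have hn := bms_norm hf.
exists (M * bint (fun z => `|f z|)); first by rewrite mulr_ge0// bint_ge0.
move=> x; have hc : bms (fun z => f z * rho (x - z)).
  by apply: bmsMM => //; exact: bms_reflect.
apply: (le_trans (le_normr_bint hc)); rewrite -bintZ//.
apply: le_bint; [exact: bms_norm|exact: bmsZ|move=> z].
by rewrite normrM mulrC ler_wpM2r.
Qed.

Lemma mollifier_bms r (rho : rV -> R) : (0 < d)%N -> mollifier r rho -> bms rho.
Proof. by move=> d0 [h1 _ h2 _ _]; exact: smooth_bms h1 h2. Qed.

Lemma smooth_lipschitz (rho : rV -> R) r : (0 < d)%N -> smooth rho -> vanish_off r rho ->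
  exists2 L : R, 0 <= L & forall x y, `|rho x - rho y| <= L * enorm (x - y).
Proof.
move=> d0 hs hv.
have hb i : exists M : R, 0 <= M /\ forall x, `|partial i rho x| <= M.
  have [M M0 hM] := bms_bound (smooth_bms d0 (smooth_partial i hs) (partial_vanish i hv)).
  by exists M.
have [M hM] := choice hb.
have M0 : 0 <= \sum_i M i by apply: sumr_ge0 => i _; case: (hM i).
exists (d%:R * \sum_i M i); first by rewrite mulr_ge0.
apply: partial_lipschitz; first exact: smooth_C1.
move=> i x; apply: (le_trans ((hM i).2 x)); rewrite (bigD1 i)//= lerDl.
by apply: sumr_ge0 => j _; case: (hM j).
Qed.

Lemma lipschitz_bms (f : rV -> R) L : (forall x y, `|f x - f y| <= L * enorm (x - y)) ->
  supported f -> bms f.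
Proof. by move=> hf; apply: bms_continuous; exact: lipschitz_continuous hf. Qed.

Definition trunc (s : R) (v : rV -> R) x := Num.max (v x - s) 0.
Definition trunc' (s : R) (v v' : rV -> R) x := \1_[set y | s < v y] x * v' x.

Lemma trunc_lipschitz s v L : (forall x y, `|v x - v y| <= L * enorm (x - y)) ->
  forall x y, `|trunc s v x - trunc s v y| <= L * enorm (x - y).
Proof.
move=> hL x y; apply: le_trans (hL x y); rewrite /trunc.
have h1 := ler_norm (v x - v y); have h2 := ler_norm (- (v x - v y)); rewrite normrN in h2.
by rewrite ler_norml; case: (ltP (v x - s) 0) => ?; case: (ltP (v y - s) 0) => ?; apply/andP; split; lra.
Qed.

Lemma trunc_close s v x : 0 <= s -> 0 <= v x -> `|trunc s v x - v x| <= s.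
Proof. by move=> s0 v0; rewrite /trunc ler_norml; case: (ltP (v x - s) 0) => ?; apply/andP; split; lra. Qed.

Lemma bms_trunc' s v v' : bms v -> bms v' -> bms (trunc' s v v').
Proof.
move=> [mv _ _] bv'; apply: bmsMr => //.
  apply: measurable_indic; have := mv measurableT _ (measurable_itv `]s, +oo[).
  rewrite setTI; congr measurable; apply/seteqP; split => x /=; rewrite in_itv /= andbT//.
by exists 1 => x; rewrite indicE; case: (_ \in _); rewrite ?normr1 ?normr0.
Qed.

Lemma trunc_derive (s L : R) (v v' : rV -> R) (x w : rV) : 0 <= L ->
  (forall x y, `|v x - v y| <= L * enorm (x - y)) -> v x != s ->
  is_derive x w v (v' x) -> is_derive x w (trunc s v) (trunc' s v v' x).
Proof.
move=> L0 hL vs dv.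
have [r r0 vr] : exists2 r : R, 0 < r & forall y, eball x r y -> (s < v y) = (s < v x) /\ (v y < s) = (v x < s).
  exists (`|v x - s| / (L + 1)).
    by rewrite divr_gt0 ?normr_gt0 ?subr_eq0// ltr_wpDl.
  move=> y; rewrite /eball /= ltr_pdivlMr ?ltr_wpDl// => hy.
  have h6 : `|v y - v x| < `|v x - s|.
    apply: le_lt_trans (hL _ _) _; apply: le_lt_trans hy.
    by rewrite mulrC ler_wpM2l ?enorm_ge0// lerDl.
  have [vlt|vlt|E] := ltgtP (v x) s.
  - move: h6; rewrite (ler0_norm (_ : v x - s <= 0)) ?subr_le0 ?ltW// => h6.
    by split; [apply/negbTE; rewrite -leNgt|]; move: h6; rewrite ltr_norml => /andP[]; lra.
  - move: h6; rewrite (ger0_norm (_ : 0 <= v x - s)) ?subr_ge0 ?ltW// => h6.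
    by split; [|apply/negbTE; rewrite -leNgt]; move: h6; rewrite ltr_norml => /andP[]; lra.
  - by rewrite E eqxx in vs.
have [vlt|vlt|E] := ltgtP (v x) s; last by rewrite E eqxx in vs.
  rewrite /trunc' indicE memNset ?mul0r; last by rewrite /= ltNge ltW.
  apply: (near_eq_is_derive (f := fun=> 0) r0 _ (is_derive_cst0 x w)).
  move=> y /vr[_ E]; rewrite /trunc; rewrite vlt in E.
  by case: ltP => //; move: E => ?; lra.
rewrite /trunc' indicE mem_set// mul1r.
apply: (near_eq_is_derive (f := fun y => v y - s) r0).
  move=> y /vr[E _]; rewrite /trunc; rewrite vlt in E.
  by case: ltP => //; move: E => ?; lra.
apply/is_deriveP => e e0; have /is_deriveP/(_ e e0)[r' r'0 hr'] := dv.
by exists r' => // h h0 hh; rewrite opprB addrA subrK; exact: hr'.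
Qed.

(* Nonnegative Lipschitz functions vanishing off [U] are limits of the truncations
   [(v - s)^+], which vanish near the complement of [U] and can be tested against. *)
Lemma trunc_weakp (U : set rV) (m : 'I_d) (f g v v' : rV -> R) (L s t : R) rho :
  (0 < d)%N -> bms f -> bms g -> weakp U m f g -> bms v -> bms v' -> 0 <= L -> 0 < s ->
  (forall x y, `|v x - v y| <= L * enorm (x - y)) -> (forall x, 0 <= v x) ->
  (forall x, ~ U x -> v x = 0) ->
  {ae leb, forall x, v x != s} ->
  {ae leb, forall x, is_derive x (e_ m) v (v' x)} ->
  mollifier t rho -> t * (L + 1) < s ->
  [/\ bms (fun x => g x * conv (trunc s v) rho x),
      bms (fun x => f x * conv (trunc' s v v') rho x) &
  bint (fun x => f x * conv (trunc' s v v') rho x) =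
    - bint (fun x => g x * conv (trunc s v) rho x)].
Proof.
move=> d0 hf hg hw hv hv' L0 s0 hL v0 vU vs dv hrho hts.
have [sm rho0 rt rho1 reven] := hrho; have br := mollifier_bms d0 hrho.
have bw' := bms_trunc' s hv hv'.
have bw : bms (trunc s v).
  apply: lipschitz_bms (trunc_lipschitz s hL) _.
  case: hv => _ _ [r hr]; exists r => x /hr vx; rewrite /trunc vx sub0r.
  by case: ltP => // ?; lra.
(* The mollifier is moved onto [f] and [g]; what remains is that the derivative of the Lipschitz
   product of [trunc s v] and [conv f rho] integrates to 0. *)
have [h1 h2 E1] := conv_swap bw hg br reven.
have [h3 h4 E2] := conv_swap bw' hf br reven.
split; [exact: h2|exact: h4|]; rewrite -E1 -E2.
apply/eqP; rewrite -subr_eq0 opprK -(bintD h3 h1); apply/eqP.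
have [_ h5 _] := conv_swap hf bw br reven.
have [K1 K10 hK1] := smooth_lipschitz d0 sm rt.
have [mr bdr _] := br.
have [K2 K20 hK2] := conv_bounded hf br.
have [K3 K30 hK3] := bms_bound bw.
pose K4 := bint (fun z => `|f z|) * K1.
have K40 : 0 <= K4 by apply: mulr_ge0 K10; apply: bint_ge0 => z; exact: normr_ge0.
have den (h : R) : enorm (h *: e_ m) = `|h| by rewrite enormZ enorm_delta mulr1.
apply: (bint_derivative0 (p := fun x => trunc s v x * conv f rho x) (v := e_ m)
  (L := L * K2 + K3 * K4)).
- exact: h5.
- exact: bmsD.
- move=> x h; rewrite (_ : _ - _ = (trunc s v (x + h *: e_ m) - trunc s v x) * conv f rho (x + h *: e_ m)
     + trunc s v x * (conv f rho (x + h *: e_ m) - conv f rho x)); last by ring.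
  apply: (le_trans (ler_normD _ _)); rewrite !normrM mulrDl; apply: lerD.
    have := trunc_lipschitz s hL (x + h *: e_ m) x; rewrite (addrC x) addrK den => h6.
    by rewrite mulrAC; apply: ler_pM => //; rewrite addrC.
  have := conv_lipschitz (x + h *: e_ m) x hf mr bdr hK1; rewrite (addrC x) addrK den => h6.
  by rewrite -mulrA; apply: ler_pM => //; rewrite addrC.
move: vs dv; apply: filterS2 => x vs dv.
have dw : is_derive x (e_ m) (trunc s v) (trunc' s v v' x).
  exact: trunc_derive L0 hL vs dv.
have dc : is_derive x (e_ m) (conv f rho) (conv f (partial m rho) x).
  have bp : bms (partial m rho) by exact: smooth_bms d0 (smooth_partial m sm) (partial_vanish m rt).
  have [K5 K50 hK5] := bms_bound bp.
  apply: (conv_derive _ _ _ _ _ (L := K5)); [exact: hf|exact: mr|exact: bdr|by case: bp| |exact: hK5].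
  by move=> y; exact: smooth_derivable.
have := is_derive_mul dw dc; move=> /is_derive_congr; apply; congr (_ + _).
clear dc dw h1 h2 h3 h4 h5 E1 E2 dv.
have [vlt|vlt|E] := ltgtP (v x) s; last by rewrite E eqxx in vs.
  have w0 : trunc s v x = 0 by rewrite /trunc max_r// subr_le0 ltW.
  rewrite w0 (mul0r (conv f (partial m rho) x)) (mul0r (conv g rho x)); reflexivity.
(* Where [v x > s], the ball of radius [r'] about [x] lies in [U], since [v] is [L]-Lipschitz and
   vanishes off [U]; the mollifier radius [t] is below [r']. *)
congr (_ * _); pose r' := s / (L + 1).
apply: (conv_weak (U := U) (r := t) (r' := r')) => //.
  by rewrite /r' ltr_pdivlMr// ltr_wpDl.
move=> y; rewrite /r' /eball /= ltr_pdivlMr ?ltr_wpDl// => hy; apply: contrapT => /vU vy.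
have := hL y x; rewrite vy sub0r normrN => h6.
have : v x <= L * enorm (y - x) by apply: le_trans h6; exact: ler_norm.
have : L * enorm (y - x) <= enorm (y - x) * (L + 1).
  by rewrite mulrC ler_wpM2l ?enorm_ge0// lerDl.
lra.
Qed.

(** The truncation level tends to 0 together with a proportionally smaller mollification radius.
    Near almost every point [v] is affine, and flat where it vanishes: there the truncated
    derivative is 0 and must converge to [v']. *)
Lemma lipschitz_weakp (phi : rV -> R) (U : set rV) (m : 'I_d) (f g v v' : rV -> R) (L : R) :
  (0 < d)%N -> kernel_function phi -> bms f -> bms g -> weakp U m f g -> bms v -> bms v' ->
  0 <= L -> (forall x y, `|v x - v y| <= L * enorm (x - y)) -> (forall x, 0 <= v x) ->
  (forall x, ~ U x -> v x = 0) ->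
  (forall s : R, 0 < s -> {ae leb, forall x, v x != s}) ->
  {ae leb, forall x, exists (r : R) (a : rV), [/\ 0 < r,
     forall y, eball x r y -> v y = v x + dot a (y - x) /\ v' y = a 0 m & v x = 0 -> a = 0]} ->
  bint (fun x => f x * v' x) = - bint (fun x => g x * v x).
Proof.
move=> d0 hphi hf hg hw hv hv' L0 hL v0 vU vs good.
have dv : {ae leb, forall x, is_derive x (e_ m) v (v' x)}.
  move: good; apply: filterS => x [r [a [r0 ha _]]].
  rewrite (ha x (eball_center _ r0)).2.
  apply: (near_eq_is_derive (f := fun y => v x + dot a (y - x)) r0).
    by move=> y /ha[].
  apply/is_deriveP => e e0; exists 1 => // h h0 _.
  rewrite subrr dot0r addr0 [v x + _]addrC addrK (addrC x) addrK dotZr mulrA mulVf// mul1r dot_sum.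
  rewrite (bigD1 m)//= mxE !eqxx mulr1 big1 ?addr0 ?subrr ?normr0// => j /negbTE jm.
  by rewrite mxE jm mulr0.
pose s (k : nat) : R := k.+1%:R^-1.
have s0 k : 0 < s k by rewrite invr_gt0.
pose t k : R := s k / (2 * (L + 1)).
have L1 : 0 < L + 1 by rewrite ltr_wpDl.
have t0 k : 0 < t k by rewrite divr_gt0// mulr_gt0.
have ts k : t k * (L + 1) < s k.
  rewrite /t -[2 * _]mulrC invfM !mulrA mulrAC divfK ?gt_eqF//; have := s0 k; lra.
have [rho hrho] := choice (fun k => mollifier_exists d0 hphi (t0 k)).
have H k := trunc_weakp d0 hf hg hw hv hv' L0 (s0 k) hL v0 vU (vs _ (s0 k)) dv (hrho k) (ts k).
have scv : s k @[k --> \oo] --> (0 : R) by exact: cvg_harmonic.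
have [Mf Mf0 hMf] := bms_bound hf; have [Mg Mg0 hMg] := bms_bound hg.
have [Mv Mv0 hMv] := bms_bound hv; have [Mv' Mv'0 hMv'] := bms_bound hv'.
have convb k (w : rV -> R) M x : bms w -> (forall z, `|w z| <= M) -> `|conv w (rho k) x| <= M.
  move=> bw hM; rewrite -[conv _ _ _]subr0; have [? ? ? ? ?] := hrho k.
  apply: (conv_close (r := t k) (r' := t k + 1)) => //; first exact: mollifier_bms (hrho k).
    by rewrite ltrDl.
  by apply: nearW => z _; rewrite subr0.
have bw k : bms (trunc (s k) v).
  apply: lipschitz_bms (trunc_lipschitz (s k) hL) _.
  case: hv => _ _ [r hr]; exists r => x /hr vx; rewrite /trunc vx sub0r.
  by case: ltP => //; have := s0 k => ? ?; lra.
have bw' k := bms_trunc' (s k) hv hv'.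
have C1 : (fun k => bint (fun x => g x * conv (trunc (s k) v) (rho k) x)) @ \oo --> bint (fun x => g x * v x).
  have [mg _ [r hr]] := hg; have [mv _ _] := hv.
  apply: (@bint_dct _ _ _ _ (Mg * Mv) r).
  - by move=> k; case: (H k) => [[]].
  - exact: measurable_funM.
  - move=> k x; rewrite normrM ler_pM//; apply: convb => // z.
    apply: le_trans (hMv z); rewrite (ger0_norm (v0 z)) /trunc ger0_norm ?le_max ?lexx ?orbT//.
    by rewrite ge_max v0 gerBl ltW.
  - by move=> k x /hr ->; rewrite mul0r.
  apply: nearW => x; apply: cvgMr; apply/cvgrPdist_le => e e0.
  have e30 : 0 < e / 2 by rewrite divr_gt0.
  move/cvgrPdist_lt: scv => /(_ _ e30); apply: filterS => k; rewrite sub0r normrN gtr0_norm// => ske.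
  rewrite distrC; apply: (le_trans (ler_distD (trunc (s k) v x) _ _)).
  have h1 : `|trunc (s k) v x - v x| <= s k by apply: trunc_close => //; exact: ltW.
  have h2 : `|conv (trunc (s k) v) (rho k) x - trunc (s k) v x| <= s k.
    have [? ? ? ? ?] := hrho k.
    apply: (conv_close (r := t k) (r' := 2 * t k)) => //; first exact: mollifier_bms (hrho k).
      by have := t0 k => ?; lra.
    apply: nearW => z hz; apply: (le_trans (trunc_lipschitz (s k) hL _ _)).
    have hz' : enorm (z - x) <= 2 * t k by exact: ltW.
    apply: (le_trans (ler_wpM2l L0 hz')).
    have E : t k * (L + 1) = s k / 2 by rewrite /t; field; rewrite gt_eqF.
    by have := t0 k; rewrite mulrDr in E; move=> ?; lra.
  lra.
have C2 : (fun k => bint (fun x => f x * conv (trunc' (s k) v v') (rho k) x)) @ \oo --> bint (fun x => f x * v' x).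
  have [mf _ [r hr]] := hf; have [mv' _ _] := hv'.
  apply: (@bint_dct _ _ _ _ (Mf * Mv') r).
  - by move=> k; case: (H k) => [_ []].
  - exact: measurable_funM.
  - move=> k x; rewrite normrM ler_pM//; apply: convb => // z.
    rewrite /trunc' indicE; case: (_ \in _); rewrite ?mul1r ?mul0r ?normr0//.
  - by move=> k x /hr ->; rewrite mul0r.
  move: good; apply: filterS => x [r' [a [r'0 ha a0]]]; apply: cvgMr.
  have [r'' r''0 hr''] : exists2 r'' : R, 0 < r'' & \forall k \near \oo, forall z, eball x r'' z ->
      trunc' (s k) v v' z = v' x.
    have va z : eball x r' z -> v' z = v' x by move=> /ha[_ ->]; rewrite (ha x (eball_center _ r'0)).2.
    have [vx|vx] := eqVneq (v x) 0.
      exists r' => //; apply: nearW => k z hz; rewrite /trunc' (va z hz).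
      by rewrite (ha x (eball_center _ r'0)).2 a0// mxE mulr0.
    have vx0 : 0 < v x by rewrite lt_neqAle eq_sym vx v0.
    exists (Num.min r' (v x / (2 * (L + 1)))).
      by rewrite lt_min r'0 divr_gt0// mulr_gt0.
    have vx20 : 0 < v x / 2 by rewrite divr_gt0.
    move/cvgrPdist_lt: scv => /(_ _ vx20); apply: filterS => k; rewrite sub0r normrN gtr0_norm// => sk z.
    rewrite /eball /= lt_min => /andP[z1 z2]; rewrite /trunc' (va z z1) indicE mem_set ?mul1r//=.
    have h1 := hL z x; move: z2; rewrite ltr_pdivlMr ?mulr_gt0// => z2.
    have h2 : L * enorm (z - x) <= enorm (z - x) * (L + 1).
      by rewrite mulrC ler_wpM2l ?enorm_ge0// lerDl.
    by move: h1; rewrite ler_norml => /andP[]; lra.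
  apply/cvgrPdist_le => e e0.
  have tcv : t k @[k --> \oo] --> (0 : R).
    by rewrite -(mul0r (2 * (L + 1))^-1); apply: cvgMl.
  move/cvgrPdist_lt: tcv => /(_ _ r''0); move: hr''; apply: filterS2 => k hk.
  rewrite sub0r normrN gtr0_norm// => tk; rewrite distrC; have [? ? ? ? ?] := hrho k.
  apply: (conv_close (r := t k) (r' := r'')) => //; first exact: mollifier_bms (hrho k).
  by apply: nearW => z hz; rewrite hk// subrr normr0 ltW.
have C3 := cvgN C1.
have E : (fun k => bint (fun x => f x * conv (trunc' (s k) v v') (rho k) x)) =
   (fun k => - bint (fun x => g x * conv (trunc (s k) v) (rho k) x)).
  by apply/funext => k; case: (H k).
rewrite E in C2; exact (@cvg_unique R^o (@norm_hausdorff R R^o) _ _ _ _ C2 (C3 _)).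
Qed.

End lipschitz_test_functions.

Section hat_weak.
Context {R : realType} {d : nat} (Omega : set 'rV[R]_d) (T : mesh R d).
Local Notation rV := 'rV[R]_d.
Local Notation N := (nb_nodes T).
Local Notation leb := (lebesgue_rV (R := R) d).
Implicit Types (K : {set 'I_N}) (i j k : 'I_N) (x y z : rV).
Hypotheses (hT : mesh_of Omega T) (d0 : (0 < d)%N).
Variables (i : 'I_N) (v : rV -> R).
Hypotheses (hv : is_hat Omega i v) (Oi : Omega (node i)).

Lemma bms_hat (L : R) : 0 <= L -> (forall K, K \in elements T -> enorm (bgrad K i) <= L) -> bms v.
Proof.
move=> L0 hL; apply: lipschitz_bms (hat_lipschitz hT hv Oi L0 hL) _.
exists (\sum_i enorm (@node _ _ T i) + 1) => x hx; apply: (hat_out hT hv Oi).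
by move=> /(Omega_hulls hT) /(hulls_bounded hT); rewrite /eball /= subr0 => ?; lra.
Qed.

(** On each open element a hat is affine with gradient [pg i], and the faces are null: this is the
    local structure that [lipschitz_weakp] asks for. *)
Lemma hat_weakp (phi f g : rV -> R) (m : 'I_d) (L : R) : 0 <= L ->
  (forall K, K \in elements T -> enorm (bgrad K i) <= L) ->
  kernel_function phi -> bms f -> bms g -> weakp Omega m f g ->
  bint (fun x => f x * pg i x 0 m) = - bint (fun x => g x * v x).
Proof.
move=> L0 hL hphi hf hg hw.
apply: (lipschitz_weakp (phi := phi) (U := Omega) (m := m) (L := L)) => //.
- exact: bms_hat hL.
- exact: bms_pg hT i m.
- by move=> x y; exact (hat_lipschitz hT hv Oi L0 hL x y).
- by move=> x; exact (hat_ge0 hT hv Oi x).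
- by move=> x; exact (hat_out hT hv Oi (x := x)).
- move=> s s0.
  (* A positive level is attained only in elements having [i] as a vertex, where it is cut out by a
     hyperplane. *)
  have sub : ~` [set x | v x != s] `<=`
      \big[setU/set0]_(K | (K \in elements T) && (i \in K)) [set x | lam K i x = s].
    move=> x /= /negP/negPn/eqP vx.
    have [Ox|/(hat_out hT hv Oi) E] := pselect (Omega x); last by rewrite E in vx; lra.
    have [K /= hK hx] := Omega_hulls hT Ox.
    have iK : i \in K.
      apply: contraT => iK; move: vx; rewrite (hat_lam hT hv hK hx) lam_off//; lra.
    by rewrite (bigD1 K) ?hK//=; left; rewrite -(hat_lam hT hv hK hx).
  apply: negligibleS sub _; elim/big_ind : _ => [|A B|K /andP[hK iK]].
  + exact: negligible_set0.
  + exact: negligibleU.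
  + have := hyperplane_negligible (bconst K i - s) (bgrad_neq0 (element_card hT hK) (element_affine hT hK) d0 iK).
    by apply: negligibleS => x /=; rewrite lamE => <-; ring.
move: (ae_ihull hT d0); apply: filterS => x [[K hK ix]|nx].
  have cK := element_card hT hK; have aK := element_affine hT hK.
  have [r r0 hr] := (open_eballP _).1 (@ihull_open _ _ T K) x ix.
  exists r, (bgrad K i); split=> //.
    move=> y hy; rewrite (pgE hT i hK (hr y hy)); split=> //.
    rewrite (hat_lam hT hv hK (ihull_hull cK aK (hr y hy))).
    by rewrite (hat_lam hT hv hK (ihull_hull cK aK ix)) -lamB addrC subrK.
  rewrite (hat_lam hT hv hK (ihull_hull cK aK ix)); have [iK|iK] := boolP (i \in K).
    by have := ix i iK => /gt_eqF/eqP.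
  by move=> _; rewrite /bgrad (negbTE iK).
have [r r0 hr] := (open_eballP _).1 (closed_openC (hulls_closed hT)) x nx.
have vr y : eball x r y -> v y = 0.
  by move=> /hr ny; apply: (hat_out hT hv Oi) => /(Omega_hulls hT).
exists r, 0; split=> // y hy; rewrite dot0l addr0 !vr//; last exact: eball_center.
rewrite mxE pg_off ?mxE// => -[K hK ix]; apply: (hr y hy); exists K => //.
exact (ihull_hull (element_card hT hK) (element_affine hT hK) ix).
Qed.

End hat_weak.

(** * Galerkin projections and measures of stars *)

(** A matrix of maximal rank among those whose row space satisfies [P] spans all of [P]. It provides
    generators for the nodal vectors of the finite element space, which are given only by a
    predicate. *)
Lemma subspace_mx (F : fieldType) n (P : 'rV[F]_n -> Prop) :
  P 0 -> (forall a c c', P c -> P c' -> P (a *: c + c')) ->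
  exists B : 'M[F]_n, forall c, P c <-> (c <= B)%MS.
Proof.
move=> P0 PD; pose Q k := `[< exists B : 'M[F]_n, (forall c : 'rV_n, (c <= B)%MS -> P c) /\ \rank B = k >].
have Q0 : exists k, Q k.
  by exists 0; apply/asboolP; exists 0; rewrite mxrank0; split=> // c; rewrite submx0 => /eqP ->.
have Qn k : Q k -> (k <= n)%N by move=> /asboolP[B [_ <-]]; exact: rank_leq_row.
have [k /asboolP[B [hB rB]] kmax] := ex_maxnP Q0 Qn.
exists B => c; split=> [Pc|]; last exact: hB.
have Q1 : Q (\rank (B + c)%MS).
  apply/asboolP; exists (B + c)%MS; split=> // c' /sub_addsmxP[[u1 u2] /= ->].
  rewrite (mx11_scalar u2) mul_scalar_mx addrC; apply: PD => //; apply: hB.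
  exact: submxMl.
have := kmax _ Q1; rewrite -rB => le_r.
have := mxrank_leqif_sup (addsmxSl B c); move=> /geq_leqif; rewrite le_r => /esym h.
exact: submx_trans (addsmxSr B c) h.
Qed.

Lemma dot_suml (R : realType) d I (s : seq I) (F : I -> 'rV[R]_d) (y : 'rV[R]_d) :
  dot (\sum_(i <- s) F i) y = \sum_(i <- s) dot (F i) y.
Proof. by elim/big_ind2 : _ => [|u r u' r' <- <-|//]; [exact: dot0l|exact: dotDl]. Qed.

Section galerkin.
Context {R : realType} {d : nat} (Omega : set 'rV[R]_d) (T : mesh R d).
Local Notation rV := 'rV[R]_d.
Local Notation N := (nb_nodes T).
Local Notation leb := (lebesgue_rV (R := R) d).
Hypotheses (hT : mesh_of Omega T) (d0 : (0 < d)%N).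

Lemma bms_dot (F G : rV -> rV) : (forall m, bms (fun x => F x 0 m)) ->
  (forall m, bms (fun x => G x 0 m)) -> bms (fun x => dot (F x) (G x)).
Proof.
move=> hF hG; rewrite (_ : (fun x => _) = fun x => \sum_m F x 0 m * G x 0 m).
  by apply: bms_sum => m _; exact: bmsMM.
by apply/funext => x; rewrite dot_sum.
Qed.

Lemma bint0_ae0 (f : rV -> R) : bms f -> (forall x, 0 <= f x) -> bint f = 0 ->
  {ae leb, forall x, f x = 0}.
Proof.
move=> hf f0 If; apply: bint_sets_eq0 => // A mA.
have b1 : bms (fun x => \1_A x * f x).
  apply: (bmsMr hf); first by apply: measurable_indic.
  by exists 1 => x; rewrite indicE; case: (_ \in _); rewrite ?normr1 ?normr0.
apply/eqP; rewrite eq_le; apply/andP; split.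
  rewrite -If; apply: le_bint => // x.
  by rewrite indicE; case: (_ \in _); rewrite ?mul1r ?mul0r.
by apply: bint_ge0 => x; rewrite mulr_ge0// indic_ge0.
Qed.

Lemma Vh0_linear (a : R) (v w : rV -> R) : Vh0 Omega T v -> Vh0 Omega T w ->
  Vh0 Omega T (fun x => a * v x + w x).
Proof.
move=> [[cv av] v0] [[cw aw] w0]; split; [split|] => [x|K hK|x hx]; last first.
- by rewrite v0// w0// mulr0 addr0.
- have [b [e hv]] := av K hK; have [b' [e' hw]] := aw K hK.
  exists (a *: b + b'), (a * e + e') => x hx.
  by rewrite hv// hw// dotDl dotZl; ring.
- by apply: cvgD; [apply: cvgMr; exact: cv|exact: cw].
Qed.

Lemma Vh00 : Vh0 Omega T (fun=> 0).
Proof.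
split=> //; split; first by move=> x; exact: cvg_cst.
by move=> K hK; exists 0, 0 => x _; rewrite dot0l addr0.
Qed.

Lemma Vh0B (v w : rV -> R) : Vh0 Omega T v -> Vh0 Omega T w ->
  Vh0 Omega T (fun x => v x - w x).
Proof.
move=> hv hw; rewrite (_ : (fun x => _) = fun x => -1 * w x + v x); first exact: Vh0_linear.
by apply/funext => x; ring.
Qed.

Let gc (c : 'rV[R]_N) (x : rV) : rV := \sum_k c 0 k *: pg k x.

Lemma bms_gc c m : bms (fun x => gc c x 0 m).
Proof.
rewrite (_ : (fun x => _) = (fun x => \sum_k c 0 k * pg k x 0 m)).
  by apply: bms_sum => k _; apply: bmsZ; exact: (bms_pg hT).
by apply/funext => x; rewrite /gc summxE; apply: eq_bigr => k _; rewrite mxE.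
Qed.

Variable G : rV -> rV.
Hypothesis bG : forall m, bms (fun x => G x 0 m).

Let S : 'M[R]_N := \matrix_(k, l) bint (fun x => dot (pg k x) (pg l x)).
Let b : 'rV[R]_N := \row_k bint (fun x => dot (G x) (pg k x)).

Lemma load_gc c : (b *m c^T) 0 0 = bint (fun x => dot (G x) (gc c x)).
Proof.
rewrite mxE (eq_bint (g := fun x => \sum_k c 0 k * dot (G x) (pg k x))); last first.
  by move=> x; rewrite /gc dotC dot_suml; apply: eq_bigr => k _; rewrite dotZl dotC.
rewrite bint_sum => [|k _]; last by apply: bmsZ; apply: bms_dot => // m; exact: (bms_pg hT).
by apply: eq_bigr => k _; rewrite bintZ ?mxE 1?mulrC// ; apply: bms_dot => // m; exact: (bms_pg hT).
Qed.

Lemma gram_gc c c' : (c *m S *m c'^T) 0 0 = bint (fun x => dot (gc c x) (gc c' x)).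
Proof.
have hb (k l : 'I_N) : bms (fun x => dot (pg k x) (pg l x)).
  by apply: bms_dot => m; exact (bms_pg hT _ m).
rewrite (eq_bint (g := fun x => \sum_l \sum_k c 0 k * c' 0 l * dot (pg k x) (pg l x))); last first.
  move=> x; rewrite /gc dotC dot_suml; apply: eq_bigr => l _.
  rewrite dotZl dotC dot_suml mulr_sumr; apply: eq_bigr => k _; rewrite dotZl; ring.
rewrite bint_sum => [|l _]; last by apply: bms_sum => k _; exact: bmsZ.
rewrite mxE; apply: eq_bigr => l _; rewrite bint_sum => [|k _]; last exact: bmsZ.
rewrite !mxE mulr_suml; apply: eq_bigr => k _; rewrite bintZ// !mxE; ring.
Qed.

(** Compatibility condition for a possibly singular Gram matrix: zero energy means zero gradient
    almost everywhere, hence zero load. *)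
Lemma gram_kernel (c : 'rV[R]_N) : (c *m S *m c^T) 0 0 = 0 -> (b *m c^T) 0 0 = 0.
Proof.
rewrite gram_gc load_gc => /bint0_ae0 h.
have : {ae leb, forall x, dot (gc c x) (gc c x) = 0}.
  apply: h => [|x]; first by apply: bms_dot => m; exact: bms_gc.
  by rewrite dotxx sqr_ge0.
move=> ae0; rewrite -[RHS](bint0 (R := R) d); apply: bint_ae_eq.
move: ae0; apply: filterS => x; rewrite dotxx => /eqP; rewrite sqrf_eq0 => /eqP/enorm0_eq0 ->.
exact: dot0r.
Qed.

Lemma galerkin_exists : exists v, galerkin_projection Omega T G v.
Proof.
pose P (c : 'rV[R]_N) := exists2 v, Vh0 Omega T v & forall j, v (node j) = c 0 j.
have [B hB] : exists B : 'M[R]_N, forall c, P c <-> (c <= B)%MS.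
  apply: subspace_mx; first by exists (fun=> 0); [exact: Vh00|move=> j; rewrite mxE].
  move=> a c c' [v hv vc] [v' hv' vc']; exists (fun x => a * v x + v' x).
    exact: Vh0_linear.
  by move=> j; rewrite !mxE vc vc'.
(* The Gram matrix restricted to the row space of [B]: a vector it annihilates has zero energy,
   hence zero load, so the right-hand side is in its range. *)
have : (b *m B^T <= B *m S *m B^T)%MS.
  rewrite submxE; apply/eqP/matrixP => i j; rewrite ord1 [RHS]mxE.
  pose w := col j (cokermx (B *m S *m B^T)).
  have Gw : B *m S *m B^T *m w = 0 by rewrite /w colE mulmxA mulmx_coker mul0mx.
  have := @gram_kernel (w^T *m B); rewrite trmx_mul trmxK => h.
  rewrite -[LHS](_ : (b *m (B^T *m w)) 0 0 = _); last first.
    by rewrite mulmxA /w colE mulmxA -colE mxE.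
  by apply: h; rewrite -!mulmxA (mulmxA S) (mulmxA B) (mulmxA B) Gw mulmx0 mxE.
move=> /submxP[y hy].
have [v hv vc] := (hB (y *m B)).2 (submxMl _ _).
exists v; split=> // w hw; have [hv1 _] := hv; have [hw1 _] := hw.
rewrite (dirichlet_Vh2 hT hv1 hw1) (dirichlet_Vh hT hw1).
pose c' : 'rV[R]_N := \row_j w (node j).
have /(hB c').1/submxP[u hu] : P c' by exists w => // j; rewrite mxE.
have Ev x : pgrad T v x = gc (y *m B) x by apply: eq_bigr => k _; rewrite vc.
have Ew x : pgrad T w x = gc c' x by apply: eq_bigr => k _; rewrite mxE.
rewrite (eq_bint (g := fun x => dot (gc (y *m B) x) (gc c' x))); last by move=> x; rewrite Ev Ew.
rewrite [RHS](eq_bint (g := fun x => dot (G x) (gc c' x))); last by move=> x; rewrite Ew.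
rewrite -gram_gc -load_gc hu trmx_mul.
have -> : b *m (B^T *m u^T) = y *m (B *m S *m B^T) *m u^T by rewrite -hy mulmxA.
by rewrite !mulmxA.
Qed.

End galerkin.

Section star_measures.
Context {R : realType} {d : nat} (Omega : set 'rV[R]_d) (T : mesh R d).
Local Notation rV := 'rV[R]_d.
Local Notation N := (nb_nodes T).
Local Notation leb := (lebesgue_rV (R := R) d).
Local Notation V := (unit_ball_volume (R := R) (d := d)).
Hypotheses (hT : mesh_of Omega T) (d0 : (0 < d)%N) (Omega0 : Omega !=set0).
Variable L : R.
Hypotheses (L0 : 0 < L) (hL : forall K (i : 'I_N), K \in elements T -> enorm (bgrad K i) <= L).
Local Notation h := (mesh_size T).

Lemma star0 (i : 'I_N) : hat Omega i = (fun=> 0) -> star_measure Omega i = 0.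
Proof.
move=> hi; rewrite /star_measure /star hi (_ : [set x | _] = set0) ?closure0 ?measure0//.
by apply/seteqP; split => x //=; rewrite eqxx.
Qed.

Section one_hat.
Variable i : 'I_N.
Local Notation v := (hat Omega i).
Hypotheses (hv : is_hat Omega i v) (Oi : Omega (node i)).

(** The hat drops from 1 at the node to 0 off the domain with slope at most [L]. *)
Lemma node_ball : eball (node i) L^-1 `<=` Omega.
Proof.
move=> y; rewrite /eball /= -[X in _ < X]div1r ltr_pdivlMr// => hy; apply: contrapT => ny.
have := hat_lipschitz hT hv Oi (ltW L0) (fun K hK => hL i hK) y (node i).
rewrite (hat_out hT hv Oi ny); case: hv => _ -> _; rewrite eqxx sub0r normrN normr1 mulrC; lra.
Qed.

Lemma hat_half y : eball (node i) (2 * L)^-1 y -> 1 / 2 <= v y.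
Proof.
rewrite /eball /= -[X in _ < X]div1r ltr_pdivlMr ?mulr_gt0// => hy.
have := hat_lipschitz hT hv Oi (ltW L0) (fun K hK => hL i hK) y (node i).
case: (hv) => _ -> _; rewrite (_ : (i == i)%:R = 1 :> R); last by rewrite eqxx.
by rewrite ler_norml => /andP[]; lra.
Qed.

Lemma int_hatE : \int[leb]_(x in Omega) v x = bint v.
Proof.
rewrite bint_set; apply: eq_bint => x; rewrite indicE.
have [Ox|Ox] := pselect (Omega x); first by rewrite mem_set// mul1r.
by rewrite memNset// mul0r (hat_out hT hv Oi Ox).
Qed.

Lemma int_hat_ge : (2 * L)^-1 ^+ d * V / 2 <= bint v.
Proof.
have r0 : 0 < (2 * L)^-1 by rewrite invr_gt0 mulr_gt0.
have bv := bms_hat hT hv Oi (ltW L0) (fun K hK => hL i hK).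
rewrite -(ball_volume (node i) r0) mulrC -bintZ; last exact: bms_indic_ball.
apply: le_bint => //; first by apply: bmsZ; exact: bms_indic_ball.
move=> y; rewrite indicE; have [hy|hy] := pselect (eball (node i) (2 * L)^-1 y).
  by rewrite mem_set// mulr1 -div1r hat_half.
by rewrite memNset// mulr0 (hat_ge0 hT hv Oi).
Qed.

Lemma star_closed_ball x : star Omega i x -> enorm (x - node i) <= h.
Proof.
pose B : set rV := [set y | enorm (y - node i) <= h].
have cB : closed B.
  apply: (@closed_comp _ _ (fun y : rV => enorm (y - node i)) [set t | t <= h]); last exact: closed_le.
  move=> y _; apply: (lipschitz_continuous (L := 1)) => z w; rewrite mul1r.
  by apply: (le_trans (enorm_dist _ _)); rewrite opprB addrA subrK.
suff : star Omega i `<=` B by move=> /[apply].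
rewrite [X in _ `<=` X]((closure_id _).1 cB); apply: closure_subset => y /=.
exact: (hat_near hT hv Oi).
Qed.

Lemma star_measurable : measurable (star Omega i).
Proof.
rewrite -[star _ _]setCK; apply: measurableC; apply: open_rV_measurable.
by apply: closed_openC; exact: closed_closure.
Qed.

Lemma star_ball : star Omega i `<=` eball (node i) (2 * h).
Proof.
move=> x /star_closed_ball hx; have := mesh_size_gt0 hT d0 Omega0.
by rewrite /eball /= => ?; lra.
Qed.

Lemma bms_star : bms (\1_(star Omega i)).
Proof.
apply: bms_indic; first exact: star_measurable.
exists (enorm (node i) + 2 * h) => x /star_ball; rewrite /eball /= subr0 => hx.
by have := enormD (x - node i) (node i); rewrite subrK => ?; lra.
Qed.

Lemma star_measureE : star_measure Omega i = bint (\1_(star Omega i)).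
Proof. by rewrite bint_indic//; exact: star_measurable. Qed.

(** [4 * h * L] is the ratio of the radii [2 * h], of a ball containing the star, and [(2 * L)^-1],
    of a ball that meets no other such ball. *)
Lemma star_measure_le : star_measure Omega i <= (4 * h * L) ^+ d * bint (\1_(eball (node i) (2 * L)^-1)).
Proof.
have h0 := mesh_size_gt0 hT d0 Omega0.
rewrite ball_volume ?invr_gt0 ?mulr_gt0// mulrA -exprMn star_measureE.
rewrite (_ : 4 * h * L * (2 * L)^-1 = 2 * h); last by field; rewrite gt_eqF.
rewrite -(ball_volume (node i)) ?mulr_gt0//; apply: le_bint.
- exact: bms_star.
- exact: bms_indic_ball.
- by move=> x; exact: le_indic star_ball.
Qed.

Lemma star_measure_int_hat : star_measure Omega i <= 2 * (4 * h * L) ^+ d * bint v.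
Proof.
apply: (le_trans star_measure_le); have h0 := mesh_size_gt0 hT d0 Omega0.
rewrite (_ : 2 * _ * _ = (4 * h * L) ^+ d * (2 * bint v)); last by ring.
apply: ler_wpM2l.
  by rewrite exprn_ge0// mulr_ge0 ?mulr_ge0// ?ltW.
rewrite ball_volume ?invr_gt0 ?mulr_gt0//.
by have := int_hat_ge; lra.
Qed.

Lemma node_separated j : j != i -> L^-1 <= enorm (node j - node i).
Proof.
move=> ji; have := hat_lipschitz hT hv Oi (ltW L0) (fun K hK => hL i hK) (node j) (node i).
case: (hv) => _ h1 _; rewrite !h1 eqxx eq_sym (negbTE ji) sub0r normrN normr1.
by move=> hh; rewrite -(mul1r L^-1) ler_pdivrMr// mulrC.
Qed.

End one_hat.

Lemma star_measure_ge0 (i : 'I_N) : 0 <= star_measure Omega i.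
Proof. by rewrite /star_measure fine_ge0. Qed.

(* The balls of radius (2 L)^-1 around the nodes are disjoint: each hat is 1 at
   its own node, 0 at the others, and L-Lipschitz. *)
Lemma sum_star (P : pred 'I_N) (A : set rV) : measurable A -> (exists r : R, A `<=` eball 0 r) ->
  (forall i, P i -> Omega (node i)) ->
  (forall i, P i -> eball (node i) (2 * L)^-1 `<=` A) ->
  \sum_(i | P i) star_measure Omega i <= (4 * h * L) ^+ d * bint (\1_A).
Proof.
move=> mA bA PO PA; pose r := (2 * L)^-1; have h0 := mesh_size_gt0 hT d0 Omega0.
pose Q i := P i && `[< is_hat Omega i (hat Omega i) >].
have c0 : 0 <= (4 * h * L) ^+ d by rewrite exprn_ge0// mulr_ge0 ?mulr_ge0// ?ltW.
apply: (@le_trans _ _ (\sum_(i | Q i) (4 * h * L) ^+ d * bint (\1_(eball (node i) r)))).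
  rewrite big_mkcond [leRHS]big_mkcond; apply: ler_sum => i _; rewrite /Q.
  case: ifP => //= Pi; case: asboolP => [hv|nh]; first by apply: star_measure_le => //; exact: PO.
  by have [//|/star0 ->] := hat_cases Omega i.
rewrite -mulr_sumr ler_wpM2l// -bint_sum => [|i _]; last exact: bms_indic_ball.
apply: le_bint; first by apply: bms_sum => i _; exact: bms_indic_ball.
  exact: bms_indic.
move=> x; have [[i Qi ix]|no] := pselect (exists2 i, Q i & eball (node i) r x); last first.
  rewrite big1 ?indic_ge0// => i Qi; rewrite indicE memNset// => ix; apply: no; by exists i.
rewrite (bigD1 i)//= big1 ?addr0; last first.
  move=> j /andP[/andP[Pj /asboolP hj] ji]; rewrite indicE memNset// => jx.
  move: Qi => /andP[Pi /asboolP hi].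
  have := node_separated hi (PO i Pi) ji.
  have : enorm (node j - node i) <= enorm (x - node i) + enorm (x - node j).
    have := enormD (node j - x) (x - node i).
    by rewrite addrA subrK [enorm (node j - x)]enormBC [X in _ <= X]addrC.
  have -> : L^-1 = 2 * r by rewrite /r; field; rewrite gt_eqF.
  by move: ix jx; rewrite /eball /=; lra.
by apply: le_indic; apply: PA; case/andP: Qi.
Qed.

End star_measures.

(** * Square roots of matrices *)

Section square_roots.
Context {R : realType} {d : nat}.
Local Notation rV := 'rV[R]_d.
Implicit Types (A B C M Y : 'M[R]_d) (x y : rV) (a b q : R).

Lemma le_of_sqr a b : 0 <= b -> a ^+ 2 <= b ^+ 2 -> a <= b.
Proof.
move=> b0 h; rewrite leNgt; apply/negP => ba.
have : 0 < (a - b) * (a + b) by rewrite mulr_gt0; lra.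
have -> : (a - b) * (a + b) = a ^+ 2 - b ^+ 2 by ring.
lra.
Qed.

Lemma dot_mxC A x y : A^T = A -> dot (x *m A) y = dot (y *m A) x.
Proof.
by move=> sA; rewrite [RHS]dotC /dot trmx_mul sA mulmxA.
Qed.

Lemma dot_scalar a x : dot (x *m a%:M) x = a * enorm x ^+ 2.
Proof. by rewrite mul_mx_scalar dotZl dotxx. Qed.

(** A bound on the spectral norm. The Frobenius norm [enorm] is too large to yield the sharp radius
    [Qradius] of the stencil. *)
Definition opb A q := forall x, enorm (x *m A) <= q * enorm x.

(** Polarisation of the quadratic form at [x] and [y = q^-1 *: (x *m C)], followed by the
    parallelogram identity. *)
Lemma sym_opb C q : 0 < q -> C^T = C -> (forall x, `|dot (x *m C) x| <= q * enorm x ^+ 2) ->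
  opb C q.
Proof.
move=> q0 sC hC x; apply: le_of_sqr; first by rewrite mulr_ge0 ?enorm_ge0 ?ltW.
pose y := q^-1 *: (x *m C).
have E : 4 * (q^-1 * enorm (x *m C) ^+ 2) =
    dot ((x + y) *m C) (x + y) - dot ((x - y) *m C) (x - y).
  rewrite -dotxx -dotZr -/y mulmxDl mulmxBl dotDl dotBl !dotDr !dotNr.
  by rewrite (dot_mxC y x sC); ring.
have h1 := hC (x + y); have h2 := hC (x - y).
have P : enorm (x + y) ^+ 2 + enorm (x - y) ^+ 2 = 2 * (enorm x ^+ 2 + enorm y ^+ 2).
  by rewrite -!dotxx !(dotDl, dotDr, dotNl, dotNr) (dotC y x); ring.
have Ey : q * enorm y ^+ 2 = q^-1 * enorm (x *m C) ^+ 2.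
  by rewrite enormZ exprMn real_normK ?num_real// exprVn; field; rewrite gt_eqF.
have h3 : 2 * (q^-1 * enorm (x *m C) ^+ 2) <= 2 * (q * enorm x ^+ 2).
  move: h1 h2; rewrite !ler_norml => /andP[_ h1] /andP[h2 _].
  have : q * (enorm (x + y) ^+ 2 + enorm (x - y) ^+ 2) =
     2 * (q * enorm x ^+ 2 + q^-1 * enorm (x *m C) ^+ 2) by rewrite P -Ey; ring.
  by rewrite mulrDr; lra.
move: h3; rewrite ler_pM2l// mulrC ler_pdivrMr//.
by rewrite exprMn expr2 mulrAC.
Qed.

Lemma opbM A B a b : 0 <= b -> opb A a -> opb B b -> opb (A *m B) (b * a).
Proof.
by move=> b0 hA hB x; rewrite mulmxA (le_trans (hB _))// -mulrA ler_wpM2l.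
Qed.

Lemma opbD A B a b : opb A a -> opb B b -> opb (A + B) (a + b).
Proof.
by move=> hA hB x; rewrite mulmxDr (le_trans (enormD _ _))// mulrDl lerD.
Qed.

Lemma opbZ A a b : 0 <= b -> opb A a -> opb (b *: A) (b * a).
Proof.
by move=> b0 hA x; rewrite -scalemxAr enormZ ger0_norm// -mulrA ler_wpM2l.
Qed.

Lemma opb_entry A a i j : opb A a -> `|A i j| <= a.
Proof.
move=> /(_ (delta_mx 0 i)); rewrite enorm_delta mulr1 -rowE => h.
by apply: le_trans h; have := coord_le_enorm (row i A) 0 j; rewrite mxE.
Qed.

Lemma geometric_cvg (a : nat -> R) q : 0 <= q < 1 ->
  (forall n, `|a n.+1 - a n| <= q ^+ n) -> exists l : R, a @ \oo --> l.
Proof.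
move=> /andP[q0 q1] ha.
have c1 : cvgn (series (fun n => `|a n.+1 - a n|)).
  apply: (@series_le_cvg _ _ (geometric 1 q)) => [n|n|n|].
  - exact: normr_ge0.
  - by rewrite /geometric /= mul1r exprn_ge0.
  - by rewrite /geometric /= mul1r.
  - by apply: is_cvg_geometric_series; rewrite ger0_norm.
have c2 := normed_cvg c1.
exists (lim (series (telescope a) @ \oo) + a 0%N).
have E : (fun n => series (telescope a) n + a 0%N) = a.
  by apply/funext => n; rewrite [RHS]eq_sum_telescope addrC.
have : (fun n => series (telescope a) n + a 0%N) @ \oo --> lim (series (telescope a) @ \oo) + a 0%N.
  by apply: cvgD; [exact: c2|exact: cvg_cst].
by move: (lim _ + _) => l; rewrite E.
Qed.

Lemma limr_le_cst (a : nat -> R) (l c : R) : a @ \oo --> l -> (forall n, a n <= c) -> l <= c.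
Proof.
move=> h ha; rewrite leNgt; apply/negP => cl.
have e0 : 0 < l - c by rewrite subr_gt0.
move/cvgrPdist_lt: h => /(_ _ e0) h.
case: (filter_ex h) => n /=; rewrite ltr_norml => /andP[_]; have := ha n; lra.
Qed.

Lemma cvg_sumR I (s : seq I) (F : I -> nat -> R) (l : I -> R) :
  (forall i, F i @ \oo --> l i) ->
  (fun n => \sum_(i <- s) F i n) @ \oo --> \sum_(i <- s) l i.
Proof.
move=> h; elim: s => [|i s IH].
  rewrite big_nil (_ : (fun n => _) = fun=> 0); first exact: cvg_cst.
  by apply/funext => n; rewrite big_nil.
rewrite big_cons (_ : (fun n => _) = fun n => F i n + \sum_(j <- s) F j n).
  by apply: cvgD; [exact: h|exact: IH].
by apply/funext => n; rewrite big_cons.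
Qed.

(* For B = c (1 - C), the square root of B is c^(1/2) (1 - Y) with Y = (C + Y^2) / 2. *)
Lemma contraction_root C q : 0 < q < 1 -> C^T = C -> opb C q ->
  exists Y, [/\ Y^T = Y, forall x, dot (x *m Y) x <= q * enorm x ^+ 2 & 2 *: Y = C + Y *m Y].
Proof.
move=> /andP[q0 q1] sC hC.
pose F Y := 2^-1 *: (C + Y *m Y); pose Y n := iter n F 0.
have YS n : Y n.+1 = F (Y n) by [].
have sY n : (Y n)^T = Y n.
  elim: n => [|n IH]; first by rewrite /Y /= trmx0.
  by rewrite YS /F linearZ /= linearD /= trmx_mul IH sC.
have oY n : opb (Y n) q.
  elim: n => [|n IH]; first by move=> x; rewrite /Y /= mulmx0 enorm0 mulr_ge0 ?enorm_ge0 ?ltW.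
  rewrite YS => x; apply: (le_trans (opbZ _ (opbD hC (opbM (ltW q0) IH IH)) _)) => //.
  rewrite ler_wpM2r ?enorm_ge0//.
  have : q * q <= q by rewrite ler_piMl// ltW.
  lra.
have oD n : opb (Y n.+1 - Y n) (q ^+ n).
  elim: n => [|n IH].
    rewrite /Y /= subr0 /F mulmx0 addr0 => x; apply: (le_trans (opbZ _ hC _)) => //.
    by rewrite ler_wpM2r ?enorm_ge0// expr0; lra.
  rewrite !YS.
  (* A difference of squares that avoids commutation; one factor in each term has norm at most [q],
     so the step sizes shrink by [q]. *)
  have -> : F (Y n.+1) - F (Y n) =
      2^-1 *: (Y n.+1 *m (Y n.+1 - Y n) + (Y n.+1 - Y n) *m Y n).
    rewrite /F -scalerBr; congr (_ *: _); rewrite mulmxBr mulmxBl addrA subrK.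
    by rewrite opprD addrACA subrr add0r.
  move=> x; apply: (le_trans (opbZ _ (opbD (opbM _ (oY n.+1) IH) (opbM _ IH (oY n))) _)) => //.
  - by rewrite exprn_ge0// ltW.
  - exact: ltW.
  rewrite ler_wpM2r ?enorm_ge0// exprS; lra.
have cvgY i j : exists l : R, (fun n => Y n i j) @ \oo --> l.
  apply: (@geometric_cvg _ q); first by rewrite (ltW q0) q1.
  by move=> n; have := opb_entry i j (oD n); rewrite !mxE.
have [l hl] : exists l : 'I_d -> 'I_d -> R, forall i j, (fun n => Y n i j) @ \oo --> l i j.
  have [g hg] := choice (fun ij : 'I_d * 'I_d => cvgY ij.1 ij.2).
  by exists (fun i j => g (i, j)) => i j; exact: hg (i, j).
pose Z : 'M[R]_d := \matrix_(i, j) l i j.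
have uniq (f : nat -> R) (a b : R) : f @ \oo --> a -> f @ \oo --> b -> a = b.
  by move=> h1 h2; exact (@cvg_unique R^o (@norm_hausdorff R R^o) _ _ _ _ h1 h2).
exists Z; split.
- apply/matrixP => i j; rewrite !mxE; apply: (uniq _ _ _ (hl j i)).
  rewrite (_ : (fun n => _) = fun n => Y n i j); first exact: hl.
  by apply/funext => n; rewrite -{1}(sY n) mxE.
- move=> x.
  have quadE W : dot (x *m W) x = \sum_i \sum_j x 0 j * W j i * x 0 i.
    rewrite dot_sum; apply: eq_bigr => i _; rewrite mxE mulr_suml.
    by apply: eq_bigr => j _.
  have c : (fun n => dot (x *m Y n) x) @ \oo --> dot (x *m Z) x.
    rewrite (_ : (fun n => _) = fun n => \sum_i \sum_j x 0 j * Y n j i * x 0 i); last first.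
      by apply/funext => n; rewrite quadE.
    rewrite quadE; apply: cvg_sumR => i; apply: cvg_sumR => j.
    by rewrite mxE; apply: cvgMl; apply: cvgMr; exact: hl.
  apply: (limr_le_cst c) => n.
  apply: (le_trans (le_trans (ler_norm _) (normr_dot_le _ _))).
  by rewrite expr2 mulrA ler_wpM2r ?enorm_ge0// oY.
apply/matrixP => i j; apply: (uniq (fun n => 2 * Y n.+1 i j)).
  rewrite !mxE; apply: cvgMr; have := hl i j.
  by rewrite -(cvg_shiftS (fun n => Y n i j)).
rewrite (_ : (fun n => _) = fun n => C i j + \sum_k Y n i k * Y n k j); last first.
  by apply/funext => n; rewrite YS /F !mxE; field.
rewrite !mxE; apply: cvgD; first exact: cvg_cst.
apply: cvg_sumR => k; rewrite !mxE; exact: cvgM.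
Qed.

Lemma sqrtmx_exists B a b : 0 < a -> a <= b -> B^T = B -> mx_le a%:M B -> mx_le B b%:M ->
  exists M, [/\ M^T = M, mx_le 0 M & M *m M = B].
Proof.
(* With [2 * b] instead of [b], the contraction factor [1 - a / c] stays positive even when
   [a = b]. *)
move=> a0 ab sB aB Bb; pose c := 2 * b; have c0 : 0 < c by rewrite /c; lra.
pose q := 1 - a / c; pose C := 1%:M - c^-1 *: B.
have ac : 0 < a / c by rewrite divr_gt0.
have ac1 : a / c < 1 by rewrite ltr_pdivrMr// mul1r /c; lra.
have q01 : 0 < q < 1 by rewrite /q; apply/andP; split; lra.
have sC : C^T = C by rewrite /C linearB /= linearZ /= trmx1 sB.
have dC x : dot (x *m C) x = enorm x ^+ 2 - c^-1 * dot (x *m B) x.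
  by rewrite /C mulmxBr mulmx1 -scalemxAr dotBl dotZl dotxx.
have hC : opb C q.
  apply: sym_opb => // [|x]; first by case/andP: q01.
  have := aB x; have := Bb x; rewrite !dot_scalar => h1 h2.
  rewrite dC ger0_norm; last first.
    rewrite subr_ge0 mulrC ler_pdivrMr// /c; apply: (le_trans h1).
    have := sqr_ge0 (enorm x); have : 0 < b by lra.
    by move=> b0 s0; rewrite mulrC ler_wpM2l//; lra.
  rewrite /q mulrBl mul1r lerD2l lerN2 [a / c]mulrC -mulrA.
  by rewrite ler_pM2l ?invr_gt0.
have [Y [sY hY E]] := contraction_root q01 sC hC.
exists (Num.sqrt c *: (1%:M - Y)); split.
- by rewrite linearZ /= linearB /= trmx1 sY.
- move=> x; rewrite mulmx0 dot0l -scalemxAr dotZl mulr_ge0 ?sqrtr_ge0//.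
  rewrite mulmxBr mulmx1 dotBl dotxx subr_ge0; apply: (le_trans (hY x)).
  by rewrite ler_piMl ?sqr_ge0//; case/andP: q01 => _ /ltW.
rewrite -scalemxAl -scalemxAr scalerA -expr2 sqr_sqrtr ?ltW//.
rewrite mulmxBl mulmxBr mulmxBr !mul1mx mulmx1.
have -> : 1%:M - Y - (Y - Y *m Y) = 1%:M - C.
  have -> : Y *m Y = 2 *: Y - C by rewrite E addrC addKr.
  apply/matrixP => i j; rewrite !mxE; ring.
by rewrite /C opprB addrC subrK scalerA divff ?scale1r ?gt_eqF.
Qed.

(** The determinant of [1 + t (M - 1)] is a polynomial in [t], equal to 1 at 0. A nonpositive value
    at 1 would give it a root, but for [t < 1] the quadratic form is positive. *)
Lemma psd_det_gt0 M : mx_le 0 M -> \det M != 0 -> 0 < \det M.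
Proof.
move=> M0 dM; rewrite ltNge; apply/negP => dle.
pose P : 'M[{poly R}]_d := map_mx polyC 1%:M + 'X *: map_mx polyC (M - 1%:M).
have hP t : (\det P).[t] = \det (1%:M + t *: (M - 1%:M)).
  rewrite -/(horner_eval t _) -det_map_mx; congr (\det _); apply/matrixP => i j.
  by rewrite /P !mxE /= horner_evalE hornerD hornerM hornerX !hornerC.
have [t /andP[t0 t1]] : exists2 t, 0 <= t <= 1 & root (- \det P) t.
  have := @poly_ivt _ (- \det P) 0 1 ler01.
  rewrite !hornerE !hP scale0r addr0 det1 scale1r addrC subrK => h.
  have [|t] := h; first by apply/andP; split; lra.
  by move=> t01 rt; exists t => //; move: t01; rewrite in_itv.
rewrite rootE hornerN hP oppr_eq0 => /det0P[x x0 hx].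
have : dot (x *m (1%:M + t *: (M - 1%:M))) x = 0 by rewrite hx dot0l.
rewrite mulmxDr mulmx1 -scalemxAr mulmxBr mulmx1 dotDl dotZl dotBl dotxx => E.
have := M0 x; rewrite mulmx0 dot0l => hM.
have x20 : 0 < enorm x ^+ 2.
  by rewrite exprn_gt0// lt_neqAle enorm_ge0 andbT eq_sym; apply: contraNneq x0 => /enorm0_eq0 ->.
have [t1'|t1'] := eqVneq t 1.
  move: hx; rewrite t1' scale1r addrC subrK => hx.
  by move/negP: dM; apply; apply/det0P; exists x.
have : 0 < (1 - t) * enorm x ^+ 2.
  by rewrite mulr_gt0// subr_gt0 lt_neqAle t1'.
have : 0 <= t * dot (x *m M) x by rewrite mulr_ge0.
by move: E; rewrite mulrBr mulrBl mul1r; lra.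
Qed.

(** The properties are derived for whichever root [sqrtmx] selects: invertibility from that of [B],
    and the norm bound from |x M|^2 = x B . x. *)
Lemma sqrtmxP B a b : 0 < a -> a <= b -> B^T = B -> mx_le a%:M B -> mx_le B b%:M ->
  [/\ (sqrtmx B)^T = sqrtmx B, sqrtmx B *m sqrtmx B = B, sqrtmx B \in unitmx,
      0 < \det (sqrtmx B) & forall x, enorm (x *m sqrtmx B) <= Num.sqrt b * enorm x].
Proof.
move=> a0 ab sB aB Bb; rewrite /sqrtmx; case: xgetP => [M _ [sM M0 MM]|no]; last first.
  by have [M hM] := sqrtmx_exists a0 ab sB aB Bb; case: (no M).
have dB : \det B != 0.
  apply/negP => /det0P[x x0 hx]; have := aB x; rewrite hx dot0l dot_scalar.
  have x20 : 0 < enorm x ^+ 2.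
    by rewrite exprn_gt0// lt_neqAle enorm_ge0 andbT eq_sym; apply: contraNneq x0 => /enorm0_eq0 ->.
  by have : 0 < a * enorm x ^+ 2; [rewrite mulr_gt0|lra].
have dM : \det M != 0.
  by apply: contraNneq dB => dM; rewrite -MM det_mulmx dM mul0r.
split=> //; first by rewrite unitmxE unitfE.
  exact: psd_det_gt0.
have b0 : 0 <= b by lra.
move=> x; apply: le_of_sqr; first by rewrite mulr_ge0 ?enorm_ge0 ?sqrtr_ge0.
rewrite exprMn (sqr_sqrtr b0).
rewrite -dotxx dot_mxC// -mulmxA MM; have := Bb x; rewrite dot_scalar => h.
by apply: le_trans h; rewrite dotC.
Qed.

End square_roots.

(** * Moments of the kernel and the dilation theta *)

Section kernel_moments.
Context {R : realType} {d : nat} (phi : 'rV[R]_d -> R).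
Local Notation rV := 'rV[R]_d.
Hypotheses (d0 : (0 < d)%N) (hphi : kernel_function phi).

Lemma kernel_bms : bms phi.
Proof. by case: hphi => h1 _ _ h2 _; exact: smooth_bms d0 h1 h2. Qed.

(** [kernel_function] leaves the unit sphere open; continuity settles it. It matters because the
    second differences are controlled in open balls only. *)
Lemma kernel_off z : 1 <= enorm z -> phi z = 0.
Proof.
case: hphi => sm _ _ off _ hz; apply/eqP; apply/negPn/negP => nz.
have e0 : 0 < `|phi z| by rewrite normr_gt0.
have [r r0 hr] := (continuous_eballP _ _).1 (@smooth_continuous _ _ phi d0 sm z) _ e0.
have z0 : 0 < enorm z by lra.
pose y := (1 + r / (2 * enorm z)) *: z.
have rz : 0 < r / (2 * enorm z) by rewrite divr_gt0// mulr_gt0.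
have offy : phi y = 0.
  apply: off; rewrite /y enormZ ger0_norm; last by lra.
  have : 0 < r / (2 * enorm z) * enorm z by rewrite mulr_gt0.
  lra.
suff /hr : eball z r y by rewrite offy subr0 ltxx.
rewrite /eball /y /= scalerDl scale1r [z + _]addrC addrK enormZ ger0_norm ?(ltW rz)//.
by rewrite invfM mulrA divfK ?gt_eqF//; lra.
Qed.

Lemma bint_orthogonal (A : 'M[R]_d) (f : rV -> R) : A *m A^T = 1%:M -> bms f ->
  bint (fun z => f (z *m A)) = bint f.
Proof.
move=> hA hf; have dA : `|\det A| = 1.
  have /(congr1 determinant) := hA; rewrite det_mulmx det_tr det1 => h.
  have : `|\det A| ^+ 2 = 1 by rewrite real_normK ?num_real// expr2.
  by move=> /eqP; rewrite sqrp_eq1// => /eqP.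
have uA : A \in unitmx by rewrite unitmxE unitfE -normr_eq0 dA oner_eq0.
rewrite (eq_bint (g := fun z => f (z *m A + 0))); last by move=> z; rewrite addr0.
by rewrite bint_affine// dA invr1 mul1r.
Qed.

Lemma orthogonal_enorm (A : 'M[R]_d) (z : rV) : A *m A^T = 1%:M -> enorm (z *m A) = enorm z.
Proof.
move=> hA; apply/eqP; rewrite -(eqrXn2 (n := 2))// ?enorm_ge0// -!dotxx.
by rewrite /dot trmx_mul mulmxA -(mulmxA z) hA mulmx1.
Qed.

Lemma bms_moment (a b : 'I_d) : bms (fun z => z 0 a * z 0 b * phi z).
Proof.
have [sm _ _ off _] := hphi; have [mphi _ _] := kernel_bms.
apply: bms_le kernel_bms _.
  by apply: measurable_funM => //; apply: measurable_funM; exact: measurable_coord.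
move=> z; have [z1|z1] := ltP 1 (enorm z); first by rewrite off// mulr0.
rewrite normrM ler_piMl// normrM -[leRHS]mulr1 ler_pM//.
  exact: le_trans (coord_le_enorm _ _ _) z1.
exact: le_trans (coord_le_enorm _ _ _) z1.
Qed.

(** Radial symmetry: reflecting one coordinate kills the mixed moments, and swapping two makes the
    pure ones equal, their sum being [d]. *)
Lemma kernel_moment (a b : 'I_d) : bint (fun z => z 0 a * z 0 b * phi z) = (a == b)%:R.
Proof.
case: (hphi) => sm _ rad off h2.
have radA A z : A *m A^T = 1%:M -> phi (z *m A) = phi z.
  by move=> hA; apply: rad; exact: orthogonal_enorm.
have [<-|ab] := eqVneq a b; last first.
  pose A : 'M[R]_d := diag_mx (\row_k (if k == a then -1 else 1)).
  have hA : A *m A^T = 1%:M.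
    rewrite tr_diag_mx mulmx_diag; apply/matrixP => k l; rewrite !mxE.
    by case: eqP => _; case: eqP => _ //; rewrite ?mulr1// mulrNN mulr1.
  have := bint_orthogonal hA (bms_moment a b).
  rewrite (eq_bint (g := fun z => - (z 0 a * z 0 b * phi z))); last first.
    move=> z; rewrite radA// mul_mx_diag !mxE eqxx eq_sym (negbTE ab); ring.
  rewrite bintN; last exact: bms_moment.
  rewrite mulr0n; lra.
have E c : bint (fun z => z 0 c * z 0 c * phi z) = bint (fun z => z 0 a * z 0 a * phi z).
  pose A : 'M[R]_d := perm_mx (tperm a c).
  have hA : A *m A^T = 1%:M by rewrite tr_perm_mx -perm_mxM mulgV perm_mx1.
  rewrite -(bint_orthogonal hA (bms_moment c c)); apply: eq_bint => z.
  rewrite radA// (_ : z *m A = col_perm (tperm a c) z); last by rewrite col_permE tpermV.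
  by rewrite !mxE tpermR.
have : bint (fun z => \sum_c z 0 c * z 0 c * phi z) = d%:R.
  rewrite -h2; apply: eq_bint => z; rewrite -dotxx dot_sum -mulr_suml; reflexivity.
rewrite bint_sum => [|c _]; last exact: bms_moment.
rewrite (eq_bigr (fun=> bint (fun z => z 0 a * z 0 a * phi z))) => [|c _]; last exact: E.
rewrite sumr_const card_ord => h; apply: (mulfI (x := d%:R)).
  by rewrite pnatr_eq0 -lt0n.
by rewrite mulr_natl h mulr1.
Qed.

(** Only the pure moments survive and assemble into [M *m M]; this is why the stencil is dilated by
    a square root of the averaged coefficients. *)
Lemma kernel_quad (M H : 'M[R]_d) : M^T = M ->
  bms (fun z => quad H (z *m M) * phi z) /\
  bint (fun z => quad H (z *m M) * phi z) = mdot (M *m M) H.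
Proof.
move=> sM.
have E : (fun z => quad H (z *m M) * phi z) =
   fun z => \sum_i \sum_j \sum_a \sum_b M a i * M b j * H i j * (z 0 a * z 0 b * phi z).
  apply/funext => z; rewrite /quad mulr_suml; apply: eq_bigr => i _.
  rewrite mulr_suml; apply: eq_bigr => j _; rewrite !mxE.
  rewrite -!mulrA mulr_suml; apply: eq_bigr => a _.
  rewrite mulr_suml mulr_sumr; apply: eq_bigr => b _; ring.
have b1 i j a b : bms (fun z : rV => M a i * M b j * H i j * (z 0 a * z 0 b * phi z)).
  by apply: bmsZ; exact: bms_moment.
have b2 i j a : bms (fun z : rV => \sum_b M a i * M b j * H i j * (z 0 a * z 0 b * phi z)).
  by apply: bms_sum => b _; exact: b1.
have b3 i j : bms (fun z : rV => \sum_a \sum_b M a i * M b j * H i j * (z 0 a * z 0 b * phi z)).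
  by apply: bms_sum => a _; exact: b2.
have b4 i : bms (fun z : rV => \sum_j \sum_a \sum_b M a i * M b j * H i j * (z 0 a * z 0 b * phi z)).
  by apply: bms_sum => j _; exact: b3.
rewrite E; split; first by apply: bms_sum => i _; exact: b4.
rewrite bint_sum => [|i _]; last exact: b4.
rewrite /mdot; apply: eq_bigr => i _; rewrite bint_sum => [|j _]; last exact: b3.
apply: eq_bigr => j _; rewrite bint_sum => [|a _]; last exact: b2.
rewrite mxE mulr_suml; apply: eq_bigr => a _; rewrite bint_sum => [|b _]; last exact: b1.
rewrite (bigD1 a)//= bintZ; last exact: bms_moment.
rewrite kernel_moment eqxx mulr1 big1 ?addr0.
  by rewrite (_ : M a i = M i a)// -{1}sM mxE.
move=> b ba; rewrite bintZ; last exact: bms_moment.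
by rewrite kernel_moment eq_sym (negbTE ba) mulr0.
Qed.

End kernel_moments.

Section theta_bounds.
Context {R : realType} {d : nat}.
Local Notation rV := 'rV[R]_d.

(** First exit along the segment: the infimum of the parameters outside [U] is outside by openness,
    and is a limit of parameters inside. *)
Lemma boundary_crossing (U : set rV) (x y : rV) : open U -> U x -> ~ U y ->
  exists2 z, boundary U z & enorm (x - z) <= enorm (x - y).
Proof.
move=> oU Ux nUy; pose p (t : R) := x + t *: (y - x).
pose S : set R := [set t | 0 <= t <= 1 /\ ~ U (p t)].
have S1 : S 1 by split; [rewrite ler01 lexx|rewrite /p scale1r addrC subrK].
have hS : has_inf S by split; [exists 1|exists 0 => t [/andP[]]].
pose c := inf S.
have c0 : 0 <= c by apply: lb_le_inf; [exists 1|move=> t [/andP[]]].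
have c1 : c <= 1 by apply: ge_inf => //; case: hS.
have pd t s : enorm (p t - p s) = `|t - s| * enorm (y - x).
  by rewrite -enormZ; congr enorm; apply/rowP => i; rewrite !mxE; ring.
have n0 : 0 < enorm (y - x) + 1 by rewrite ltr_wpDl ?enorm_ge0.
have pnear t r : 0 < r -> exists2 s : R, 0 < s & forall t', `|t' - t| < s -> eball (p t) r (p t').
  move=> r0; exists (r / (enorm (y - x) + 1)); first by rewrite divr_gt0.
  move=> t'; rewrite ltr_pdivlMr// /eball /= pd => h; apply: le_lt_trans h.
  by rewrite ler_wpM2l// lerDl.
have Uc : ~ U (p c).
  move=> Uc; have [r r0 hr] := (open_eballP _).1 oU _ Uc.
  have [s s0 hs] := pnear c r r0.
  have [t St tc] := inf_adherent s0 hS; have [_ nt] := St.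
  apply: nt; apply: hr; apply: hs; rewrite ger0_norm; first by rewrite ltrBlDl.
  by rewrite subr_ge0; apply: ge_inf; [case: hS|].
have cpos : 0 < c.
  rewrite lt_neqAle c0 andbT eq_sym; apply/eqP => cE; apply: Uc.
  by rewrite cE /p scale0r addr0.
exists (p c).
  split; last by move=> /interior_subset.
  move=> A /nbhs_eballP[r r0 hr]; have [s s0 hs] := pnear c r r0.
  pose t := Num.max 0 (c - s / 2).
  have tc : t < c by rewrite /t gt_max cpos /= ltrBlDr ltrDl divr_gt0.
  have t0 : 0 <= t by rewrite /t le_max lexx.
  exists (p t); split.
    apply: contrapT => nt; have : c <= t.
      by apply: ge_inf; [case: hS|split => //; rewrite t0 (ltW (lt_le_trans tc c1))].
    by rewrite leNgt tc.
  apply: hr; apply: hs; rewrite ltr0_norm ?subr_lt0//.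
  have : c - s / 2 <= t by rewrite /t le_max lexx orbT.
  lra.
rewrite /p opprD addrA subrr add0r enormN enormZ ger0_norm// [leRHS]enormBC.
by rewrite ler_piMl// enorm_ge0.
Qed.

(** The interface to [theta]. Far from the boundary, a point of the ball outside the domain would
    give a boundary point closer than [dist_to] allows; otherwise an inscribed ball of radius [r]
    puts [min 1 (r / q)] in the set whose supremum is taken. *)
Lemma thetaP (Omega : set rV) (lambda Lambda eps : R) (x : rV) :
  open Omega -> Omega x -> 0 < Qradius lambda Lambda * eps ->
  let t := theta Omega lambda Lambda eps x in
  [/\ 0 < t <= 1, eball x (t * (Qradius lambda Lambda * eps)) `<=` Omega &
      forall r, 0 < r -> eball x r `<=` Omega -> Num.min 1 (r / (Qradius lambda Lambda * eps)) <= t].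
Proof.
move=> oO Ox; set q := _ * eps => q0 /=; rewrite /theta -/q; case: ifPn => hq.
  split; [by rewrite ltr01 lexx| |by move=> r r0 _; rewrite ge_min lexx].
  rewrite mul1r => y; rewrite /eball /= enormBC => hy; apply: contrapT => ny.
  have [z bz hz] := boundary_crossing oO Ox ny.
  move: hq; rewrite ltNge => /negP; apply; apply: (le_trans _ (ltW hy)); apply: le_trans hz.
  apply: ge_inf; last by exists z.
  by exists 0 => _ [w _ <-]; exact: enorm_ge0.
set S := [set t | _]; have hub : has_ubound S by exists 1 => t [/andP[]].
have key r : 0 < r -> eball x r `<=` Omega -> S (Num.min 1 (r / q)).
  move=> r0 hr; have m0 : 0 < Num.min 1 (r / q) by rewrite lt_min ltr01 divr_gt0.
  have mr : Num.min 1 (r / q) * q <= r.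
    by rewrite -ler_pdivlMr// ge_min lexx orbT.
  split; first by rewrite m0 ge_min lexx.
  move=> y; rewrite /eball /= subr0 => hy.
  have h : Num.min 1 (r / q) * enorm y < r by apply: lt_le_trans mr; rewrite ltr_pM2l.
  split; apply: hr; rewrite /eball /=.
    by rewrite addrC addKr enormZ gtr0_norm.
  by rewrite addrC addKr enormN enormZ gtr0_norm.
have [r r0 hr] := (open_eballP _).1 oO x Ox.
have Sne : has_sup S by split => //; exists (Num.min 1 (r / q)); exact: key.
have sup0 : 0 < sup S.
  apply: lt_le_trans (ub_le_sup hub (key r r0 hr)).
  by rewrite lt_min ltr01 divr_gt0.
split.
- by rewrite sup0 /=; apply: ge_sup; [case: Sne|move=> t [/andP[]]].
- move=> y; rewrite /eball /= => hy.
  have e0 : 0 < sup S - enorm (y - x) / q by rewrite subr_gt0 ltr_pdivrMr.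
  have [t [/andP[t0 t1] ht]] := sup_adherent e0 Sne.
  rewrite opprB addrC subrK ltr_pdivrMr// => hyt.
  have /ht[] : eball 0 q (t^-1 *: (y - x)).
    by rewrite /eball /= subr0 enormZ gtr0_norm ?invr_gt0// mulrC ltr_pdivrMr// mulrC.
  by rewrite scalerA divff ?gt_eqF// scale1r addrC subrK.
- by move=> r' r'0 hr'; apply: ub_le_sup => //; exact: key.
Qed.

(** Between a point of [U] and one outside, the segment meets the boundary, where [v] vanishes, at
    no greater distance. *)
Lemma zero_extension_continuous (U : set rV) (v : rV -> R) : open U ->
  {within closure U, continuous v} -> (forall x, boundary U x -> v x = 0) ->
  continuous (fun x => \1_U x * v x).
Proof.
move=> oU cv v0 x.
have off y : ~ U y -> \1_U y * v y = 0 by move=> ny; rewrite indicE memNset// mul0r.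
have on y : U y -> \1_U y * v y = v y by move=> ny; rewrite indicE mem_set// mul1r.
apply/continuous_eballP => e e0.
have [cx|ncx] := pselect (closure U x); last first.
  have /open_eballP/(_ x ncx)[r r0 hr] : open (~` closure U) by apply: closed_openC; exact: closed_closure.
  exists r => // y /hr ny; rewrite !off ?subrr ?normr0//.
    by move=> /subset_closure.
  by move=> /subset_closure.
have Ev : \1_U x * v x = v x.
  have [Ux|nUx] := pselect (U x); first exact: on.
  by rewrite off// v0//; split=> // /interior_subset.
have := (subspace_continuousP _ _).1 cv x cx => /cvgrPdist_lt/(_ e e0).
rewrite near_withinE => /nbhs_eballP[r r0 hr].
exists r => // y hy; rewrite Ev; have [Uy|nUy] := pselect (U y).
  by rewrite (on y Uy); apply: hr => //; exact: subset_closure.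
rewrite (off y nUy); have [Ux|nUx] := pselect (U x); last first.
  by rewrite -Ev off// subrr normr0.
have [z bz hz] := boundary_crossing oU Ux nUy.
rewrite -(v0 z bz); apply: hr; last by case: bz.
by rewrite /eball /= enormBC; apply: le_lt_trans hz _; rewrite enormBC.
Qed.

End theta_bounds.

(** * The integral operator *)

Section integral_operator.
Context {R : realType} {d : nat}.
Local Notation rV := 'rV[R]_d.
Variables (Omega : set rV) (lambda Lambda eps : R) (phi : rV -> R).
Variables (A : rV -> 'M[R]_d) (T : mesh R d) (i : 'I_(nb_nodes T)).
Local Notation M := (Mnode Omega lambda A i).
Local Notation Q := (Qradius lambda Lambda).
Local Notation x := (node i).
Local Notation t := (theta Omega lambda Lambda eps x).
Local Notation sd := (second_difference Omega lambda Lambda eps).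
Local Notation I v := (Ieps Omega lambda Lambda phi eps A v i).
Hypotheses (d0 : (0 < d)%N) (hphi : kernel_function phi) (oO : open Omega) (Ox : Omega x).
Hypotheses (e0 : 0 < eps) (Q0 : 0 < Q).
Hypotheses (sM : M^T = M) (uM : M \in unitmx) (dM : 0 < \det M)
  (nM : forall z : rV, enorm (z *m M) <= Q * enorm z).

(** A representative on the whole space. It agrees with [v] wherever the integral operator looks,
    since the arguments of the dilated second difference stay in the domain. *)
Definition zext (v : rV -> R) y := \1_Omega y * v y.

Lemma zext_in v y : Omega y -> zext v y = v y.
Proof. by move=> Oy; rewrite /zext indicE mem_set// mul1r. Qed.

Lemma theta_gt0 : 0 < t.
Proof. by have [/andP[]] := thetaP oO Ox (mulr_gt0 Q0 e0). Qed.

Lemma sd_zext v y : enorm y < Q * eps -> sd v x y = sd (zext v) x y.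
Proof.
move=> hy; have [_ hb _] := thetaP oO Ox (mulr_gt0 Q0 e0); have t0 := theta_gt0.
rewrite /second_difference !zext_in//; apply: hb; rewrite /eball /= addrC addKr ?enormN enormZ gtr0_norm//.
  by rewrite ltr_pM2l.
by rewrite ltr_pM2l.
Qed.

Lemma mulM_lt (z : rV) : enorm z < 1 -> enorm (eps *: (z *m M)) < Q * eps.
Proof.
move=> z1; rewrite enormZ gtr0_norm// mulrC ltr_pM2r//; apply: le_lt_trans (nM z) _.
by rewrite -[ltRHS]mulr1 ltr_pM2l.
Qed.

Lemma kernel_support (g h : rV -> R) : (forall z, enorm z < 1 -> g z = h z) ->
  (fun z => g z * phi z) = (fun z => h z * phi z).
Proof.
move=> gh; apply/funext => z; have [z1|z1] := ltP (enorm z) 1; first by rewrite gh.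
by rewrite (kernel_off d0 hphi z1) !mulr0.
Qed.

Lemma sd_measurable v : bms v -> measurable_fun setT (sd v x) /\ bounded_fun (sd v x).
Proof.
move=> bv; have t0 := theta_gt0.
have b1 (s : R) : s != 0 -> bms (fun y : rV => v (x + s *: y)).
  move=> s0; rewrite (_ : (fun y => _) = fun y => v (y *m s%:M + x)).
    by apply: bms_affine => //; rewrite unitmxE det_scalar unitfE expf_neq0.
  by apply/funext => y; rewrite mul_mx_scalar addrC.
have [m1 [M1 h1] _] : bms (fun y : rV => v (x + t *: y)) by apply: b1; rewrite gt_eqF.
have [m2 [M2 h2] _] : bms (fun y : rV => v (x - t *: y)).
  rewrite (_ : (fun y => _) = fun y => v (x + (- t) *: y)).
    by apply: b1; rewrite oppr_eq0 gt_eqF.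
  by apply/funext => y; rewrite scaleNr.
split.
  rewrite /second_difference; apply: measurable_funM; first exact: measurable_cst.
  apply: measurable_funB; last exact: measurable_cst.
  by apply: measurable_funD.
exists (`|(t ^+ 2)^-1| * (M1 + M2 + `|2 * v x|)) => y; rewrite /second_difference normrM ler_wpM2l//.
apply: (le_trans (ler_normB _ _)); rewrite lerD2r.
by apply: (le_trans (ler_normD _ _)); rewrite lerD.
Qed.

Lemma bms_sd v : bms v -> bms (fun z => sd v x (eps *: (z *m M)) * phi z).
Proof.
move=> /sd_measurable[m1 [M1 h1]]; apply: (bmsMr (kernel_bms d0 hphi)).
  rewrite (_ : (fun z => _) = sd v x \o (fun z : rV => z *m (eps *: M) + 0)).
    by apply: measurableT_comp => //; exact: measurable_rV_affine.
  by apply/funext => z /=; rewrite addr0 -scalemxAr.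
by exists M1.
Qed.

(** Substitution [y = eps *: (z *m M)], whose Jacobian cancels [eps ^+ d * \det M]; the support of
    the kernel forces |y| < Q eps. *)
Lemma IepsE v : bms (zext v) ->
  I v = (eps ^+ 2)^-1 * bint (fun z => sd v x (eps *: (z *m M)) * phi z).
Proof.
move=> bv; have [m1 [M1 h1]] := sd_measurable bv.
pose c := (eps ^+ (d + 2) * \det M)^-1.
have iM : (eps^-1 *: invmx M) \in unitmx.
  by rewrite unitmxZ ?unitmx_inv// unitfE invr_neq0 ?gt_eqF.
have uE : (eps *: M) \in unitmx by rewrite unitmxZ// unitfE gt_eqF.
pose g (y : rV) := sd (zext v) x y * c * phi (y *m (eps^-1 *: invmx M) + 0).
have bg : bms g.
  apply: bmsMr; first by apply: bms_affine => //; exact: kernel_bms.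
    by apply: measurable_funM => //; exact: measurable_cst.
  by exists (M1 * `|c|) => y; rewrite normrM ler_wpM2r.
rewrite /Ieps -/(bint _) (eq_bint (g := g)); last first.
  move=> y; rewrite /g addr0 -scalemxAr.
  have [z1|z1] := ltP (enorm (eps^-1 *: (y *m invmx M))) 1; last first.
    by rewrite (kernel_off d0 hphi z1) !mulr0.
  rewrite (sd_zext v (y := y))//.
  have -> : y = eps *: ((eps^-1 *: (y *m invmx M)) *m M).
    by rewrite -scalemxAl mulmxKV// scalerA divff ?scale1r ?gt_eqF.
  exact: mulM_lt.
have E := bint_affine 0 uE bg.
have dE : `|\det (eps *: M)| = eps ^+ d * \det M.
  by rewrite detZ gtr0_norm// mulr_gt0// exprn_gt0.
have dE0 : eps ^+ d * \det M != 0 by rewrite gt_eqF// mulr_gt0// exprn_gt0.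
rewrite dE in E.
have -> : bint g = eps ^+ d * \det M * bint (fun z : rV => g (z *m (eps *: M) + 0)).
  by rewrite E mulrA divff// mul1r.
have S : (fun z => sd v x (eps *: (z *m M)) * phi z) = (fun z => sd (zext v) x (eps *: (z *m M)) * phi z).
  by apply: kernel_support => z z1; apply: sd_zext; exact: mulM_lt.
rewrite S.
rewrite (eq_bint (g := fun z => c * (sd (zext v) x (eps *: (z *m M)) * phi z))); last first.
  move=> z; rewrite /g !addr0 -!scalemxAr -scalemxAl mulmxK// !scalerA mulVf ?gt_eqF// scale1r; ring.
rewrite bintZ; last exact: bms_sd.
rewrite mulrA; congr (_ * _); rewrite /c exprD.
have key (a b e : R) : a != 0 -> b != 0 -> e != 0 -> a * b * (a * e * b)^-1 = e^-1.
  by move=> a1 b1 e1; field; rewrite a1 b1 e1.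
by apply: key; rewrite gt_eqF// exprn_gt0.
Qed.

Lemma bms_sd_zext v : bms (zext v) -> bms (fun z => sd v x (eps *: (z *m M)) * phi z).
Proof.
move=> bv; rewrite (_ : (fun z => _) = (fun z => sd (zext v) x (eps *: (z *m M)) * phi z)).
  exact: bms_sd.
by apply: kernel_support => z z1; apply: sd_zext; exact: mulM_lt.
Qed.

Lemma IepsB v w : bms (zext v) -> bms (zext w) -> I (fun y => v y - w y) = I v - I w.
Proof.
move=> bv bw; have bvw : bms (zext (fun y => v y - w y)).
  rewrite (_ : zext _ = fun y => zext v y - zext w y); first exact: bmsB.
  by apply/funext => y; rewrite /zext mulrBr.
rewrite !IepsE// -mulrBr -bintB; [|exact: bms_sd_zext|exact: bms_sd_zext].
by congr (_ * _); apply: eq_bint => z; rewrite /second_difference; ring.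
Qed.

(** The operator is exact on quadratics by [kernel_quad]; the remainder [k |y|^2] is integrated with
    |y| <= Q eps |z| and the second moment [d]. *)
Lemma Ieps_quad v (H : 'M[R]_d) (k : R) : bms (zext v) -> 0 <= k ->
  (forall y, enorm y < Q * eps -> `|sd v x y - quad H y| <= k * enorm y ^+ 2) ->
  `|I v - mdot (M *m M) H| <= k * Q ^+ 2 * d%:R.
Proof.
move=> bv k0 hk; have [bq Eq] := kernel_quad d0 hphi H sM.
have e20 : 0 < eps ^+ 2 by rewrite exprn_gt0.
have qZ z : quad H (eps *: (z *m M)) = eps ^+ 2 * quad H (z *m M).
  rewrite /quad mulr_sumr; apply: eq_bigr => a _; rewrite mulr_sumr; apply: eq_bigr => b _.
  by rewrite !mxE; ring.
rewrite IepsE// -Eq -[bint (fun z => quad _ _ * _)](mulKf (lt0r_neq0 e20)) -mulrBr.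
rewrite -(bintZ _ bq) -bintB; [|exact: bms_sd_zext|exact: bmsZ].
rewrite normrM gtr0_norm ?invr_gt0// mulrC ler_pdivrMr//.
have b1 : bms (fun z => sd v x (eps *: (z *m M)) * phi z - eps ^+ 2 * (quad H (z *m M) * phi z)).
  by apply: bmsB; [exact: bms_sd_zext|exact: bmsZ].
have bphi2 : bms (fun z => enorm z ^+ 2 * phi z).
  rewrite (_ : (fun z => _) = fun z : rV => \sum_a z 0 a * z 0 a * phi z).
    by apply: bms_sum => a _; exact: bms_moment.
  by apply/funext => z; rewrite -dotxx dot_sum mulr_suml.
apply: (le_trans (le_normr_bint b1)).
have -> : k * Q ^+ 2 * d%:R * eps ^+ 2 = bint (fun z => k * Q ^+ 2 * eps ^+ 2 * (enorm z ^+ 2 * phi z)).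
  by rewrite bintZ// /bint (_ : \int[_]_z _ = d%:R); [ring|case: hphi].
apply: le_bint; [exact: bms_norm|exact: bmsZ|].
move=> z; rewrite mulrA -qZ -mulrBl normrM.
have [_ phi0 _ _ _] := hphi; rewrite (ger0_norm (phi0 z)) [leRHS]mulrA.
have [z1|z1] := ltP (enorm z) 1; last by rewrite (kernel_off d0 hphi z1) !mulr0.
rewrite ler_wpM2r//; apply: (le_trans (hk _ (mulM_lt z1))).
rewrite -!mulrA ler_wpM2l// enormZ gtr0_norm// exprMn.
rewrite (_ : Q * _ = eps ^+ 2 * (Q * enorm z) ^+ 2); last by ring.
rewrite ler_pM2l//.
by rewrite lerXn2r ?nnegrE ?enorm_ge0 ?mulr_ge0 ?enorm_ge0 ?(ltW Q0).
Qed.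

(** A crude bound meant for [u - u_G]: the weights 1, 1 and 2 of the second difference give
    [4 * E]. *)
Lemma Ieps_small v (E : R) : bms (zext v) -> (forall y, Omega y -> `|v y| <= E) ->
  `|I v| <= (eps ^+ 2)^-1 * (t ^+ 2)^-1 * (4 * E * bint phi).
Proof.
move=> bv hE; have t0 := theta_gt0; rewrite IepsE// normrM.
have e20 : 0 < (eps ^+ 2)^-1 by rewrite invr_gt0 exprn_gt0.
have t20 : 0 < (t ^+ 2)^-1 by rewrite invr_gt0 exprn_gt0.
rewrite (gtr0_norm e20) -[leRHS]mulrA; apply: ler_wpM2l; first exact: ltW.
have bp := kernel_bms d0 hphi.
rewrite mulrA -bintZ//; apply: (le_trans (le_normr_bint (bms_sd_zext bv))).
apply: le_bint; [by apply: bms_norm; exact: bms_sd_zext|exact: bmsZ|].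
move=> z; rewrite normrM; have [_ phi0 _ _ _] := hphi; rewrite (ger0_norm (phi0 z)).
have [z1|z1] := ltP (enorm z) 1; last by rewrite (kernel_off d0 hphi z1) !mulr0.
apply: ler_wpM2r => //; rewrite /second_difference normrM (gtr0_norm t20); apply: ler_wpM2l; first exact: ltW.
have [_ hb _] := thetaP oO Ox (mulr_gt0 Q0 e0).
have hy := mulM_lt z1; set y := eps *: _ in hy *.
have O1 : Omega (x + t *: y).
  by apply: hb; rewrite /eball /= addrC addKr enormZ gtr0_norm// ltr_pM2l.
have O2 : Omega (x - t *: y).
  by apply: hb; rewrite /eball /= addrC addKr enormN enormZ gtr0_norm// ltr_pM2l.
have h1 := hE _ O1; have h2 := hE _ O2; have h3 := hE _ Ox.
move: h1 h2 h3; rewrite !ler_norml => /andP[? ?] /andP[? ?] /andP[? ?].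
by apply/andP; split; lra.
Qed.

(** Either [theta] is 1 or the dilated radius [theta * Q * eps] is at least [r]; the sum covers both
    cases. *)
Lemma theta_scale r : 0 < r -> eball x r `<=` Omega ->
  (eps ^+ 2)^-1 * (t ^+ 2)^-1 <= (eps ^+ 2)^-1 + Q ^+ 2 / r ^+ 2.
Proof.
move=> r0 hr; have t0 := theta_gt0; have [_ _ /(_ r r0 hr)] := thetaP oO Ox (mulr_gt0 Q0 e0).
have e20 : 0 < (eps ^+ 2)^-1 by rewrite invr_gt0 exprn_gt0.
have inv2 s : 0 < s -> s <= t -> (t ^+ 2)^-1 <= (s ^+ 2)^-1.
  move=> s0 st; rewrite lef_pV2 ?posrE ?exprn_gt0//.
  by rewrite lerXn2r// nnegrE ltW.
rewrite minEle; case: ifP => _ ht.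
  have := inv2 1 ltr01 ht; rewrite expr1n invr1 => h.
  apply: (@le_trans _ _ (eps ^+ 2)^-1); first by rewrite ler_piMr// ltW.
  by rewrite lerDl divr_ge0// ?exprn_ge0 ?ltW.
have s0 : 0 < r / (Q * eps) by rewrite divr_gt0// mulr_gt0.
apply: (@le_trans _ _ ((eps ^+ 2)^-1 * ((r / (Q * eps)) ^+ 2)^-1)).
  by rewrite ler_wpM2l ?(ltW e20)// inv2.
have -> : (eps ^+ 2)^-1 * ((r / (Q * eps)) ^+ 2)^-1 = Q ^+ 2 / r ^+ 2.
  by field; rewrite !gt_eqF.
by rewrite lerDr ltW.
Qed.

Lemma theta_far r : Q * eps <= r -> eball x r `<=` Omega -> t = 1.
Proof.
move=> rq hr; have qe := mulr_gt0 Q0 e0.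
have [/andP[_ t1] _ /(_ r (lt_le_trans qe rq) hr)] := thetaP oO Ox qe.
by rewrite min_l ?ler_pdivlMr ?mul1r// => h; apply/eqP; rewrite eq_le t1 h.
Qed.

Lemma sd_le (u : rV -> R) (Du : 'I_d -> rV -> R) (D2u : 'I_d -> 'I_d -> rV -> R)
    (H : 'M[R]_d) (k r : R) (y : rV) : 0 <= k ->
  bms (zext u) -> continuous (zext u) -> (forall a, bms (Du a)) -> (forall a b, bms (D2u a b)) ->
  (forall a, weakp Omega a (zext u) (Du a)) -> (forall a b, weakp Omega b (Du a) (D2u a b)) ->
  eball x r `<=` Omega -> t * (Q * eps) <= r ->
  {ae lebesgue_rV d, forall z, eball x r z -> enorm (\matrix_(a, b) D2u a b z - H) <= k} ->
  enorm y < Q * eps -> `|sd u x y - quad H y| <= 2 * k * enorm y ^+ 2.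
Proof.
move=> k0 bu cu bD bD2 w1 w2 hr tr hk hy; have t0 := theta_gt0.
have t20 : 0 < t ^+ 2 by rewrite exprn_gt0.
have ty : enorm (t *: y) < r.
  by apply: lt_le_trans tr; rewrite enormZ gtr0_norm// ltr_pM2l.
have := second_difference_le d0 hphi k0 bu bD bD2 w1 w2 hr (fun z _ => cu z) hk ty.
rewrite sd_zext// /second_difference => h.
have qZ : quad H y = (t ^+ 2)^-1 * quad H (t *: y).
  rewrite /quad mulr_sumr; apply: eq_bigr => a _; rewrite mulr_sumr; apply: eq_bigr => b _.
  by rewrite !mxE; field; rewrite gt_eqF.
rewrite qZ -mulrBr normrM gtr0_norm ?invr_gt0// mulrC ler_pdivrMr//.
apply: (le_trans h); rewrite enormZ gtr0_norm// exprMn le_eqVlt; apply/orP; left; apply/eqP; ring.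
Qed.

End integral_operator.

(** * Borel versions *)

Section borel_versions.
Context {R : realType} {d : nat}.
Local Notation rV := 'rV[R]_d.
Local Notation leb := (lebesgue_rV (R := R) d).
Implicit Types (U : set rV) (v w : rV -> R).

Lemma lebesgue_setT_gt0 : (0 < leb setT)%E.
Proof.
apply: lt_le_trans (eball_gt0 (0 : rV) (r := 1) ltr01) _.
by apply: le_measure; rewrite ?inE//; exact: eball_measurable.
Qed.

Lemma Loo_ae U v (M : R) : (Lp_norm +oo U v <= M%:E)%E ->
  {ae leb, forall x, U x -> `|v x| <= M}.
Proof.
rewrite /Lp_norm unlock /= lebesgue_setT_gt0 => /ess_supP; apply: filterS => x /= h Ux.
by move: h; rewrite patchE mem_set//= lee_fin.
Qed.

Lemma ae_Loo U v (M : R) : 0 <= M -> {ae leb, forall x, U x -> `|v x| <= M} ->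
  (Lp_norm +oo U v <= M%:E)%E.
Proof.
move=> M0 h; rewrite /Lp_norm unlock /= lebesgue_setT_gt0; apply/ess_supP.
move: h; apply: filterS => x /= h; rewrite patchE lee_fin.
by case: ifPn => [/set_mem/h//|_]; rewrite normr0.
Qed.

Lemma Loo_finite U v : (Lp_norm +oo U v < +oo)%E ->
  exists2 M : R, 0 <= M & (Lp_norm +oo U v <= M%:E)%E.
Proof.
have := Lnorm_ge0 leb +oo%E (EFin \o (v \_ U)); rewrite -/(Lp_norm _ _ _).
by case: (Lp_norm _ _ _) => // r; rewrite lee_fin => r0 _; exists r.
Qed.

(** Clipping at [|M|] turns an almost everywhere bound into a bound everywhere and alters the
    function only on a null subset of [U]. *)
Lemma borel_version U v (M : R) : open U -> (exists r : R, U `<=` eball 0 r) ->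
  lebesgue_measurable_fun U v -> {ae leb, forall x, U x -> `|v x| <= M} ->
  exists w, [/\ bms w, forall x, ~ U x -> w x = 0 & {ae leb, forall x, U x -> v x = w x}].
Proof.
move=> oU [r hr] [w mw vw] hM; pose c := `|M|; have c0 : 0 <= c by exact: normr_ge0.
pose w1 := fun x => Num.max (- c) (Num.min c ((w \_ U) x)).
exists w1; have off x : ~ U x -> w1 x = 0.
  move=> nx; rewrite /w1 patchE memNset// min_r// max_r// oppr_le0//.
split=> //.
- split.
  + apply: measurable_maxr; first exact: measurable_cst.
    apply: measurable_minr; first exact: measurable_cst.
    by apply/(measurable_restrictT _ (open_rV_measurable oU)).
  + exists c => x; rewrite /w1 ler_norml le_max lexx /= ge_max ge_min lexx /=.
    by rewrite (le_trans _ c0)// oppr_le0.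
  + exists r => x hx; apply: off => /hr; rewrite /eball /= subr0; lra.
move: vw hM; apply: filterS2 => x h1 h2 Ux; rewrite /w1 patchE mem_set//.
have := h2 Ux; rewrite (h1 Ux) => h; have hc : `|w x| <= c by apply: le_trans h (ler_norm _).
by move: hc; rewrite ler_norml => /andP[h3 h4]; rewrite min_r// max_r.
Qed.

Lemma weakp_version U i v w v' w' : weak_partial U i v w ->
  {ae leb, forall x, U x -> v x = v' x} -> (forall x, ~ U x -> v' x = 0) ->
  {ae leb, forall x, U x -> w x = w' x} -> (forall x, ~ U x -> w' x = 0) -> weakp U i v' w'.
Proof.
have key (p p' q : rV -> R) : {ae leb, forall x, U x -> p x = p' x} -> (forall x, ~ U x -> p' x = 0) ->
    \int[leb]_(x in U) (p x * q x) = bint (fun x => p' x * q x).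
  move=> h1 h2; rewrite bint_set; apply: bint_ae_eq; move: h1; apply: filterS => x h1.
  rewrite indicE; have [Ux|nUx] := pselect (U x); first by rewrite mem_set// mul1r h1.
  by rewrite memNset// mul0r h2// mul0r.
by move=> h h1 h2 h3 h4 psi hpsi; have := h psi hpsi; rewrite (key _ v')// (key _ w').
Qed.

Lemma W2oo_version U (u : rV -> R) (Du : rV -> rV) (D2u : rV -> 'M[R]_d) : open U ->
  (exists r : R, U `<=` eball 0 r) -> W2oo U u Du D2u ->
  exists (Du' : 'I_d -> rV -> R) (D2u' : 'I_d -> 'I_d -> rV -> R),
  [/\ (forall i, bms (Du' i)) /\ (forall i j, bms (D2u' i j)),
      forall i, weakp U i (zext U u) (Du' i),
      forall i j, weakp U j (Du' i) (D2u' i j),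
      {ae leb, forall x, U x -> Du x = \row_i Du' i x} &
      {ae leb, forall x, U x -> D2u x = \matrix_(i, j) D2u' i j x}].
Proof.
move=> oU bU [_ hD hD2 w1 w2].
have ver v : Lp +oo U v -> exists w, [/\ bms w, forall x, ~ U x -> w x = 0 & {ae leb, forall x, U x -> v x = w x}].
  by move=> [mv /Loo_finite[M _ /Loo_ae hM]]; exact: borel_version hM.
have [Du' h1] := choice (fun i => ver _ (hD i)).
have [D2' h2] := choice (fun ij : 'I_d * 'I_d => ver _ (hD2 ij.1 ij.2)).
exists Du', (fun i j => D2' (i, j)); split.
- by split=> [i|i j]; [case: (h1 i)|case: (h2 (i, j))].
- move=> i; have [_ o1 a1] := h1 i; apply: (weakp_version (w1 i)) => //.
    by apply: nearW => x Ux; rewrite zext_in.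
  by move=> x nx; rewrite /zext indicE memNset// mul0r.
- move=> i j; have [_ o1 a1] := h1 i; have [_ o2 a2] := h2 (i, j).
  exact: (weakp_version (w2 i j)).
- have : forall i, {ae leb, forall x, U x -> Du x 0 i = Du' i x} by move=> i; case: (h1 i).
  move=> /filter_forall; apply: filterS => x h Ux; apply/rowP => i.
  by rewrite mxE h.
- have : forall ij : 'I_d * 'I_d, {ae leb, forall x, U x -> D2u x ij.1 ij.2 = D2' ij x}.
    by move=> ij; case: (h2 ij).
  move=> /filter_forall; apply: filterS => x h Ux; apply/matrixP => i j.
  by rewrite mxE (h (i, j)).
Qed.

Lemma coefficient_bounds (A : 'M[R]_d) (lambda Lambda : R) : 0 < lambda -> lambda <= Lambda ->
  A^T = A -> mx_le lambda%:M A -> mx_le A Lambda%:M -> opb A Lambda.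
Proof.
move=> l0 lL sA h1 h2; apply: sym_opb => // [|x]; first by lra.
have := h1 x; have := h2 x; rewrite !dot_scalar => h3 h4.
rewrite ger0_norm// (le_trans _ h4)// mulr_ge0 ?sqr_ge0// ltW//.
Qed.

Lemma coefficient_version U (A : rV -> 'M[R]_d) (lambda Lambda : R) : 0 < lambda -> lambda <= Lambda ->
  open U -> (exists r : R, U `<=` eball 0 r) -> coefficient_matrix U lambda Lambda A ->
  exists A' : 'I_d -> 'I_d -> rV -> R, (forall i j, bms (A' i j)) /\
    {ae leb, forall x, U x -> [/\ A x = \matrix_(i, j) A' i j x, (A x)^T = A x,
        mx_le lambda%:M (A x), mx_le (A x) Lambda%:M & opb (A x) Lambda]}.
Proof.
move=> l0 lL oU bU [mA sA bA].
have bA' : {ae leb, forall x, U x -> opb (A x) Lambda}.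
  by move: bA; apply: filterS => x h Ux; have [h1 h2] := h Ux; apply: coefficient_bounds h1 h2 => //; exact: sA.
have ver (ij : 'I_d * 'I_d) : exists w, bms w /\ {ae leb, forall x, U x -> A x ij.1 ij.2 = w x}.
  have [|w [h1 _ h2]] := borel_version oU bU (mA ij.1 ij.2) (M := Lambda); last by exists w.
  by move: bA'; apply: filterS => x h Ux; exact: opb_entry (h Ux).
have [A' hA'] := choice ver; exists (fun i j => A' (i, j)); split.
  by move=> i j; case: (hA' (i, j)).
have : forall ij : 'I_d * 'I_d, {ae leb, forall x, U x -> A x ij.1 ij.2 = A' ij x}.
  by move=> ij; case: (hA' ij).
move=> /filter_forall h; move: h bA bA'; apply: filterS3 => x h h1 h2 Ux.
have [? ?] := h1 Ux; split => //; [|exact: sA|exact: h2].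
by apply/matrixP => i j; rewrite mxE (h (i, j) Ux).
Qed.

(** A violation at one point would persist in a ball, which has positive measure. *)
Lemma ae_le_continuous U (v : rV -> R) (M : R) : open U ->
  (forall x, U x -> {for x, continuous v}) -> {ae leb, forall x, U x -> `|v x| <= M} ->
  forall x, U x -> `|v x| <= M.
Proof.
move=> oU cv h x Ux; rewrite leNgt; apply/negP => lt.
have e0 : 0 < `|v x| - M by rewrite subr_gt0.
have [r r0 hr] := (continuous_eballP _ _).1 (cv x Ux) _ e0.
have [s s0 hs] := (open_eballP _).1 oU x Ux.
pose m := Num.min r s; have m0 : 0 < m by rewrite /m lt_min r0.
suff : leb (eball x m) = 0%E by have := eball_gt0 x m0; move=> /[swap] ->; rewrite ltxx.
apply/eqP; rewrite eq_le measure_ge0 andbT.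
move: h => [N [mN N0 hN]]; rewrite -N0; apply: le_measure; rewrite ?inE//.
  exact: eball_measurable.
move=> y ym; apply: hN => /= hy.
have yr : eball x r y by move: ym; rewrite /eball /= /m lt_min => /andP[].
have ys : eball x s y by move: ym; rewrite /eball /= /m lt_min => /andP[].
have := hr y yr; have := hy (hs y ys) => h1 h2.
by have := ler_distD (v y) (v x) 0; rewrite !subr0; lra.
Qed.

End borel_versions.

(** * Classical and weak Hessians *)

Section classical_hessian.
Context {R : realType} {d : nat}.
Local Notation rV := 'rV[R]_d.
Local Notation leb := (lebesgue_rV (R := R) d).
Local Notation e_ i := (delta_mx 0 i : rV).
Implicit Types (U : set rV) (v w : rV -> R).

Lemma closed_ball_compact (S : set rV) (r : R) : closed S -> S `<=` eball 0 r -> compact S.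
Proof.
move=> cS hr; apply: bounded_closed_compact => //.
exact: bounded_eball hr.
Qed.

(** Compactness of the closure bounds the continuous extension, and openness of [U] makes its
    superlevel sets in [U] open. *)
Lemma zext_bms U v : open U -> (exists r : R, U `<=` eball 0 r) ->
  continuous_upto_boundary U v -> bms (zext U v).
Proof.
move=> oU [r hr] [w cw vw].
have E : zext U v = zext U w.
  apply/funext => x; rewrite /zext; have [Ux|nUx] := pselect (U x).
    by rewrite vw// mem_set.
  by rewrite indicE memNset// !mul0r.
have cK : compact (closure U).
  by apply: closed_ball_compact (closure_eball hr); exact: closed_closure.
have cnw : {within closure U, continuous (fun x => `|w x|)}.
  by move=> x; apply: cvg_norm; exact: cw.
have [M hM] : exists M : R, forall x, closure U x -> `|w x| <= M.
  have [[x0 Ux0]|noU] := pselect (U !=set0); last first.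
    exists 0 => x cx; exfalso; apply: noU; have [y [Uy _]] := cx _ filterT.
    by exists y.
  have [c _ hc] := @EVT_max_rV R d _ (closure U) (ex_intro _ x0 (subset_closure Ux0)) cK cnw.
  by exists `|w c| => x cx; apply: hc; rewrite inE.
have cU x : U x -> {for x, continuous w}.
  move=> Ux; apply/continuous_eballP => e e0.
  have := (subspace_continuousP _ _).1 cw x (subset_closure Ux) => /cvgrPdist_lt/(_ e e0).
  rewrite near_withinE => /nbhs_eballP[s s0 hs].
  have [s' s'0 hs'] := (open_eballP _).1 oU x Ux.
  exists (Num.min s s'); first by rewrite lt_min s0.
  move=> y; rewrite /eball /= lt_min => /andP[y1 y2]; apply: hs => //.
  by apply: subset_closure; exact: hs'.
rewrite E; split.
- apply: (@measurability _ _ _ _ _ _ (@RGenOInfty.G R)); first exact: RGenOInfty.measurableE.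
  move=> _ [_ [a ->] <-]; rewrite setTI.
  have oP : measurable [set x | U x /\ a < w x].
    apply: open_rV_measurable; apply/open_eballP => x [Ux ax].
    have e0 : 0 < w x - a by rewrite subr_gt0.
    have [s s0 hs] := (continuous_eballP _ _).1 (cU x Ux) _ e0.
    have [s' s'0 hs'] := (open_eballP _).1 oU x Ux.
    exists (Num.min s s'); first by rewrite lt_min s0.
    move=> y; rewrite /eball /= lt_min => /andP[y1 y2]; split; first exact: hs'.
    by have := hs y y1; rewrite ltr_norml => /andP[]; lra.
  have mU : measurable (~` U) by apply: measurableC; exact: open_rV_measurable.
  have [a0|a0] := ltP a 0.
    rewrite (_ : _ @^-1` _ = [set x | U x /\ a < w x] `|` ~` U); first exact: measurableU.
    apply/seteqP; split => x /=; rewrite in_itv /= andbT.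
      have [Ux|nUx] := pselect (U x); last by right.
      by rewrite zext_in// => ?; left.
    move=> [[Ux ax]|nUx]; first by rewrite zext_in.
    by rewrite /zext indicE memNset// mul0r.
  rewrite (_ : _ @^-1` _ = [set x | U x /\ a < w x])//.
  apply/seteqP; split => x /=; rewrite in_itv /= andbT.
    have [Ux|nUx] := pselect (U x); first by rewrite zext_in.
    by rewrite /zext indicE memNset// mul0r ltNge a0.
  by move=> [Ux ax]; rewrite zext_in.
- exists `|M| => x; rewrite /zext indicE; have [Ux|nUx] := pselect (U x).
    by rewrite mem_set// mul1r (le_trans (hM x _))// ?ler_norm//; exact: subset_closure.
  by rewrite memNset// mul0r normr0.
- exists r => x hx; rewrite /zext indicE memNset ?mul0r// => /hr.
  by rewrite /eball /= subr0; lra.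
Qed.

Lemma test_outside U (psi : rV -> R) x : test_function U psi -> ~ U x -> psi x = 0.
Proof. by move=> h nx; have [r r0 hr] := test_off h nx; apply: hr; exact: eball_center. Qed.

(** The difference of the two weak derivatives is orthogonal to every test function. *)
Lemma weakp_unique (phi : rV -> R) U i v v' w w' : (0 < d)%N -> kernel_function phi -> open U ->
  bms w -> bms w' -> weakp U i v w -> weakp U i v' w' ->
  {ae leb, forall x, U x -> v x = v' x} -> {ae leb, forall x, U x -> w x = w' x}.
Proof.
move=> d0 hphi oU bw bw' h h' E.
have := du_bois_reymond d0 hphi (bmsB bw bw') oU _.
move=> H; have : {ae leb, forall x, U x -> w x - w' x = 0}.
  apply: H => psi hpsi; have bp := test_bms d0 hpsi.
  rewrite (eq_bint (g := fun x => w x * psi x - w' x * psi x)); last by move=> x; ring.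
  rewrite bintB; [|exact: bmsMM|exact: bmsMM].
  have e1 := h _ hpsi; have e2 := h' _ hpsi.
  have e3 : bint (fun x => v x * partial i psi x) = bint (fun x => v' x * partial i psi x).
    apply: bint_ae_eq; move: E; apply: filterS => x E.
    have [Ux|nUx] := pselect (U x); first by rewrite E.
    by rewrite (test_outside (test_partial i hpsi) nUx) !mulr0.
  by move: e1 e2; rewrite e3; lra.
by apply: filterS => x h1 /h1; lra.
Qed.

Lemma weakp_sub U V i v w : V `<=` U -> weakp U i v w -> weakp V i v w.
Proof.
move=> VU h psi [h1 h2 h3]; apply: h; split=> //.
exact: subset_trans VU.
Qed.

(** Classical derivatives in [U] are weak ones, and weak ones are unique: this identifies first the
    gradient, then the Hessian. *)
Lemma hessian_ae (phi : rV -> R) (Omega U : set rV) (u : rV -> R) (Du : 'I_d -> rV -> R)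
    (D2u : 'I_d -> 'I_d -> rV -> R) (alpha K : R) : (0 < d)%N -> kernel_function phi ->
  open Omega -> (exists r : R, Omega `<=` eball 0 r) -> open U -> U `<=` Omega ->
  bms (zext Omega u) -> (forall i, bms (Du i)) -> (forall i j, bms (D2u i j)) ->
  (forall i, weakp Omega i (zext Omega u) (Du i)) ->
  (forall i j, weakp Omega j (Du i) (D2u i j)) ->
  C2alpha alpha U u K ->
  {ae leb, forall x, U x -> \matrix_(i, j) D2u i j x = hess u x}.
Proof.
move=> d0 hphi oO bO oU UO bu bD bD2 w1 w2 [_ hd hd2 _].
have bU : exists r : R, U `<=` eball 0 r.
  by have [r hr] := bO; exists r; exact: subset_trans hr.
have near (W : set rV) (v : rV -> R) i x : open W -> U `<=` W -> U x ->
    derivable v x (e_ i) -> is_derive x (e_ i) (zext W v) (partial i v x).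
  move=> oW UW Ux dv; have [r r0 hr] := (open_eballP _).1 oU x Ux.
  apply: (near_eq_is_derive (f := v) r0); last exact: is_derive_partial.
  by move=> y /hr Uy; rewrite zext_in//; exact: UW.
have bp i : bms (zext U (partial i u)) by apply: zext_bms => //; case: (hd i).
have bp2 i j : bms (zext U (partial j (partial i u))) by apply: zext_bms => //; case: (hd2 i j).
have E1 i : {ae leb, forall x, U x -> Du i x = zext U (partial i u) x}.
  apply: (weakp_unique (phi := phi) (i := i) (v := zext Omega u) (v' := zext Omega u)) => //.
  - exact: weakp_sub UO (w1 i).
  - apply: classical_weakp => // x Ux; rewrite zext_in//.
    by apply: near => //; case: (hd i) => h _; apply: h; exact: mem_set.
  - by apply: nearW.
have E2 (ij : 'I_d * 'I_d) : {ae leb, forall x, U x -> D2u ij.1 ij.2 x = zext U (partial ij.2 (partial ij.1 u)) x}.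
  apply: (weakp_unique (phi := phi) (i := ij.2) (v := Du ij.1) (v' := zext U (partial ij.1 u))) => //.
  - exact: weakp_sub UO (w2 ij.1 ij.2).
  - apply: classical_weakp => // x Ux; rewrite zext_in//.
    by apply: near => //; case: (hd2 ij.1 ij.2) => h _; apply: h; exact: mem_set.
move: E2 => /filter_forall; apply: filterS => x h Ux; apply/matrixP => i j.
by rewrite !mxE (h (i, j))// zext_in.
Qed.

End classical_hessian.

(** * Consistency at one node *)

Section bounded_measurable.
Context {R : realType} {d : nat}.
Local Notation rV := 'rV[R]_d.
Local Notation leb := (lebesgue_rV (R := R) d).

(** Like [bms] but with no condition at infinity, so as to admit constants; a factor of bounded
    support is supplied at integration. *)
Definition mb (f : rV -> R) := measurable_fun setT f /\ bounded_fun f.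

Lemma bms_mb f : bms f -> mb f. Proof. by case. Qed.

Lemma mb_cst (c : R) : mb (fun=> c).
Proof. by split; [exact: measurable_cst|exists `|c|]. Qed.

Lemma mbD f g : mb f -> mb g -> mb (fun x => f x + g x).
Proof.
move=> [mf [M hM]] [mg [M' hM']]; split; first exact: measurable_funD.
by exists (M + M') => x; apply: (le_trans (ler_normD _ _)); exact: lerD.
Qed.

Lemma mbM f g : mb f -> mb g -> mb (fun x => f x * g x).
Proof.
move=> [mf [M hM]] [mg [M' hM']]; split; first exact: measurable_funM.
by exists (M * M') => x; rewrite normrM ler_pM.
Qed.

Lemma mbB f g : mb f -> mb g -> mb (fun x => f x - g x).
Proof.
move=> hf hg; rewrite (_ : (fun x => _) = fun x => f x + (-1) * g x).
  by apply: mbD => //; apply: mbM => //; exact: mb_cst.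
by apply/funext => x; ring.
Qed.

Lemma mb_sum I (s : seq I) (F : I -> rV -> R) : (forall i, mb (F i)) ->
  mb (fun x => \sum_(i <- s) F i x).
Proof.
move=> hF; elim: s => [|i s IH].
  rewrite (_ : (fun x => _) = fun=> 0); first exact: mb_cst.
  by apply/funext => x; rewrite big_nil.
rewrite (_ : (fun x => _) = fun x => F i x + \sum_(j <- s) F j x); first exact: mbD.
by apply/funext => x; rewrite big_cons.
Qed.

Lemma mbX f n : mb f -> mb (fun x => f x ^+ n).
Proof.
move=> hf; elim: n => [|n IH].
  rewrite (_ : (fun x => _) = fun=> 1); first exact: mb_cst.
  by apply/funext => x; rewrite expr0.
rewrite (_ : (fun x => _) = fun x => f x * f x ^+ n); first exact: mbM.
by apply/funext => x; rewrite exprS.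
Qed.

Lemma mb_mdot m n (C : 'M[R]_(m, n)) (F : 'I_m -> 'I_n -> rV -> R) : (forall i j, mb (F i j)) ->
  mb (fun x => mdot C (\matrix_(i, j) F i j x)).
Proof.
move=> hF; rewrite (_ : (fun x => _) = fun x => \sum_i \sum_j C i j * F i j x).
  by apply: mb_sum => i; apply: mb_sum => j; apply: mbM => //; exact: mb_cst.
by apply/funext => x; rewrite /mdot; apply: eq_bigr => i _; apply: eq_bigr => j _; rewrite mxE.
Qed.

Lemma mb_enorm m n (F : 'I_m -> 'I_n -> rV -> R) : (forall i j, mb (F i j)) ->
  mb (fun x => enorm (\matrix_(i, j) F i j x)).
Proof.
move=> hF; split.
  rewrite (_ : (fun x => _) = Num.sqrt \o (fun x => \sum_i \sum_j F i j x ^+ 2)).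
    apply: measurableT_comp; first by apply: continuous_measurable_fun; exact: sqrt_continuous.
    have [] // : mb (fun x => \sum_i \sum_j F i j x ^+ 2).
    by apply: mb_sum => i; apply: mb_sum => j; exact: mbX.
  apply/funext => x /=; rewrite /enorm; congr Num.sqrt; apply: eq_bigr => i _.
  by apply: eq_bigr => j _; rewrite mxE.
have [M hM] := choice (fun ij : 'I_m * 'I_n => (hF ij.1 ij.2).2).
exists (\sum_i \sum_j M (i, j)) => x; rewrite ger0_norm ?enorm_ge0//.
apply: (le_trans (enorm_le_sum _)); apply: ler_sum => i _; apply: ler_sum => j _.
by rewrite mxE; exact: hM (i, j) x.
Qed.

(** The tangent of t^n at [b] lies below the graph for nonnegative arguments; passing from [n] to
    [n + 1] leaves the gap n b^(n-1) (a - b)^2. *)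
Lemma bernoulli_tangent (a b : R) n : 0 <= a -> 0 <= b ->
  b ^+ n + n%:R * b ^+ n.-1 * (a - b) <= a ^+ n.
Proof.
move=> a0 b0; case: n => [|n]; first by rewrite !expr0 mul0r mul0r addr0.
rewrite /=; elim: n => [|n IH]; first by rewrite !expr1 expr0; lra.
have h : a * (b ^+ n.+1 + n.+1%:R * b ^+ n * (a - b)) <= a * a ^+ n.+1 by rewrite ler_wpM2l.
rewrite -exprS in h; apply: le_trans h; rewrite -subr_ge0.
rewrite (_ : _ - _ = n.+1%:R * b ^+ n * (a - b) ^+ 2).
  by rewrite mulr_ge0 ?sqr_ge0// mulr_ge0// exprn_ge0.
rewrite !exprS -[n.+2%:R]natr1; ring.
Qed.

(** Jensen's inequality: integrate the tangent inequality at the mean [m], whose linear term has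
    integral 0. *)
Lemma power_mean (S : set rV) (g : rV -> R) n : bms (\1_S : rV -> R) -> mb g -> (forall x, 0 <= g x) ->
  0 < bint (\1_S) ->
  bint (\1_S) * ((bint (\1_S))^-1 * bint (fun x => \1_S x * g x)) ^+ n <=
    bint (fun x => \1_S x * g x ^+ n).
Proof.
move=> bS hg g0 S0; set s := bint \1_S in S0 *; set m := s^-1 * _.
have b1 f : mb f -> bms (fun x => \1_S x * f x) by move=> [? ?]; exact: bmsM.
have m0 : 0 <= m.
  apply: mulr_ge0; first by rewrite invr_ge0 ltW.
  by apply: bint_ge0 => x; rewrite mulr_ge0 ?indic_ge0.
have E : s * m ^+ n = bint (fun x => \1_S x * (m ^+ n + n%:R * m ^+ n.-1 * (g x - m))).
  rewrite (eq_bint (g := fun x => (m ^+ n - n%:R * m ^+ n.-1 * m) * \1_S x +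
     n%:R * m ^+ n.-1 * (\1_S x * g x))); last by move=> x; ring.
  rewrite bintD; [|exact: bmsZ|by apply: bmsZ; exact: b1].
  rewrite bintZ// bintZ; last exact: b1.
  rewrite -/s (_ : bint (fun x => \1_S x * g x) = s * m); last by rewrite mulrA divff ?mul1r ?gt_eqF.
  ring.
rewrite E; apply: le_bint.
- by apply: b1; apply: mbD; [exact: mb_cst|apply: mbM; [exact: mb_cst|apply: mbB => //; exact: mb_cst]].
- by apply: b1; exact: mbX.
- by move=> x; apply: ler_wpM2l; [exact: indic_ge0|exact: bernoulli_tangent].
Qed.

End bounded_measurable.

Section node_consistency.
Context {R : realType} {d : nat} (Omega : set 'rV[R]_d) (T : mesh R d).
Local Notation rV := 'rV[R]_d.
Local Notation leb := (lebesgue_rV (R := R) d).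
Variables (lambda Lambda eps L : R) (phi : rV -> R).
Variables (A : rV -> 'M[R]_d) (f u wG : rV -> R) (Du : rV -> rV) (D2u : rV -> 'M[R]_d).
Variables (A' D2 : 'I_d -> 'I_d -> rV -> R) (D1 : 'I_d -> rV -> R) (E : R).
Hypotheses (d0 : (0 < d)%N) (l0 : 0 < lambda) (lL : lambda <= Lambda) (e0 : 0 < eps).
Hypotheses (hphi : kernel_function phi) (hT : mesh_of Omega T) (Omega0 : Omega !=set0).
Hypotheses (L0 : 0 < L)
  (hL : forall (K : {set 'I_(nb_nodes T)}) i, K \in elements T -> enorm (bgrad K i) <= L).
Hypotheses (bA : forall a b, bms (A' a b))
  (hA : {ae leb, forall x, Omega x -> [/\ A x = \matrix_(a, b) A' a b x, (A x)^T = A x,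
     mx_le lambda%:M (A x), mx_le (A x) Lambda%:M & opb (A x) Lambda]}).
Hypotheses (bD1 : forall a, bms (D1 a)) (bD2 : forall a b, bms (D2 a b))
  (w1 : forall a, weakp Omega a (zext Omega u) (D1 a)) (w2 : forall a b, weakp Omega b (D1 a) (D2 a b))
  (hD1 : {ae leb, forall x, Omega x -> Du x = \row_a D1 a x})
  (hD2 : {ae leb, forall x, Omega x -> D2u x = \matrix_(a, b) D2 a b x}).
Hypotheses (bu : bms (zext Omega u)) (cu : continuous (zext Omega u)).
Hypotheses (hsol : solves Omega A f D2u) (hG : galerkin_projection Omega T Du wG)
  (hE : forall x, Omega x -> `|u x - wG x| <= E).
Variable i : 'I_(nb_nodes T).
Local Notation v := (hat Omega i).
Local Notation x0 := (node i).
Local Notation Q := (Qradius lambda Lambda).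
Local Notation S := (star_measure Omega i).
Local Notation Am x := (\matrix_(a, b) A' a b x).
Local Notation Hm x := (\matrix_(a, b) D2 a b x).
Local Notation h := (mesh_size T).
Hypotheses (hv : is_hat Omega i v) (Oi : Omega x0).

Let oO : open Omega := Omega_open hT.
Let bv : bms v := bms_hat hT hv Oi (ltW L0) (fun K hK => hL i hK).

Lemma star_gt0 : 0 < S.
Proof.
rewrite star_measureE; have r0 : 0 < (2 * L)^-1 by rewrite invr_gt0 mulr_gt0.
apply: lt_le_trans (_ : 0 < bint (\1_(eball x0 (2 * L)^-1))) _.
  by rewrite ball_volume// mulr_gt0 ?exprn_gt0// unit_ball_volume_gt0.
apply: le_bint; [exact: bms_indic_ball|exact: (bms_star hT d0 Omega0 hv Oi)|].
move=> x; apply: le_indic => y hy; apply: subset_closure => /=.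
have := hat_half hT L0 hL hv Oi hy; apply: contraTneq => ->; lra.
Qed.

(** A star is closed and may touch the boundary of the domain, but only along faces of elements. *)
Lemma ae_star : {ae leb, forall x, star Omega i x -> Omega x}.
Proof.
move: (ae_ihull hT d0); apply: filterS => x [[K hK ix]|nx] sx; first exact (ihull_Omega hT hK ix).
exfalso; apply: nx; apply: (closure_hulls hT); move: sx; apply: closure_subset => y /= vy.
by apply: contrapT => /(hat_out hT hv Oi) E0; move: vy; rewrite E0 eqxx.
Qed.

Lemma hat_star x : v x != 0 -> star Omega i x. Proof. by move=> vx; apply: subset_closure. Qed.

Lemma Abar_mdot (C : 'M[R]_d) :
  mdot C (Abar Omega A i) = S^-1 * bint (fun x => \1_(star Omega i) x * mdot C (Am x)).
Proof.
have bS := bms_star hT d0 Omega0 hv Oi.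
have b1 a b : bms (fun x => \1_(star Omega i) x * A' a b x) by exact: bmsMM.
rewrite (eq_bint (g := fun x => \sum_a \sum_b C a b * (\1_(star Omega i) x * A' a b x))); last first.
  move=> x; rewrite /mdot mulr_sumr; apply: eq_bigr => a _; rewrite mulr_sumr.
  by apply: eq_bigr => b _; rewrite mxE mulrCA.
rewrite bint_sum => [|a _]; last by apply: bms_sum => b _; exact: bmsZ.
rewrite /mdot mulr_sumr; apply: eq_bigr => a _.
rewrite bint_sum => [|b _]; last exact: bmsZ.
rewrite mulr_sumr; apply: eq_bigr => b _; rewrite bintZ// mxE bint_set mulrCA; congr (_ * (_ * _)).
apply: bint_ae_eq; move: ae_star hA; apply: filterS2 => x hs hAx.
rewrite indicE; have [sx|nsx] := pselect (star Omega i x); last by rewrite memNset// !mul0r.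
by rewrite mem_set// !mul1r; have [-> _ _ _ _] := hAx (hs sx); rewrite mxE.
Qed.

Lemma quadE (X : 'M[R]_d) (y : rV) : dot (y *m X) y = mdot (y^T *m y) X.
Proof.
rewrite dot_sum /mdot exchange_big; apply: eq_bigr => b _; rewrite mxE mulr_suml.
by apply: eq_bigr => a _; rewrite !mxE big_ord1 !mxE; ring.
Qed.

Lemma Abar_sym : (Abar Omega A i)^T = Abar Omega A i.
Proof.
apply/matrixP => a b; rewrite !mxE !bint_set; congr (_ * _).
apply: bint_ae_eq; move: ae_star hA; apply: filterS2 => x hs hAx.
rewrite indicE; have [sx|nsx] := pselect (star Omega i x); last by rewrite memNset// !mul0r.
by rewrite mem_set// !mul1r; have [_ sA _ _ _] := hAx (hs sx); rewrite -{1}sA mxE.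
Qed.

Lemma Abar_bounds : mx_le lambda%:M (Abar Omega A i) /\ mx_le (Abar Omega A i) Lambda%:M.
Proof.
have bS := bms_star hT d0 Omega0 hv Oi; have S0 := star_gt0.
have b1 (y : rV) : bms (fun x => \1_(star Omega i) x * mdot (y^T *m y) (Am x)).
  have [m1 m2] : mb (fun x => mdot (y^T *m y) (Am x)) by apply: mb_mdot => a b; exact: bms_mb.
  exact: bmsM.
have E1 c : c = S^-1 * bint (fun x => \1_(star Omega i) x * c).
  rewrite (eq_bint (g := fun x => c * \1_(star Omega i) x)); last by move=> x; rewrite mulrC.
  rewrite bintZ// -star_measureE mulrCA mulVf ?mulr1// gt_eqF//.
have b2 (c : R) : bms (fun x => \1_(star Omega i) x * c).
  by have [? ?] := mb_cst (d := d) c; exact: bmsM.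
split=> y; rewrite dot_scalar quadE Abar_mdot.
- rewrite [leLHS]E1 ler_wpM2l ?invr_ge0 ?(ltW S0)//; apply: le_bint_ae => //.
  move: ae_star hA; apply: filterS2 => x hs hAx.
  rewrite indicE; have [sx|nsx] := pselect (star Omega i x); last by rewrite memNset// !mul0r.
  by rewrite mem_set// !mul1r; have [<- _ h1 _ _] := hAx (hs sx); rewrite -quadE -dot_scalar.
- rewrite [leRHS]E1 ler_wpM2l ?invr_ge0 ?(ltW S0)//; apply: le_bint_ae => //.
  move: ae_star hA; apply: filterS2 => x hs hAx.
  rewrite indicE; have [sx|nsx] := pselect (star Omega i x); last by rewrite memNset// !mul0r.
  by rewrite mem_set// !mul1r; have [<- _ _ h1 _] := hAx (hs sx); rewrite -quadE -dot_scalar.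
Qed.

Lemma Qradius_gt0 : 0 < Q.
Proof. by rewrite /Qradius sqrtr_gt0; have := l0; have := lL => ? ?; lra. Qed.

Lemma Mnode_spec : let M := Mnode Omega lambda A i in
  [/\ M^T = M, M *m M = Abar Omega A i - (lambda / 2)%:M, M \in unitmx, 0 < \det M &
    forall z : rV, enorm (z *m M) <= Q * enorm z].
Proof.
have [h1 h2] := Abar_bounds; rewrite /Qradius.
have dsub c y : dot (y *m (Abar Omega A i - c%:M)) y = dot (y *m Abar Omega A i) y - c * enorm y ^+ 2.
  by rewrite mulmxBr dotBl dot_scalar.
apply: (sqrtmxP (a := lambda / 2)).
- by rewrite divr_gt0.
- by have := l0; have := lL => ? ?; lra.
- by rewrite linearB /= Abar_sym tr_scalar_mx.
- move=> y; have := h1 y; rewrite dsub !dot_scalar; lra.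
- move=> y; have := h2 y; rewrite dsub !dot_scalar mulrBl; lra.
Qed.

Lemma hat_Vh0 : Vh0 Omega T v.
Proof.
case: (hv) => h1 _ _; split=> // x [_ nx]; apply: (hat_out hT hv Oi).
by move=> Ox; apply: nx; move: oO; rewrite openE; apply.
Qed.

Lemma laplacian_galerkin :
  discrete_laplacian Omega wG i = (bint v)^-1 * bint (fun x => \tr (Hm x) * v x).
Proof.
have [_ /(_ _ hat_Vh0) Egal] := hG; case: (hv) => hvV _ _.
rewrite /discrete_laplacian (int_hatE hT hv Oi) Egal mulNr -mulrN; congr (_ * _).
rewrite (dirichlet_Vh hT hvV).
rewrite [RHS](eq_bint (g := fun x => \sum_a D2 a a x * v x)); last first.
  by move=> x; rewrite /mxtrace mulr_suml; apply: eq_bigr => a _; rewrite mxE.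
rewrite bint_sum => [|a _]; last exact: bmsMM.
have -> : bint (fun x => dot (Du x) (pgrad T v x)) = bint (fun x => \sum_a D1 a x * pg i x 0 a).
  apply: bint_ae_eq; move: hD1; apply: filterS => x h1.
  rewrite (hat_pgrad hv); have [Ox|nOx] := pselect (Omega x).
    by rewrite h1// dot_sum; apply: eq_bigr => a _; rewrite mxE.
  have p0 : pg i x = 0 by rewrite pg_off// => -[K hK ix]; apply: nOx; exact (ihull_Omega hT hK ix).
  by rewrite p0 dot0r big1// => a _; rewrite mxE mulr0.
rewrite bint_sum => [|a _]; last by apply: bmsMM => //; exact: bms_pg hT i a.
rewrite -sumrN; apply: eq_bigr => a _.
have := hat_weakp hT d0 hv Oi (ltW L0) (fun K hK => hL i hK) hphi (bD1 a) (bD2 a a) (w2 a a).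
by move=> ->; rewrite opprK.
Qed.

Lemma loadE : load Omega f i = (bint v)^-1 * bint (fun x => mdot (Am x) (Hm x) * v x).
Proof.
rewrite /load (int_hatE hT hv Oi) mulrC; congr (_ * _); rewrite bint_set; apply: bint_ae_eq.
move: hsol hA hD2; apply: filterS3 => x h1 h2 h3.
rewrite indicE; have [Ox|nOx] := pselect (Omega x); last first.
  by rewrite memNset// mul0r (hat_out hT hv Oi nOx) mulr0.
rewrite mem_set// mul1r -(h1 Ox); have [-> _ _ _ _] := h2 Ox; rewrite (h3 Ox).
by congr (_ * _); rewrite /mdot; apply: eq_bigr => a _; apply: eq_bigr => b _.
Qed.

Lemma zext_Vh0 w : Vh0 Omega T w -> bms (zext Omega w).
Proof.
move=> [[cw _] wb]; apply: bms_continuous; first exact: zero_extension_continuous.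
exists (\sum_i enorm (@node _ _ T i) + 1) => x hx; rewrite /zext indicE memNset ?mul0r//.
by move=> /(Omega_hulls hT)/(hulls_bounded hT); rewrite /eball /= subr0 => ?; lra.
Qed.

(** The replacement of the Hessian by [H] is paid three times: in the trace, in the second
    differences of [u], and in [A : D2u], where the entries of [A] are bounded by [Lambda] and its
    Frobenius norm by [d * d * Lambda]. *)
Definition consistency_constant : R :=
  lambda / 2 * d%:R + 2 * Q ^+ 2 * d%:R + d%:R * d%:R * Lambda.

Lemma node_consistency (H : 'M[R]_d) (k r : R) : 0 <= k -> eball x0 r `<=` Omega ->
  theta Omega lambda Lambda eps x0 * (Q * eps) <= r ->
  {ae leb, forall z, eball x0 r z -> enorm (Hm z - H) <= k} ->
  {ae leb, forall z, star Omega i z -> Omega z -> enorm (Hm z - H) <= k} ->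
  `|Leps Omega lambda Lambda phi eps A wG i - load Omega f i| <=
    consistency_constant * k +
    enorm H * (2 * (4 * h * L) ^+ d *
      (S^-1 * bint (fun x => \1_(star Omega i) x * enorm (Am x - Abar Omega A i)))) +
    (eps ^+ 2)^-1 * (theta Omega lambda Lambda eps x0 ^+ 2)^-1 * (4 * E * bint phi).
Proof.
move=> k0 hr tr hk1 hk2.
have Q0 := Qradius_gt0; have [sM MM uM dM nM] := Mnode_spec.
have [hVG _] := hG; have bG := zext_Vh0 hVG.
have IB := IepsB d0 hphi oO Oi e0 Q0 uM dM nM bu bG.
have I1 : `|Ieps Omega lambda Lambda phi eps A u i - mdot (Abar Omega A i - (lambda / 2)%:M) H| <=
    2 * k * Q ^+ 2 * d%:R.
  rewrite -MM; apply: (Ieps_quad d0 hphi oO Oi e0 Q0 sM uM dM nM bu); first by rewrite mulr_ge0.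
  by move=> y hy; exact: (sd_le d0 hphi oO Oi e0 Q0 k0 bu cu bD1 bD2 w1 w2 hr tr hk1 hy).
have I2 : `|Ieps Omega lambda Lambda phi eps A (fun y => u y - wG y) i| <=
    (eps ^+ 2)^-1 * (theta Omega lambda Lambda eps x0 ^+ 2)^-1 * (4 * E * bint phi).
  apply: (Ieps_small d0 hphi oO Oi e0 Q0 uM dM nM _ hE).
  rewrite (_ : zext _ _ = fun y => zext Omega u y - zext Omega wG y); first exact: bmsB.
  by apply/funext => y; rewrite /zext mulrBr.
have S0 := star_gt0; have W0 : 0 < bint v.
  apply: lt_le_trans (int_hat_ge hT L0 hL hv Oi).
  by rewrite divr_gt0// mulr_gt0 ?unit_ball_volume_gt0// exprn_gt0// invr_gt0 mulr_gt0.
have Wn0 : bint v != 0 by rewrite gt_eqF.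
set Ab := Abar Omega A i in I1 *.
have v0 x : 0 <= v x := hat_ge0 hT hv Oi x.
have mA a b : mb (A' a b) by exact: bms_mb.
have mH a b : mb (D2 a b) by exact: bms_mb.
have mbd (F : rV -> R) : mb F -> bms (fun x => F x * v x) by move=> [? ?]; exact: bmsMr.
have mtr : mb (fun x => \tr (Hm x)).
  rewrite (_ : (fun x => _) = fun x => \sum_a D2 a a x); first exact: mb_sum.
  by apply/funext => x; rewrite /mxtrace; apply: eq_bigr => a _; rewrite mxE.
have mAH : mb (fun x => mdot (Am x) (Hm x)).
  rewrite (_ : (fun x => _) = fun x => \sum_a \sum_b A' a b x * D2 a b x).
    by apply: mb_sum => a; apply: mb_sum => b; exact: mbM.
  by apply/funext => x; rewrite /mdot; apply: eq_bigr => a _; apply: eq_bigr => b _; rewrite !mxE.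
have mdA : mb (fun x => enorm (Am x - Ab)).
  rewrite (_ : (fun x => _) = fun x => enorm (\matrix_(a, b) (A' a b x - Ab a b))).
    by apply: mb_enorm => a b; apply: mbB => //; exact: mb_cst.
  by apply/funext => x; congr enorm; apply/matrixP => a b; rewrite !mxE.
(* The added constant is the integral operator on the quadratic [H]; with it, [P] vanishes when the
   Hessian is [H] and the coefficients are [Ab]. *)
pose P x := lambda / 2 * \tr (Hm x) - mdot (Am x) (Hm x) + mdot (Ab - (lambda / 2)%:M) H.
have mP : mb P.
  apply: mbD; last exact: mb_cst.
  by apply: mbB => //; apply: mbM => //; exact: mb_cst.
have mdot_scalar (c : R) (X : 'M[R]_d) : mdot c%:M X = c * \tr X.
  rewrite /mdot /mxtrace mulr_sumr; apply: eq_bigr => a _.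
  by rewrite (bigD1 a)//= mxE eqxx mulr1n big1 ?addr0// => b ba; rewrite mxE eq_sym (negbTE ba) mulr0n mul0r.
have EL : Leps Omega lambda Lambda phi eps A wG i - load Omega f i =
    (bint v)^-1 * bint (fun x => P x * v x) +
    (Ieps Omega lambda Lambda phi eps A u i - mdot (Ab - (lambda / 2)%:M) H) -
    Ieps Omega lambda Lambda phi eps A (fun y => u y - wG y) i.
  rewrite IB /Leps laplacian_galerkin loadE.
  rewrite (eq_bint (f := fun x => P x * v x) (g := fun x => lambda / 2 * (\tr (Hm x) * v x) - mdot (Am x) (Hm x) * v x
     + mdot (Ab - (lambda / 2)%:M) H * v x)) => [|x]; last by rewrite /P; ring.
  have b1 := mbd _ mtr; have b2 := mbd _ mAH.
  rewrite bintD; [|by apply: bmsB => //; exact: bmsZ|exact: bmsZ].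
  rewrite bintB//; last exact: bmsZ.
  rewrite !bintZ//; field; exact: Wn0.
have EP x : P x = lambda / 2 * \tr (Hm x - H) - mdot (Am x) (Hm x - H) - mdot (Am x - Ab) H.
  by rewrite /P !mdotBl mdotBr mdot_scalar linearB /=; ring.
have Lam0 : 0 <= Lambda by have := l0; have := lL => ? ?; lra.
pose c := lambda / 2 * d%:R + d%:R * d%:R * Lambda.
have IP : `|(bint v)^-1 * bint (fun x => P x * v x)| <= c * k +
    enorm H * (2 * (4 * h * L) ^+ d * (S^-1 * bint (fun x => \1_(star Omega i) x * enorm (Am x - Ab)))).
  have bS := bms_star hT d0 Omega0 hv Oi.
  have bSA : bms (fun x => \1_(star Omega i) x * enorm (Am x - Ab)) by case: mdA => ? ?; exact: bmsM.
  rewrite normrM gtr0_norm ?invr_gt0// mulrC ler_pdivrMr//.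
  apply: (le_trans (le_normr_bint (mbd _ mP))).
  apply: (@le_trans _ _ (bint (fun x => c * k * v x + enorm H * (\1_(star Omega i) x * enorm (Am x - Ab))))).
    apply: le_bint_ae; first by apply: bms_norm; exact: mbd.
      by apply: bmsD; exact: bmsZ.
    move: hk2 hA; apply: filterS2 => x hx hAx; rewrite normrM (ger0_norm (v0 x)).
    have [vx|vx] := eqVneq (v x) 0.
      by rewrite vx !mulr0 add0r mulr_ge0 ?enorm_ge0// mulr_ge0 ?enorm_ge0 ?indic_ge0.
    have sx := hat_star vx; have Ox : Omega x by apply: contrapT => /(hat_out hT hv Oi)/eqP; exact/negP.
    rewrite indicE mem_set// mul1r; have hX := hx sx Ox; have [EA _ _ _ oA] := hAx Ox.
    have v1 := hat_le1 hT hv Oi x.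
    have hP : `|P x| <= c * k + enorm H * enorm (Am x - Ab).
      rewrite EP; apply: (le_trans (ler_normB _ _)); apply: lerD; last first.
        by rewrite [leRHS]mulrC; exact: normr_mdot_le.
      apply: (le_trans (ler_normB _ _)); rewrite /c mulrDl; apply: lerD.
        rewrite normrM ger0_norm ?divr_ge0 ?(ltW l0)// -mulrA ler_wpM2l ?divr_ge0 ?(ltW l0)//.
        apply: (le_trans (ler_norm_sum _ _ _)); apply: (@le_trans _ _ (\sum_(a < d) k)).
          by apply: ler_sum => a _; exact: le_trans (coord_le_enorm _ a a) hX.
        by rewrite sumr_const card_ord mulr_natl.
      apply: (le_trans (normr_mdot_le _ _)); apply: ler_pM; rewrite ?enorm_ge0//.
      apply: (le_trans (enorm_le_sum _)); apply: (@le_trans _ _ (\sum_(a < d) \sum_(b < d) Lambda)).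
        by apply: ler_sum => a _; apply: ler_sum => b _; rewrite -EA; exact: opb_entry.
      by rewrite !sumr_const !card_ord -mulrA !mulr_natl.
    apply: (le_trans (ler_wpM2r (v0 x) hP)); rewrite mulrDl lerD2l.
    by rewrite ler_piMr// mulr_ge0 ?enorm_ge0.
  rewrite bintD; [|exact: bmsZ|exact: bmsZ].
  rewrite !bintZ// [leRHS]mulrDl lerD2l -[leRHS]mulrA; apply: ler_wpM2l; first exact: enorm_ge0.
  set X := bint _; have X0 : 0 <= X by apply: bint_ge0 => x; rewrite mulr_ge0 ?enorm_ge0 ?indic_ge0.
  (* Passing from the hat average to the star average costs the ratio of the star measure to the
     integral of the hat. *)
  have hS := star_measure_int_hat hT d0 Omega0 L0 hL hv Oi.
  rewrite (_ : 2 * _ * _ * _ = X * (S^-1 * (2 * (4 * h * L) ^+ d * bint v))); last by ring.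
  rewrite -[leLHS]mulr1 ler_wpM2l//.
  by rewrite mulrC ler_pdivlMr// mul1r.
rewrite EL; apply: (le_trans (ler_normB _ _)); apply: lerD I2.
apply: (le_trans (ler_normD _ _)); have := lerD IP I1.
by rewrite /consistency_constant /c; lra.
Qed.

End node_consistency.

(** * Scales and strips *)

Section scales.
Context {R : realType}.

Lemma powR_expR (a x : R) : 0 < a -> a `^ x = expR (x * ln a).
Proof. by move=> a0; rewrite /powR gt_eqF. Qed.

(** The inequality x <= exp x at x = p l / (n + 1), raised to the power n + 1. *)
Lemma log_pow_le (l p : R) n : 0 <= l -> 0 < p ->
  l ^+ n.+1 <= (n.+1%:R / p) ^+ n.+1 * expR (p * l).
Proof.
move=> l0 p0; pose m : R := n.+1%:R / p; have m0 : 0 < m by rewrite divr_gt0.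
have h : l / m <= expR (l / m) by have := expR_ge1Dx (l / m); lra.
have h1 : (l / m) ^+ n.+1 <= expR (l / m) ^+ n.+1.
  by rewrite lerXn2r// nnegrE ?expR_ge0// divr_ge0// ltW.
have -> : p * l = n.+1%:R * (l / m).
  have key (b : R) : b != 0 -> p * l = b * (l / (b / p)).
    by move=> b0; field; rewrite b0 gt_eqF.
  by apply: key; rewrite pnatr_eq0.
rewrite expRM_natl -/m.
rewrite (_ : l ^+ n.+1 = m ^+ n.+1 * (l / m) ^+ n.+1); last first.
  by rewrite -exprMn mulrC divfK ?gt_eqF.
by rewrite ler_wpM2l// exprn_ge0// ltW.
Qed.

(** Everything is read off exponents of h = exp (- l). With p = 1 / (1 + 2d), so that 2 d p = 1 - p,
    and l >= 1, one has tau >= exp (- 2 p l) and tau^d >= exp (- (1 - p) l). The gap exp (- p l)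
    between h and tau^d absorbs l^(d+1). *)
Lemma scale_facts (h : R) (d : nat) : 0 < h -> h <= expR (-1) ->
  let l := `|ln h| in let s := h ^+ 2 * l in let tau := s `^ (1 + 2 * d%:R)^-1 in
  [/\ 1 <= l, 0 < tau <= 1, s = tau ^+ (1 + 2 * d),
      s `^ (d%:R / (1 + 2 * d%:R)) = tau ^+ d & h <= tau ^+ d] /\
  ((forall beta, 2 / (1 + 2 * d%:R) <= beta -> h `^ beta <= tau) /\
  h * l ^+ d.+1 <= (d.+1%:R * (1 + 2 * d%:R)) ^+ d.+1 * tau ^+ d).
Proof.
move=> h0 h1 l s tau.
have D0 : 0 < 1 + 2 * d%:R :> R by rewrite ltr_pwDl// mulr_ge0.
have D1 : 1 + 2 * d%:R != 0 :> R by rewrite gt_eqF.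
pose p : R := (1 + 2 * d%:R)^-1; have p0 : 0 < p by rewrite invr_gt0.
have lnh : ln h <= -1 by rewrite -(expRK (-1)) ler_ln// posrE expR_gt0.
have lE : l = - ln h by rewrite /l ler0_norm//; lra.
have l1 : 1 <= l by rewrite lE; lra.
have hE : h = expR (- l) by rewrite lE opprK lnK.
have s0 : 0 < s by rewrite mulr_gt0 ?exprn_gt0//; lra.
have lns : ln s = - (2 * l) + ln l.
  rewrite /s lnM ?posrE ?exprn_gt0//; last by lra.
  by rewrite lnXn// -mulr_natl lE; ring.
have lnl0 : 0 <= ln l by rewrite ln_ge0.
have lnll : ln l <= l.
  rewrite -[leRHS]expRK ler_ln ?posrE ?expR_gt0//; last by lra.
  by have := expR_ge1Dx l; lra.
have tauE : tau = expR (p * ln s) by rewrite /tau powR_expR.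
have tau0 : 0 < tau by rewrite tauE expR_gt0.
have taud : tau ^+ d = expR (d%:R * p * ln s) by rewrite tauE -expRM_natl mulrA.
have tau_ge : expR (p * - (2 * l)) <= tau.
  by rewrite tauE ler_expR ler_wpM2l ?(ltW p0)// lns; lra.
have taud_ge : expR (d%:R * p * - (2 * l)) <= tau ^+ d.
  by rewrite taud ler_expR ler_wpM2l ?mulr_ge0 ?(ltW p0)// lns; lra.
have pd : 2 * (d%:R * p) = 1 - p by rewrite /p; field.
split; [split|split].
- exact: l1.
- rewrite tau0 /= tauE -expR0 ler_expR mulr_ge0_le0 ?(ltW p0)// lns; lra.
- rewrite tauE -expRM_natl (_ : _ * _ = ln s) ?lnK ?posrE//.
  by rewrite natrD natrM mulrA /p divff ?mul1r.
- by rewrite powR_expR// taud -/p.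
- apply: le_trans taud_ge; rewrite {1}hE ler_expR.
  have -> : d%:R * p * - (2 * l) = - ((1 - p) * l) by rewrite -pd; ring.
  by rewrite lerN2 ler_piMl//; lra.
- move=> beta hb; apply: le_trans tau_ge; rewrite powR_expR// ler_expR.
  have -> : ln h = - l by rewrite lE opprK.
  rewrite !mulrN lerN2 mulrA ler_wpM2r//; first by lra.
  by rewrite mulrC.
have := log_pow_le d (_ : 0 <= l) p0 => /(_ ltac:(lra)) h2.
apply: (@le_trans _ _ (h * ((d.+1%:R / p) ^+ d.+1 * expR (p * l)))).
  by rewrite ler_wpM2l// ltW.
rewrite mulrCA /p invrK ler_wpM2l ?exprn_ge0 ?mulr_ge0 ?(ltW D0)//.
apply: le_trans taud_ge; rewrite {1}hE -expRD ler_expR -/p.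
have -> : d%:R * p * - (2 * l) = - ((1 - p) * l) by rewrite -pd; ring.
lra.
Qed.

Lemma addX_le (a b : R) n : 0 <= a -> 0 <= b -> (a + b) ^+ n <= 2 ^+ n * (a ^+ n + b ^+ n).
Proof.
move=> a0 b0; wlog ab : a b a0 b0 / a <= b.
  by move=> H; have [/H->//|/ltW/H] := leP a b; rewrite addrC [X in _ * X]addrC; apply.
apply: (@le_trans _ _ ((2 * b) ^+ n)).
  by rewrite lerXn2r ?nnegrE ?addr_ge0 ?mulr_ge0//; lra.
by rewrite exprMn ler_wpM2l ?exprn_ge0// lerDr exprn_ge0.
Qed.

End scales.

Section strips.
Context {R : realType} {d : nat} (Omega : set 'rV[R]_d) (T : mesh R d).
Local Notation rV := 'rV[R]_d.
Local Notation leb := (lebesgue_rV (R := R) d).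
Local Notation N := (nb_nodes T).
Local Notation h := (mesh_size T).
Hypotheses (hT : mesh_of Omega T) (d0 : (0 < d)%N) (Omega0 : Omega !=set0).
Variable L : R.
Hypotheses (L0 : 0 < L) (hL : forall (K : {set 'I_N}) (i : 'I_N), K \in elements T -> enorm (bgrad K i) <= L).
Variables (J : nat) (Oj : 'I_J -> set rV) (rho : R) (c : 'I_J -> R).
Hypotheses (hrho : Omega `<=` eball 0 rho) (Lh : 1 <= h * L)
  (hc : forall j (delta : R), 0 < delta ->
     bint (\1_(nbd (boundary (Oj j)) delta `&` eball 0 rho)) <= c j * delta).

Lemma ae_exists (P : rV -> Prop) (x : rV) (r : R) : 0 < r -> {ae leb, forall y, P y} ->
  exists2 y, eball x r y & P y.
Proof.
move=> r0 [N' [mN N0 hN]]; apply: contrapT => no.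
suff : leb (eball x r) = 0%E by have := eball_gt0 x r0; move=> /[swap] ->; rewrite ltxx.
apply/eqP; rewrite eq_le measure_ge0 andbT -N0; apply: le_measure; rewrite ?inE//.
  exact: eball_measurable.
by move=> y hy; apply: hN => /= Py; apply: no; exists y.
Qed.

Lemma hat_ball_Omega (i : 'I_N) : Omega (node i) -> is_hat Omega i (hat Omega i) ->
  eball (node i) (2 * L)^-1 `<=` Omega.
Proof.
move=> Oi hv y hy; apply: (node_ball hT L0 hL hv Oi); move: hy; rewrite /eball /= => hy.
apply: lt_le_trans hy _; rewrite lef_pV2 ?posrE ?mulr_gt0//; have := L0 => ?; lra.
Qed.

Lemma sum_star_hat (P : pred 'I_N) (A : set rV) : measurable A -> (exists r : R, A `<=` eball 0 r) ->
  (forall i, P i -> Omega (node i)) ->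
  (forall i, P i -> is_hat Omega i (hat Omega i) -> eball (node i) (2 * L)^-1 `<=` A) ->
  \sum_(i | P i) star_measure Omega i <= (4 * h * L) ^+ d * bint (\1_A).
Proof.
move=> mA bA PO PA.
pose Q i := P i && `[< is_hat Omega i (hat Omega i) >].
have -> : \sum_(i | P i) star_measure Omega i = \sum_(i | Q i) star_measure Omega i.
  rewrite big_mkcond [RHS]big_mkcond; apply: eq_bigr => i _; rewrite /Q.
  case: ifP => //= Pi; case: asboolP => // nh.
  by have [//|/star0] := hat_cases Omega i.
apply: (sum_star hT d0 Omega0 L0 hL mA bA) => i /andP[Pi /asboolP hi]; first exact: PO.
exact: PA.
Qed.

(** The disjoint balls around these nodes have radius at most [h], so they lie in the strips of
    width [delta + h], whose volume controls the sum. *)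
Lemma strip_sum (P : pred 'I_N) (delta : R) : 0 < delta ->
  (forall i, P i -> Omega (node i) /\ exists j z, boundary (Oj j) z /\ enorm (node i - z) < delta) ->
  \sum_(i | P i) star_measure Omega i <= (4 * h * L) ^+ d * ((\sum_j c j) * (delta + h)).
Proof.
move=> de0 hP; have h0 := mesh_size_gt0 hT d0 Omega0.
pose B j : set rV := nbd (boundary (Oj j)) (delta + h) `&` eball 0 rho.
have mB j : measurable (B j) by apply: measurableI; [exact: nbd_measurable|exact: eball_measurable].
have sB j : B j `<=` eball 0 rho by move=> x [].
pose A : set rV := \big[setU/set0]_j B j.
have inA j x : B j x -> A x by move=> Bx; rewrite /A (bigD1 j)//=; left.
have mA : measurable A by apply: bigsetU_measurable.
have bA : exists r : R, A `<=` eball 0 r.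
  exists rho; rewrite /A; elim/big_ind : _ => [x []|X Y hX hY x [/hX|/hY]|j _]//; exact: sB.
have c0 : 0 <= (4 * h * L) ^+ d by rewrite exprn_ge0// mulr_ge0 ?mulr_ge0// ?ltW.
apply: (@le_trans _ _ ((4 * h * L) ^+ d * bint (\1_A))).
  apply: sum_star_hat => // [i /hP[]//|i Pi hi y hy].
  have [Oi [j [z [bz hz]]]] := hP i Pi; apply: (inA j); split.
    exists z => //; have := enormD (y - node i) (node i - z); rewrite addrA subrK.
    have : (2 * L)^-1 <= h.
      rewrite -[leLHS]mul1r ler_pdivrMr ?mulr_gt0//; have := Lh => ?; lra.
    by move: hy; rewrite /eball /=; lra.
  by apply: hrho; exact: hat_ball_Omega hy.
rewrite ler_wpM2l//; have bB j : bms (\1_(B j)) by apply: bms_indic => //; exists rho.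
apply: (@le_trans _ _ (bint (fun x => \sum_j \1_(B j) x))).
  apply: le_bint; [exact: bms_indic|by apply: bms_sum => j _|move=> x].
  rewrite indicE; have [Ax|nAx] := pselect (A x); last first.
    by rewrite memNset// sumr_ge0// => j _; exact: indic_ge0.
  rewrite mem_set//.
  have [j Bj] : exists j, B j x.
    apply: contrapT => no; move: Ax; rewrite /A; elim/big_ind : _ => [[]|X Y hX hY [/hX|/hY]|j _ Bj] //.
    by apply: no; exists j.
  rewrite (bigD1 j)//= indicE mem_set// lerDl sumr_ge0// => k _; exact: indic_ge0.
rewrite bint_sum => [|j _]; last exact: bB.
rewrite mulr_suml; apply: ler_sum => j _; apply: hc; lra.
Qed.

End strips.

(** * Sum of the residuals *)

Section consistency_sum.
Context {R : realType} {d : nat} (Omega : set 'rV[R]_d) (T : mesh R d).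
Local Notation rV := 'rV[R]_d.
Local Notation leb := (lebesgue_rV (R := R) d).
Local Notation N := (nb_nodes T).
Variables (lambda Lambda eps L : R) (phi : rV -> R).
Variables (A : rV -> 'M[R]_d) (f u wG : rV -> R) (Du : rV -> rV) (D2u : rV -> 'M[R]_d).
Variables (A' D2 : 'I_d -> 'I_d -> rV -> R) (D1 : 'I_d -> rV -> R) (E : R).
Hypotheses (d0 : (0 < d)%N) (l0 : 0 < lambda) (lL : lambda <= Lambda) (e0 : 0 < eps).
Hypotheses (hphi : kernel_function phi) (hT : mesh_of Omega T) (Omega0 : Omega !=set0).
Hypotheses (L0 : 0 < L)
  (hL : forall (K : {set 'I_N}) i, K \in elements T -> enorm (bgrad K i) <= L).
Local Notation Am x := (\matrix_(a, b) A' a b x).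
Local Notation Hm x := (\matrix_(a, b) D2 a b x).
Hypotheses (bA : forall a b, bms (A' a b))
  (hA : {ae leb, forall x, Omega x -> [/\ A x = Am x, (A x)^T = A x,
     mx_le lambda%:M (A x), mx_le (A x) Lambda%:M & opb (A x) Lambda]}).
Hypotheses (bD1 : forall a, bms (D1 a)) (bD2 : forall a b, bms (D2 a b))
  (w1 : forall a, weakp Omega a (zext Omega u) (D1 a)) (w2 : forall a b, weakp Omega b (D1 a) (D2 a b))
  (hD1 : {ae leb, forall x, Omega x -> Du x = \row_a D1 a x})
  (hD2 : {ae leb, forall x, Omega x -> D2u x = Hm x}).
Hypotheses (bu : bms (zext Omega u)) (cu : continuous (zext Omega u)).
Hypotheses (hsol : solves Omega A f D2u) (hG : galerkin_projection Omega T Du wG)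
  (hE : forall x, Omega x -> `|u x - wG x| <= E).
Local Notation Q := (Qradius lambda Lambda).
Local Notation h := (mesh_size T).
Variables (J : nat) (Oj : 'I_J -> set rV) (rho : R) (c Kj : 'I_J -> R).
Variables (alpha K CA C3 CL Lz cE l tau : R).
Hypotheses (hrho : Omega `<=` eball 0 rho)
  (hc : forall j (delta : R), 0 < delta ->
     bint (\1_(nbd (boundary (Oj j)) delta `&` eball 0 rho)) <= c j * delta)
  (oj : forall j, open (Oj j)) (ojO : forall j, Oj j `<=` Omega)
  (Ocov : closure Omega `<=` \bigcup_j closure (Oj j)).
Hypotheses (K0 : 0 <= K) (hK : {ae leb, forall x, Omega x -> enorm (Hm x) <= K})
  (hess_ae : forall j, {ae leb, forall x, Oj j x -> Hm x = hess u x})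
  (holder : forall j x y, Oj j x -> Oj j y ->
     enorm (hess u x - hess u y) <= Kj j * enorm (x - y) `^ alpha)
  (al1 : 1 <= d%:R * alpha) (al2 : alpha <= 1).
Local Notation osc i := (bint (fun x => \1_(star Omega i) x * enorm (Am x - Abar Omega A i) ^+ d)).
Hypotheses (CA0 : 0 <= CA)
  (hosc : forall j, \sum_(i < N | interior_node Omega i && `[< star Omega i `<=` Oj j >]) osc i <=
     (CA * tau) ^+ d).
Hypotheses (C30 : 0 < C3) (l1 : 1 <= l) (tau01 : 0 < tau <= 1) (epsE : eps = C3 * tau ^+ d)
  (htau : h <= tau ^+ d) (sE : h ^+ 2 * l = tau ^+ (1 + 2 * d))
  (hl : h * l ^+ d.+1 <= CL * tau ^+ d)
  (LzE : h * L = Lz) (Lz1 : 1 <= Lz) (cE0 : 0 <= cE) (hcE : 4 * E * bint phi <= cE * (h ^+ 2 * l)).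

Let h0 : 0 < h := mesh_size_gt0 hT d0 Omega0.
Let tau0 : 0 < tau. Proof. by case/andP: tau01. Qed.
Let taud0 : 0 < tau ^+ d. Proof. by rewrite exprn_gt0. Qed.
Let Q0 : 0 < Q := Qradius_gt0 l0 lL.
Let oO : open Omega := Omega_open hT.

Local Notation g i := `|Leps Omega lambda Lambda phi eps A wG i - load Omega f i|.
Local Notation S i := (star_measure Omega i).
Local Notation cc := (consistency_constant (d := d) lambda Lambda).
Local Notation rr := (Q * eps + 2 * h).
(** The radius [rr] covers both the stencil, of radius [Q * eps], and the star, which lies in the
    ball of radius [2 * h]. *)
Definition good_node (i : 'I_N) : bool := `[< exists j, eball (node i) rr `<=` Oj j >].
(** At distance [h * l] the projection error [h ^+ 2 * l] divided by the squared distance is [l^-1],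
    which is at most 1. *)
Definition deep_node (i : 'I_N) : bool := `[< eball (node i) (h * l) `<=` Omega >].

(* G1 and G2 bound the residual at the nodes well inside some subdomain, G3 at
   the others that are farther than h l from the boundary of the domain, and
   G4 l at the remaining ones. *)
Definition cK := (\sum_j `|Kj j|) * (Q * C3 + 3).
Definition G1 := cc * cK + cE / C3 ^+ 2.
Definition G2 := (K + cK) * (2 * (4 * Lz) ^+ d).
Definition G3 := cc * K + cE / C3 ^+ 2 + Q ^+ 2 * cE.
Definition G4 := cc * K + cE / C3 ^+ 2 + Q ^+ 2 * Lz ^+ 2 * cE.

Lemma cc_ge0 : 0 <= cc.
Proof.
have lam0 := ltW l0; have Lam0 : 0 <= Lambda by exact: le_trans lam0 lL.
by rewrite /consistency_constant !addr_ge0// !mulr_ge0// ?invr_ge0 ?exprn_ge0// ltW.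
Qed.

Lemma cK_ge0 : 0 <= cK.
Proof.
apply: mulr_ge0; first by apply: sumr_ge0 => j _.
by rewrite addr_ge0// mulr_ge0// ltW.
Qed.

Lemma cE_ge0 : 0 <= cE / C3 ^+ 2.
Proof. by rewrite divr_ge0// exprn_ge0// ltW. Qed.

Lemma Lz_ge0 : 0 <= (4 * Lz) ^+ d.
Proof. by rewrite exprn_ge0// mulr_ge0// (le_trans _ Lz1). Qed.

Lemma G1_ge0 : 0 <= G1.
Proof. by rewrite addr_ge0 ?cE_ge0// mulr_ge0 ?cc_ge0 ?cK_ge0. Qed.

Lemma G2_ge0 : 0 <= G2.
Proof. by apply: mulr_ge0; [rewrite addr_ge0 ?cK_ge0|rewrite mulr_ge0 ?Lz_ge0]. Qed.

Lemma G3_ge0 : 0 <= G3.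
Proof.
by rewrite addr_ge0// ?addr_ge0 ?cE_ge0// mulr_ge0 ?cc_ge0// exprn_ge0// ltW.
Qed.

Lemma G4_ge0 : 0 <= G4.
Proof.
apply: addr_ge0; first by rewrite addr_ge0 ?cE_ge0// mulr_ge0 ?cc_ge0.
by apply: mulr_ge0 => //; apply: mulr_ge0; rewrite exprn_even_ge0.
Qed.

(** The identity that fixes the exponent of eps: tau^(1+2d) divided by tau^(2d). *)
Lemma eps_term : (eps ^+ 2)^-1 * (cE * (h ^+ 2 * l)) = cE / C3 ^+ 2 * tau.
Proof.
rewrite sE epsE exprD expr1 exprM exprMn -exprM mulnC exprM.
by field; rewrite !gt_eqF ?exprn_gt0.
Qed.

Lemma rr_le : rr <= (Q * C3 + 3) * tau ^+ d.
Proof.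
have -> : (Q * C3 + 3) * tau ^+ d = Q * (C3 * tau ^+ d) + 3 * tau ^+ d by ring.
rewrite epsE lerD2l; have := htau; have := taud0 => ? ?; lra.
Qed.

Lemma rr_gt0 : 0 < rr. Proof. by rewrite addr_gt0// mulr_gt0. Qed.

(** [d * alpha >= 1] and [tau <= 1] handle the power of tau; [alpha <= 1] handles the prefactor,
    which is at least 1. *)
Lemma rr_alpha : rr `^ alpha <= (Q * C3 + 3) * tau.
Proof.
have q0 : 0 < Q * C3 by rewrite mulr_gt0.
have q1 : 1 <= Q * C3 + 3 by lra.
have al0 : 0 <= alpha.
  have dp : 0 < d%:R :> R by rewrite ltr0n.
  by rewrite -(pmulr_rge0 _ dp); apply: le_trans al1.
have p0 : 0 < (Q * C3 + 3) * tau ^+ d by rewrite mulr_gt0//; lra.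
apply: (@le_trans _ _ (((Q * C3 + 3) * tau ^+ d) `^ alpha)).
  apply: ge0_ler_powR; [exact: al0| | |exact: rr_le]; rewrite nnegrE.
    exact: ltW rr_gt0.
  exact: ltW p0.
rewrite powRM; [|lra|exact: ltW].
apply: ler_pM; rewrite ?powR_ge0//.
  by rewrite -[leRHS]powRr1 ?ler_powR//; lra.
rewrite powR_expR// lnXn// -mulr_natl mulrA -[leRHS]lnK// ler_expR.
have : ln tau <= 0 by rewrite ln_le0//; case/andP: tau01.
have : 1 <= alpha * d%:R by rewrite mulrC.
move=> h1 h2; rewrite -subr_ge0 (_ : _ - _ = (1 - alpha * d%:R) * ln tau); last by ring.
by rewrite mulr_le0//; lra.
Qed.

Section node.
Variable i : 'I_N.
Hypotheses (hv : is_hat Omega i (hat Omega i)) (Oi : Omega (node i)).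

Let avg := (S i)^-1 * bint (fun x => \1_(star Omega i) x * enorm (Am x - Abar Omega A i)).

Lemma Am_avg_ge0 : 0 <= avg.
Proof.
apply: mulr_ge0; first by rewrite invr_ge0 star_measure_ge0.
by apply: bint_ge0 => x; rewrite mulr_ge0 ?indic_ge0 ?enorm_ge0.
Qed.

Lemma E_term (X : R) : 0 <= X -> X * (4 * E * bint phi) <= X * (cE * (h ^+ 2 * l)).
Proof. by move=> X0; rewrite ler_wpM2l. Qed.

(** [node_consistency] with [H = 0] and [k = K]: only boundedness of the Hessian is exploited. *)
Lemma bad_bound r : 0 < r -> eball (node i) r `<=` Omega ->
  g i <= cc * K + cE / C3 ^+ 2 * tau + Q ^+ 2 / r ^+ 2 * (cE * (h ^+ 2 * l)).
Proof.
move=> r0 hr; have [t01 ht _] := thetaP oO Oi (mulr_gt0 Q0 e0).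
have hk : {ae leb, forall z, Omega z -> enorm (Hm z - 0) <= K}.
  by move: hK; apply: filterS => z; rewrite subr0.
have hk1 : {ae leb, forall z, eball (node i) (theta Omega lambda Lambda eps (node i) * (Q * eps)) z -> enorm (Hm z - 0) <= K}.
  by move: hk; apply: filterS => z h1 /ht.
have hk2 : {ae leb, forall z, star Omega i z -> Omega z -> enorm (Hm z - 0) <= K}.
  by move: hk; apply: filterS => z h1 _.
have := node_consistency d0 l0 lL e0 hphi hT Omega0 L0 hL bA hA bD1 bD2 w1 w2 hD1 hD2 bu cu hsol hG hE
  hv Oi K0 ht (lexx _) hk1 hk2.
rewrite enorm0 mul0r addr0 => h1; apply: (le_trans h1); rewrite -addrA lerD2l.
have X0 : 0 <= (eps ^+ 2)^-1 * (theta Omega lambda Lambda eps (node i) ^+ 2)^-1.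
  by rewrite mulr_ge0// invr_ge0 exprn_even_ge0.
apply: (le_trans (E_term X0)).
have Y0 : 0 <= cE * (h ^+ 2 * l).
  by rewrite !mulr_ge0// ?exprn_ge0 ?ltW//; apply: lt_le_trans l1.
apply: (le_trans (ler_wpM2r Y0 (theta_scale oO Oi e0 Q0 r0 hr))).
by rewrite mulrDl eps_term.
Qed.

(** [H] is the classical Hessian at the node and [k] its Hölder oscillation over the ball, of order
    tau; the ball also forces [theta = 1]. *)
Lemma good_bound j : eball (node i) rr `<=` Oj j -> g i <= G1 * tau + G2 * avg.
Proof.
move=> hr; have [/andP[t0 t1] _ _] := thetaP oO Oi (mulr_gt0 Q0 e0).
have Oji : Oj j (node i) by apply: hr; apply: eball_center; exact: rr_gt0.
pose H := hess u (node i); pose k := `|Kj j| * rr `^ alpha.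
have k0 : 0 <= k by rewrite mulr_ge0// powR_ge0.
have al0 : 0 <= alpha.
  have dp : 0 < d%:R :> R by rewrite ltr0n.
  by rewrite -(pmulr_rge0 _ dp); apply: le_trans al1.
have kk : k <= cK * tau.
  rewrite /cK -mulrA; apply: ler_pM; rewrite ?powR_ge0 ?normr_ge0//; last exact: rr_alpha.
  by rewrite (bigD1 j)//= lerDl sumr_ge0.
have hrO : eball (node i) rr `<=` Omega by apply: subset_trans hr _; exact: ojO.
have tr : theta Omega lambda Lambda eps (node i) * (Q * eps) <= rr.
  have qe : 0 < Q * eps by rewrite mulr_gt0.
  have : theta Omega lambda Lambda eps (node i) * (Q * eps) <= Q * eps by rewrite ler_piMl// ltW.
  by have := h0 => ? ?; lra.
have hk1 : {ae leb, forall z, eball (node i) rr z -> enorm (Hm z - H) <= k}.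
  move: (hess_ae j); apply: filterS => z hz zr; rewrite hz; last exact: hr.
  apply: (le_trans (holder (hr z zr) Oji)).
  apply: (@le_trans _ _ (`|Kj j| * enorm (z - node i) `^ alpha)).
    by rewrite ler_wpM2r ?powR_ge0// ler_norm.
  rewrite ler_wpM2l//; apply: ge0_ler_powR; rewrite ?nnegrE ?enorm_ge0 ?(ltW rr_gt0)//.
  exact: ltW.
have hk2 : {ae leb, forall z, star Omega i z -> Omega z -> enorm (Hm z - H) <= k}.
  move: hk1; apply: filterS => z hz /(star_ball hT d0 Omega0 hv Oi) sz _; apply: hz.
  move: sz; rewrite /eball /= => sz; apply: lt_le_trans sz _.
  by rewrite lerDr mulr_ge0 ?ltW.
have := node_consistency d0 l0 lL e0 hphi hT Omega0 L0 hL bA hA bD1 bD2 w1 w2 hD1 hD2 bu cu hsol hG hE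
  hv Oi k0 hrO tr hk1 hk2.
have t1E : theta Omega lambda Lambda eps (node i) = 1.
  apply: (theta_far oO Oi e0 Q0 _ hrO); by rewrite lerDl mulr_ge0// ltW.
rewrite t1E expr1n invr1 mulr1 => h1; apply: (le_trans h1).
(* [K] bounds the weak Hessian only almost everywhere, so [H] is compared with its value at some
   nearby point where both bounds hold. *)
have HK : enorm H <= K + cK.
  have [z zr [z1 z2]] : exists2 z, eball (node i) rr z & enorm (Hm z - H) <= k /\ enorm (Hm z) <= K.
    have : {ae leb, forall z, eball (node i) rr z -> enorm (Hm z - H) <= k /\ enorm (Hm z) <= K}.
      by move: hk1 hK; apply: filterS2 => z h2 h3 zr; split; [exact: h2|apply: h3; exact: hrO].
    by move=> /(ae_exists (node i) rr_gt0)[z zr hz]; exists z => //; exact: hz.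
  have : k <= cK.
    apply: le_trans kk _; rewrite ler_piMr//; last by case/andP: tau01.
    exact: cK_ge0.
  have := enormB (Hm z) (Hm z - H); rewrite opprB addrC subrK; lra.
have -> : 4 * h * L = 4 * Lz by rewrite -LzE mulrA.
have X0 : 0 <= (eps ^+ 2)^-1 by rewrite invr_ge0 exprn_even_ge0.
have := E_term X0; rewrite eps_term => h2.
have h3 : cc * k <= cc * (cK * tau) by rewrite ler_wpM2l// cc_ge0.
have h4 : enorm H * (2 * (4 * Lz) ^+ d * avg) <= G2 * avg.
  rewrite (_ : G2 * avg = (K + cK) * (2 * (4 * Lz) ^+ d * avg)); last by rewrite /G2; ring.
  apply: ler_wpM2r => //.
  have := Lz1 => ?; apply: mulr_ge0; last exact: Am_avg_ge0.
  by rewrite mulr_ge0// exprn_ge0// mulr_ge0//; lra.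
have := lerD (lerD h3 h4) h2; rewrite -/avg /G1 mulrDl; lra.
Qed.

Lemma avg_osc : S i * avg ^+ d <= osc i.
Proof.
have mA a b : mb (A' a b) by exact: bms_mb.
rewrite /avg star_measureE; apply: power_mean.
- exact: (bms_star hT d0 Omega0 hv Oi).
- rewrite (_ : (fun x => _) = fun x => enorm (\matrix_(a, b) (A' a b x - Abar Omega A i a b))).
    by apply: mb_enorm => a b; apply: mbB => //; exact: mb_cst.
  by apply/funext => x; congr enorm; apply/matrixP => a b; rewrite !mxE.
- by move=> x; exact: enorm_ge0.
- rewrite -star_measureE; exact: (star_gt0 d0 hT Omega0 L0 hL hv Oi).
Qed.

Lemma good_term j : eball (node i) rr `<=` Oj j ->
  g i ^+ d * S i <= 2 ^+ d * (G1 * tau) ^+ d * S i + 2 ^+ d * G2 ^+ d * osc i.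
Proof.
move=> hr; have G10 := G1_ge0; have G20 := G2_ge0.
have a0 := Am_avg_ge0.
have m1 : 0 <= G1 * tau by rewrite mulr_ge0// ltW.
have m2 : 0 <= G2 * avg by rewrite mulr_ge0.
have h1 : g i ^+ d <= 2 ^+ d * ((G1 * tau) ^+ d + (G2 * avg) ^+ d).
  apply: le_trans (addX_le d m1 m2); rewrite lerXn2r ?nnegrE ?normr_ge0 ?addr_ge0//.
  exact: good_bound hr.
apply: (le_trans (ler_wpM2r (star_measure_ge0 Omega i) h1)).
rewrite mulrDr mulrDl lerD2l exprMn -!mulrA ler_wpM2l ?exprn_ge0//.
by rewrite ler_wpM2l ?exprn_ge0// mulrC avg_osc.
Qed.

End node.

Lemma close_boundary (i : 'I_N) : Omega (node i) -> ~~ good_node i ->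
  exists j z, boundary (Oj j) z /\ enorm (node i - z) < rr.
Proof.
move=> Oi /asboolP no; have [j _ cj] := Ocov (subset_closure Oi); exists j.
have r0 := rr_gt0.
have [Oij|nOij] := pselect (Oj j (node i)); last first.
  exists (node i); rewrite subrr enorm0; split=> //; split=> // /interior_subset.
  by [].
have [y yr nOy] : exists2 y, eball (node i) rr y & ~ Oj j y.
  apply: contrapT => ny; apply: no; exists j => y yr; apply: contrapT => nOy; apply: ny; by exists y.
have [z bz hz] := boundary_crossing (@oj j) Oij nOy.
exists z; split=> //; apply: le_lt_trans hz _; by rewrite enormBC.
Qed.

(** The boundary of the domain is covered by those of the subdomains, so the layer is measured by
    the same strips. *)
Lemma shallow_boundary (i : 'I_N) : Omega (node i) -> ~~ deep_node i ->
  exists j z, boundary (Oj j) z /\ enorm (node i - z) < h * l.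
Proof.
move=> Oi /asboolP no.
have [y yr nOy] : exists2 y, eball (node i) (h * l) y & ~ Omega y.
  apply: contrapT => ny; apply: no => y yr; apply: contrapT => nOy; apply: ny; by exists y.
have [z [cz nz] hz] := boundary_crossing oO Oi nOy.
have [j _ cj] := Ocov cz; exists j, z; split; last by apply: le_lt_trans hz _; rewrite enormBC.
split=> // /interior_subset/ojO Oz; apply: nz.
by move: oO; rewrite openE; apply.
Qed.

Definition total_constant :=
  2 ^+ d * G1 ^+ d * ((4 * Lz) ^+ d * bint (\1_Omega)) + 2 ^+ d * G2 ^+ d * (J%:R * CA ^+ d) +
  G3 ^+ d * ((4 * Lz) ^+ d * ((\sum_j c j) * (Q * C3 + 4))) +
  G4 ^+ d * ((4 * Lz) ^+ d * ((\sum_j c j) * (2 * CL))).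

Lemma consistency_sum : \sum_(i < N | interior_node Omega i) g i ^+ d * S i <=
  total_constant * tau ^+ d.
Proof.
have [tau_ge tau1] := andP tau01.
have c4E : 4 * h * L = 4 * Lz by rewrite -LzE mulrA.
have Lz0 : 0 < Lz by apply: lt_le_trans Lz1.
have c40 : 0 <= (4 * Lz) ^+ d by rewrite exprn_ge0// mulr_ge0// ltW.
have l00 : 0 < l by apply: lt_le_trans l1.
have S0 i : 0 <= S i by exact: star_measure_ge0.
have cc0 := cc_ge0.
have cEC : 0 <= cE / C3 ^+ 2 by rewrite divr_ge0// exprn_ge0// ltW.
have Lh : 1 <= h * L by rewrite LzE.
have osc0 i : 0 <= osc i.
  by apply: bint_ge0 => x; rewrite mulr_ge0 ?indic_ge0// exprn_ge0// enorm_ge0.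
have cj0 : 0 <= \sum_j c j.
  apply: sumr_ge0 => j _; have := hc j ltr01; rewrite mulr1; apply: le_trans.
  by apply: bint_ge0 => x; exact: indic_ge0.
have cK0 := cK_ge0; have G10 := G1_ge0; have G20 := G2_ge0; have G30 := G3_ge0; have G40 := G4_ge0.
have nohat i : hat Omega i = (fun=> 0) -> S i = 0 by exact: star0.
have intP i : interior_node Omega i -> Omega (node i) by move=> /asboolP.
have spread (x y z w t : R) : (x + y + z + w) * t = x * t + y * t + z * t + w * t by ring.
(* Three groups of nodes: good, bad but deep, bad and shallow. The first two summands of
   [total_constant] come from the good ones. *)
rewrite (bigID good_node) /= [X in _ + X](bigID deep_node) /= addrA /total_constant spread.
apply: lerD; first apply: lerD.
(* The star of a good node lies in some subdomain; bounding by the sum over all subdomains costs the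
   factor [J]. *)
- apply: (@le_trans _ _ (\sum_(i < N | interior_node Omega i)
      (2 ^+ d * (G1 * tau) ^+ d * S i + 2 ^+ d * G2 ^+ d * \sum_j (if `[< star Omega i `<=` Oj j >] then osc i else 0)))).
    rewrite big_mkcondr; apply: ler_sum => i /intP Oi.
    have n0 : 0 <= 2 ^+ d * (G1 * tau) ^+ d * S i + 2 ^+ d * G2 ^+ d * \sum_j (if `[< star Omega i `<=` Oj j >] then osc i else 0).
      apply: addr_ge0; first by rewrite !mulr_ge0// !exprn_ge0// mulr_ge0// ltW.
      rewrite mulr_ge0// ?mulr_ge0 ?exprn_ge0// sumr_ge0// => j _.
      by case: ifP.
    case: ifPn => // /asboolP[j hr].
    have [hv|/nohat S00] := hat_cases Omega i; last by rewrite S00 mulr0; move: n0; rewrite S00.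
    apply: (le_trans (good_term hv Oi hr)); rewrite lerD2l ler_wpM2l ?mulr_ge0 ?exprn_ge0//.
    rewrite (bigD1 j)//= asboolT; last first.
      move=> z /(star_ball hT d0 Omega0 hv Oi) hz; apply: hr.
      move: hz; rewrite /eball /= => hz; apply: lt_le_trans hz _.
      by rewrite lerDr mulr_ge0 ?ltW.
    by rewrite lerDl sumr_ge0// => k _; case: ifP.
  rewrite big_split /= -!mulr_sumr; apply: lerD.
    have sumS : \sum_(i < N | interior_node Omega i) S i <= (4 * Lz) ^+ d * bint (\1_Omega).
      rewrite -c4E; apply: (sum_star_hat hT d0 Omega0 L0 hL) => //.
      - exact: open_rV_measurable.
      - by exists rho.
      - by move=> i /intP.
      - by move=> i /intP Oi hv; exact: (hat_ball_Omega hT L0 hL Oi hv).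
    have m0 : 0 <= 2 ^+ d * (G1 * tau) ^+ d.
      by rewrite mulr_ge0// exprn_ge0// mulr_ge0// ltW.
    apply: (le_trans (ler_wpM2l m0 sumS)).
    rewrite [(G1 * tau) ^+ d]exprMn le_eqVlt; apply/orP; left; apply/eqP.
    by rewrite -!mulrA; congr (_ * (_ * _)); rewrite mulrC !mulrA.
  rewrite -[leRHS]mulrA; apply: ler_wpM2l; first by rewrite mulr_ge0// exprn_ge0.
  rewrite exchange_big /= (_ : J%:R * CA ^+ d * tau ^+ d = \sum_(j < J) (CA * tau) ^+ d); last first.
    by rewrite sumr_const card_ord exprMn -mulrA mulr_natl.
  by apply: ler_sum => j _; apply: le_trans (hosc j); rewrite [leRHS]big_mkcondr.
- apply: (@le_trans _ _ (\sum_(i < N | interior_node Omega i && ~~ good_node i) G3 ^+ d * S i)).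
    rewrite [leLHS]big_mkcondr; apply: ler_sum => i /andP[/intP Oi bi].
    case: ifPn => [/asboolP dp|_]; last by rewrite mulr_ge0// exprn_ge0.
    have [hv|/nohat ->] := hat_cases Omega i; last by rewrite !mulr0.
    rewrite ler_wpM2r//; suff : g i <= G3 by move=> hg; rewrite lerXn2r// nnegrE ?normr_ge0.
    apply: (le_trans (bad_bound hv Oi (mulr_gt0 h0 l00) dp)); rewrite /G3; apply: lerD.
      by rewrite lerD2l ler_piMr.
    have -> : Q ^+ 2 / (h * l) ^+ 2 * (cE * (h ^+ 2 * l)) = Q ^+ 2 * cE * l^-1.
      by field; rewrite !gt_eqF.
    by rewrite ler_piMr ?mulr_ge0 ?exprn_ge0 ?(ltW Q0)// invf_le1.
  rewrite -mulr_sumr -[leRHS]mulrA ler_wpM2l ?exprn_ge0// -[leRHS]mulrA.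
  apply: (@le_trans _ _ ((4 * h * L) ^+ d * ((\sum_j c j) * (rr + h)))).
    apply: (strip_sum hT d0 Omega0 L0 hL hrho Lh hc rr_gt0) => i /andP[/intP Oi bi].
    by split => //; exact: close_boundary.
  rewrite c4E ler_wpM2l// -mulrA ler_wpM2l//.
  have := rr_le; have := htau; rewrite !mulrDl; lra.
(* In the layer the inscribed ball has radius [L^-1], which makes the residual O(l); its d-th power
   times the width [h * l] is [h * l ^+ d.+1], controlled by [hl]. *)
apply: (@le_trans _ _ (\sum_(i < N | interior_node Omega i && ~~ deep_node i) (G4 * l) ^+ d * S i)).
  rewrite (eq_bigl (fun i => (interior_node Omega i && ~~ deep_node i) && ~~ good_node i)); last first.
    by move=> i; rewrite andbAC.
  rewrite [leLHS]big_mkcondr; apply: ler_sum => i /andP[/intP Oi bi].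
  have G4l0 : 0 <= G4 * l by rewrite mulr_ge0 ?(ltW l00).
  case: ifPn => _; last by rewrite mulr_ge0// exprn_ge0.
  have [hv|/nohat ->] := hat_cases Omega i; last by rewrite !mulr0.
  rewrite ler_wpM2r//; suff : g i <= G4 * l by move=> hg; rewrite lerXn2r// nnegrE ?normr_ge0.
  have Li0 : 0 < L^-1 by rewrite invr_gt0.
  apply: (le_trans (bad_bound hv Oi Li0 (node_ball hT L0 hL hv Oi))).
  have -> : Q ^+ 2 / (L^-1) ^+ 2 * (cE * (h ^+ 2 * l)) = Q ^+ 2 * Lz ^+ 2 * cE * l.
    by rewrite -LzE; field; rewrite gt_eqF.
  rewrite /G4 [leRHS]mulrDl lerD2r [leRHS]mulrDl; apply: lerD.
    by rewrite ler_peMr ?mulr_ge0.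
  apply: (@le_trans _ _ (cE / C3 ^+ 2)); first by rewrite ler_piMr.
  by rewrite ler_peMr.
have hl0 : 0 < h * l by rewrite mulr_gt0.
rewrite -mulr_sumr [(G4 * l) ^+ d]exprMn -[leRHS]mulrA -[leLHS]mulrA.
apply: ler_wpM2l; first by rewrite exprn_ge0.
apply: (@le_trans _ _ (l ^+ d * ((4 * h * L) ^+ d * ((\sum_j c j) * (h * l + h))))).
  apply: ler_wpM2l; first by rewrite exprn_ge0// ltW.
  apply: (strip_sum hT d0 Omega0 L0 hL hrho Lh hc hl0) => i /andP[/intP Oi bi].
  by split => //; exact: shallow_boundary.
rewrite c4E mulrCA -[leRHS]mulrA; apply: ler_wpM2l => //.
rewrite mulrCA -[leRHS]mulrA; apply: ler_wpM2l => //.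
apply: (@le_trans _ _ (2 * (h * l ^+ d.+1))); last by rewrite -mulrA ler_pM2l.
rewrite (_ : 2 * _ = l ^+ d * (2 * (h * l))); last by rewrite exprS; ring.
rewrite ler_wpM2l ?exprn_ge0 ?(ltW l00)//.
have : h <= h * l by rewrite ler_peMr// ltW.
lra.
Qed.

End consistency_sum.

(** * The error estimate *)

Lemma dist_le_via (R : realType) (x y z a b : R) :
  `|x - z| <= a -> - (z - y) <= b -> - (y - z) <= b -> `|x - y| <= a + b.
Proof. by rewrite !ler_norml => /andP[? ?] ? ?; apply/andP; split; lra. Qed.

Section residual_and_oscillation.
Context {R : realType} {d : nat} (Omega : set 'rV[R]_d) (T : mesh R d).
Local Notation rV := 'rV[R]_d.
Local Notation leb := (lebesgue_rV (R := R) d).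
Local Notation N := (nb_nodes T).
Variables (lambda Lambda eps L : R) (phi : rV -> R) (A : rV -> 'M[R]_d).
Variable A' : 'I_d -> 'I_d -> rV -> R.
Hypotheses (d0 : (0 < d)%N) (l0 : 0 < lambda) (lL : lambda <= Lambda) (e0 : 0 < eps).
Hypotheses (hphi : kernel_function phi) (hT : mesh_of Omega T) (Omega0 : Omega !=set0).
Hypotheses (L0 : 0 < L)
  (hL : forall (K : {set 'I_N}) i, K \in elements T -> enorm (bgrad K i) <= L).
Local Notation Am x := (\matrix_(a, b) A' a b x).
Hypotheses (bA : forall a b, bms (A' a b))
  (hA : {ae leb, forall x, Omega x -> [/\ A x = Am x, (A x)^T = A x,
     mx_le lambda%:M (A x), mx_le (A x) Lambda%:M & opb (A x) Lambda]}).

Lemma LepsB (i : 'I_N) v w : is_hat Omega i (hat Omega i) -> Omega (node i) ->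
  Vh0 Omega T v -> Vh0 Omega T w ->
  Leps Omega lambda Lambda phi eps A (fun x => v x - w x) i =
  Leps Omega lambda Lambda phi eps A v i - Leps Omega lambda Lambda phi eps A w i.
Proof.
move=> hv Oi Vv Vw; have [_ _ uM dM nM] := Mnode_spec d0 l0 lL hT Omega0 L0 hL bA hA hv Oi.
rewrite /Leps (IepsB d0 hphi (Omega_open hT) Oi e0 (Qradius_gt0 l0 lL) uM dM nM
  (zext_Vh0 hT Vv) (zext_Vh0 hT Vw)).
suff -> : discrete_laplacian Omega (fun x => v x - w x) i =
    discrete_laplacian Omega v i - discrete_laplacian Omega w i.
  by rewrite mulrBr opprD addrACA.
have [hv1 _ _] := hv; have [Vv1 _] := Vv; have [Vw1 _] := Vw.
have [Vvw _] := Vh0B Vv Vw.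
rewrite /discrete_laplacian -mulrBr !(dirichlet_Vh2 hT _ hv1)//; congr (_ * _).
rewrite -bintB; [|by apply: bms_dot => m; exact: (bms_pgrad hT)|by apply: bms_dot => m; exact: (bms_pgrad hT)].
apply: eq_bint => x; rewrite -dotBl; congr dot.
by rewrite /pgrad -sumrB; apply: eq_bigr => k _; rewrite scalerBl.
Qed.

Lemma ler_exp_ge0 (a b : R) n : 0 <= a -> a <= b -> a ^+ n <= b ^+ n.
Proof. by move=> a0 ab; rewrite lerXn2r// nnegrE// (le_trans a0). Qed.

Lemma powR_invK (x : R) : 0 <= x -> (x `^ d%:R^-1) ^+ d = x.
Proof.
move=> x0; rewrite -powR_mulrn ?powR_ge0// -powRrM mulVf ?powRr1//.
by rewrite pnatr_eq0 -lt0n.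
Qed.

(** Transfers the oscillation hypothesis to the Borel version of the coefficients; the star of a
    node without hat function is empty. *)
Lemma oscillation_sum (U : set rV) (B : R) : coefficient_oscillation Omega A T U <= B ->
  \sum_(i < N | interior_node Omega i && `[< star Omega i `<=` U >])
    bint (fun x => \1_(star Omega i) x * enorm (Am x - Abar Omega A i) ^+ d) <= B ^+ d.
Proof.
move=> hB; set X := \sum_(i < N | _) _.
have EX : coefficient_oscillation Omega A T U = X `^ d%:R^-1.
  rewrite /coefficient_oscillation; congr (_ `^ _); apply: eq_bigr => i /andP[/asboolP Oi _].
  rewrite bint_set; have [hv|hv0] := hat_cases Omega i; last first.
    have -> : star Omega i = set0.
      rewrite /star hv0 (_ : [set x | _] = set0) ?closure0//.
      by apply/seteqP; split => x //=; rewrite eqxx.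
    by apply: eq_bint => x; rewrite indic0 !mul0r.
  apply: bint_ae_eq; move: (ae_star d0 hT hv Oi) hA; apply: filterS2 => x hs hAx.
  rewrite indicE; have [sx|nsx] := pselect (star Omega i x); last by rewrite memNset// !mul0r.
  by rewrite mem_set//; have [-> _ _ _ _] := hAx (hs sx).
have X0 : 0 <= X.
  apply: sumr_ge0 => i _; apply: bint_ge0 => x.
  by apply: mulr_ge0; [exact: indic_ge0|apply: exprn_ge0; exact: enorm_ge0].
have -> : X = (X `^ d%:R^-1) ^+ d.
  by rewrite (powR_invK X0).
by apply: ler_exp_ge0; [exact: powR_ge0|rewrite -EX].
Qed.

Lemma galerkin_projection_ae (G G' : rV -> rV) v :
  {ae leb, forall x, Omega x -> G x = G' x} -> galerkin_projection Omega T G v ->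
  galerkin_projection Omega T G' v.
Proof.
move=> h [hv hw]; split=> // w Vw; rewrite hw//; have [Vw1 _] := Vw.
rewrite !(dirichlet_Vh hT Vw1); apply: bint_ae_eq; move: h; apply: filterS => x h.
have [Ox|nOx] := pselect (Omega x); first by rewrite h.
rewrite [pgrad T w x]big1 ?dot0r// => k _; rewrite pg_off ?scaler0// => -[K hK ix].
by apply: nOx; exact (ihull_Omega hT hK ix).
Qed.

End residual_and_oscillation.

Theorem corollary6p9 (R : realType) (d : nat) (Omega : set 'rV[R]_d)
    (lambda Lambda : R) (phi : 'rV[R]_d -> R) (C3 sigma q alpha beta : R)
    (J : nat) (Omegaj : 'I_J -> set 'rV[R]_d)
    (C_ABP C_G C_A K : R) (Kj : 'I_J -> R) :
  (2 <= d)%N ->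
  is_domain Omega -> bounded_set Omega ->
  0 < lambda -> lambda <= Lambda ->
  kernel_function phi ->
  0 < C3 ->
  d%:R^-1 <= alpha <= 1 ->
  2 * alpha / (2 + alpha) <= beta <= alpha ->
  closure Omega = \bigcup_j closure (Omegaj j) ->
  trivIset setT Omegaj ->
  (forall j, lipschitz_domain (Omegaj j) /\ Omegaj j `<=` Omega) ->
  discrete_ABP_estimate Omega lambda Lambda phi sigma q C_ABP ->
  exists C h0 : R, 0 < h0 /\
  forall (A : 'rV[R]_d -> 'M[R]_d) (f u : 'rV[R]_d -> R)
    (Du : 'rV[R]_d -> 'rV[R]_d) (D2u : 'rV[R]_d -> 'M[R]_d)
    (T : mesh R d) (uh : 'rV[R]_d -> R),
  let h := mesh_size T in
  let eps := C3 * (h ^+ 2 * `|ln h|) `^ (d%:R / (1 + 2 * d%:R)) in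
  coefficient_matrix Omega lambda Lambda A ->
  Lp d%:R%:E Omega f ->
  W2oo Omega u Du D2u -> zero_on_boundary Omega u ->
  solves Omega A f D2u ->
  (Lp_norm +oo Omega (fun x => enorm (D2u x)) <= K%:E)%E ->
  (forall j, C2alpha alpha (Omegaj j) u (Kj j)) ->
  mesh_of Omega T -> shape_regular sigma T -> quasi_uniform q T ->
  face_weakly_acute Omega T ->
  galerkin_Loo_estimate Omega T C_G ->
  (forall j, coefficient_oscillation Omega A T (Omegaj j) <= C_A * h `^ beta) ->
  h <= h0 ->
  fem_solution Omega lambda Lambda phi eps A f T uh ->
  (Lp_norm +oo Omega (u \- uh)%R <=
   (C * (h ^+ 2 * `|ln h|) `^ (1 + 2 * d%:R)^-1)%:E)%E.
Proof.
move=> d2 [oO _ O0] bO l0 lL hphi C30 /andP[al1 al2] /andP[be1 _] Ocov _ hOj hABP.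
have d0 : (0 < d)%N by exact: ltn_trans d2.
have dp : 0 < d%:R :> R by rewrite ltr0n.
have [rho rho0 hrho] := bounded_setP bO.
have oj j : open (Omegaj j) by case: (hOj j) => -[[]].
have ojO j : Omegaj j `<=` Omega by case: (hOj j).
have [c hc] : exists c : 'I_J -> R, forall j (delta : R), 0 < delta ->
    bint (\1_(nbd (boundary (Omegaj j)) delta `&` eball 0 rho)) <= c j * delta.
  have [c hc] := choice (fun j => let: conj (And3 _ bj lj) _ := hOj j in
    let: ex_intro2 C _ h := vol_strip rho bj lj in ex_intro _ C h).
  by exists c.
(* [Lz / h] will be a common Lipschitz constant [L] of the hats; the added 1 gives [h * L >= 1], so
   that the balls around the nodes are no larger than [h]. *)
pose Lz : R := `|q| * `|sigma| + 1; have Lz1 : 1 <= Lz by rewrite lerDr mulr_ge0.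
pose P := bint phi; have P0 : 0 <= P by apply: bint_ge0; case: hphi.
pose cE := 4 * (`|C_G| * `|K|) * P; have cE0 : 0 <= cE by rewrite !mulr_ge0.
pose CL : R := (d.+1%:R * (1 + 2 * d%:R)) ^+ d.+1.
pose Ct := total_constant Omega lambda Lambda c Kj `|K| `|C_A| C3 CL Lz cE.
(* The first summand is the projection error, the second comes from the discrete maximum principle;
   the threshold ensures |ln h| >= 1. *)
exists (`|C_G| * `|K| + `|C_ABP| * Ct `^ d%:R^-1), (expR (-1)); split; first exact: expR_gt0.
move=> A f u Du D2u T uh h eps hcoef _ hW hub hsol hK hC2 hT hsr hqu hfwa hgal hosc hh hfem.
have h0 : 0 < h := mesh_size_gt0 hT d0 O0.
have [[l1 tau01 sE powE htau] [hbeta hl]] := scale_facts d h0 hh.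
set l := `|ln h| in l1 tau01 sE powE htau hbeta hl *.
set s := h ^+ 2 * l in tau01 sE powE htau hbeta hl *.
set tau := s `^ (1 + 2 * d%:R)^-1 in tau01 sE powE htau hbeta hl *.
have [tau0 tau1] := andP tau01.
have epsE : eps = C3 * tau ^+ d by rewrite /eps powE.
have e0 : 0 < eps by rewrite epsE mulr_gt0// exprn_gt0.
have bR : exists r : R, Omega `<=` eball 0 r by exists rho.
have s0 : 0 <= s by rewrite sE exprn_ge0// ltW.
pose L := Lz / h; have L0 : 0 < L by rewrite divr_gt0//; apply: lt_le_trans Lz1.
have LzE : h * L = Lz by rewrite mulrC divfK// gt_eqF.
have hL (K' : {set 'I_(nb_nodes T)}) i : K' \in elements T -> enorm (bgrad K' i) <= L.
  move=> hK'; rewrite ler_pdivlMr// mulrC; apply: (le_trans (bgrad_mesh_size hT d0 i hsr hqu hK')).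
  by rewrite lerDl.
have [D1 [D2 [[bD1 bD2] w1 w2 hD1 hD2]]] := W2oo_version oO bR hW.
have [A' [bA hA]] := coefficient_version l0 lL oO bR hcoef.
have [cub ub0] := hub.
have cu : continuous (zext Omega u) := zero_extension_continuous oO cub ub0.
have bu : bms (zext Omega u).
  apply: bms_continuous => //; exists rho => x hx; rewrite /zext indicE memNset ?mul0r//.
  by move=> /hrho; rewrite /eball /= subr0; lra.
have hKae : {ae lebesgue_rV d, forall x, Omega x -> enorm (\matrix_(a, b) D2 a b x) <= `|K|}.
  move: (Loo_ae hK) hD2; apply: filterS2 => x h1 h2 Ox; rewrite -h2//.
  by apply: le_trans (ler_norm K); have := h1 Ox; rewrite ger0_norm ?enorm_ge0.
(* The projection is built from the Borel version of the gradient and then transferred to [Du]. *)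
have [wG hG0] : exists v, galerkin_projection Omega T (fun x => \row_a D1 a x) v.
  apply: (galerkin_exists hT) => m.
  rewrite (_ : (fun x => _) = D1 m)//; by apply/funext => x; rewrite mxE.
have hG : galerkin_projection Omega T Du wG.
  apply: (galerkin_projection_ae hT _ hG0); move: hD1; apply: filterS => x h1 Ox.
  by rewrite h1.
have [VG _] := hG; have [Vuh hfemE] := hfem.
pose E := `|C_G| * `|K| * s; have E0 : 0 <= E by apply: mulr_ge0 s0; apply: mulr_ge0.
(* The projection estimate holds almost everywhere; continuity of both functions extends it to every
   point, the nodes included. *)
have hE x : Omega x -> `|u x - wG x| <= E.
  have hLoo : (Lp_norm +oo Omega (u \- wG)%R <= E%:E)%E.
    apply: (le_trans (hgal _ _ _ _ hW hub hG)).
    apply: (@le_trans _ _ ((`|C_G| * s)%:E * Lp_norm +oo Omega (fun x => enorm (D2u x)))%E).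
      apply: lee_wpmul2r; first exact: Lnorm_ge0.
      by rewrite lee_fin -/h -/l -/s ler_wpM2r// ler_norm.
    apply: (@le_trans _ _ ((`|C_G| * s)%:E * `|K|%:E)%E).
      apply: lee_wpmul2l; first by rewrite lee_fin mulr_ge0.
      by apply: (le_trans hK); rewrite lee_fin ler_norm.
    by rewrite -EFinM lee_fin /E mulrAC.
  have cwG : continuous (zext Omega wG).
    by case: VG => -[cw _] wb; exact: zero_extension_continuous.
  have ha : {ae lebesgue_rV d, forall x, Omega x -> `|zext Omega u x - zext Omega wG x| <= E}.
    by move: (Loo_ae hLoo); apply: filterS => y h1 Oy; rewrite !zext_in//; exact: h1.
  move=> Ox; have := ae_le_continuous oO (v := fun x => zext Omega u x - zext Omega wG x) _ ha Ox.
  rewrite !zext_in//; apply => y _.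
  have := cvgB (cu y) (cwG y); exact.
have hess_ae j : {ae lebesgue_rV d, forall x, Omegaj j x -> \matrix_(a, b) D2 a b x = hess u x}.
  exact: (hessian_ae d0 hphi oO bR (oj j) (@ojO j) bu bD1 bD2 w1 w2 (hC2 j)).
have holder j x y : Omegaj j x -> Omegaj j y ->
    enorm (hess u x - hess u y) <= Kj j * enorm (x - y) `^ alpha.
  by move=> hx hy; case: (hC2 j) => _ _ _; apply; exact: mem_set.
have al1' : 1 <= d%:R * alpha by rewrite mulrC -ler_pdivrMr// div1r.
(* [2 * alpha / (2 + alpha)] increases with [alpha] and equals [2 / (1 + 2 * d)] at
   [alpha = 1 / d]. *)
have hbe : 2 / (1 + 2 * d%:R) <= beta.
  apply: le_trans be1; have a0 : 0 < 2 + alpha by have : 0 < d%:R^-1 :> R; [rewrite invr_gt0|lra].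
  rewrite ler_pdivlMr// mulrAC ler_pdivrMr; last by rewrite ltr_pwDl// mulr_ge0.
  lra.
have hoscj j : \sum_(i < nb_nodes T | interior_node Omega i && `[< star Omega i `<=` Omegaj j >])
    bint (fun x => \1_(star Omega i) x * enorm (\matrix_(a, b) A' a b x - Abar Omega A i) ^+ d)
    <= (`|C_A| * tau) ^+ d.
  apply: (oscillation_sum d0 hT hA); apply: (le_trans (hosc j)).
  apply: (@le_trans _ _ (`|C_A| * h `^ beta)); first by rewrite ler_wpM2r ?powR_ge0// ler_norm.
  by rewrite ler_wpM2l// hbeta.
have Ocov' : closure Omega `<=` \bigcup_j closure (Omegaj j) by rewrite Ocov.
have hcE : 4 * E * bint phi <= cE * (h ^+ 2 * l).
  by rewrite -/P /E /cE -/s le_eqVlt; apply/orP; left; apply/eqP; ring.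
have hsum := consistency_sum d0 l0 lL e0 hphi hT O0 L0 hL bA hA bD1 bD2 w1 w2 hD1 hD2 bu cu hsol hG hE
  hrho hc oj ojO Ocov' (normr_ge0 K) hKae hess_ae holder al1' al2 hoscj C30 l1 tau01 epsE htau sE hl LzE Lz1 cE0 hcE.
rewrite -/Ct in hsum.
have abp v : Vh0 Omega T v -> (forall i : 'I_(nb_nodes T), Omega (node i) -> is_hat Omega i (hat Omega i) ->
    `|Leps Omega lambda Lambda phi eps A v i| = `|Leps Omega lambda Lambda phi eps A wG i - load Omega f i|) ->
    forall x, Omega x -> - v x <= `|C_ABP| * Ct `^ d%:R^-1 * tau.
  move=> [Vv vb] hv x Ox.
  have vb0 y : boundary Omega y -> 0 <= v y by move=> /vb ->.
  (* The estimate is applied with [g] equal to the operator on [v] itself; at nodes without hat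
     function its value is irrelevant, the weight being 0. *)
  have H := hABP T A eps e0 hT hsr hqu hfwa hcoef v
    (fun i => Leps Omega lambda Lambda phi eps A v i) Vv vb0 (fun i _ => lexx _) x Ox.
  apply: (@le_trans _ _ (Num.max (- v x) 0)); first by rewrite le_max lexx.
  apply: (le_trans H).
  set X := \sum_(i | _) _.
  have X0 : 0 <= X.
    by apply: sumr_ge0 => i _; rewrite mulr_ge0 ?star_measure_ge0// exprn_ge0// le_max lexx orbT.
  have XC : X <= Ct * tau ^+ d.
    apply: le_trans hsum; apply: ler_sum => i /asboolP Oi.
    have [hi|/star0 ->] := hat_cases Omega i; last by rewrite !mulr0.
    rewrite ler_wpM2r ?star_measure_ge0// lerXn2r ?nnegrE ?le_max ?lexx ?orbT//.
    by rewrite -(hv i Oi hi) ge_max ler_norm normr_ge0.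
  have Ct0 : 0 <= Ct by rewrite -(pmulr_lge0 _ (exprn_gt0 d tau0)); exact: le_trans XC.
  rewrite -mulrA; apply: (@le_trans _ _ (`|C_ABP| * X `^ d%:R^-1)).
    by rewrite ler_wpM2r ?powR_ge0// ler_norm.
  rewrite ler_wpM2l//; apply: (@le_trans _ _ ((Ct * tau ^+ d) `^ d%:R^-1)).
    by apply: ge0_ler_powR; rewrite ?nnegrE ?invr_ge0// (le_trans X0).
  rewrite powRM// ?exprn_ge0 ?(ltW tau0)// -powR_mulrn ?(ltW tau0)// -powRrM divff ?gt_eqF//.
  by rewrite powRr1// ltW.
have LE (i : 'I_(nb_nodes T)) : Omega (node i) -> is_hat Omega i (hat Omega i) ->
    Leps Omega lambda Lambda phi eps A (fun x => wG x - uh x) i =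
    Leps Omega lambda Lambda phi eps A wG i - load Omega f i.
  move=> Oi hi; rewrite (LepsB d0 l0 lL e0 hphi hT O0 L0 hL bA hA hi Oi VG Vuh) hfemE//.
  exact/asboolP.
have LE' (i : 'I_(nb_nodes T)) : Omega (node i) -> is_hat Omega i (hat Omega i) ->
    Leps Omega lambda Lambda phi eps A (fun x => uh x - wG x) i =
    - (Leps Omega lambda Lambda phi eps A wG i - load Omega f i).
  move=> Oi hi; rewrite (LepsB d0 l0 lL e0 hphi hT O0 L0 hL bA hA hi Oi Vuh VG) hfemE ?opprB//.
  exact/asboolP.
have e1 := abp _ (Vh0B VG Vuh) (fun i Oi hi => congr1 Num.norm (LE i Oi hi)).
have e2 := abp _ (Vh0B Vuh VG) (fun i Oi hi => etrans (congr1 Num.norm (LE' i Oi hi)) (normrN _)).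
have st : s <= tau by rewrite sE addnC addn1 exprS ler_piMr ?(ltW tau0)// exprn_ile1 ?(ltW tau0).
apply: ae_Loo.
  by rewrite mulr_ge0 ?powR_ge0// addr_ge0 ?mulr_ge0 ?powR_ge0.
apply: nearW => x Ox /=; have h1 := hE x Ox; have h2 := e1 x Ox; have h3 := e2 x Ox.
have h4 : E <= `|C_G| * `|K| * tau by rewrite /E ler_wpM2l// mulr_ge0.
by rewrite mulrDl; apply: dist_le_via (le_trans h1 h4) h2 h3.
Qed.
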